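(* Let $\phi,\psi:[0,1]\to\mathbb{R}$ be continuous on $[0,1]$ with $\phi$ concave, $\phi(0)=\phi(1)=0$, $-1<\phi'(1)<0$, and $\psi$ convex, $\psi(1)=0$, $\psi'(1)<0$, $\psi''(1)-\phi''(1)>0$. Assume that $\phi,\psi$ are $C^3$ on $(0,1]$ with $\phi'''(x)\ge0$ and $\psi'''(x)\le 0$ for $0<x\le1$, and that the function $$x\mapsto \phi'(x)+\phi'(1)-\frac{\phi(x)[\psi'(x)+\psi'(1)]}{\psi(x)}$$ is decreasing for $0\le x<1$. Let $w(x,t)$, with associated function $\kappa(\cdot)$, be the solution of $$\frac{\partial w}{\partial t}+[\phi(x)-\kappa(t)\psi(x)]\frac{\partial w}{\partial x}=w,\qquad \int_0^1 w(x,t)\,dx=1,\qquad 0\le x<1,\ t\ge0,$$ with initial data $w(\cdot,0)=w_0$ whose beta function satisfies $\lim_{x\to1}\beta(x,0)=1$. (a) If $\lim_{x\to0}\phi(x)/x=\infty$, then there exist constants $C_1,C_2>0$ depending only on the initial data such that $C_1\le\kappa(t)\le C_2$ for all $t\ge 0$, and $$\lim_{T\to\infty}\frac1T\int_0^T\kappa(t)\,dt=\frac{-\phi'(1)}{|\psi'(1)|}.$$ (b) If $\phi,\psi$ are $C^2$ on the closed interval $[0,1]$ and in addition there exists $\delta>0$ such that $\beta(x,0)\le1$ for $1-\delta\le x<1$, then the same conclusions hold: there exist constants $C_1,C_2>0$ depending only on the initial data such that $C_1\le\kappa(t)\le C_2$ for all $t\ge0$, and $\lim_{T\to\infty}\f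rac1T\int_0^T\kappa(t)\,dt=-\phi'(1)/|\psi'(1)|$.
   Context: ''Decreasing'' is understood in the weak sense (non-increasing); if $\phi'$ or $\psi'$ is not finite at $0$ the monotonicity condition is understood on $(0,1)$. Initial data: $w_0(x)=\int_x^1 c_0(x')\,dx'$, $0\le x<1$, where $c_0\ge 0$ is an integrable function on $[0,1)$, $w_0(x)>0$ for all $0\le x<1$, and $\int_0^1 w_0(x)\,dx=1$. Solution: $\kappa:[0,\infty)\to(0,\infty)$ is the continuous function uniquely determined by the requirement that the solution $w$ of the PDE satisfies $\int_0^1 w(x,t)\,dx=1$ for all $t\ge0$. The solution is $w(x,t)=e^t w_0(F(x,t))$, where $F(x,t)=x(0)$ and $x(s)$, $0\le s\le t$, solves $\frac{dx(s)}{ds}=\phi(x(s))-\kappa(s)\psi(x(s))$, $x(t)=x$. Beta function: $c(x,t)=-\partial w(x,t)/\partial x$ (so $c(\cdot,0)=c_0$), $h(x,t)=\int_x^1 w(x',t)\,dx'$, $\beta(x,t)=c(x,t)h(x,t)/w(x,t)^2$, $0\le x<1$. ''Depending only on the initial data'' means: for the given coefficients $\phi,\psi$, the constant is determined by $w_0$ and does not depend on $t$. *)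

(* Defs.v *)
From HB Require Import structures.
From mathcomp Require Import all_boot all_order all_algebra.
From mathcomp Require Import all_classical all_reals all_analysis.

Set Implicit Arguments.
Unset Strict Implicit.
Unset Printing Implicit Defensive.

Import Order.TTheory GRing.Theory Num.Theory.
Import numFieldNormedType.Exports.

Local Open Scope classical_set_scope.
Local Open Scope ring_scope.

Definition diff_quotient (R : realType) (f : R -> R) (x y : R) : R :=
  (f y - f x) / (y - x).

(* The coefficients are functions on [0, 1], represented by total functions
   whose values outside [0, 1] are irrelevant. Derivatives are therefore taken
   within [0, 1]: two-sided in the interior, one-sided at 0 and 1. An infinite
   one-sided derivative counts as non-derivable. *)
Definition derivable01 (R : realType) (f : R -> R) (x : R) : Prop :=
  cvg (diff_quotient f x y @[y --> within `[0, 1] x^']).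

Definition deriv01 (R : realType) (f : R -> R) (x : R) : R :=
  lim (diff_quotient f x y @[y --> within `[0, 1] x^']).

Definition deriv01n (R : realType) (n : nat) (f : R -> R) : R -> R :=
  iter n (@deriv01 R) f.

(* f is C^n on A, where A is `[0, 1] or `]0, 1]. *)
Definition Cn01 (R : realType) (n : nat) (A : set R) (f : R -> R) : Prop :=
  (forall k : nat, (k < n)%N ->
     forall x : R, A x -> derivable01 (deriv01n k f) x) /\
  {within A, continuous (deriv01n n f)}.

Definition tail_integral (R : realType) (f : R -> R) (x : R) : R :=
  \int[lebesgue_measure]_(y in `[x, 1[) f y.

(* The beta function c h / w ^ 2 of a profile w on [0, 1) with density
   c = - w' and h(x) the integral of w over [x, 1). *)
Definition profile_beta (R : realType) (c w : R -> R) (x : R) : R :=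
  c x * tail_integral w x / w x ^+ 2.

(* c0 is passed separately from w0: w0 is merely absolutely continuous, so
   - w0' is defined only almost everywhere, while beta(x, 0) uses c0 itself. *)
Definition initial_data (R : realType) (c0 w0 : R -> R) : Prop :=
  [/\ (forall x : R, 0 <= x < 1 -> 0 <= c0 x),
      lebesgue_measure.-integrable `[0, 1[ (EFin \o c0),
      (forall x : R, 0 <= x < 1 -> w0 x = tail_integral c0 x),
      (forall x : R, 0 <= x < 1 -> 0 < w0 x) &
      \int[lebesgue_measure]_(x in `[0, 1[) w0 x = 1].

(* X is the characteristic through (x, t), on the time interval [0, t] (the
   derivative is one-sided at s = 0 and s = t). *)
Definition characteristic (R : realType) (phi psi kappa : R -> R)
    (x t : R) (X : R -> R) : Prop :=
  [/\ X t = x,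
      (forall s : R, 0 <= s <= t -> 0 <= X s < 1) &
      (forall s : R, 0 <= s <= t ->
         diff_quotient X s r @[r --> within `[0, t] s^'] -->
           phi (X s) - kappa s * psi (X s))].

(* (w, kappa) solves
     dw/dt + (phi x - kappa t psi x) dw/dx = w,  int_0^1 w(x, t) dx = 1,
   with w(., 0) = w0. Since w0 need not be differentiable, the equation is
   understood by characteristics: w(x, t) = e^t w0 (F(x, t)), where F(x, t) is
   the position at time 0 of the characteristic through (x, t). *)
Definition is_solution (R : realType) (phi psi w0 : R -> R)
    (w : R -> R -> R) (kappa : R -> R) : Prop :=
  [/\ {within `[0, +oo[, continuous kappa},
      (forall t : R, 0 <= t -> 0 < kappa t),
      (exists F : R -> R -> R, forall x t : R, 0 <= x < 1 -> 0 <= t ->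
         (exists2 X : R -> R,
            characteristic phi psi kappa x t X & F x t = X 0) /\
         w x t = expR t * w0 (F x t)) &
      (forall t : R, 0 <= t ->
         \int[lebesgue_measure]_(x in `[0, 1[) w x t = 1)].

(* C1 and C2 are chosen before kappa, w and t, so that they depend only on the
   coefficients and the initial data. *)
Definition kappa_asymptotics (R : realType) (phi psi w0 : R -> R) : Prop :=
  exists C1 C2 : R, [/\ 0 < C1, 0 < C2 &
    forall (w : R -> R -> R) (kappa : R -> R),
      is_solution phi psi w0 w kappa ->
      (forall t : R, 0 <= t -> C1 <= kappa t <= C2) /\
      T^-1 * (\int[lebesgue_measure]_(t in `[0, T]) kappa t) @[T --> +oo] -->
        - deriv01 phi 1 / `|deriv01 psi 1|].

(* Main.v *)
(** Write v = phi - kappa psi, F(x, t) for the backward flow and L = h0 / w0 for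
   the mean residual life of the initial profile, so that L' = beta - 1 and L is
   eps-Lipschitz near 1 for every eps > 0; this is all that is used of beta -> 1.
   Trajectories are compared in pairs and triples: for da/ds = f(s, a) with f
   concave in a the ratio (a3 - a2) / (a2 - a1) of three solutions is monotone.
   Hence F is convex in x (v is concave), and by the monotonicity hypothesis on
   the coefficients convex, after exponentiation, in al Psi, where Psi' = 1 / psi
   and al = - psi'(1); away from 0 it is concave in exp(B Psi) for B large.

   Upper bound for w(0, t): if w(0, t) is large and comparable to its past
   values, then kappa stays below g(xh), g = phi / psi, on a preceding window
   (test phi - kappa psi against its tangent at xh), where the backward flow
   contracts in the coordinate Psi. A bulk part of the profile then comes from an
   interval short in units of L, so w is nearly constant on it, which contradicts
   int w = 1. For coefficients regular at 0 the window is long; in the singular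
   case the contraction rate W(xh) / psi(0), W = phi' psi - phi psi', is
   unbounded, and xh is chosen where x W(x) is at a record.

   Lower bound for w(0, t) - 1: the spread (F(x2, t) - F(x1, t)) / L(F(x1, t))
   cannot decay, because a small spread makes w nearly constant and kappa large,
   which by convexity in exp(al Psi) increases the spread again over a time in
   which kappa has integral 1. The inequalities 1 <= kappa psi(0) (w(0, t) - 1) and
   s w(0, t) <= 1 + s with s = al kappa - be, be = - phi'(1), turn the two bounds
   into bounds for kappa.

   Time average: L(F(0, T)) >= exp(- o(T)), since L' -> 0 near 1 and
   e^T w0(F(0, T)) >= 1. As v = (al kappa - be) (1 - x) to first order at 1,
   following the trajectories that end at (0, T) and (z, T) gives
   al K(T) - be T = o(T), where K' = kappa. *)
Require Import Defs.
From HB Require Import structures.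
From mathcomp Require Import all_boot all_order all_algebra.
From mathcomp Require Import all_classical all_reals all_analysis.
From mathcomp Require Import measurable_realfun ring lra.
Set Implicit Arguments.
Unset Strict Implicit.
Unset Printing Implicit Defensive.

Import Order.TTheory GRing.Theory Num.Theory.
Import numFieldNormedType.Exports.

Local Open Scope classical_set_scope.
Local Open Scope ring_scope.

(* lra and nra get slow in large contexts: slra and snra only use the facts moved
   to the goal, and drop_facts is told in each section which hypotheses to keep,
   since lra cannot run without the section hypotheses. *)
Ltac drop_facts := clear.
Ltac slra := drop_facts; lra.
Ltac snra := drop_facts; nra.

(** * Calculus *)

Section Calculus.
Variable R : realType.
Implicit Types (f df : R -> R) (a b x : R).

(** Formally, [int w = 1] gives [int (kappa psi - phi) c dx = 1] with [c = - dw/dx], and bounding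
    [kappa psi - phi] by affine functions of [x] yields the two inequalities for [kappa], since
    [int (1 - x) c dx = w(0, t) - 1]. As [w] need not be differentiable, each use of this identity
    is a comparison, over a short time, of the profile with an affine image of its past. Two
    obstacles shape the rest. The slope of [phi] may be infinite at 0, so the velocity has only a
    one-sided Lipschitz bound, [v(y) - v(x) >= - (y - x)] for [x <= y], from [be < 1]. And the
    concave comparison needs a barrier [xd] with [v(xd) <= 0] in the whole past, that is
    [kappa >= g(xd)]. With [w(0, t)] of order [1 / xh], the inequality
    [1 <= kappa psi(0) (w(0, t) - 1)] gives [kappa] only of order [xh], which in the singular case
    is far below [g(xd)] for [xd] a fixed fraction of a small [xh]. A finer bound, integrating [v]
    against the nearly constant part of the profile, closes this gap. At a record of [x W(x)] the
    contraction and distortion exponents are both proportional to [W(xh)], so they can be balanced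
    once and for all. *)

Lemma ge0_derive_le f df a b : a <= b ->
  (forall x, a < x < b -> is_derive x 1 f (df x)) ->
  (forall x, a < x < b -> 0 <= df x) ->
  (forall x, a <= x <= b -> {for x, continuous f}) -> f a <= f b.
Proof.
rewrite le_eqVlt => /orP[/eqP -> //|ab] fd df0 fc.
have fw : {within `[a, b], continuous f}.
  apply: continuous_in_subspaceT => x; rewrite inE /= in_itv /= => xab.
  exact: fc.
have fd' x : x \in `]a, b[ -> is_derive x 1 f (df x).
  by rewrite in_itv /=; exact: fd.
have [c cab e] := MVT ab fd' fw.
rewrite -subr_ge0 e mulr_ge0 ?subr_ge0 ?(ltW ab)// df0//.
Qed.

Lemma le0_derive_ge f df a b : a <= b ->
  (forall x, a < x < b -> is_derive x 1 f (df x)) ->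
  (forall x, a < x < b -> df x <= 0) ->
  (forall x, a <= x <= b -> {for x, continuous f}) -> f b <= f a.
Proof.
move=> ab fd df0 fc.
rewrite -lerN2; apply: (@ge0_derive_le (fun x => - f x) (fun x => - df x) _ _ ab).
- by move=> x xab; have := fd x xab => ?; exact: is_deriveN.
- by move=> x xab; rewrite oppr_ge0 df0.
- by move=> x xab; apply: continuousN; exact: fc.
Qed.

Lemma continuous_for_dist f x : {for x, continuous f} <->
  forall e, 0 < e -> exists2 d : R, 0 < d & forall y, `|y - x| < d -> `|f y - f x| < e.
Proof.
split.
  move=> fx e e0; have /cvgrPdist_lt/(_ e e0) := fx.
  move=> /nbhs_ballP[d /= d0 h]; exists d => // y yx.
  by rewrite distrC; apply: h; rewrite /ball /= distrC.
move=> h; apply/cvgrPdist_lt => e e0; have [d d0 {}h] := h e e0.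
by apply/nbhs_ballP; exists d => //= y; rewrite /ball /= => yx; rewrite distrC h// distrC.
Qed.

(** The supremum of the [s] such that [P] holds on [[a, s]] belongs to this set by the closing step,
    and the opening step would exceed it. It serves for facts that must be propagated together with
    the estimate that preserves them. *)
Lemma real_induction (P : R -> Prop) a b : P a ->
  (forall x, a <= x < b -> (forall y, a <= y <= x -> P y) ->
     exists2 e : R, 0 < e & forall y, x < y < x + e -> P y) ->
  (forall x, a < x <= b -> (forall y, a <= y < x -> P y) -> P x) ->
  forall x, a <= x <= b -> P x.
Proof.
move=> Pa Popen Pclosed x /andP[ax xb].
pose A := [set s : R | a <= s <= b /\ forall y, a <= y <= s -> P y].
have ab : a <= b by rewrite (le_trans ax).
have Aa : A a.
  split; first by rewrite lexx.
  by move=> y ya; have -> : y = a by apply/eqP; rewrite eq_le andbC.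
have supA : has_sup A.
  split; first by exists a.
  by exists b => s [/andP[_ ?] _].
have as_ : a <= sup A by apply: (ub_le_sup supA.2).
have sb : sup A <= b by apply: ge_sup => [|s [/andP[_ ?] _]//]; exists a.
have Pbelow y : a <= y < sup A -> P y.
  move=> /andP[ay ys].
  have [s [_ h] ys'] := @sup_gt R A y ltac:(by exists a) ys.
  by apply: h; rewrite ay (ltW ys').
have Psup : P (sup A).
  move: as_; rewrite le_eqVlt => /orP[/eqP <- //|as_].
  by apply: Pclosed => //; rewrite as_.
have Ple y : a <= y <= sup A -> P y.
  move=> /andP[ay]; rewrite le_eqVlt => /orP[/eqP -> //|ys].
  by apply: Pbelow; rewrite ay.
have [xs|sx] := leP x (sup A); first by apply: Ple; rewrite ax.
exfalso.
have sltb : sup A < b by rewrite (lt_le_trans sx).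
have [||e e0 h] := Popen (sup A); [by rewrite as_|exact: Ple|].
pose s := Num.min b (sup A + e / 2).
have ss : sup A < s by rewrite /s lt_min sltb/= ltrDl divr_gt0.
have : A s.
  split; first by rewrite (le_trans as_ (ltW ss))/= /s ge_min lexx.
  move=> y /andP[ay ys]; have [yS|Sy] := leP y (sup A); first by apply: Ple; rewrite ay.
  apply: h; rewrite Sy/= (le_lt_trans ys)// /s gt_min.
  by rewrite ltrD2l ltr_pdivrMr// ltr_pMr// ltr1n orbT.
by move=> /(ub_le_sup supA.2); rewrite leNgt ss.
Qed.

Lemma continuous_gtc f x c : {for x, continuous f} -> c < f x ->
  exists2 e : R, 0 < e & forall y, `|y - x| < e -> c < f y.
Proof.
move=> /continuous_for_dist fx cf; have [|d d0 h] := fx (f x - c).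
  by rewrite subr_gt0.
exists d => // y /h; rewrite ltr_norml => /andP[+ _]; lra.
Qed.

Lemma continuous_ltc f x c : {for x, continuous f} -> f x < c ->
  exists2 e : R, 0 < e & forall y, `|y - x| < e -> f y < c.
Proof.
move=> /continuous_for_dist fx cf; have [|d d0 h] := fx (c - f x).
  by rewrite subr_gt0.
exists d => // y /h; rewrite ltr_norml => /andP[_]; lra.
Qed.

(** The sign of the derivative is known only while [f > 0]. On any initial stretch where [f > 0] one
    has [f >= f a], which keeps [f] positive at the end of the stretch, so real induction closes the
    circle. *)
Lemma pos_ge0_derive_le f df a b : a <= b -> 0 < f a ->
  (forall x, a < x < b -> is_derive x 1 f (df x)) ->
  (forall x, a < x < b -> 0 < f x -> 0 <= df x) ->
  (forall x, a <= x <= b -> {for x, continuous f}) -> f a <= f b.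
Proof.
move=> ab fa fd df0 fc.
have mono x : a <= x <= b -> (forall y, a <= y < x -> 0 < f y) -> f a <= f x.
  move=> /andP[ax xb] h; apply: (@ge0_derive_le f df) => //.
  - by move=> y /andP[ay yx]; apply: fd; rewrite ay (lt_le_trans yx).
  - move=> y /andP[ay yx]; apply: df0; first by rewrite ay (lt_le_trans yx).
    by apply: h; rewrite (ltW ay).
  - by move=> y /andP[ay yx]; apply: fc; rewrite ay (le_trans yx).
have P x : a <= x <= b -> 0 < f x.
  apply: (@real_induction (fun x => 0 < f x) a b) => //.
  - move=> y /andP[ay yb] h.
    have fy : 0 < f y by apply: h; rewrite ay lexx.
    have [|e e0 he] := @continuous_gtc f y 0 _ fy; first by apply: fc; rewrite ay ltW.
    exists e => // z /andP[yz ze]; apply: he; rewrite gtr0_norm ?subr_gt0//; lra.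
  - move=> y /andP[ay yb] h; apply: (lt_le_trans fa); apply: mono => //.
    by rewrite (ltW ay).
by apply: mono => [|y /andP[ay yb]]; rewrite ?ab ?lexx//; apply: P; rewrite ay ltW.
Qed.

(** The differential inequality is asked only where [D > 0]: for a difference of trajectories,
    velocities can be compared only at ordered points, and the order comes out together with the
    bound. *)
Lemma Gronwall_lower (D dD : R -> R) (c : R) a b : a <= b -> 0 < D a ->
  (forall x, a < x < b -> is_derive x 1 D (dD x)) ->
  (forall x, a < x < b -> 0 < D x -> - c * D x <= dD x) ->
  (forall x, a <= x <= b -> {for x, continuous D}) ->
  D a * expR (- c * (b - a)) <= D b.
Proof.
move=> ab Da Dd dD0 Dc.
pose E x := D x * expR (c * x).
have : E a <= E b.
  apply: (@pos_ge0_derive_le E (fun x => (dD x + c * D x) * expR (c * x))) => //.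
  - by rewrite /E mulr_gt0// expR_gt0.
  - move=> x xab; have := Dd x xab => ?; apply: is_derive_eq.
    rewrite /GRing.scale/=; ring.
  - move=> x xab; rewrite /E pmulr_lgt0 ?expR_gt0// => Dx.
    by rewrite mulr_ge0 ?expR_ge0//; have := dD0 x xab Dx; lra.
  - move=> x xab; apply: continuousM; first exact: Dc.
    apply: continuous_comp; first by apply: continuousM; [exact: cst_continuous|].
    exact: continuous_expR.
move=> Eab; have -> : - c * (b - a) = c * a - c * b by ring.
by rewrite expRD expRN mulrA ler_pdivrMr ?expR_gt0.
Qed.
End Calculus.

(** * Quotients, Gronwall's inequality with variable rate, ratios of three solutions, primitives *)

Section Calculus2.
Variable R : realType.
Implicit Types (f g : R -> R) (a b x : R).

Lemma is_derive_continuous f x (l : R) : is_derive x 1 f l -> {for x, continuous f}.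
Proof.
by move=> fx; apply: differentiable_continuous; apply/derivable1_diffP; exact: ex_derive.
Qed.

Lemma is_derive_div f g x (df dg : R) : g x != 0 ->
  is_derive x 1 f df -> is_derive x 1 g dg ->
  is_derive x 1 (fun y => f y / g y) ((df * g x - f x * dg) / g x ^+ 2).
Proof.
move=> gx fd gd; have ? := is_deriveV gx gd.
by apply: is_derive_eq; rewrite /GRing.scale/=; field.
Qed.

Lemma continuous_div f g x : g x != 0 ->
  {for x, continuous f} -> {for x, continuous g} ->
  {for x, continuous (fun y => f y / g y)}.
Proof. by move=> gx fc gc; apply: continuousM => //; exact: continuousV. Qed.

Lemma continuous_expR_comp f x : {for x, continuous f} ->
  {for x, continuous (fun y => expR (f y))}.
Proof. by move=> fc; apply: continuous_comp => //; exact: continuous_expR. Qed.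

Lemma continuous_ln_comp f x : 0 < f x -> {for x, continuous f} ->
  {for x, continuous (fun y => ln (f y))}.
Proof. by move=> f0 fc; apply: continuous_comp => //; exact: continuous_ln. Qed.

Lemma is_derive_ln_comp f x (df : R) : 0 < f x -> is_derive x 1 f df ->
  is_derive x 1 (fun y => ln (f y)) (df / f x).
Proof.
move=> f0 fd; have ? := is_derive1_ln f0.
by rewrite mulrC; apply: (@is_derive1_comp R (@ln R) f).
Qed.

Lemma is_derive_expR_comp f x (df : R) : is_derive x 1 f df ->
  is_derive x 1 (fun y => expR (f y)) (df * expR (f x)).
Proof.
by move=> fd; rewrite mulrC; apply: (@is_derive1_comp R (@expR R) f).
Qed.

Lemma Gronwall_upper (D dD G dG : R -> R) a b : a <= b ->
  (forall x, a < x < b -> is_derive x 1 D (dD x)) ->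
  (forall x, a < x < b -> is_derive x 1 G (dG x)) ->
  (forall x, a < x < b -> dD x <= dG x * D x) ->
  (forall x, a <= x <= b -> {for x, continuous D}) ->
  (forall x, a <= x <= b -> {for x, continuous G}) ->
  D b <= D a * expR (G b - G a).
Proof.
move=> ab Dd Gd dD0 Dc Gc.
pose E x := D x * expR (- G x).
have : E b <= E a.
  apply: (@le0_derive_ge _ E (fun x => (dD x - dG x * D x) * expR (- G x))) => //.
  - move=> x xab; have ? := Dd x xab; have ? := Gd x xab.
    have ? : is_derive x 1 (fun y => - G y) (- dG x) by apply: is_deriveN.
    have ? := @is_derive_expR_comp (fun y => - G y) x (- dG x) _.
    by apply: is_derive_eq; rewrite /GRing.scale/=; ring.
  - move=> x xab; apply: mulr_le0_ge0; last exact: expR_ge0.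
    by rewrite subr_le0 dD0.
  - move=> x xab; apply: continuousM; first exact: Dc.
    by apply: continuous_expR_comp; apply: continuousN; exact: Gc.
rewrite /E => Eab; have -> : D b = D b * expR (- G b) * expR (G b).
  by rewrite -mulrA -expRD addNr expR0 mulr1.
by rewrite expRD [X in _ <= _ * X]mulrC mulrA ler_pM2r ?expR_gt0.
Qed.

(** The last hypothesis is the numerator of the quotient rule for [(a3 - a2) / (a2 - a1)]. The
    functions are kept abstract so that they may be trajectories, a constant, or images of
    trajectories under a monotone function. *)
Lemma three_point_ratio (a1 a2 a3 d1 d2 d3 : R -> R) a b : a <= b ->
  (forall x, a < x < b -> is_derive x 1 a1 (d1 x)) ->
  (forall x, a < x < b -> is_derive x 1 a2 (d2 x)) ->
  (forall x, a < x < b -> is_derive x 1 a3 (d3 x)) ->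
  (forall x, a <= x <= b -> {for x, continuous a1}) ->
  (forall x, a <= x <= b -> {for x, continuous a2}) ->
  (forall x, a <= x <= b -> {for x, continuous a3}) ->
  (forall x, a <= x <= b -> a1 x < a2 x) ->
  (forall x, a < x < b ->
     (d3 x - d2 x) * (a2 x - a1 x) <= (d2 x - d1 x) * (a3 x - a2 x)) ->
  (a3 b - a2 b) * (a2 a - a1 a) <= (a3 a - a2 a) * (a2 b - a1 b).
Proof.
move=> ab D1 D2 D3 C1 C2 C3 lt12 slope.
pose Q x := (a3 x - a2 x) / (a2 x - a1 x).
have p x : a <= x <= b -> 0 < a2 x - a1 x by move=> /lt12; rewrite subr_gt0.
have : Q b <= Q a.
  apply: (@le0_derive_ge _ Q (fun x => ((d3 x - d2 x) * (a2 x - a1 x)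
      - (a3 x - a2 x) * (d2 x - d1 x)) / (a2 x - a1 x) ^+ 2)) => //.
  - move=> x xab; have ? := D1 x xab; have ? := D2 x xab; have ? := D3 x xab.
    have xab' : a <= x <= b by move: xab => /andP[/ltW -> /ltW ->].
    by apply: is_derive_div; rewrite ?gt_eqF ?p//.
  - move=> x xab; apply: mulr_le0_ge0; last by rewrite invr_ge0 sqr_ge0.
    by have := slope x xab; lra.
  - move=> x xab; apply: continuous_div; first by rewrite gt_eqF ?p.
      by apply: continuousB; [exact: C3|exact: C2].
    by apply: continuousB; [exact: C2|exact: C1].
by rewrite /Q ler_pdivrMr ?p ?ab ?lexx// mulrAC ler_pdivlMr// p// ab lexx.
Qed.

(** A right-hand bound at each point, without a derivative: it is meant for [life], which need not
    be differentiable everywhere. Real induction moves the bound to the right and continuity passes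
    it to the limit. *)
Lemma local_slope_le f (c : R) a b : a <= b ->
  (forall x, a <= x <= b -> {for x, continuous f}) ->
  (forall x, a <= x < b -> exists2 e : R, 0 < e &
     forall y, x < y < x + e -> y <= b -> f y - f x <= c * (y - x)) ->
  f b - f a <= c * (b - a).
Proof.
move=> ab fc loc.
apply: (@real_induction _ (fun x => x <= b -> f x - f a <= c * (x - a)) a b) => //.
- by rewrite !subrr mulr0.
- move=> x /andP[ax xb] h; have [|e e0 he] := loc x; first by rewrite ax.
  exists e => // y yx yb; have := he y yx yb.
  have := h x; rewrite ax lexx (ltW xb) => /(_ isT isT).
  by rewrite !mulrBr; lra.
- move=> x /andP[ax xb] h _; rewrite leNgt; apply/negP => hlt.
  pose g y := f y - f a - c * (y - a).
  have gc : {for x, continuous g}.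
    have ? : {for x, continuous f} by apply: fc; rewrite (ltW ax).
    apply: continuousB; first by apply: continuousB => //; exact: cst_continuous.
    apply: continuousM; first exact: cst_continuous.
    by apply: continuousB; [exact: cvg_id|exact: cst_continuous].
  have [|e e0 he] := @continuous_gtc _ g x 0 gc; first by rewrite subr_gt0.
  pose y := Num.max a (x - e / 2).
  have yx : y < x by rewrite /y gt_max ax/= ltrBlDr ltrDl divr_gt0.
  have ya : a <= y by rewrite /y le_max lexx.
  have := he y; rewrite ltr0_norm ?subr_lt0// opprB.
  have : x - e / 2 <= y by rewrite /y le_max lexx orbT.
  move=> yy; have -> : x - y < e by lra.
  move=> /(_ isT); have := h y; rewrite ya yx => /(_ isT (le_trans (ltW yx) xb)).
  rewrite /g; lra.
- by rewrite ab lexx.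
Qed.

Lemma primitive_exists f a b :
  (forall x, a <= x < b -> {for x, continuous f}) ->
  exists G : R -> R, forall x, a < x < b -> is_derive x 1 G (f x).
Proof.
move=> fc; exists (fun x => \int[lebesgue_measure]_(t in `[a, x]) f t).
move=> x /andP[ax xb].
pose u := (x + b) / 2.
have xu : x < u by rewrite /u; lra.
have ub : u < b by rewrite /u; lra.
have [] := @continuous_FTC1_closed _ f a x u xu _ ax.
- apply: continuous_compact_integrable; first exact: segment_compact.
  apply: continuous_in_subspaceT => y; rewrite inE /= in_itv/= => /andP[ay yu].
  by apply: fc; rewrite ay (le_lt_trans yu).
- by apply: fc; rewrite (ltW ax).
- by move=> /derivableP dF <-; rewrite derive1E.
Qed.

End Calculus2.

(** * Trajectories and the backward flow *)

(** What is used of the coefficients once they are extended to the line. Concavity and convexity are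
    stated by chords, which still make sense at 0 where derivatives may be infinite. [strong]
    expresses the curvature at 1, with [p + q > 0] coming from psi''(1) - phi''(1) > 0; [dW_half]
    comes from the signs of the third derivatives; [g_concave] is the monotonicity hypothesis
    divided by [al], up to an additive constant. *)
Record coefs (R : realType) (phi psi phi1 psi1 dW : R -> R) (al be : R) : Prop := Coefs {
  phi_cont : forall x : R, {for x, continuous phi};
  psi_cont : forall x : R, {for x, continuous psi};
  phi_der : forall x : R, 0 < x < 1 -> is_derive x 1 phi (phi1 x);
  psi_der : forall x : R, 0 < x < 1 -> is_derive x 1 psi (psi1 x);
  phi_at0 : phi 0 = 0;
  phi_at1 : phi 1 = 0;
  psi_at1 : psi 1 = 0;
  al_gt0 : 0 < al;
  be_gt0 : 0 < be;
  be_lt1 : be < 1;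
  phi_chord : forall x y z : R, 0 <= x -> x <= y -> y <= z -> z <= 1 ->
    (phi z - phi y) * (y - x) <= (phi y - phi x) * (z - y);
  psi_chord : forall x y z : R, 0 <= x -> x <= y -> y <= z -> z <= 1 ->
    (psi y - psi x) * (z - y) <= (psi z - psi y) * (y - x);
  phi_decr : forall x y : R, 0 <= x -> x <= y -> y <= 1 -> - be * (y - x) <= phi y - phi x;
  psi_decr : forall x y : R, 0 <= x -> x <= y -> y <= 1 -> psi y - psi x <= - al * (y - x);
  strong : exists p q : R, [/\ 0 <= p, 0 <= q, 0 < p + q &
    forall x y : R, 0 <= x -> x < y -> y < 1 ->
      p * (1 - y) <= (phi y - phi x) / (y - x) + phi x / (1 - x) /\
      (psi y - psi x) / (y - x) + psi x / (1 - x) <= - (q * (1 - y))];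
  taylor1 : exists2 C : R, 0 < C & forall x : R, 0 <= x -> x <= 1 ->
      be * (1 - x) - C * (1 - x) ^+ 2 <= phi x /\
      psi x <= al * (1 - x) + C * (1 - x) ^+ 2;
  W_der : forall x : R, 0 < x < 1 ->
    is_derive x 1 (fun x => phi1 x * psi x - phi x * psi1 x) (dW x);
  dW_le0 : forall x : R, 0 < x < 1 -> dW x <= 0;
  W_gt0 : forall x : R, 0 < x < 1 -> 0 < phi1 x * psi x - phi x * psi1 x;
  dW_half : forall x : R, 0 < x < 1 -> - dW x <=
    4 / x * (phi1 (x / 2) * psi (x / 2) - phi (x / 2) * psi1 (x / 2));
  dW_lower : forall xd : R, 0 < xd < 1 -> exists2 B : R, 0 < B & forall x : R, xd <= x < 1 ->
    - dW x * psi x <= B * (phi1 x * psi x - phi x * psi1 x);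
  g_concave : forall x y : R, 0 < x -> x <= y -> y < 1 ->
    phi y / psi y + (phi1 y * psi y - phi y * psi1 y) / (al * psi y) <=
    phi x / psi x + (phi1 x * psi x - phi x * psi1 x) / (al * psi x)
}.

Section Paths.
Variables (R : realType) (phi psi phi1 psi1 dW : R -> R) (al be : R).
Hypothesis co : coefs phi psi phi1 psi1 dW al be.
Variable kappa : R -> R.
Hypothesis kappa_cont : forall s : R, {for s, continuous kappa}.
Hypothesis kappa_gt0 : forall s, 0 < kappa s.
Implicit Types (X Y : R -> R) (s t x y : R).

Definition velocity s x := phi x - kappa s * psi x.

Local Notation vel := velocity.

Definition trajectory t X := [/\ forall s : R, {for s, continuous X},
  forall s, 0 <= s <= t -> 0 <= X s < 1 &
  forall s, 0 < s < t -> is_derive s 1 X (vel s (X s))].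
Local Notation path := trajectory.

Lemma phi_ge0 x : 0 <= x <= 1 -> 0 <= phi x.
Proof.
move=> /andP[x0 x1]; have := phi_chord co (lexx 0) x0 x1 (lexx 1).
rewrite (phi_at0 co) (phi_at1 co); nra.
Qed.

Lemma phi_le x : 0 <= x <= 1 -> phi x <= be * (1 - x).
Proof.
by move=> /andP[x0 x1]; have := phi_decr co x0 x1 (lexx 1); rewrite (phi_at1 co); lra.
Qed.

Lemma psi_ge x : 0 <= x <= 1 -> al * (1 - x) <= psi x.
Proof.
by move=> /andP[x0 x1]; have := psi_decr co x0 x1 (lexx 1); rewrite (psi_at1 co); lra.
Qed.

Lemma psi_le x : 0 <= x <= 1 -> psi x <= psi 0 * (1 - x).
Proof.
move=> /andP[x0 x1]; have := psi_chord co (lexx 0) x0 x1 (lexx 1).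
rewrite (psi_at1 co); nra.
Qed.

Lemma psi_ninc x y : 0 <= x -> x <= y -> y <= 1 -> psi y <= psi x.
Proof. by move=> x0 xy y1; have := psi_decr co x0 xy y1; have := al_gt0 co; nra. Qed.

Lemma psi_gt0 x : 0 <= x < 1 -> 0 < psi x.
Proof.
move=> /andP[x0 x1]; have := @psi_ge x; rewrite x0 (ltW x1) => /(_ isT).
have := al_gt0 co; nra.
Qed.

(** Slopes of [phi] are at least [- be > - 1], and [- kappa psi] is increasing. There is no such
    bound from above near 0. *)
Lemma vel_lip s x y : 0 <= x -> x <= y -> y <= 1 -> - (y - x) <= vel s y - vel s x.
Proof.
move=> x0 xy y1; rewrite /velocity; have := phi_decr co x0 xy y1.
have := psi_ninc x0 xy y1; have := be_lt1 co; have := kappa_gt0 s; nra.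
Qed.

Lemma vel_chord s x y z : 0 <= x -> x <= y -> y <= z -> z <= 1 ->
  (vel s z - vel s y) * (y - x) <= (vel s y - vel s x) * (z - y).
Proof.
move=> x0 xy yz z1; rewrite /velocity; have := phi_chord co x0 xy yz z1.
have := psi_chord co x0 xy yz z1; have := kappa_gt0 s; nra.
Qed.

Lemma vel1 s : vel s 1 = 0.
Proof. by rewrite /velocity (phi_at1 co) (psi_at1 co) mulr0 subr0. Qed.

Lemma vel0 s : vel s 0 < 0.
Proof.
rewrite /velocity (phi_at0 co) sub0r oppr_lt0 mulr_gt0//.
by apply: psi_gt0; rewrite lexx ltr01.
Qed.

Lemma path_cont t X s : path t X -> {for s, continuous X}.
Proof. by case. Qed.

Lemma path_in t X s : path t X -> 0 <= s <= t -> 0 <= X s < 1.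
Proof. by case=> _ + _; exact. Qed.

Lemma path_der t X s : path t X -> 0 < s < t -> is_derive s 1 X (vel s (X s)).
Proof. by case=> _ _; exact. Qed.

Lemma path_sub t a X : path t X -> a <= t -> path a X.
Proof.
move=> [? h1 h2] at_; split => // s /andP[s0 sa].
  by apply: h1; rewrite s0 (le_trans sa).
by apply: h2; rewrite s0 (lt_le_trans sa).
Qed.

Lemma path_gap t a X Y : path t X -> path t Y -> 0 <= a <= t -> X a < Y a ->
  (Y a - X a) * expR (- (t - a)) <= Y t - X t.
Proof.
move=> pX pY /andP[a0 at_] XY.
have := @Gronwall_lower _ (fun s => Y s - X s)
  (fun s => vel s (Y s) - vel s (X s)) 1 a t at_.
rewrite mulN1r; apply.
- by rewrite subr_gt0.
- move=> s /andP[as_ st]; have s0t : 0 < s < t by rewrite (le_lt_trans a0).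
  by have ? := path_der pX s0t; have ? := path_der pY s0t; exact: is_deriveB.
- move=> s /andP[as_ st]; rewrite subr_gt0 => lts; rewrite mulN1r.
  have s0t : 0 <= s <= t by rewrite (le_trans a0 (ltW as_)) ltW.
  have /andP[? ?] := path_in pX s0t; have /andP[? ?] := path_in pY s0t.
  by apply: vel_lip => //; exact: ltW.
- by move=> s _; apply: continuousB; [exact: path_cont pY|exact: path_cont pX].
Qed.

Lemma path_lt t a X Y : path t X -> path t Y -> 0 <= a <= t -> X a < Y a -> X t < Y t.
Proof.
move=> pX pY at_ XY; rewrite -subr_gt0; apply: lt_le_trans (path_gap pX pY at_ XY).
by rewrite mulr_gt0 ?expR_gt0// subr_gt0.
Qed.

Lemma path_le t a X Y : path t X -> path t Y -> 0 <= a <= t -> X t <= Y t -> X a <= Y a.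
Proof.
move=> pX pY at_; rewrite leNgt; apply: contraNle.
exact: path_lt.
Qed.

Lemma path_eq t a X Y : path t X -> path t Y -> 0 <= a <= t -> X t = Y t -> X a = Y a.
Proof.
move=> pX pY at_ XY; apply/eqP; rewrite eq_le.
by rewrite (path_le pX pY at_) ?XY// (path_le pY pX at_) ?XY.
Qed.

(** Where the velocity at [c] is not positive, a trajectory below [c] stays below it in forward
    time. For [c > 1] the zero of the velocity at 1 takes over. *)
Lemma path_low t a X c : path t X -> 0 <= a <= t -> 0 <= c ->
  (forall s, a < s < t -> vel s c <= 0) -> c <= X t -> c <= X a.
Proof.
move=> pX /andP[a0 at_] c0 vc; rewrite leNgt; apply: contraNle => Xc.
rewrite -subr_gt0.
have c0' : 0 < c - X a by rewrite subr_gt0.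
apply: lt_le_trans (@Gronwall_lower _ (fun s => c - X s)
  (fun s => 0 - vel s (X s)) 1 a t at_ c0' _ _ _).
- by rewrite mulr_gt0// expR_gt0.
- move=> s /andP[as_ st]; have s0t : 0 < s < t by rewrite (le_lt_trans a0).
  by have ? := path_der pX s0t; apply: is_deriveB.
- move=> s /andP[as_ st]; rewrite subr_gt0 => lts; rewrite mulN1r.
  have s0t : 0 <= s <= t by rewrite (le_trans a0 (ltW as_)) ltW.
  have /andP[X0 X1] := path_in pX s0t.
  have vs : vel s c <= 0 by apply: vc; rewrite as_.
  have [c1|c1] := leP c 1.
    by have := vel_lip s X0 (ltW lts) c1; lra.
  by have := vel_lip s X0 (ltW X1) (lexx 1); rewrite vel1; lra.
- by move=> s _; apply: continuousB; [exact: cst_continuous|exact: path_cont pX].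
Qed.

Lemma path_up t a X c : path t X -> 0 <= a <= t -> 0 <= c ->
  (forall s, a < s < t -> 0 <= vel s c) -> X t <= c -> X a <= c.
Proof.
move=> pX /andP[a0 at_] c0 vc; rewrite leNgt; apply: contraNle => Xc.
rewrite -subr_gt0.
have c0' : 0 < X a - c by rewrite subr_gt0.
apply: lt_le_trans (@Gronwall_lower _ (fun s => X s - c)
  (fun s => vel s (X s) - 0) 1 a t at_ c0' _ _ _).
- by rewrite mulr_gt0// expR_gt0.
- move=> s /andP[as_ st]; have s0t : 0 < s < t by rewrite (le_lt_trans a0).
  by have ? := path_der pX s0t; apply: is_deriveB.
- move=> s /andP[as_ st]; rewrite subr_gt0 => lts; rewrite mulN1r.
  have s0t : 0 <= s <= t by rewrite (le_trans a0 (ltW as_)) ltW.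
  have /andP[X0 X1] := path_in pX s0t.
  have vs : 0 <= vel s c by apply: vc; rewrite as_.
  by have := vel_lip s c0 (ltW lts) (ltW X1); lra.
- by move=> s _; apply: continuousB; [exact: path_cont pX|exact: cst_continuous].
Qed.

Lemma vel_comp_cont X s : {for s, continuous X} ->
  {for s, continuous (fun s => vel s (X s))}.
Proof.
move=> Xc; apply: continuousB; first by apply: continuous_comp => //; exact: phi_cont co _.
apply: continuousM; first exact: kappa_cont.
by apply: continuous_comp => //; exact: psi_cont co _.
Qed.

(** The velocity at 0 is negative, so a trajectory at 0 before its final time would be nonincreasing
    just afterwards, hence identically 0 there, with the wrong derivative. *)
Lemma path_gt0 t X s : path t X -> 0 <= s < t -> 0 < X s.
Proof.
move=> pX /andP[s0 st].
have s0t : 0 <= s <= t by rewrite s0 ltW.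
have /andP[X0 _] := path_in pX s0t.
rewrite lt_neqAle X0 andbT; apply/eqP => Xs0.
have vX : vel s (X s) < 0 by rewrite -Xs0 vel0.
have [e e0 he] := continuous_ltc (vel_comp_cont (path_cont pX)) vX.
pose u := Num.min t (s + e / 2).
have su : s < u by rewrite /u lt_min st/= ltrDl divr_gt0.
have ut : u <= t by rewrite /u ge_min lexx.
have ue : u <= s + e / 2 by rewrite /u ge_min lexx orbT.
have Xle a : s < a <= u -> X a <= X s.
  move=> /andP[sa au]; apply: (@le0_derive_ge _ X (fun s => vel s (X s))).
  - exact: ltW.
  - move=> r /andP[sr ra]; apply: (path_der pX); rewrite (le_lt_trans s0)//=.
    by rewrite (lt_le_trans ra)// (le_trans au).
  - move=> r /andP[sr ra]; apply/ltW/he; rewrite gtr0_norm ?subr_gt0//; lra.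
  - by move=> r _; exact: path_cont pX.
have X0' a : s < a <= u -> X a = 0.
  move=> sau; apply/eqP; rewrite eq_le Xs0 Xle//= -Xs0.
  case/andP: sau => sa au.
  have : 0 <= a <= t by rewrite (le_trans s0 (ltW sa)) (le_trans au).
  by move=> /(path_in pX)/andP[].
(* X vanishes on an interval, where its derivative is negative *)
pose a := (s + u) / 2.
have sa : s < a by rewrite /a; lra.
have au : a < u by rewrite /a; lra.
have at_ : 0 < a < t by rewrite (le_lt_trans s0 sa) (lt_le_trans au).
have dX := path_der pX at_.
have : is_derive a 1 X 0.
  have c0 : is_derive a 1 (fun=> 0 : R) (0 : R) by apply: is_derive_cst.
  apply: near_eq_is_derive c0.
  near=> z; rewrite X0'//; apply/andP; split; near: z.
    exact: lt_nbhsr.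
  by near=> z; apply/ltW; near: z; exact: lt_nbhsl.
move=> [_ D0]; have := dX; rewrite X0'; last by rewrite sa ltW.
by move=> [_]; rewrite D0 => v0; have := vel0 a; rewrite -v0 ltxx.
Unshelve. all: by end_near. Qed.

Lemma kappa_bounded a b : a <= b -> exists2 M, 0 < M & forall s, a <= s <= b -> kappa s <= M.
Proof.
move=> ab; have [|c _ hc] := @EVT_max R kappa a b ab.
  by apply: continuous_subspaceT => s; exact: kappa_cont.
by exists (kappa c) => // s sab; apply: hc; rewrite in_itv.
Qed.

Lemma path_min_gt0 t X a b : path t X -> 0 <= a <= b -> b < t ->
  exists2 d, 0 < d & forall s, a <= s <= b -> d <= X s.
Proof.
move=> pX /andP[a0 ab] bt; have [|c cab hc] := @EVT_min R X a b ab.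
  by apply: continuous_subspaceT => s; exact: path_cont pX.
exists (X c) => [|s sab]; last by apply: hc; rewrite in_itv.
move: cab; rewrite in_itv/= => /andP[ac cb]; apply: (path_gt0 pX).
by rewrite (le_trans a0 ac) (le_lt_trans cb).
Qed.

(** By concavity no slope to the right of [d] exceeds the chord slope over [[0, d]]: away from 0 the
    velocity is Lipschitz from above as well. *)
Lemma vel_slope_le s d x y : 0 < d -> d <= x -> x <= y -> y <= 1 ->
  vel s y - vel s x <= (phi d + kappa s * (psi 0 - psi d)) / d * (y - x).
Proof.
move=> d0 dx xy y1.
have d1 : d <= 1 by rewrite (le_trans dx)// (le_trans xy).
have x1 : x <= 1 by rewrite (le_trans xy).
have x0 : 0 < x by rewrite (lt_le_trans d0).
have E : (phi d + kappa s * (psi 0 - psi d)) / d = (vel s d - vel s 0) / d.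
  by rewrite /velocity (phi_at0 co); congr (_ / _); ring.
rewrite E -(ler_pM2r x0).
have h1 := vel_chord s (lexx 0) (ltW x0) xy y1.
have h2 := vel_chord s (lexx 0) (ltW d0) dx x1.
have h3 : (vel s x - vel s 0) * d <= (vel s d - vel s 0) * x by lra.
have : (vel s x - vel s 0) <= (vel s d - vel s 0) / d * x.
  by rewrite mulrAC ler_pdivlMr.
move=> h4; rewrite subr0 in h1; apply: (le_trans h1).
have yx : 0 <= y - x by rewrite subr_ge0.
by have := ler_wpM2r yx h4; lra.
Qed.

(** Backward separation despite the infinite slope at 0. Up to a time [b < t] the lower trajectory
    stays above some [d > 0] by [path_gt0], so a meeting at [a] would persist until [b] by Gronwall;
    but [b] is so close to [t] that continuity keeps the two apart there. *)
Lemma path_lt_back t a X Y : path t X -> path t Y -> 0 <= a <= t -> X t < Y t -> X a < Y a.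
Proof.
move=> pX pY /andP[a0 at_] XYt.
have le_XY s : 0 <= s <= t -> X s <= Y s by move=> ?; apply: (path_le pX pY) => //; exact: ltW.
rewrite lt_neqAle le_XY ?a0// andbT; apply/eqP => XYa.
have {}at_ : a < t.
  by rewrite lt_neqAle at_ andbT; apply/eqP => e; move: XYt; rewrite -e XYa ltxx.
have XYc : {for t, continuous (fun s => Y s - X s)}.
  by apply: continuousB; [exact: path_cont pY|exact: path_cont pX].
have [|e e0 he] := @continuous_gtc _ _ t 0 XYc; first by rewrite subr_gt0.
pose b := Num.max a (t - e / 2).
have ab : a <= b by rewrite /b le_max lexx.
have bt : b < t by rewrite /b gt_max at_/=; lra.
have be_ : t - e / 2 <= b by rewrite /b le_max lexx orbT.
have := he b; rewrite ltr0_norm ?subr_lt0// opprB => /(_ ltac:(lra)).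
apply/negP; rewrite -leNgt.
have [d d0 hd] := path_min_gt0 pX (introT andP (conj a0 ab)) bt.
have [M M0 hM] := kappa_bounded ab.
pose L := (phi d + M * (psi 0 - psi d)) / d.
have bin : 0 <= b <= t by rewrite (le_trans a0 ab) ltW.
have /andP[_ Xb1] := path_in pX bin.
have d1 : d <= 1 by apply: le_trans (ltW Xb1); apply: hd; rewrite ab lexx.
have := @Gronwall_upper _ (fun s => Y s - X s) (fun s => vel s (Y s) - vel s (X s))
  (fun s => L * s) (fun=> L) a b ab.
rewrite XYa subrr mul0r; apply.
- move=> s /andP[as_ sb]; have s0t : 0 < s < t by rewrite (le_lt_trans a0)// (lt_trans sb).
  by have ? := path_der pX s0t; have ? := path_der pY s0t; exact: is_deriveB.
- by move=> s _; apply: is_derive_eq; rewrite /GRing.scale/=; ring.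
- move=> s /andP[as_ sb].
  have s0t : 0 <= s <= t by rewrite (le_trans a0 (ltW as_))// (le_trans (ltW sb))// ltW.
  have /andP[X0 X1] := path_in pX s0t; have /andP[Y0 Y1] := path_in pY s0t.
  have XY := le_XY s s0t.
  have dX : d <= X s by apply: hd; rewrite !ltW.
  apply: (le_trans (vel_slope_le s d0 dX XY (ltW Y1))).
  rewrite ler_wpM2r ?subr_ge0// /L ler_pM2r ?invr_gt0// lerD2l ler_wpM2r//.
    by rewrite subr_ge0; exact: psi_ninc (ltW d0) d1.
  by apply: hM; rewrite !ltW.
- by move=> s _; apply: continuousB; [exact: path_cont pY|exact: path_cont pX].
- move=> s _; apply: continuousM; [exact: cst_continuous|exact: cvg_id].
Qed.

End Paths.

(** * Convexity of the backward flow, in [x] and in exponentials of [Psi] *)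

Section Flow.
Variables (R : realType) (phi psi phi1 psi1 dW : R -> R) (al be : R).
Hypothesis co : coefs phi psi phi1 psi1 dW al be.
Variable kappa : R -> R.
Hypothesis kappa_cont : forall s : R, {for s, continuous kappa}.
Hypothesis kappa_gt0 : forall s, 0 < kappa s.
Local Notation path := (trajectory phi psi kappa).
Local Notation vel := (velocity phi psi kappa).
Local Notation pder p := (fun s => path_der (s := s) p).
Implicit Types (X Y : R -> R) (s t x y z : R).

(** Existence of trajectories is part of the notion of solution; [path_eq] then makes the value
    independent of the trajectory chosen. *)
Definition is_flow (F : R -> R -> R) := forall x t, 0 <= x < 1 -> 0 <= t ->
  exists X, [/\ path t X, X t = x & F x t = X 0].

Variable F : R -> R -> R.
Hypothesis flow : is_flow F.

Lemma flow_path t X : path t X -> 0 <= t -> F (X t) t = X 0.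
Proof.
move=> pX t0; have Xt : 0 <= X t < 1 by apply: (path_in pX); rewrite t0 lexx.
have [Y [pY Yt ->]] := flow Xt t0.
by apply: (path_eq co kappa_gt0 pY pX); rewrite ?lexx.
Qed.

Lemma flow_in x t : 0 <= x < 1 -> 0 <= t -> 0 <= F x t < 1.
Proof.
by move=> x01 t0; have [X [pX _ ->]] := flow x01 t0; apply: (path_in pX); rewrite lexx.
Qed.

Lemma flow_sub t a X : path t X -> 0 <= a <= t -> F (X t) t = F (X a) a.
Proof.
move=> pX /andP[a0 at_]; rewrite (flow_path pX) ?(le_trans a0)//.
by rewrite (flow_path (path_sub pX at_)).
Qed.

Lemma flow_lt x y t : 0 <= x -> x < y -> y < 1 -> 0 <= t -> F x t < F y t.
Proof.
move=> x0 xy y1 t0.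
have [X [pX Xt ->]] := flow (introT andP (conj x0 (lt_trans xy y1))) t0.
have [Y [pY Yt ->]] := flow (introT andP (conj (le_trans x0 (ltW xy)) y1)) t0.
by apply: (path_lt_back co kappa_cont kappa_gt0 pX pY); rewrite ?lexx// Xt Yt.
Qed.

Lemma flow_le x y t : 0 <= x -> x <= y -> y < 1 -> 0 <= t -> F x t <= F y t.
Proof.
move=> x0; rewrite le_eqVlt => /orP[/eqP -> //|xy] y1 t0; exact/ltW/flow_lt.
Qed.

Lemma flow_lip x y t : 0 <= x -> x <= y -> y < 1 -> 0 <= t ->
  F y t - F x t <= expR t * (y - x).
Proof.
move=> x0; rewrite le_eqVlt => /orP[/eqP ->|xy] y1 t0; first by rewrite !subrr mulr0.
have [X [pX Xt FX]] := flow (introT andP (conj x0 (lt_trans xy y1))) t0.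
have [Y [pY Yt FY]] := flow (introT andP (conj (le_trans x0 (ltW xy)) y1)) t0.
have := flow_lt x0 xy y1 t0; rewrite FX FY => XY.
have := path_gap co kappa_gt0 pX pY (introT andP (conj (lexx 0) t0)) XY.
by rewrite subr0 expRN Xt Yt ler_pdivrMr ?expR_gt0// mulrC.
Qed.

Lemma flow_convex x y z t : 0 <= x -> x <= y -> y <= z -> z < 1 -> 0 <= t ->
  (F y t - F x t) * (z - y) <= (F z t - F y t) * (y - x).
Proof.
move=> x0; rewrite le_eqVlt => /orP[/eqP ->|xy]; first by rewrite !subrr mul0r mulr0.
rewrite le_eqVlt => /orP[/eqP ->|yz] z1 t0; first by rewrite !subrr mul0r mulr0.
have y1 := lt_trans yz z1; have y0 := le_trans x0 (ltW xy).
have [X [pX Xt ->]] := flow (introT andP (conj x0 (lt_trans xy y1))) t0.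
have [Y [pY Yt ->]] := flow (introT andP (conj y0 y1)) t0.
have [Z [pZ Zt ->]] := flow (introT andP (conj (le_trans y0 (ltW yz)) z1)) t0.
have XY s : 0 <= s <= t -> X s < Y s.
  by move=> st; apply: (path_lt_back co kappa_cont kappa_gt0 pX pY); rewrite ?Xt ?Yt.
have YZ s : 0 <= s <= t -> Y s < Z s.
  by move=> st; apply: (path_lt_back co kappa_cont kappa_gt0 pY pZ); rewrite ?Yt ?Zt.
rewrite mulrC -Xt -Yt -Zt; apply: (three_point_ratio t0 (pder pX) (pder pY) (pder pZ)) => //.
- by move=> s _; exact: path_cont pX.
- by move=> s _; exact: path_cont pY.
- by move=> s _; exact: path_cont pZ.
- move=> s /andP[s0 st].
  have s0t : 0 <= s <= t by rewrite !ltW.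
  have /andP[? ?] := path_in pX s0t; have /andP[? ?] := path_in pZ s0t.
  by apply: (vel_chord co kappa_gt0) => //; apply: ltW => //; [exact: XY|exact: YZ].
Qed.

(** Convexity up to the endpoint 1: the stationary solution 1 is the third trajectory. *)
Lemma flow_convex1 x y t : 0 <= x -> x <= y -> y < 1 -> 0 <= t ->
  (1 - y) * (1 - F x t) <= (1 - F y t) * (1 - x).
Proof.
move=> x0; rewrite le_eqVlt => /orP[/eqP ->|xy y1 t0]; first by rewrite mulrC.
have y0 := le_trans x0 (ltW xy).
have [X [pX Xt ->]] := flow (introT andP (conj x0 (lt_trans xy y1))) t0.
have [Y [pY Yt ->]] := flow (introT andP (conj y0 y1)) t0.
have XY s : 0 <= s <= t -> X s < Y s.
  by move=> st; apply: (path_lt_back co kappa_cont kappa_gt0 pX pY); rewrite ?Xt ?Yt.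
suff : (1 - Y t) * (Y 0 - X 0) <= (1 - Y 0) * (Y t - X t) by rewrite Xt Yt; nra.
apply: (@three_point_ratio _ X Y (fun=> 1) _ _ (fun=> 0) 0 t t0 (pder pX) (pder pY)) => //.
- by move=> s _; exact: path_cont pX.
- by move=> s _; exact: path_cont pY.
- by move=> s _; exact: cst_continuous.
- move=> s /andP[s0 st].
  have s0t : 0 <= s <= t by rewrite !ltW.
  have /andP[? ?] := path_in pX s0t; have /andP[? ?] := path_in pY s0t.
  rewrite -[X in (X - _) * _](vel1 co kappa s).
  by apply: (vel_chord co kappa_gt0) => //; apply: ltW => //; exact: XY.
Qed.

Lemma Psi_exists : exists Psi : R -> R, forall x, 0 <= x < 1 -> is_derive x 1 Psi (psi x)^-1.
Proof.
(* Freezing [psi] to the left of 0 gives the primitive a two-sided derivative at 0. *)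
pose f x := (psi (Num.max 0 x))^-1.
have [|G hG] := @primitive_exists R f (- 1) 1.
  move=> x /andP[x1 x1'].
  apply: continuousV.
    rewrite gt_eqF//; apply: (psi_gt0 co); rewrite le_max lexx/= gt_max ltr01//.
  apply: continuous_comp; last exact: psi_cont co _.
  apply: (@continuous_max R R (fun=> 0) id); [exact: cst_continuous|exact: cvg_id].
exists G => x /andP[x0 x1]; have := hG x; rewrite x1 (lt_le_trans _ x0)//.
by rewrite /f max_r// => /(_ isT).
Qed.

Variable Psi : R -> R.
Hypothesis PsiP : forall x, 0 <= x < 1 -> is_derive x 1 Psi (psi x)^-1.

(* Psi is the coordinate in which the vector field psi is constant; the flow is
   convex or concave in x and in suitable exponentials of Psi. *)
Definition Ec (c x : R) := expR (c * Psi x).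

Lemma Ec_gt0 c x : 0 < Ec c x. Proof. exact: expR_gt0. Qed.

Lemma Ec_der c x : 0 <= x < 1 -> is_derive x 1 (Ec c) (c * Ec c x / psi x).
Proof.
move=> x01; have ? := PsiP x01.
have ? : is_derive x 1 (fun y => c * Psi y) (c / psi x).
  by apply: is_derive_eq; rewrite /GRing.scale/=; ring.
have -> : c * Ec c x / psi x = c / psi x * expR (c * Psi x) by rewrite /Ec; ring.
exact: (@is_derive_expR_comp _ (fun y => c * Psi y)).
Qed.

Lemma Ec_cont c x : 0 <= x < 1 -> {for x, continuous (Ec c)}.
Proof. by move=> x01; exact: is_derive_continuous (Ec_der c x01). Qed.

Lemma Psi_cont x : 0 <= x < 1 -> {for x, continuous Psi}.
Proof. by move=> x01; exact: is_derive_continuous (PsiP x01). Qed.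

Lemma Psi_bounds x y : 0 <= x -> x <= y -> y < 1 ->
  (y - x) / psi x <= Psi y - Psi x <= (y - x) / psi y.
Proof.
move=> x0 xy y1.
have inner z : x < z < y -> 0 <= z < 1.
  by move=> /andP[xz zy]; rewrite (le_trans x0 (ltW xz)) (lt_trans zy).
have inner' z : x <= z <= y -> 0 <= z < 1.
  by move=> /andP[xz zy]; rewrite (le_trans x0 xz) (le_lt_trans zy).
have gen k z : x <= z <= y -> is_derive z 1 (fun u => Psi u - k * u) ((psi z)^-1 - k).
  move=> /inner' /PsiP ?; apply: is_derive_eq; rewrite /GRing.scale/=; ring.
have genc k z : x <= z <= y -> {for z, continuous (fun u => Psi u - k * u)}.
  by move=> /(gen k); exact: is_derive_continuous.
have sub z : x < z < y -> x <= z <= y by move=> /andP[/ltW -> /ltW ->].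
apply/andP; split.
- have := @ge0_derive_le _ (fun u => Psi u - (psi x)^-1 * u)
    (fun z => (psi z)^-1 - (psi x)^-1) x y xy (fun z h => gen _ z (sub z h)) _ (genc _).
  rewrite (mulrC (y - x)) mulrBr => H; suff : Psi x - (psi x)^-1 * x <= Psi y - (psi x)^-1 * y by lra.
  apply: H => z /andP[xz zy]; rewrite subr_ge0 lef_pV2 ?posrE.
  + by apply: (psi_ninc co x0 (ltW xz)); rewrite ltW// (lt_trans zy).
  + by apply: (psi_gt0 co); rewrite x0 (le_lt_trans xy).
  + by apply: (psi_gt0 co); apply: inner; rewrite xz.
- have := @le0_derive_ge _ (fun u => Psi u - (psi y)^-1 * u)
    (fun z => (psi z)^-1 - (psi y)^-1) x y xy (fun z h => gen _ z (sub z h)) _ (genc _).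
  rewrite (mulrC (y - x)) mulrBr => H; suff : Psi y - (psi y)^-1 * y <= Psi x - (psi y)^-1 * x by lra.
  apply: H => z /andP[xz zy]; rewrite subr_le0 lef_pV2 ?posrE.
  + by apply: (psi_ninc co (le_trans x0 (ltW xz)) (ltW zy)); rewrite ltW.
  + by apply: (psi_gt0 co); apply: inner; rewrite xz.
  + by apply: (psi_gt0 co); rewrite (le_trans x0 xy).
Qed.

Lemma Psi_lt x y : 0 <= x -> x < y -> y < 1 -> Psi x < Psi y.
Proof.
move=> x0 xy y1; have /andP[h _] := Psi_bounds x0 (ltW xy) y1.
rewrite -subr_gt0; apply: lt_le_trans h; rewrite divr_gt0 ?subr_gt0//.
by apply: (psi_gt0 co); rewrite x0 (lt_trans xy).
Qed.

Lemma Ec_lt c x y : 0 < c -> 0 <= x -> x < y -> y < 1 -> Ec c x < Ec c y.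
Proof. by move=> c0 x0 xy y1; rewrite ltr_expR ltr_pM2l// Psi_lt. Qed.

Definition coef_ratio x := phi x / psi x.
Definition wronskian x := phi1 x * psi x - phi x * psi1 x.
Local Notation g := coef_ratio.
Local Notation W := wronskian.
(* d (E_c g) / d E_c *)
Definition Gam (c x : R) := g x + W x / (c * psi x).

Lemma g_cont x : 0 <= x < 1 -> {for x, continuous g}.
Proof.
move=> x01; apply: continuous_div; first by rewrite gt_eqF// (psi_gt0 co).
  exact: phi_cont co x.
exact: psi_cont co x.
Qed.

Lemma g_der x : 0 < x < 1 -> is_derive x 1 g (W x / psi x ^+ 2).
Proof.
move=> /andP[x0 x1]; have x01 : 0 < x < 1 by rewrite x0.
have ? := phi_der co x01; have ? := psi_der co x01.
by apply: is_derive_div => //; rewrite gt_eqF// (psi_gt0 co)// ltW.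
Qed.

Lemma Ecg_der c x : c != 0 -> 0 < x < 1 ->
  is_derive x 1 (fun u => Ec c u * g u) (c * Ec c x / psi x * Gam c x).
Proof.
move=> c0 x01; have x01' : 0 <= x < 1 by case/andP: x01 => /ltW -> ->.
have ? := Ec_der c x01'; have ? := g_der x01.
have p0 : psi x != 0 by rewrite gt_eqF// (psi_gt0 co).
apply: is_derive_eq; rewrite /GRing.scale/= /Gam; field.
by rewrite p0 c0.
Qed.

Lemma Ecg_cont c x : 0 <= x < 1 -> {for x, continuous (fun u => Ec c u * g u)}.
Proof. by move=> x01; apply: continuousM; [exact: Ec_cont|exact: g_cont]. Qed.

Lemma Ecg_slope c k x y : 0 < c -> 0 <= x -> x <= y -> y < 1 ->
  ((forall z, x < z < y -> Gam c z <= k) ->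
    Ec c y * g y - Ec c x * g x <= k * (Ec c y - Ec c x)) /\
  ((forall z, x < z < y -> k <= Gam c z) ->
    k * (Ec c y - Ec c x) <= Ec c y * g y - Ec c x * g x).
Proof.
move=> c0 x0 xy y1; have c0' : c != 0 by rewrite gt_eqF.
pose f u := Ec c u * g u - k * Ec c u.
pose df z := c * Ec c z / psi z * (Gam c z - k).
have fd z : x < z < y -> is_derive z 1 f (df z).
  move=> /andP[xz zy]; have z01 : 0 < z < 1 by rewrite (le_lt_trans x0 xz) (lt_trans zy).
  have ? := Ecg_der c0' z01; have ? := Ec_der c (introT andP (conj (le_trans x0 (ltW xz)) (lt_trans zy y1))).
  by apply: is_derive_eq; rewrite /GRing.scale/= /df; ring.
have fc z : x <= z <= y -> {for z, continuous f}.
  move=> /andP[xz zy]; have z01 : 0 <= z < 1 by rewrite (le_trans x0 xz) (le_lt_trans zy).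
  apply: continuousB; first exact: Ecg_cont.
  by apply: continuousM; [exact: cst_continuous|exact: Ec_cont].
have pos z : x < z < y -> 0 <= c * Ec c z / psi z.
  move=> /andP[xz zy]; rewrite divr_ge0 ?mulr_ge0 ?ltW ?Ec_gt0//.
  by apply: (psi_gt0 co); rewrite (le_trans x0 (ltW xz)) (lt_trans zy).
split => h.
- have := le0_derive_ge xy fd _ fc; rewrite /f => H.
  suff : Ec c y * g y - k * Ec c y <= Ec c x * g x - k * Ec c x by lra.
  by apply: H => z zxy; rewrite /df mulr_ge0_le0 ?pos// subr_le0 h.
- have := ge0_derive_le xy fd _ fc; rewrite /f => H.
  suff : Ec c x * g x - k * Ec c x <= Ec c y * g y - k * Ec c y by lra.
  by apply: H => z zxy; rewrite /df mulr_ge0 ?pos// subr_ge0 h.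
Qed.

(** Since [Gam B] is the slope of [E_B g] with respect to [E_B], this is convexity of [E_B g] as a
    function of [E_B] to the right of [xd]. *)
Definition conv_at (B xd : R) := forall x y, 0 < x -> xd <= x -> x <= y -> y < 1 ->
  Gam B x <= Gam B y.

(** In the coordinate [E_c] the term with [kappa] is linear, so whether the velocity is convex or
    concave depends only on [E_c g] as a function of [E_c]. *)
Lemma Ec_path_der c t X s : path t X -> 0 < s < t ->
  is_derive s 1 (fun s => Ec c (X s)) (c * (Ec c (X s) * g (X s) - kappa s * Ec c (X s))).
Proof.
move=> pX st; have s0t : 0 <= s <= t by case/andP: st => /ltW -> /ltW ->.
have Xs := path_in pX s0t; have ? := path_der pX st; have ? := Ec_der c Xs.
have p0 : psi (X s) != 0 by rewrite gt_eqF// (psi_gt0 co).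
have := @is_derive1_comp R (Ec c) X s _ _ (Ec_der c Xs) (path_der pX st).
move=> ?; apply: is_derive_eq; rewrite /velocity /g; by field.
Qed.

Lemma Ec_path_cont c t X s : path t X -> 0 <= s <= t ->
  {for s, continuous (fun s => Ec c (X s))}.
Proof.
move=> pX st; apply: continuous_comp; first exact: path_cont pX.
exact/Ec_cont/(path_in pX).
Qed.

Ltac drop_facts ::= clear - co kappa_cont kappa_gt0 flow PsiP.

Lemma flow_Ec_convex x y z t : 0 <= x -> x < y -> y < z -> z < 1 -> 0 <= t ->
  (Ec al (F y t) - Ec al (F x t)) * (Ec al z - Ec al y) <=
  (Ec al (F z t) - Ec al (F y t)) * (Ec al y - Ec al x).
Proof.
move=> x0 xy yz z1 t0; have a0 := al_gt0 co.
have y1 := lt_trans yz z1; have y0 := le_trans x0 (ltW xy).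
have [X [pX Xt ->]] := flow (introT andP (conj x0 (lt_trans xy y1))) t0.
have [Y [pY Yt ->]] := flow (introT andP (conj y0 y1)) t0.
have [Z [pZ Zt ->]] := flow (introT andP (conj (le_trans y0 (ltW yz)) z1)) t0.
have XY s : 0 <= s <= t -> X s < Y s.
  by move=> st; apply: (path_lt_back co kappa_cont kappa_gt0 pX pY); rewrite ?Xt ?Yt.
have YZ s : 0 <= s <= t -> Y s < Z s.
  by move=> st; apply: (path_lt_back co kappa_cont kappa_gt0 pY pZ); rewrite ?Yt ?Zt.
rewrite mulrC -Xt -Yt -Zt.
apply: (three_point_ratio t0 (fun s => Ec_path_der (s := s) al pX) (fun s => Ec_path_der (s := s) al pY)
  (fun s => Ec_path_der (s := s) al pZ)) => //.
- by move=> s ?; exact: Ec_path_cont pX _.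
- by move=> s ?; exact: Ec_path_cont pY _.
- by move=> s ?; exact: Ec_path_cont pZ _.
- move=> s st; have /andP[? ?] := path_in pX st; have /andP[? ?] := path_in pY st.
  by apply: Ec_lt => //; exact: XY.
- move=> s /andP[s0 st].
  have s0t : 0 <= s <= t by rewrite !ltW.
  have /andP[X0 X1] := path_in pX s0t; have /andP[Y0 Y1] := path_in pY s0t.
  have /andP[Z0 Z1] := path_in pZ s0t.
  have XYs := XY s s0t; have YZs := YZ s s0t.
  have Yp : 0 < Y s by apply: le_lt_trans XYs.
  have [h1 _] := Ecg_slope (Gam al (Y s)) a0 Y0 (ltW YZs) Z1.
  have [_ h2] := Ecg_slope (Gam al (Y s)) a0 X0 (ltW XYs) Y1.
  have {}h1 := h1 (fun u hu => ltac:(case/andP: hu => yu uz;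
    exact: (g_concave co Yp (ltW yu) (lt_trans uz Z1)))).
  have {}h2 : Gam al (Y s) * (Ec al (Y s) - Ec al (X s)) <= Ec al (Y s) * g (Y s) - Ec al (X s) * g (X s).
    apply: h2 => u /andP[xu uy].
    exact: (g_concave co (le_lt_trans X0 xu) (ltW uy) Y1).
  have e1 := Ec_lt a0 X0 XYs Y1; have e2 := Ec_lt a0 Y0 YZs Z1.
  set K := Gam al (Y s) in h1 h2.
  have h3 : (Ec al (Z s) * g (Z s) - Ec al (Y s) * g (Y s)) * (Ec al (Y s) - Ec al (X s)) <=
    (Ec al (Y s) * g (Y s) - Ec al (X s) * g (X s)) * (Ec al (Z s) - Ec al (Y s)).
    apply: (@le_trans _ _ (K * (Ec al (Z s) - Ec al (Y s)) * (Ec al (Y s) - Ec al (X s)))).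
      by rewrite ler_wpM2r// subr_ge0 ltW.
    by rewrite mulrAC ler_wpM2r// subr_ge0 ltW.
  have := ler_wpM2l (ltW a0) h3; slra.
Qed.

(** The sign of the velocity at [xd] keeps the three trajectories in [[xd, 1)], where [conv_at]
    applies. The inequality between slopes is opposite to the one in [flow_Ec_convex]; negating [Ec]
    and exchanging the outer trajectories brings back [three_point_ratio]. *)
Lemma flow_Ec_concave B xd x y z t : 0 < B -> conv_at B xd ->
  (forall s, 0 < s < t -> vel s xd <= 0) -> 0 <= xd ->
  xd <= x -> x < y -> y < z -> z < 1 -> 0 <= t ->
  (Ec B (F z t) - Ec B (F y t)) * (Ec B y - Ec B x) <=
  (Ec B (F y t) - Ec B (F x t)) * (Ec B z - Ec B y).
Proof.
move=> B0 cB vd xd0 xdx xy yz z1 t0; have x0 := le_trans xd0 xdx.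
have y1 := lt_trans yz z1; have y0 := le_trans x0 (ltW xy).
have [X [pX Xt ->]] := flow (introT andP (conj x0 (lt_trans xy y1))) t0.
have [Y [pY Yt ->]] := flow (introT andP (conj y0 y1)) t0.
have [Z [pZ Zt ->]] := flow (introT andP (conj (le_trans y0 (ltW yz)) z1)) t0.
have XY s : 0 <= s <= t -> X s < Y s.
  by move=> st; apply: (path_lt_back co kappa_cont kappa_gt0 pX pY); rewrite ?Xt ?Yt.
have YZ s : 0 <= s <= t -> Y s < Z s.
  by move=> st; apply: (path_lt_back co kappa_cont kappa_gt0 pY pZ); rewrite ?Yt ?Zt.
have XD s : 0 <= s <= t -> xd <= X s.
  move=> /andP[s0 st]; apply: (path_low co kappa_gt0 pX); rewrite ?s0 ?Xt//.
  by move=> r /andP[sr rt]; apply: vd; rewrite (le_lt_trans s0).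
suff : (- Ec B (X t) - - Ec B (Y t)) * (- Ec B (Y 0) - - Ec B (Z 0)) <=
   (- Ec B (X 0) - - Ec B (Y 0)) * (- Ec B (Y t) - - Ec B (Z t)).
  by rewrite -Xt -Yt -Zt; lra.
have dN V (pV : path t V) s : 0 < s < t -> is_derive s 1 (fun s => - Ec B (V s))
    (- (B * (Ec B (V s) * g (V s) - kappa s * Ec B (V s)))).
  by move=> st; have ? := Ec_path_der B pV st; apply: is_deriveN.
have cN V (pV : path t V) s : 0 <= s <= t -> {for s, continuous (fun s => - Ec B (V s))}.
  by move=> st; apply: continuousN; exact: Ec_path_cont pV st.
apply: (three_point_ratio t0 (dN Z pZ) (dN Y pY) (dN X pX) (cN Z pZ) (cN Y pY) (cN X pX)).
- move=> s st; have /andP[? ?] := path_in pZ st; have /andP[? ?] := path_in pY st.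
  by rewrite ltrN2; apply: Ec_lt => //; exact: YZ.
- move=> s /andP[s0 st].
  have s0t : 0 <= s <= t by rewrite !ltW.
  have /andP[X0 X1] := path_in pX s0t; have /andP[Y0 Y1] := path_in pY s0t.
  have /andP[Z0 Z1] := path_in pZ s0t; have Xd := XD s s0t.
  have XYs := XY s s0t; have YZs := YZ s s0t.
  have Yp : 0 < Y s by apply: le_lt_trans XYs.
  have [_ h1] := Ecg_slope (Gam B (Y s)) B0 Y0 (ltW YZs) Z1.
  have [h2 _] := Ecg_slope (Gam B (Y s)) B0 X0 (ltW XYs) Y1.
  have {}h1 : Gam B (Y s) * (Ec B (Z s) - Ec B (Y s)) <= Ec B (Z s) * g (Z s) - Ec B (Y s) * g (Y s).
    apply: h1 => u /andP[yu uz]; apply: cB (ltW yu) (lt_trans uz Z1) => //.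
    exact: le_trans (ltW XYs).
  have {}h2 : Ec B (Y s) * g (Y s) - Ec B (X s) * g (X s) <= Gam B (Y s) * (Ec B (Y s) - Ec B (X s)).
    apply: h2 => u /andP[xu uy]; apply: cB (ltW uy) Y1; first exact: le_lt_trans xu.
    exact: le_trans (ltW xu).
  have e1 := Ec_lt B0 X0 XYs Y1; have e2 := Ec_lt B0 Y0 YZs Z1.
  set K := Gam B (Y s) in h1 h2.
  have h3 : (Ec B (Y s) * g (Y s) - Ec B (X s) * g (X s)) * (Ec B (Z s) - Ec B (Y s)) <=
    (Ec B (Z s) * g (Z s) - Ec B (Y s) * g (Y s)) * (Ec B (Y s) - Ec B (X s)).
    apply: (@le_trans _ _ (K * (Ec B (Y s) - Ec B (X s)) * (Ec B (Z s) - Ec B (Y s)))).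
      by rewrite ler_wpM2r// subr_ge0 ltW.
    by rewrite mulrAC ler_wpM2r// subr_ge0 ltW.
  have := ler_wpM2l (ltW B0) h3; slra.
Qed.

End Flow.

(** * Profiles *)

Section Mass.
Variable R : realType.
Implicit Types (w H f : R -> R) (x y a c p q : R).

Lemma is_derive_eps f x (l : R) :
  (forall e : R, 0 < e -> exists2 d : R, 0 < d & forall y, `|y - x| < d -> y != x ->
     `|(f y - f x) / (y - x) - l| <= e) -> is_derive x 1 f l.
Proof.
move=> fe.
have cv : (fun h : R => h^-1 *: (f (h *: 1 + x) - f x)) @ 0^' --> l.
  apply/cvgrPdist_le => e e0; have [d d0 hd] := fe e e0.
  apply/nbhs_ballP; exists d => //= h; rewrite /ball /= sub0r normrN => hd' h0.
  have := hd (h + x); rewrite addrK => /(_ hd').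
  rewrite distrC /GRing.scale/= mulr1 (mulrC h^-1); apply.
  by apply: contraNneq h0 => hx; apply/eqP/(@addIr _ x); rewrite add0r.
split; first by apply/cvg_ex; exists l; exact: cv.
by apply: cvg_lim; first exact: Rhausdorff.
Qed.

(** [H] stands for the tail integral of [w], known through what comparison arguments need; as a
    total function it is continuous at 0 from both sides. *)
Record mass w H : Prop := Mass {
  mass_gt0 : forall x, 0 <= x < 1 -> 0 < w x;
  mass_ninc : forall x y, 0 <= x -> x <= y -> y < 1 -> w y <= w x;
  mass_right0 : forall e : R, 0 < e -> exists2 d : R, 0 < d & forall x, 0 <= x < d -> x < 1 -> w 0 - e < w x;
  mass_ge0 : forall x, 0 <= x < 1 -> 0 <= H x;
  mass_le : forall x, 0 <= x < 1 -> H x <= (1 - x) * w x;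
  mass_incr : forall x y, 0 <= x -> x <= y -> y < 1 ->
    (y - x) * w y <= H x - H y <= (y - x) * w x;
  mass_cont : forall x : R, 0 <= x < 1 -> {for x, continuous H};
  mass_der : forall x : R, 0 < x < 1 -> is_derive x 1 H (- w x) }.

Section Compare.
Variables (w1 H1 w2 H2 : R -> R) (a c p q : R).
Hypotheses (m1 : mass w1 H1) (m2 : mass w2 H2).
Hypotheses (a01 : 0 <= a < 1) (c0 : 0 <= c) (q0 : 0 < q).
Hypotheses (pa : 0 <= p + q * a) (p1 : p + q <= 1).

Let z x := p + q * x.

Let z01 x : a <= x < 1 -> 0 <= z x < 1.
Proof.
move=> /andP[ax x1]; rewrite /z; apply/andP; split.
  by apply: (le_trans pa); rewrite lerD2l ler_pM2l.
by apply: lt_le_trans p1; rewrite ltrD2l gtr_pMr.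
Qed.

Let z0 x : a < x < 1 -> 0 < z x.
Proof.
by move=> /andP[ax x1]; apply: (le_lt_trans pa); rewrite ltrD2l ltr_pM2l.
Qed.

Let D x := H1 x - c / q * H2 (z x).

Let Dder x : a < x < 1 -> is_derive x 1 D (- w1 x + c * w2 (z x)).
Proof.
move=> /andP[ax x1]; have /andP[a0 a1] := a01.
have ? : is_derive x 1 H1 (- w1 x) by apply: (mass_der m1); rewrite (le_lt_trans a0 ax).
have ? : is_derive x 1 z q.
  by apply: is_derive_eq; rewrite /GRing.scale/=; ring.
have ? : is_derive (z x) 1 H2 (- w2 (z x)).
  apply: (mass_der m2); rewrite z0 ?ax//=.
  by have := @z01 x; rewrite (ltW ax) x1 => /(_ isT)/andP[].
have ? := @is_derive1_comp R H2 z x _ _ _ _.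
by apply: is_derive_eq; rewrite /GRing.scale/=; field; rewrite gt_eqF.
Qed.

Let Dcont x : a <= x < 1 -> {for x, continuous D}.
Proof.
move=> ax; apply: continuousB.
  by apply: (mass_cont m1); case/andP: a01 ax => a0 _ /andP[ax ->]; rewrite (le_trans a0).
apply: continuousM; first exact: cst_continuous.
apply: continuous_comp; last exact: (mass_cont m2 (z01 ax)).
apply: continuousD; first exact: cst_continuous.
by apply: continuousM; [exact: cst_continuous|exact: cvg_id].
Qed.

Let limit k M : (forall b, a < b < 1 -> k <= M * (1 - b)) -> k <= 0.
Proof.
move=> kM; rewrite leNgt; apply/negP => k0; have /andP[_ a1] := a01.
have M0 : 0 < M.
  have := kM ((a + 1) / 2); have -> : a < (a + 1) / 2 < 1 by apply/andP; split; lra.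
  move=> /(_ isT) h; have : 0 < M * (1 - (a + 1) / 2) by apply: lt_le_trans h.
  rewrite pmulr_lgt0//; lra.
pose b := Num.max ((a + 1) / 2) (1 - k / (2 * M)).
have kM2 : 0 < k / (2 * M) by rewrite divr_gt0// mulr_gt0.
have b1 : b < 1 by rewrite /b gt_max; apply/andP; split; lra.
have ab : a < b by rewrite /b lt_max; apply/orP; left; lra.
have := kM b; rewrite ab b1 => /(_ isT).
have : 1 - k / (2 * M) <= b by rewrite /b le_max lexx orbT.
rewrite -(ler_pM2l M0) => h1 h2.
have E : M * (1 - k / (2 * M)) = M - k / 2 by field; rewrite gt_eqF.
by move: h1; rewrite E; lra.
Qed.

(** The derivative of [c / q * H2 (p + q * x)] is [- c * w2 (p + q * x)], so [D] is monotone on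
    [[a, b]]. Nothing is assumed at 1 itself, hence the limit [b -> 1] with an error of order
    [1 - b]. *)
Lemma mass_compare_le : (forall x, a < x < 1 -> w1 x <= c * w2 (z x)) ->
  H1 a <= c / q * H2 (z a).
Proof.
move=> wle; rewrite -subr_le0; have /andP[a0 a1] := a01.
apply: (limit (M := w1 a)) => b /andP[ab b1].
have : D a <= D b.
  apply: (ge0_derive_le (ltW ab) (df := fun x => - w1 x + c * w2 (z x))).
  - by move=> x /andP[ax xb]; apply: Dder; rewrite ax (lt_trans xb).
  - by move=> x /andP[ax xb]; have := wle x; rewrite ax (lt_trans xb b1) => /(_ isT); lra.
  - by move=> x /andP[ax xb]; apply: Dcont; rewrite ax (le_lt_trans xb).
rewrite /D.
have b01 : 0 <= b < 1 by rewrite b1 (le_trans a0 (ltW ab)).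
have hb := mass_le m1 b01; have hw := mass_ninc m1 a0 (ltW ab) b1.
have zb : 0 <= c / q * H2 (z b).
  by rewrite mulr_ge0 ?divr_ge0 ?(ltW q0)//; apply: (mass_ge0 m2); apply: z01; rewrite b1 ltW.
have : (1 - b) * w1 b <= (1 - b) * w1 a by rewrite ler_wpM2l// subr_ge0 ltW.
lra.
Qed.

(** The affine map must send 1 to 1: mass of [w2] beyond [p + q] would count on the left with no
    counterpart on the right. *)
Lemma mass_compare_ge : p + q = 1 -> (forall x, a < x < 1 -> c * w2 (z x) <= w1 x) ->
  c / q * H2 (z a) <= H1 a.
Proof.
move=> pq wle; rewrite -subr_le0; have /andP[a0 a1] := a01.
apply: (limit (M := c * w2 (z a))) => b /andP[ab b1].
have : D b <= D a.
  apply: (le0_derive_ge (ltW ab) (df := fun x => - w1 x + c * w2 (z x))).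
  - by move=> x /andP[ax xb]; apply: Dder; rewrite ax (lt_trans xb).
  - by move=> x /andP[ax xb]; have := wle x; rewrite ax (lt_trans xb b1) => /(_ isT); lra.
  - by move=> x /andP[ax xb]; apply: Dcont; rewrite ax (le_lt_trans xb).
rewrite /D.
have b01 : 0 <= b < 1 by rewrite b1 (le_trans a0 (ltW ab)).
have hb := mass_ge0 m1 b01.
have zab : z a <= z b by rewrite /z lerD2l ler_pM2l// ltW.
have zb1 : 0 <= z b < 1 by apply: z01; rewrite b1 ltW.
have [zb0 zb1'] := andP zb1.
have /andP[za0 _] := @z01 a (introT andP (conj (lexx a) a1)).
have hz := mass_le m2 zb1; have hw := mass_ninc m2 za0 zab zb1'.
have e1 : 1 - z b = q * (1 - b) by rewrite /z; lra.
have : c / q * H2 (z b) <= c / q * (q * (1 - b) * w2 (z a)).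
  rewrite ler_wpM2l ?divr_ge0 ?(ltW q0)//; apply: (le_trans hz); rewrite -e1.
  by rewrite ler_wpM2l// subr_ge0 ltW.
have -> : c / q * (q * (1 - b) * w2 (z a)) = c * w2 (z a) * (1 - b).
  by field; rewrite gt_eqF.
lra.
Qed.
End Compare.

Definition life w H x := H x / w x.

(* The initial profile: [life] is the mean residual life, and beta -> 1 only enters
   through its Lipschitz constant near 1, since life' = beta - 1. *)
Record profile w H : Prop := Profile {
  profile_mass : mass w H;
  profile_cont : forall x : R, 0 <= x < 1 -> {for x, continuous w};
  profile_lip : forall e : R, 0 < e -> exists2 d : R, 0 < d < 1 & forall x y, 1 - d <= x -> x <= y -> y < 1 ->
    `|life w H y - life w H x| <= e * (y - x);
  profile_lim : forall e : R, 0 < e -> exists2 x, 0 <= x < 1 & w x < e }.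

Section LipLife.
Variables (w H : R -> R) (e d : R).
Hypothesis mw : mass w H.
Hypotheses (e0 : 0 < e) (d01 : 0 < d < 1).
Hypothesis lip : forall x y, 1 - d <= x -> x <= y -> y < 1 ->
  `|life w H y - life w H x| <= e * (y - x).
Local Notation L := (life w H).

Lemma life_gt0 x : 0 <= x < 1 -> 0 < L x.
Proof.
move=> /andP[x0 x1]; rewrite /life divr_gt0//; last by apply: (mass_gt0 mw); rewrite x0.
pose y := (x + 1) / 2; have xy : x < y by rewrite /y; lra.
have y1 : y < 1 by rewrite /y; lra.
have y01 : 0 <= y < 1 by rewrite y1 (le_trans x0 (ltW xy)).
have /andP[h _] := mass_incr mw x0 (ltW xy) y1.
have hy := mass_ge0 mw y01; have wy := mass_gt0 mw y01.
have : 0 < (y - x) * w y by rewrite mulr_gt0// subr_gt0.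
lra.
Qed.

Lemma life_le1 x : 0 <= x < 1 -> L x <= 1 - x.
Proof. by move=> x01; rewrite ler_pdivrMr ?(mass_gt0 mw)// (mass_le mw). Qed.

(** [H x >= H y + (y - x) w y] and [L y >= L x - e (y - x)], with [H = L w]. The quotient
    [(y - x) / L x] measures length in units of the scale on which [w] varies. *)
Lemma ratio_le x y : 1 - d <= x -> x <= y -> y < 1 ->
  w y * (1 + (1 - e) * ((y - x) / L x)) <= w x.
Proof.
move=> dx xy y1; have x0 : 0 <= x by case/andP: d01; lra.
have x01 : 0 <= x < 1 by rewrite x0 (le_lt_trans xy).
have y01 : 0 <= y < 1 by rewrite y1 (le_trans x0).
have wx := mass_gt0 mw x01; have wy := mass_gt0 mw y01; have Lx := life_gt0 x01.
have /andP[h _] := mass_incr mw x0 xy y1.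
have := lip dx xy y1; rewrite ler_norml => /andP[hl _].
have Hx : H x = L x * w x by rewrite /life mulfVK ?gt_eqF.
have Hy : H y = L y * w y by rewrite /life mulfVK ?gt_eqF.
have : w y * (L x + (1 - e) * (y - x)) <= w x * L x.
  rewrite Hx Hy in h.
  have : (L x - e * (y - x)) * w y <= L y * w y by rewrite ler_pM2r//; lra.
  nra.
rewrite -ler_pdivrMr//.
suff -> : w y * (1 + (1 - e) * ((y - x) / L x)) = w y * (L x + (1 - e) * (y - x)) / L x by [].
by field; rewrite gt_eqF.
Qed.

Lemma ratio_ge x y : 1 - d <= x -> x <= y -> y < 1 ->
  w x * (1 - (y - x) / L x) <= w y * (1 + e * ((y - x) / L x)).
Proof.
move=> dx xy y1; have x0 : 0 <= x by case/andP: d01; lra.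
have x01 : 0 <= x < 1 by rewrite x0 (le_lt_trans xy).
have y01 : 0 <= y < 1 by rewrite y1 (le_trans x0).
have wx := mass_gt0 mw x01; have wy := mass_gt0 mw y01; have Lx := life_gt0 x01.
have /andP[_ h] := mass_incr mw x0 xy y1.
have := lip dx xy y1; rewrite ler_norml => /andP[_ hl].
have Hx : H x = L x * w x by rewrite /life mulfVK ?gt_eqF.
have Hy : H y = L y * w y by rewrite /life mulfVK ?gt_eqF.
rewrite -(ler_pM2r Lx).
have -> : w x * (1 - (y - x) / L x) * L x = w x * (L x - (y - x)) by field; rewrite gt_eqF.
have -> : w y * (1 + e * ((y - x) / L x)) * L x = w y * (L x + e * (y - x)).
  by field; rewrite gt_eqF.
rewrite Hx Hy in h.
have : L y * w y <= (L x + e * (y - x)) * w y by rewrite ler_pM2r//; lra.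
nra.
Qed.
End LipLife.
End Mass.

(** * Solutions *)

Record solution (R : realType) (phi psi w0 : R -> R) (kappa : R -> R)
    (F w H : R -> R -> R) : Prop := Solution {
  sol_kcont : forall s : R, {for s, continuous kappa};
  sol_kgt0 : forall s, 0 < kappa s;
  sol_flow : is_flow phi psi kappa F;
  sol_w : forall x t, 0 <= x < 1 -> 0 <= t -> w x t = expR t * w0 (F x t);
  sol_mass : forall t, 0 <= t -> mass (w ^~ t) (H t);
  sol_H0 : forall t, 0 <= t -> H t 0 = 1 }.

Section Sol.
Variables (R : realType) (phi psi phi1 psi1 dW : R -> R) (al be : R).
Hypothesis co : coefs phi psi phi1 psi1 dW al be.
Variables (w0 h0 : R -> R).
Hypothesis prof : profile w0 h0.
Variables (kappa : R -> R) (F w H : R -> R -> R).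
Hypothesis sol : solution phi psi w0 kappa F w H.
Local Notation path := (trajectory phi psi kappa).
Local Notation vel := (velocity phi psi kappa).
Local Notation L := (life w0 h0).
Implicit Types (X Y : R -> R) (s t x y z : R).

Let kc := sol_kcont sol.
Let kp := sol_kgt0 sol.
Let fl := sol_flow sol.
Let m0 := profile_mass prof.

Let zero01 : 0 <= (0 : R) < 1.
Proof. by rewrite lexx ltr01. Qed.

Let psi00 : 0 < psi 0. Proof. exact: (psi_gt0 co zero01). Qed.

Lemma sol_path t a X : path t X -> 0 <= a <= t -> w (X t) t = expR (t - a) * w (X a) a.
Proof.
move=> pX at_; have /andP[a0 at'] := at_; have t0 := le_trans a0 at'.
rewrite (sol_w sol) ?(path_in pX) ?t0 ?lexx// (sol_w sol) ?(path_in pX)//.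
by rewrite (flow_sub co kp fl pX at_) mulrA -expRD subrK.
Qed.

Lemma sol_ninc t x y : 0 <= t -> 0 <= x -> x <= y -> y < 1 -> w y t <= w x t.
Proof. by move=> t0; exact: (mass_ninc (sol_mass sol t0)). Qed.

Lemma sol_incr t x y : 0 <= t -> 0 <= x -> x <= y -> y < 1 ->
  (y - x) * w y t <= H t x - H t y <= (y - x) * w x t.
Proof. by move=> t0; exact: (mass_incr (sol_mass sol t0)). Qed.

Lemma sol_gt0 t x : 0 <= t -> 0 <= x < 1 -> 0 < w x t.
Proof. by move=> t0; exact: (mass_gt0 (sol_mass sol t0)). Qed.

Lemma sol_ge1 t : 0 <= t -> 1 <= w 0 t.
Proof.
move=> t0; rewrite -(sol_H0 sol t0); apply: (le_trans (mass_le (sol_mass sol t0) zero01)).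
by rewrite subr0 mul1r.
Qed.

Lemma sol_growth t t' : 0 <= t -> t <= t' -> w 0 t' <= expR (t' - t) * w 0 t.
Proof.
move=> t0 tt'; have [X [pX Xt _]] := fl zero01 (le_trans t0 tt').
have -> : w 0 t' = w (X t') t' by rewrite Xt.
rewrite (sol_path pX (introT andP (conj t0 tt'))) ler_pM2l ?expR_gt0//.
have /andP[X0 X1] : 0 <= X t < 1 by apply: (path_in pX); rewrite t0.
exact: sol_ninc.
Qed.

Ltac drop_facts ::= clear - co prof sol kc kp fl m0 zero01 psi00.

(** Formally, [phi >= 0] and [psi <= psi 0 * (1 - x)] bound [1 = int (kappa psi - phi) c] by
    [kappa psi(0) int (1 - x) c]. Rigorously, a failure would give [w x (t + tau) >= exp tau * w (1
    - rho + rho * x) t] with [rho = exp (- k' tau)], and for small [tau] the mass at [t + tau] would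
    exceed 1. *)
Lemma kappa_lower t : 0 <= t -> 1 <= kappa t * psi 0 * (w 0 t - 1).
Proof.
move=> t0; rewrite leNgt; apply/negP => lt1.
have q1 := sol_ge1 t0; set q := w 0 t in lt1 q1.
(* A constant slightly above [kappa t] that still violates the inequality; it dominates [kappa] on a
   short interval after [t]. *)
have [k kk kq] : exists2 k, kappa t < k & k * psi 0 * (q - 1) < 1.
  exists (kappa t + (1 - kappa t * psi 0 * (q - 1)) / (2 * (psi 0 * q))).
    by rewrite ltrDl divr_gt0 ?subr_gt0// !mulr_gt0//; lra.
  set D := 1 - _; have D0 : 0 < D by rewrite subr_gt0.
  have -> : (kappa t + D / (2 * (psi 0 * q))) * psi 0 * (q - 1) =
    kappa t * psi 0 * (q - 1) + D / 2 * ((q - 1) / q).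
    by field; rewrite !gt_eqF//; lra.
  have : (q - 1) / q <= 1 by rewrite ler_pdivrMr; lra.
  have := ltr_pM2l (divr_gt0 D0 (@ltr0n R 2)); rewrite /D; nra.
have [e e0 he] := continuous_ltc (@kc t) kk.
have k0 : 0 < k by apply: lt_trans kk; exact: kp.
pose k' := k * psi 0; have k'0 : 0 < k' by rewrite mulr_gt0.
(* [sg] is the first-order defect: the product that must be at most 1 in the end equals
   [1 + tau (sg - M tau)]. *)
pose sg := 1 - k' * (q - 1); have sg0 : 0 < sg by rewrite subr_gt0.
pose M := (1 + k') * k' * q.
have M0 : 0 < M by rewrite !mulr_gt0//; lra.
pose tau := Num.min (e / 2) (sg / (2 * M)).
have tau0 : 0 < tau by rewrite /tau lt_min !divr_gt0// mulr_gt0.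
have tau1 : tau <= e / 2 by rewrite /tau ge_min lexx.
have tau2 : M * tau <= sg / 2.
  have := ler_wpM2l (ltW M0) (_ : tau <= sg / (2 * M)); rewrite (_ : M * (sg / (2 * M)) = sg / 2); last by field; rewrite gt_eqF.
  by apply; rewrite /tau ge_min lexx orbT.
pose rho := expR (- (k' * tau)).
have rho0 : 0 < rho by exact: expR_gt0.
have rho1 : rho <= 1 by rewrite -expR0 ler_expR oppr_le0 mulr_ge0 ?ltW.
have tt0 : 0 <= t + tau by rewrite addr_ge0// ltW.
have wle x : 0 < x < 1 -> expR tau * w (1 - rho + rho * x) t <= w x (t + tau).
  move=> /andP[x0 x1].
  have [X [pX Xt _]] := fl (introT andP (conj (ltW x0) x1)) tt0.
  have at_ : 0 <= t <= t + tau by rewrite t0 lerDl ltW.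
  have -> : w x (t + tau) = w (X (t + tau)) (t + tau) by rewrite Xt.
  rewrite (sol_path pX at_) (_ : t + tau - t = tau); last by ring.
  rewrite ler_pM2l ?expR_gt0//.
  have /andP[Xt0 Xt1] := path_in pX at_.
  apply: (sol_ninc t0 Xt0); last by nra.
  have := @Gronwall_upper _ (fun s => 1 - X s) (fun s => 0 - vel s (X s))
    (fun s => k' * s) (fun=> k') t (t + tau).
  have -> : k' * (t + tau) - k' * t = k' * tau by ring.
  rewrite Xt => gu.
  have : 1 - x <= (1 - X t) * expR (k' * tau).
    apply: gu; first by rewrite lerDl ltW.
    - move=> s /andP[ts st]; have ? : is_derive s 1 X (vel s (X s)).
        by apply: (path_der pX); rewrite (le_lt_trans t0).
      by apply: is_deriveB.
    - by move=> s _; apply: is_derive_eq; rewrite /GRing.scale/=; ring.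
    - move=> s /andP[ts st].
      have s01 : 0 <= s <= t + tau by rewrite (le_trans t0 (ltW ts)) ltW.
      have /andP[Xs0 Xs1] := path_in pX s01.
      have Xs : 0 <= X s <= 1 by rewrite Xs0 ltW.
      have h1 := phi_ge0 co Xs; have h2 := psi_le co Xs.
      have h3 := ltW (psi_gt0 co (path_in pX s01)).
      have h4 : kappa s <= k.
        by apply/ltW/he; rewrite gtr0_norm ?subr_gt0//; move: tau0 tau1 s01; slra.
      have h5 : kappa s * psi (X s) <= k * (psi 0 * (1 - X s)).
        by apply: ler_pM => //; exact/ltW/kp.
      by rewrite /velocity /k'; move: h1 h5; slra.
    - by move=> s _; apply: continuousB; [exact: cst_continuous|exact: path_cont pX].
    - by move=> s _; apply: continuousM; [exact: cst_continuous|exact: cvg_id].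
  rewrite -ler_pdivrMr ?expR_gt0// -expRN -/rho; slra.
have := mass_compare_ge (sol_mass sol tt0) (sol_mass sol t0) zero01 (expR_ge0 tau) rho0 _ _ _ wle.
rewrite mulr0 addr0 subrK lexx => /(_ _ isT erefl); rewrite (sol_H0 sol tt0).
have -> : 0 <= 1 - rho by rewrite subr_ge0.
move=> /(_ isT) h.
have rho1' : 1 - rho < 1 by lra.
have rho2 : 0 <= 1 - rho by lra.
have /andP[_] := sol_incr t0 (lexx 0) rho2 rho1'.
rewrite (sol_H0 sol t0) -/q subr0 => h1.
have h2 : 1 - rho <= k' * tau by have := expR_ge1Dx (- (k' * tau)); rewrite -/rho; slra.
have h3 : expR tau / rho = expR ((1 + k') * tau).
  by rewrite /rho -expRN opprK -expRD; congr expR; ring.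
rewrite h3 in h.
have h4 := expR_ge1Dx ((1 + k') * tau).
have kt0 : 0 < k' * tau by rewrite mulr_gt0.
have h5 : 1 - k' * tau * q <= H t (1 - rho).
  have : (1 - rho) * q <= k' * tau * q by rewrite ler_wpM2r//; move: q1; slra.
  move: h1; slra.
have h6 : 0 < 1 - k' * tau * q.
  have : k' * q * tau <= M * tau by rewrite ler_pM2r// /M; nra.
  have : sg <= 1 by rewrite /sg; nra.
  move: tau2; slra.
have : (1 + (1 + k') * tau) * (1 - k' * tau * q) <= 1.
  apply: le_trans h; apply: ler_pM => //; [|move: h6; slra].
  have : 0 <= (1 + k') * tau by rewrite mulr_ge0; move: h6 k'0 tau0; slra.
  slra.
have : 0 < tau * (sg - M * tau) by rewrite mulr_gt0//; move: sg0 tau2; slra.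
rewrite /M /sg; slra.
Qed.

(** If [kappa t > k], then [kappa psi - phi >= s (c - x)] near time [t], and the formal identity
    gives [1 >= s (c w(0, t) - 1)], against the last hypothesis. The affine map of the comparison is
    the backward flow of the field [s (x - c)]. *)
Lemma kappa_upper t k s c : 0 <= t -> 0 < s -> 0 < c <= 1 ->
  (forall x, 0 <= x < 1 -> phi x - k * psi x <= s * (x - c)) ->
  1 + s < s * c * w 0 t -> kappa t <= k.
Proof.
move=> t0 s0 /andP[c0 c1] phile sq; rewrite leNgt; apply/negP => kk.
set q := w 0 t in sq.
have [e e0 he] := continuous_gtc (@kc t) kk.
(* [eta] leaves room for replacing [w 0 t] by [w p t] at the small point [p] below, by right
   continuity at 0. *)
pose eta := (q - (1 + s) / (s * c)) / 2.
have sc0 : 0 < s * c by rewrite mulr_gt0.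
have eta0 : 0 < eta by rewrite /eta divr_gt0// subr_gt0 ltr_pdivrMr// mulrC.
have q' : 1 + s < s * c * (q - eta).
  rewrite mulrC -ltr_pdivrMr//.
  by move: eta0; rewrite /eta; lra.
have [d d0 hd] := mass_right0 (sol_mass sol t0) eta0.
pose sg := s * c * (q - eta) - (1 + s); have sg0 : 0 < sg by rewrite subr_gt0.
pose M := (1 + s) * s; have M0 : 0 < M by rewrite mulr_gt0//; lra.
pose tau := Num.min (e / 2) (Num.min (d / (2 * (s * c))) (sg / (2 * M))).
have tau0 : 0 < tau by rewrite /tau !lt_min !divr_gt0// mulr_gt0.
have tau1 : tau <= e / 2 by rewrite /tau ge_min lexx.
have tau2 : M * tau <= sg / 2.
  have := ler_wpM2l (ltW M0) (_ : tau <= sg / (2 * M)); rewrite (_ : M * (sg / (2 * M)) = sg / 2); last by field; rewrite gt_eqF.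
  by apply; rewrite /tau !ge_min lexx !orbT.
have tau3 : s * c * tau <= d / 2.
  have := ler_wpM2l (ltW sc0) (_ : tau <= d / (2 * (s * c))); rewrite (_ : s * c * (d / (2 * (s * c))) = d / 2); last by field; rewrite !gt_eqF.
  by apply; rewrite /tau !ge_min lexx !orbT.
pose rho := expR (- (s * tau)).
have rho0 : 0 < rho by exact: expR_gt0.
have st0 : 0 < s * tau by rewrite mulr_gt0.
have rho1 : rho < 1 by rewrite -expR0 ltr_expR oppr_lt0.
have tt0 : 0 <= t + tau by rewrite addr_ge0// ltW.
pose p := c * (1 - rho).
have p0 : 0 < p by rewrite mulr_gt0// subr_gt0.
have prho : p + rho <= 1 by rewrite /p; nra.
have wle x : 0 < x < 1 -> w x (t + tau) <= expR tau * w (p + rho * x) t.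
  move=> /andP[x0 x1].
  have [X [pX Xt _]] := fl (introT andP (conj (ltW x0) x1)) tt0.
  have at_ : 0 <= t <= t + tau by rewrite t0 lerDl ltW.
  have -> : w x (t + tau) = w (X (t + tau)) (t + tau) by rewrite Xt.
  rewrite (sol_path pX at_) (_ : t + tau - t = tau); last by ring.
  rewrite ler_pM2l ?expR_gt0//.
  have /andP[Xt0 Xt1] := path_in pX at_.
  apply: (sol_ninc t0) Xt1; first by rewrite addr_ge0 ?ltW// mulr_gt0.
  have := @Gronwall_upper _ (fun s => X s - c) (fun r => vel r (X r) - 0)
    (fun r => s * r) (fun=> s) t (t + tau).
  have -> : s * (t + tau) - s * t = s * tau by ring.
  rewrite Xt => gu.
  have : x - c <= (X t - c) * expR (s * tau).
    apply: gu; first by rewrite lerDl ltW.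
    - move=> r /andP[tr rt]; have ? : is_derive r 1 X (vel r (X r)).
        by apply: (path_der pX); rewrite (le_lt_trans t0).
      by apply: is_deriveB.
    - by move=> r _; apply: is_derive_eq; rewrite /GRing.scale/=; ring.
    - move=> r /andP[tr rt].
      have r01 : 0 <= r <= t + tau by rewrite (le_trans t0 (ltW tr)) ltW.
      have h1 := phile _ (path_in pX r01).
      have h2 := psi_gt0 co (path_in pX r01).
      have h4 : k <= kappa r by apply/ltW/he; rewrite gtr0_norm ?subr_gt0//; move: tau1 tr r01; slra.
      have : k * psi (X r) <= kappa r * psi (X r) by rewrite ler_pM2r.
      by rewrite /velocity; move: h1; slra.
    - by move=> r _; apply: continuousB; [exact: path_cont pX|exact: cst_continuous].
    - by move=> r _; apply: continuousM; [exact: cst_continuous|exact: cvg_id].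
  rewrite -ler_pdivrMr ?expR_gt0// -expRN -/rho /p; slra.
have := mass_compare_le (sol_mass sol tt0) (sol_mass sol t0) zero01 (expR_ge0 tau) rho0 _ prho wle.
rewrite mulr0 addr0 (ltW p0) (sol_H0 sol tt0) => /(_ isT) h.
have p1 : p < 1 by move: rho0 prho; slra.
have pd : p < d.
  have : 1 - rho <= s * tau by have := expR_ge1Dx (- (s * tau)); rewrite -/rho; slra.
  by rewrite -(ler_pM2l c0) -/p; move: tau3 p0; slra.
have /andP[h1 _] := sol_incr t0 (lexx 0) (ltW p0) p1.
rewrite (sol_H0 sol t0) subr0 in h1.
have h2 := hd p; rewrite (ltW p0) pd in h2; have {}h2 := h2 isT p1; rewrite -/q in h2.
have h3 : p * (q - eta) <= p * w p t by rewrite ler_pM2l// ltW.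
have Et : expR tau / rho = (expR (- ((1 + s) * tau)))^-1.
  by rewrite /rho -!expRN -expRD; congr expR; ring.
rewrite Et mulrC ler_pdivlMr ?expR_gt0// mul1r in h.
have h4 := expR_ge1Dx (- ((1 + s) * tau)).
have h5 : s * tau / (1 + s * tau) <= 1 - rho.
  rewrite ler_pdivrMr; last by move: st0; slra.
  have := expR_ge1Dx (s * tau); rewrite -(ler_pM2l rho0).
  have -> : rho * expR (s * tau) = 1 by rewrite /rho -expRD addNr expR0.
  slra.
have q'0 : 0 < q - eta.
  by rewrite -(pmulr_rgt0 _ sc0); move: s0 q'; slra.
have h6 : c * (s * tau / (1 + s * tau)) * (q - eta) <= p * (q - eta).
  by rewrite ler_pM2r// /p ler_pM2l.
have : c * (s * tau / (1 + s * tau)) * (q - eta) <= (1 + s) * tau by move: h1 h3 h h4 h6; slra.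
have -> : c * (s * tau / (1 + s * tau)) * (q - eta) = tau * (s * c * (q - eta)) / (1 + s * tau).
  by field; rewrite gt_eqF//; move: st0; slra.
rewrite ler_pdivrMr; last by move: st0; slra.
have -> : (1 + s) * tau * (1 + s * tau) = tau * ((1 + s) + M * tau) by rewrite /M; ring.
rewrite ler_pM2l// => h7; move: tau2 sg0; rewrite /sg in h7 *; move: h7; slra.
Qed.

(** Otherwise convexity puts [F (1 / 2) t] below [1 - d / 2], so [w (1 / 2) t > 2] and [[0, 1 / 2]]
    alone carries more than mass 1. *)
Lemma flow_late d t : 0 < d < 1 -> 0 <= t -> 2 < expR t * w0 (1 - d / 2) -> 1 - d <= F 0 t.
Proof.
move=> /andP[d0 d1] t0 h; rewrite leNgt; apply/negP => F0.
have half : 0 <= (1 / 2 : R) < 1 by apply/andP; split; lra.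
have /andP[hl hr] := half.
have := flow_convex1 co kc kp fl (lexx 0) hl hr t0.
have /andP[F20 F21] := flow_in fl half t0.
move=> hF; have : w0 (1 - d / 2) <= w0 (F (1 / 2) t).
  by apply: (mass_ninc m0) => //; lra.
rewrite -(ler_pM2l (expR_gt0 t)) -(sol_w sol half t0) => hw.
have /andP[h1 _] := sol_incr t0 (lexx 0) hl hr.
have h2 := mass_ge0 (sol_mass sol t0) half.
rewrite (sol_H0 sol t0) in h1; lra.
Qed.

Section Late.
Variables (e d : R).
Hypotheses (e0 : 0 < e) (e4 : e <= 1 / 4) (d01 : 0 < d < 1).
Hypothesis lip : forall x y, 1 - d <= x -> x <= y -> y < 1 -> `|L y - L x| <= e * (y - x).
Variable t : R.
Hypotheses (t0 : 0 <= t) (late : 1 - d <= F 0 t).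

Ltac drop_facts ::= clear - co prof sol kc kp fl m0 zero01 psi00 e0 e4 d01 lip t0 late.

(** Let [s] be the chord slope of [F] over [[0, x]]. Beyond [x], convexity keeps [F] above the line
    of slope [s], so the mass there is at most [w x t * L (F x t) / s]; it is also at least
    [1 - x * w 0 t]. This bounds [s], while [L] changes by at most [e] times the gap. *)
Lemma gap_le x : 0 <= x < 1 -> x * w 0 t <= 1 / 4 ->
  F x t - F 0 t <= 3 / 2 * (x * w 0 t) * L (F 0 t).
Proof.
move=> /andP[]; rewrite le_eqVlt => /orP[/eqP <- _ _|x0 x1 xq].
  by rewrite subrr mul0r mulr0 mul0r.
have x01 : 0 <= x < 1 by rewrite x1 ltW.
set q := w 0 t in xq *.
have q1 : 1 <= q := sol_ge1 t0.
have F0x := flow_lt co kc kp fl (lexx 0) x0 x1 t0.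
have Fx01 := flow_in fl x01 t0; have /andP[Fx0 Fx1] := Fx01.
have F001 := flow_in fl zero01 t0.
set G := F x t - F 0 t; have G0 : 0 < G by rewrite subr_gt0.
pose s := G / x; have s0 : 0 < s by rewrite divr_gt0.
have c1 := flow_convex1 co kc kp fl (lexx 0) (ltW x0) x1 t0.
have ps1 : (F x t - s * x) + s <= 1.
  have : s * (1 - x) <= 1 - F x t.
    by rewrite /s mulrAC ler_pdivrMr// /G; nra.
  lra.
have sx : s * x = G by rewrite /s mulfVK// gt_eqF.
have wle y : x < y < 1 -> w y t <= expR t * w0 (F x t - s * x + s * y).
  move=> /andP[xy y1]; have y01 : 0 <= y < 1 by rewrite y1 (ltW (lt_trans x0 xy)).
  rewrite (sol_w sol y01 t0) ler_pM2l ?expR_gt0//.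
  have /andP[Fy0 Fy1] := flow_in fl y01 t0.
  apply: (mass_ninc m0 _ _ Fy1); first by rewrite sx /G; have /andP[? _] := F001; nra.
  have := flow_convex co kc kp fl (lexx 0) (ltW x0) (ltW xy) y1 t0.
  rewrite subr0 -/G => cv.
  have : s * (y - x) <= F y t - F x t by rewrite /s mulrAC ler_pdivrMr.
  lra.
have h := mass_compare_le (sol_mass sol t0) m0 x01 (expR_ge0 t) s0 _ ps1 wle.
rewrite subrK in h; have {}h := h Fx0.
have Hx : h0 (F x t) = L (F x t) * w0 (F x t).
  by rewrite /life mulfVK ?gt_eqF// (mass_gt0 m0).
have wx : w x t = expR t * w0 (F x t) by exact: (sol_w sol).
have h1 : H t x * s <= w x t * L (F x t).
  rewrite wx -ler_pdivlMr//; apply: (le_trans h); rewrite Hx le_eqVlt.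
  by apply/orP; left; apply/eqP; ring.
have /andP[_ h2] := sol_incr t0 (lexx 0) (ltW x0) x1.
rewrite (sol_H0 sol t0) subr0 -/q in h2.
have wxq : w x t <= q by apply: sol_ninc => //; exact: ltW.
have LF0 := life_gt0 m0 F001.
have := lip late (ltW F0x) Fx1; rewrite ler_norml => /andP[_ h3].
have LFx := life_gt0 m0 Fx01.
have h4 : w x t * L (F x t) <= q * (L (F 0 t) + e * G).
  by apply: ler_pM; [exact/ltW/(sol_gt0 t0)|exact: ltW| |rewrite /G; move: h3; slra].
have h5 : (1 - x * q) * s <= q * (L (F 0 t) + e * G).
  by apply: le_trans h4; apply: le_trans h1; rewrite ler_pM2r//; move: h2; slra.
have h6 : (1 - x * q) * G <= x * q * (L (F 0 t) + e * G).
  have E : (1 - x * q) * G = (1 - x * q) * s * x by rewrite -[in LHS]sx; ring.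
  by have := ler_wpM2r (ltW x0) h5; rewrite E; slra.
have xq0 : 0 <= x * q by rewrite mulr_ge0 ?ltW//; move: q1; slra.
set u := x * q in xq h6 xq0 *.
have a1 : u * G <= 1 / 4 * G by rewrite ler_pM2r.
have a2 : e * (u * G) <= 1 / 4 * (u * G) by rewrite ler_wpM2r// mulr_ge0// ltW.
have -> : 3 / 2 * u * L (F 0 t) = 3 / 2 * (u * L (F 0 t)) by ring.
move: G0 h6 a1 a2; slra.
Qed.

(** By [gap_le] the interval [[0, x]] comes from one that is short in units of [L], and [ratio_ge]
    applies. Thus the profile stays comparable to its maximum over a length of order
    [1 / w(0, t)]. *)
Lemma profile_ge x : 0 <= x < 1 -> x * w 0 t <= 1 / 4 ->
  w 0 t * (1 - 2 * (x * w 0 t)) <= w x t.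
Proof.
move=> x01 xq; have /andP[x0 x1] := x01; have gl := gap_le x01 xq.
have F001 := flow_in fl zero01 t0; have /andP[_ Fx1] := flow_in fl x01 t0.
have LF0 := life_gt0 m0 F001.
have F0x := flow_le co kc kp fl (lexx 0) x0 x1 t0.
pose N := (F x t - F 0 t) / L (F 0 t).
have N0 : 0 <= N by rewrite divr_ge0 ?subr_ge0// ltW.
have N1 : N <= 3 / 2 * (x * w 0 t) by rewrite ler_pdivrMr.
have h : w 0 t * (1 - N) <= w x t * (1 + e * N).
  rewrite (sol_w sol zero01 t0) (sol_w sol x01 t0) -[X in X <= _]mulrA -[X in _ <= X]mulrA.
  by rewrite ler_pM2l ?expR_gt0//; exact: (ratio_ge m0 d01 lip late F0x Fx1).
have q0 : 0 < w 0 t by have := sol_ge1 t0; lra.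
have wx0 := sol_gt0 t0 x01.
set q := w 0 t in N1 h q0 xq *; set u := x * q in N1 xq *.
have eN : e * N <= 1 / 4 * N by rewrite ler_wpM2r.
have : w x t * (1 + e * N) <= w x t * (1 + 1 / 4 * N) by rewrite ler_pM2l//; lra.
have h2 : q * (1 - 2 * u) * (1 + 1 / 4 * N) <= q * (1 - N).
  have uN : 0 <= u * N by rewrite mulr_ge0// mulr_ge0// ltW.
  by rewrite -mulrA ler_pM2l//; lra.
move=> h3; have p : 0 < 1 + 1 / 4 * N by lra.
by rewrite -(ler_pM2r p); lra.
Qed.
End Late.

End Sol.

(** * Upper bound for w(0, t) *)

Section Core.
Variables (R : realType) (phi psi phi1 psi1 dW : R -> R) (al be : R).
Hypothesis co : coefs phi psi phi1 psi1 dW al be.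
Variables (w0 h0 : R -> R).
Hypothesis prof : profile w0 h0.
Variables (kappa : R -> R) (F w H : R -> R -> R).
Hypothesis sol : solution phi psi w0 kappa F w H.
Variable Psi : R -> R.
Hypothesis PsiP : forall x : R, 0 <= x < 1 -> is_derive x 1 Psi (psi x)^-1.
Local Notation path := (trajectory phi psi kappa).
Local Notation vel := (velocity phi psi kappa).
Local Notation L := (life w0 h0).
Local Notation Ec := (Ec Psi).
Local Notation g := (coef_ratio phi psi).
Local Notation W := (wronskian phi psi phi1 psi1).
Local Notation conv_at := (conv_at phi psi phi1 psi1).
Implicit Types (X Y : R -> R) (s t x y z : R).

Let kc := sol_kcont sol.
Let kp := sol_kgt0 sol.
Let fl := sol_flow sol.
Let m0 := profile_mass prof.

Let zero01 : 0 <= (0 : R) < 1.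
Proof. by rewrite lexx ltr01. Qed.

Lemma W_ninc x y : 0 < x -> x <= y -> y < 1 -> W y <= W x.
Proof.
move=> x0 xy y1.
have i z : x <= z <= y -> 0 < z < 1.
  by move=> /andP[xz zy]; rewrite (lt_le_trans x0 xz) (le_lt_trans zy).
apply: (@le0_derive_ge _ W dW x y xy) => z.
- by move=> /andP[xz zy]; apply: (W_der co); apply: i; rewrite !ltW.
- by move=> /andP[xz zy]; apply: (dW_le0 co); apply: i; rewrite !ltW.
- by move=> /i/(W_der co) Wd; exact: is_derive_continuous Wd.
Qed.

Lemma Ec_bounds B x y : 0 < B -> 0 <= x -> x <= y -> y < 1 ->
  B * Ec B x / psi x * (y - x) <= Ec B y - Ec B x <= B * Ec B y / psi y * (y - x).
Proof.
move=> B0 x0 xy y1.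
have i z : x <= z <= y -> 0 <= z < 1.
  by move=> /andP[xz zy]; rewrite (le_trans x0 xz) (le_lt_trans zy).
have sub z : x < z < y -> x <= z <= y by move=> /andP[/ltW -> /ltW ->].
have gen k z : x <= z <= y ->
    is_derive z 1 (fun u => Ec B u - k * u) (B * Ec B z / psi z - k).
  by move=> /i /(Ec_der PsiP B) ?; apply: is_derive_eq; rewrite /GRing.scale/=; ring.
have genc k z : x <= z <= y -> {for z, continuous (fun u => Ec B u - k * u)}.
  by move=> /(gen k); exact: is_derive_continuous.
have mono z z' : x <= z -> z <= z' -> z' <= y ->
    B * Ec B z / psi z <= B * Ec B z' / psi z'.
  move=> xz zz' z'y; have z0 : 0 <= z := le_trans x0 xz.
  have z'1 := le_lt_trans z'y y1.
  have p1 : 0 < psi z by apply: (psi_gt0 co); rewrite z0 (le_lt_trans zz').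
  have p2 : 0 < psi z' by apply: (psi_gt0 co); rewrite (le_trans z0 zz').
  apply: ler_pM; rewrite ?invr_ge0 ?mulr_ge0 ?(ltW p1) ?(ltW B0) ?(ltW (Ec_gt0 _ _ _))//.
    rewrite ler_pM2l// ler_expR ler_pM2l//.
    move: zz'; rewrite le_eqVlt => /orP[/eqP -> //|zz'].
    by apply/ltW/(Psi_lt co PsiP).
  by rewrite lef_pV2 ?posrE//; apply: (psi_ninc co z0 zz'); exact: ltW.
apply/andP; split.
- set k := B * Ec B x / psi x.
  suff : Ec B x - k * x <= Ec B y - k * y by lra.
  apply: (ge0_derive_le xy (fun z h => gen k z (sub z h)) _ (genc k)).
  by move=> z /andP[xz zy]; rewrite subr_ge0; apply: mono; rewrite ?lexx ?ltW.
- set k := B * Ec B y / psi y.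
  suff : Ec B y - k * y <= Ec B x - k * x by lra.
  apply: (le0_derive_ge xy (fun z h => gen k z (sub z h)) _ (genc k)).
  by move=> z /andP[xz zy]; rewrite subr_le0; apply: mono; rewrite ?lexx ?ltW.
Qed.

(** This is [flow_Ec_concave] with exponentials replaced by their slopes. The slope of [E_B] at
    [F y t] is an upper bound on its left and a lower bound on its right, so it cancels. *)
Lemma flow_distortion B xd x y z t : 0 < B -> conv_at B xd ->
  (forall s, 0 < s < t -> vel s xd <= 0) -> 0 <= xd ->
  xd <= x -> x < y -> y < z -> z < 1 -> 0 <= t ->
  (F z t - F y t) * (Ec B x / psi x * (y - x)) <=
  (F y t - F x t) * (Ec B z / psi z * (z - y)).
Proof.
move=> B0 cB vd xd0 xdx xy yz z1 t0.
have x0 := le_trans xd0 xdx; have y1 := lt_trans yz z1.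
have y0 := le_trans x0 (ltW xy); have z0 := le_trans y0 (ltW yz).
have cc := flow_Ec_concave co kc kp fl PsiP B0 cB vd xd0 xdx xy yz z1 t0.
have /andP[Fx0 Fx1] : 0 <= F x t < 1 by apply: (flow_in fl); rewrite ?x0 ?(lt_trans xy).
have /andP[Fy0 Fy1] : 0 <= F y t < 1 by apply: (flow_in fl); rewrite ?y0.
have /andP[Fz0 Fz1] : 0 <= F z t < 1 by apply: (flow_in fl); rewrite ?z0.
have Fxy := flow_lt co kc kp fl x0 xy y1 t0.
have Fyz := flow_lt co kc kp fl y0 yz z1 t0.
have /andP[_ h1] := Ec_bounds B0 Fx0 (ltW Fxy) Fy1.
have /andP[h2 _] := Ec_bounds B0 Fy0 (ltW Fyz) Fz1.
have /andP[h3 _] := Ec_bounds B0 x0 (ltW xy) y1.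
have /andP[_ h4] := Ec_bounds B0 y0 (ltW yz) z1.
set Dy := B * Ec B (F y t) / psi (F y t) in h1 h2.
have Dy0 : 0 < Dy.
  by rewrite divr_gt0 ?mulr_gt0 ?Ec_gt0//; apply: (psi_gt0 co); rewrite Fy0.
have bxy : Ec B x < Ec B y by apply: (Ec_lt co PsiP B0).
have byz : Ec B y < Ec B z by apply: (Ec_lt co PsiP B0).
set bx := Ec B x in h3 bxy cc *; set by_ := Ec B y in h3 h4 bxy byz cc.
set bz := Ec B z in h4 byz cc *.
have e1 : (F z t - F y t) * Dy * (by_ - bx) <= (F y t - F x t) * Dy * (bz - by_).
  apply: (@le_trans _ _ ((Ec B (F z t) - Ec B (F y t)) * (by_ - bx))).
    by rewrite ler_wpM2r ?subr_ge0 ?(ltW bxy)// mulrC.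
  by apply: (le_trans cc); rewrite ler_wpM2r ?subr_ge0 ?(ltW byz)// mulrC.
have e2 : (F z t - F y t) * (by_ - bx) <= (F y t - F x t) * (bz - by_).
  by rewrite -(ler_pM2l Dy0); lra.
rewrite -(ler_pM2l B0).
have -> : B * ((F z t - F y t) * (bx / psi x * (y - x))) =
  (F z t - F y t) * (B * bx / psi x * (y - x)) by ring.
have -> : B * ((F y t - F x t) * (bz / psi z * (z - y))) =
  (F y t - F x t) * (B * bz / psi z * (z - y)) by ring.
apply: (@le_trans _ _ ((F z t - F y t) * (by_ - bx))).
  by rewrite ler_wpM2l// subr_ge0 ltW.
by apply: (le_trans e2); rewrite ler_wpM2l// subr_ge0 ltW.
Qed.

Lemma Psi_path_der t X s : path t X -> 0 < s < t ->
  is_derive s 1 (fun s => Psi (X s)) (g (X s) - kappa s).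
Proof.
move=> pX st; have s0t : 0 <= s <= t by case/andP: st => /ltW -> /ltW ->.
have Xs := path_in pX s0t.
have p0 : psi (X s) != 0 by rewrite gt_eqF// (psi_gt0 co).
have ? := @is_derive1_comp R Psi X s _ _ (PsiP Xs) (path_der pX st).
by apply: is_derive_eq; rewrite /velocity /coef_ratio; field.
Qed.

Lemma Psi_path_cont t X s : path t X -> 0 <= s <= t ->
  {for s, continuous (fun s => Psi (X s))}.
Proof.
move=> pX st; apply: continuous_comp; first exact: path_cont pX.
exact/(Psi_cont PsiP)/(path_in pX).
Qed.

(** With respect to [Psi] the function [g] has derivative [W / psi]; [W] is nonincreasing and
    [psi <= psi 0]. *)
Lemma g_slope_ge xh x y : 0 <= x -> x <= y -> y <= xh -> xh < 1 ->
  W xh / psi 0 * (Psi y - Psi x) <= g y - g x.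
Proof.
move=> x0 xy yh h1; set k := W xh / psi 0.
have [->|yne0] := eqVneq y x; first by rewrite !subrr mulr0.
have xy' : x < y by rewrite lt_neqAle eq_sym yne0.
have y1 := le_lt_trans yh h1.
have xh0 : 0 < xh by apply: lt_le_trans yh; apply: le_lt_trans xy'.
have Wh0 : 0 < W xh by apply: (W_gt0 co); rewrite xh0.
have psi00 : 0 < psi 0 := psi_gt0 co zero01.
pose f u := g u - k * Psi u.
suff : f x <= f y by rewrite /f; lra.
apply: (@ge0_derive_le _ f (fun z => W z / psi z ^+ 2 - k / psi z)) => //.
- move=> z /andP[xz zy]; have z0 := le_lt_trans x0 xz.
  have z01 : 0 < z < 1 by rewrite z0 (lt_trans zy).
  have ? := g_der co z01; have ? : is_derive z 1 Psi (psi z)^-1.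
    by apply: PsiP; rewrite (ltW z0) (lt_trans zy).
  by apply: is_derive_eq; rewrite /GRing.scale/=; ring.
- move=> z /andP[xz zy]; have z0 := le_lt_trans x0 xz.
  have z1 := lt_trans zy y1.
  have pz : 0 < psi z by apply: (psi_gt0 co); rewrite (ltW z0).
  have -> : W z / psi z ^+ 2 - k / psi z = (W z / psi z - k) / psi z by field; rewrite gt_eqF.
  apply: divr_ge0; last exact: ltW.
  rewrite subr_ge0 /k; apply: ler_pM; rewrite ?invr_ge0 ?(ltW Wh0) ?(ltW psi00)//.
    by apply: W_ninc => //; exact: (le_trans (ltW zy)).
  by rewrite lef_pV2 ?posrE//; apply: (psi_ninc co (lexx 0) (ltW z0)); exact: ltW.
- move=> z /andP[xz zy]; have z01 : 0 <= z < 1 by rewrite (le_trans x0 xz) (le_lt_trans zy).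
  apply: continuousB; first exact: (g_cont co).
  by apply: continuousM; [exact: cst_continuous|exact: (Psi_cont PsiP)].
Qed.

(** In the coordinate [Psi] the velocity is [g - kappa], so [kappa] cancels in the difference of two
    trajectories and only the growth of [g] remains. *)
Lemma path_contraction xh t a X Y : path t X -> path t Y -> 0 <= a <= t -> X t < Y t ->
  xh < 1 -> (forall s, a < s < t -> Y s <= xh) ->
  (Psi (Y a) - Psi (X a)) * expR (W xh / psi 0 * (t - a)) <= Psi (Y t) - Psi (X t).
Proof.
move=> pX pY at01 XY h1 Yh; have /andP[a0 at_] := at01.
have lts s : 0 <= s <= t -> X s < Y s.
  by move=> st; apply: (path_lt_back co kc kp pX pY).
have := @Gronwall_lower _ (fun s => Psi (Y s) - Psi (X s))
  (fun s => (g (Y s) - kappa s) - (g (X s) - kappa s)) (- (W xh / psi 0)) a t at_.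
rewrite opprK; apply.
- rewrite subr_gt0; have /andP[? _] := path_in pX at01; have /andP[_ ?] := path_in pY at01.
  by apply: (Psi_lt co PsiP) => //; exact: lts.
- move=> s /andP[as_ st]; have s0t : 0 < s < t by rewrite (le_lt_trans a0).
  have ? := Psi_path_der pX s0t; have ? := Psi_path_der pY s0t; exact: is_deriveB.
- move=> s /andP[as_ st] _.
  have s0t : 0 <= s <= t by rewrite (le_trans a0 (ltW as_)) ltW.
  have /andP[Xs0 _] := path_in pX s0t.
  have Ys : Y s <= xh by apply: Yh; rewrite as_.
  have := g_slope_ge Xs0 (ltW (lts s s0t)) Ys h1; lra.
- move=> s /andP[as_ st]; have s0t : 0 <= s <= t by rewrite (le_trans a0 as_).
  by apply: continuousB; [exact: Psi_path_cont pY s0t|exact: Psi_path_cont pX s0t].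
Qed.

Ltac drop_facts ::= clear - co prof sol PsiP kc kp fl m0 zero01.

Lemma flow_chord p q y u t : 0 <= p -> p <= q -> q <= y -> y < u -> u < 1 -> 0 <= t ->
  (F q t - F p t) * (u - y) <= (F u t - F y t) * (q - p).
Proof.
move=> p0 pq qy yu u1 t0.
have q0 := le_trans p0 pq; have qu := le_lt_trans qy yu.
have k1 := flow_convex co kc kp fl p0 pq (ltW qu) u1 t0.
have k2 := flow_convex co kc kp fl q0 qy (ltW yu) u1 t0.
have uq : 0 < u - q by rewrite subr_gt0.
have uy : 0 < u - y by rewrite subr_gt0.
have qp : 0 <= q - p by rewrite subr_ge0.
rewrite -(ler_pM2r uq).
have k3 := ler_wpM2r (ltW uy) k1.
have k4 : (F u t - F q t) * (u - y) * (q - p) <= (F u t - F y t) * (u - q) * (q - p).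
  by rewrite ler_wpM2r//; move: k2; slra.
by move: k3 k4; slra.
Qed.

(* If w(0, t) exceeded 1 / mu, then the part of the profile at time t lying in
   [xd, 4 mu] would come from an interval at time t - la so short that w is nearly
   constant on it; hence w(4 mu, t) would be comparable to w(0, t), contradicting
   int w = 1. *)
Lemma no_concentration (e d la mu xd xh B t : R) :
  0 < e -> e <= 1 / 4 -> 0 < d < 1 ->
  (forall x y, 1 - d <= x -> x <= y -> y < 1 -> `|L y - L x| <= e * (y - x)) ->
  0 < la -> 0 < mu -> 0 <= xd -> 0 < B -> conv_at B xd ->
  e * expR la <= 1 / 8 -> 16 * xd * expR la <= mu -> 4 * mu <= xh -> 2 * xh < 1 ->
  960 * (psi 0 / psi (2 * xh)) * (Ec B (2 * xh) / psi (2 * xh) / (Ec B xd / psi xd)) <=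
    expR (W xh / psi 0 * la) ->
  la <= t ->
  (forall s, t - la <= s <= t -> 1 - d <= F 0 s) ->
  (forall s, 0 < s < t -> vel s xd <= 0) ->
  (forall s, t - la < s < t -> 0 <= vel s xh) ->
  w 0 (t - la) <= 2 / mu -> w 0 t <= 1 / mu.
Proof.
move=> e0 e4 d01 lip la0 mu0 xd0 B0 cB ela xdla muh h1 small lat late vd vh qa.
rewrite leNgt; apply/negP => qt.
set a := t - la in late vh qa.
have a0 : 0 <= a by rewrite subr_ge0.
have at_ : a <= t by rewrite lerBlDr lerDl ltW.
have a0t : 0 <= a <= t by rewrite a0.
have t0 := le_trans a0 at_.
have la1 : 1 <= expR la by rewrite -expR0 ler_expR ltW.
have xd16 : 16 * xd <= mu by apply: le_trans xdla; rewrite ler_peMr// mulr_ge0.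
have xh0 : 0 < xh by move: mu0 muh; slra.
have x31 : 4 * mu < 1 by move: muh h1; slra.
have xdx3 : xd < 4 * mu by move: mu0 xd16; slra.
have xd01 : 0 <= xd < 1 by rewrite xd0; move: x31 xdx3; slra.
have x301 : 0 <= 4 * mu < 1 by rewrite x31 mulr_ge0// ltW.
have lat_a : 1 - d <= F 0 a by apply: late; rewrite lexx.
have lat_t : 1 - d <= F 0 t by apply: late; rewrite at_ lexx.
have [X [pX Xt _]] := fl xd01 t0.
have [Y [pY Yt _]] := fl x301 t0.
have XYt : X t < Y t by rewrite Xt Yt.
set p := X a; set q := Y a.
have pq : p < q by apply: (path_lt_back co kc kp pX pY).
have /andP[p0 p1] : 0 <= p < 1 := path_in pX a0t.
have /andP[q0 q1] : 0 <= q < 1 := path_in pY a0t.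
have Yh s : a <= s <= t -> Y s <= xh.
  move=> /andP[as_ st]; apply: (path_up co kp pY); rewrite ?(le_trans a0 as_)//.
  - exact: ltW.
  - by move=> r /andP[sr rt]; apply: vh; rewrite (le_lt_trans as_).
  - by rewrite Yt.
have qh : q <= xh by apply: Yh; rewrite lexx.
have psi00 : 0 < psi 0 := psi_gt0 co zero01.
have ps2h : 0 < psi (2 * xh) by apply: (psi_gt0 co); rewrite h1 mulr_ge0// ltW.
have h1' : xh < 1 by move: h1; slra.
have short : q - p <= 4 * mu * (psi 0 / psi (2 * xh)) / expR (W xh / psi 0 * la).
  have := path_contraction pX pY a0t XYt h1' (fun s h => ltac:(case/andP: h => ? ?;
    apply: Yh; rewrite !ltW //)).
  have -> : t - a = la by rewrite /a; ring.
  rewrite -/p -/q Xt Yt -ler_pdivlMr ?expR_gt0// => c1.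
  have /andP[c2 _] := Psi_bounds co PsiP p0 (ltW pq) q1.
  have /andP[_ c3] := Psi_bounds co PsiP xd0 (ltW xdx3) x31.
  have pp : 0 < psi p by apply: (psi_gt0 co); rewrite p0.
  have c4 : q - p <= psi 0 * (Psi q - Psi p).
    move: c2; rewrite ler_pdivrMr// => /le_trans; apply; rewrite mulrC ler_wpM2r//.
      by rewrite subr_ge0; apply/ltW/(Psi_lt co PsiP).
    by apply: (psi_ninc co (lexx 0) p0); exact: ltW.
  have c5 : Psi (4 * mu) - Psi xd <= 4 * mu / psi (2 * xh).
    apply: (le_trans c3); apply: ler_pM; rewrite ?invr_ge0 ?subr_ge0 ?(ltW xdx3)//.
    - by apply/ltW/(psi_gt0 co).
    - by rewrite lerBlDr lerDl.
    - rewrite lef_pV2 ?posrE ?(psi_gt0 co x301)//.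
      by apply: (psi_ninc co); [exact: mulr_ge0 (ltW mu0)|move: mu0 muh; slra|exact: ltW].
  apply: (le_trans c4); rewrite -mulrA.
  apply: (@le_trans _ _ (psi 0 * ((4 * mu / psi (2 * xh)) / expR (W xh / psi 0 * la)))).
    rewrite ler_pM2l//; apply: (le_trans c1).
    by rewrite ler_pM2r ?invr_gt0 ?expR_gt0.
  by rewrite le_eqVlt; apply/orP; left; apply/eqP; ring.
(* The bound [w 0 a <= 2 / mu] gives [xm * w 0 a <= 1 / 4], the range of [gap_le]. This controls the
   slope of the flow on [[xd, xm]], and the distortion estimate carries it to [[xm, 2 * xh]]. *)
pose xm := mu / 8.
have xm01 : 0 <= xm < 1 by rewrite /xm; apply/andP; split; move: x301; slra.
have xdm : 2 * xd <= xm by rewrite /xm; move: xd16; slra.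
have xmq : xm * w 0 a <= 1 / 4.
  apply: (@le_trans _ _ (xm * (2 / mu))); first by rewrite ler_pM2l// /xm divr_gt0.
  by rewrite /xm le_eqVlt; apply/orP; left; apply/eqP; field; rewrite gt_eqF.
have gap := gap_le co prof sol e4 lip a0 lat_a xm01 xmq.
have L0 : 0 < L (F 0 a) by apply: (life_gt0 m0); exact: (flow_in fl).
have [l0 l0E] : exists l0, l0 = L (F 0 a) by eexists.
rewrite -l0E in gap L0.
have xm0 : 0 < xm by rewrite /xm divr_gt0.
have gap' : F xm a - F xd a <= 3 / 8 * l0.
  have : F 0 a <= F xd a by apply: (flow_le co kc kp fl) => //; move: xm01 xdm; slra.
  have : 3 / 2 * (xm * w 0 a) * l0 <= 3 / 2 * (1 / 4) * l0.
    by rewrite ler_pM2r// ler_pM2l.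
  move: gap; slra.
have xdxm : xd < xm by move: xdm xm0; slra.
have xm2h : xm < 2 * xh by rewrite /xm; move: mu0 muh; slra.
have vd' s : 0 < s < a -> vel s xd <= 0.
  by move=> /andP[s0 sa]; apply: vd; rewrite s0 (lt_le_trans sa).
have dist := flow_distortion B0 cB vd' xd0 (lexx xd) xdxm xm2h h1 a0.
have Du0 : 0 < Ec B (2 * xh) / psi (2 * xh) by rewrite divr_gt0// Ec_gt0.
have Dx0 : 0 < Ec B xd / psi xd by rewrite divr_gt0 ?Ec_gt0// (psi_gt0 co).
move: (Ec B (2 * xh) / psi (2 * xh)) (Ec B xd / psi xd) dist small Du0 Dx0 => Du Dx dist small Du0 Dx0.
have steep : F (2 * xh) a - F xm a <= 12 * (Du / Dx) * xh / mu * l0.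
  have k1 : (F (2 * xh) a - F xm a) * (Dx * (mu / 16)) <= (3 / 8 * l0) * (Du * (2 * xh)).
    apply: (@le_trans _ _ ((F (2 * xh) a - F xm a) * (Dx * (xm - xd)))).
      rewrite ler_wpM2l//; last by rewrite ler_pM2l//; move: xdm; rewrite /xm; slra.
      by rewrite subr_ge0; apply: (flow_le co kc kp fl) => //; exact: ltW.
    apply: (le_trans dist); apply: ler_pM => //.
    - by rewrite subr_ge0; apply: (flow_le co kc kp fl) => //; [exact: ltW|case/andP: xm01].
    - by rewrite mulr_ge0 ?(ltW Du0)// subr_ge0 ltW.
    - by rewrite ler_pM2l// lerBlDr lerDl ltW.
  rewrite -(ler_pM2r (_ : 0 < Dx * (mu / 16))); last by rewrite mulr_gt0// divr_gt0.
  apply: (le_trans k1); rewrite le_eqVlt; apply/orP; left; apply/eqP.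
  by field; rewrite !gt_eqF.
have cvx : (F q a - F p a) * xh <= (F (2 * xh) a - F xm a) * (q - p).
  have h2h : xh < 2 * xh by move: xh0; slra.
  have := flow_chord p0 (ltW pq) qh h2h h1 a0.
  have -> : 2 * xh - xh = xh by ring.
  move=> /le_trans; apply; rewrite ler_wpM2r ?subr_ge0 ?(ltW pq)// lerD2l lerN2.
  apply: (flow_le co kc kp fl) => //; first exact: ltW.
  by move: muh xh0; rewrite /xm; slra.
have E0 := expR_gt0 (W xh / psi 0 * la).
move: (expR (W xh / psi 0 * la)) E0 small short => E E0 small short.
have r0 : 0 < psi 0 / psi (2 * xh) by rewrite divr_gt0.
move: (psi 0 / psi (2 * xh)) r0 small short => r r0 small short.
(* The factor 12 of [steep], the 4 of [short] and the target 1 / 20 make up the 960 of the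
   hypothesis. *)
have narrow : F q a - F p a <= 1 / 20 * l0.
  have DD0 : 0 < Du / Dx by rewrite divr_gt0.
  have k0 : 0 < 12 * (Du / Dx) * xh / mu * l0.
    by rewrite mulr_gt0// divr_gt0// mulr_gt0// mulr_gt0.
  have k1 : (F q a - F p a) * xh <= 12 * (Du / Dx) * xh / mu * l0 * (4 * mu * r / E).
    apply: (le_trans cvx); apply: (@le_trans _ _ (12 * (Du / Dx) * xh / mu * l0 * (q - p))).
      by rewrite ler_wpM2r// subr_ge0 ltW.
    by rewrite ler_wpM2l// ltW.
  have k3 : 12 * (Du / Dx) * xh / mu * l0 * (4 * mu * r / E) =
      (960 * r * (Du / Dx)) / E * (1 / 20 * l0 * xh).
    by field; rewrite !gt_eqF.
  have Q1 : 960 * r * (Du / Dx) / E <= 1 by rewrite ler_pdivrMr// mul1r.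
  have Q0 : 0 < 1 / 20 * l0 by rewrite mulr_gt0// divr_gt0.
  have Q2 := ler_wpM2r (ltW (mulr_gt0 Q0 xh0)) Q1.
  rewrite [X in _ <= X]mul1r -k3 in Q2.
  have := le_trans k1 Q2.
  by rewrite (ler_pM2r xh0).
clear cvx steep dist small short gap' gap vd vd' vh Yh cB.
have wp : w xd t = expR la * w p a.
  by rewrite -[in LHS]Xt (sol_path co sol pX a0t) (_ : t - a = la)// /a; ring.
have wq : w (4 * mu) t = expR la * w q a.
  by rewrite -[in LHS]Yt (sol_path co sol pY a0t) (_ : t - a = la)// /a; ring.
have growth := sol_growth co sol a0 at_.
rewrite (_ : t - a = la) in growth; last by rewrite /a; ring.
have qt2 : w 0 t <= expR la * (2 / mu) by apply: (le_trans growth); rewrite ler_pM2l ?expR_gt0.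
have xdq : xd * w 0 t <= 1 / 8.
  apply: (@le_trans _ _ (xd * (expR la * (2 / mu)))); first by rewrite ler_wpM2l.
  have -> : xd * (expR la * (2 / mu)) = (16 * xd * expR la) / (8 * mu) by field; rewrite gt_eqF.
  by rewrite ler_pdivrMr ?mulr_gt0//; move: xdla; slra.
have wxd : 3 / 4 * w 0 t <= w xd t.
  have := profile_ge co prof sol e4 d01 lip t0 lat_t xd01 (ltac:(move: xdq; slra) : xd * w 0 t <= 1 / 4).
  have : 0 < w 0 t by apply: (sol_gt0 sol t0).
  by move: xdq; snra.
have Fp0 : F 0 a <= F p a by apply: (flow_le co kc kp fl).
have /andP[_ Fp1] : 0 <= F p a < 1 by apply: (flow_in fl); rewrite ?p0.
have Fq1 : F q a < 1 by have /andP[] : 0 <= F q a < 1 by apply: (flow_in fl); rewrite ?q0.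
(* [F p a] may lie several units of [L] from [F 0 a], but at most [4 * exp la] of them, because
   [w p a] is not much smaller than [w 0 a]. As [e] is small against [exp (- la)], [L] loses at most
   half of its value. *)
have Lp : 1 / 2 * l0 <= L (F p a).
  have r1 := ratio_le m0 d01 lip lat_a Fp0 Fp1.
  rewrite -l0E in r1; set N := (F p a - F 0 a) / l0 in r1.
  have N0 : 0 <= N by rewrite divr_ge0 ?subr_ge0// ltW.
  have r2 : w p a * (1 + (1 - e) * N) <= w 0 a.
    rewrite (sol_w sol) ?p0// (sol_w sol zero01 a0) -mulrA ler_pM2l ?expR_gt0//.
  have r3 : 3 / 4 / mu <= expR la * w p a.
    rewrite -wp; apply: le_trans wxd; rewrite ler_pM2l ?divr_gt0//.
    by rewrite -[X in X <= _]mul1r ltW.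
  have r4 : 3 / 4 / mu * (1 + (1 - e) * N) <= expR la * (2 / mu).
    have n1 : 0 <= 1 + (1 - e) * N.
      have n2 : 0 <= (1 - e) * N by rewrite mulr_ge0//; move: e4; slra.
      by move: n2; slra.
    apply: (@le_trans _ _ (expR la * w p a * (1 + (1 - e) * N))); first by rewrite ler_wpM2r.
    by rewrite -mulrA ler_pM2l ?expR_gt0//; exact: le_trans qa.
  have r5 : 3 / 4 * (1 + (1 - e) * N) <= 2 * expR la.
    by rewrite -(ler_pM2r (_ : 0 < mu^-1)) ?invr_gt0//; move: r4; slra.
  have r6 : N <= 4 * expR la.
    have r7 : (1 - 1 / 4) * N <= (1 - e) * N by rewrite ler_wpM2r//; move: e4; slra.
    by move: r5 r7 la1; slra.
  have r7 : e * N <= 1 / 2.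
    by apply: (@le_trans _ _ (e * (4 * expR la))); [rewrite ler_pM2l|move: ela; slra].
  have := lip _ _ lat_a Fp0 Fp1; rewrite ler_norml -l0E => /andP[r8 _].
  have NE : F p a - F 0 a = N * l0 by rewrite /N mulfVK// gt_eqF.
  rewrite NE in r8.
  have r9 : e * N * l0 <= 1 / 2 * l0 by rewrite ler_pM2r.
  by move: r8 r9; slra.
have latp : 1 - d <= F p a by exact: le_trans Fp0.
have Fpq : F p a <= F q a by apply: (flow_le co kc kp fl) => //; exact: ltW.
have r1 := ratio_ge m0 d01 lip latp Fpq Fq1.
set n := (F q a - F p a) / L (F p a) in r1.
have Lp0 : 0 < L (F p a) by apply: lt_le_trans Lp; rewrite mulr_gt0// divr_gt0.
have n0 : 0 <= n by rewrite divr_ge0 ?subr_ge0// ltW.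
have n1 : n <= 1 / 10 by rewrite ler_pdivrMr//; move: narrow Lp; slra.
have r2 : w p a * (1 - n) <= w q a * (1 + e * n).
  rewrite (sol_w sol) ?p0// (sol_w sol) ?q0// -[X in X <= _]mulrA -[X in _ <= X]mulrA.
  by rewrite ler_pM2l ?expR_gt0.
have wp0 : 0 < w p a by apply: (sol_gt0 sol a0); rewrite p0.
have wq0 : 0 < w q a by apply: (sol_gt0 sol a0); rewrite q0.
have r3 : 4 / 5 * w p a <= w q a.
  have en : e * n <= 1 / 40.
    by have := ler_pM (ltW e0) n0 e4 n1; slra.
  have : w q a * (1 + e * n) <= w q a * (1 + 1 / 40) by rewrite ler_pM2l//; move: en; slra.
  have : w p a * (1 - 1 / 10) <= w p a * (1 - n) by rewrite ler_pM2l//; move: n1; slra.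
  move: r2 wp0; slra.
have r4 : 4 / 5 * w xd t <= w (4 * mu) t.
  by rewrite wp wq mulrCA ler_pM2l ?expR_gt0.
have /andP[r5 _] := sol_incr sol t0 (lexx 0) (ltW (ltac:(move: xdx3 xd01; slra) : 0 < 4 * mu)) x31.
rewrite subr0 (sol_H0 sol t0) in r5.
have := mass_ge0 (sol_mass sol t0) x301.
(* Now [[0, 4 * mu]] carries mass at least [12 / 5 * mu * w 0 t], which exceeds 1. *)
have r6 : 3 / 5 * w 0 t <= w (4 * mu) t by move: wxd r4; slra.
have : 4 * mu * (3 / 5 * w 0 t) <= 4 * mu * w (4 * mu) t by rewrite ler_pM2l//; move: xdx3 xd01; slra.
move: qt; rewrite ltr_pdivrMr//; move: r5; slra.
Qed.
End Core.

(** * A lower bound for [kappa] from the mean of [phi - k psi] near 0 *)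

Section Average.
Variables (R : realType) (phi psi phi1 psi1 dW : R -> R) (al be : R).
Hypothesis co : coefs phi psi phi1 psi1 dW al be.
Variables (w0 h0 : R -> R).
Hypothesis prof : profile w0 h0.
Variables (kappa : R -> R) (F w H : R -> R -> R).
Hypothesis sol : solution phi psi w0 kappa F w H.
Local Notation path := (trajectory phi psi kappa).
Local Notation vel := (velocity phi psi kappa).
Local Notation L := (life w0 h0).
Implicit Types (X Y : R -> R) (s t x y z : R).

Let kc := sol_kcont sol.
Let kp := sol_kgt0 sol.
Let fl := sol_flow sol.

Let zero01 : 0 <= (0 : R) < 1.
Proof. by rewrite lexx ltr01. Qed.

Variables (e d t k p : R) (Om : R -> R).
Hypotheses (e4 : e <= 1 / 4) (d01 : 0 < d < 1).
Hypothesis lip : forall x y, 1 - d <= x -> x <= y -> y < 1 -> `|L y - L x| <= e * (y - x).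
Hypotheses (t0 : 0 <= t) (late : 1 - d <= F 0 t).
Let U x := phi x - k * psi x.
Hypotheses (k0 : 0 < k) (p0 : 0 < p) (p4 : p <= 1 / 4) (pq : 8 * p * w 0 t <= 1).
Hypothesis Om_der : forall x : R, 0 < x < p -> is_derive x 1 Om (U x).
Hypothesis Om_cont : forall x : R, 0 <= x <= p -> {for x, continuous Om}.
Hypotheses (Om0 : Om 0 = 0) (Omp : 0 <= Om p).
Hypothesis U_incr : forall x, 0 < x < p -> 0 <= phi1 x - k * psi1 x.
Hypotheses (Up0 : 0 <= U p) (Up16 : U p <= 1 / 16) (Uhalf : U p <= U (1 / 2)).

Let U_cont x : {for x, continuous U}.
Proof.
apply: continuousB; first exact: (phi_cont co).
by apply: continuousM; [exact: cst_continuous|exact: (psi_cont co)].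
Qed.

Let U_chord x y z : 0 <= x -> x <= y -> y <= z -> z <= 1 ->
  (U z - U y) * (y - x) <= (U y - U x) * (z - y).
Proof.
move=> x0 xy yz z1; rewrite /U; have := phi_chord co x0 xy yz z1.
have := ler_wpM2l (ltW k0) (psi_chord co x0 xy yz z1); lra.
Qed.

Let U_lip x y : 0 <= x -> x <= y -> y <= 1 -> - (y - x) <= U y - U x.
Proof.
move=> x0 xy y1; rewrite /U; have := phi_decr co x0 xy y1.
have := ler_wpM2l (ltW k0) (psi_ninc co x0 xy y1).
have yx : 0 <= y - x by rewrite subr_ge0.
have := ler_wpM2r yx (ltW (be_lt1 co)); lra.
Qed.

Let U0 : U 0 = - (k * psi 0). Proof. by rewrite /U (phi_at0 co) sub0r. Qed.
Let U1 : U 1 = 0. Proof. by rewrite /U (phi_at1 co) (psi_at1 co) mulr0 subr0. Qed.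

(* concavity makes the modulus of continuity of U at 0 a one-sided modulus everywhere *)
Let U_sub x y : 0 <= x -> x <= y -> y <= 1 -> U y - U x <= U (y - x) - U 0.
Proof.
move=> x0 xy y1; move: (x0); rewrite le_eqVlt => /orP[/eqP <-|xp]; first by rewrite subr0.
have c0 : 0 <= y - x by rewrite subr_ge0.
have [xc|cx|E] := ltgtP x (y - x).
- have h1 := U_chord (lexx 0) x0 (ltW xc) (le_trans (ltac:(lra) : y - x <= y) y1).
  have h2 := U_chord x0 (ltW xc) (ltac:(lra) : y - x <= y) y1.
  rewrite (_ : y - (y - x) = x) in h2; last by ring.
  rewrite subr0 in h1; have := le_trans h2 h1.
  rewrite ler_pM2r ?subr_gt0//; lra.
- have h1 := U_chord (lexx 0) c0 (ltW cx) (le_trans xy y1).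
  have h2 := U_chord c0 (ltW cx) xy y1.
  rewrite subr0 in h1; have := le_trans h2 h1.
  rewrite ler_pM2r ?subr_gt0//; lra.
- have h1 := U_chord (lexx 0) x0 xy y1.
  by move: h1; rewrite -E subr0 ler_pM2r.
Qed.

Ltac drop_facts ::= clear - co prof sol kc kp fl zero01 e4 d01 lip t0 late U k0 p0 p4 pq
  Om_der Om_cont Om0 Omp U_incr Up0 Up16 Uhalf U_cont U_chord U_lip U0 U1 U_sub.

(** If [kappa t < k], the velocity exceeds [U] near time [t], and formally [int U c <= - 1] with
    [c = - dw/dx]. On [[0, p]], integrate by parts and use [U' >= 0] and [w >= q (1 - 2 q x)],
    [q = w 0 t]: the terms at 0 cancel, and besides [- U p * w p t] there remain nonnegative terms,
    among them [2 q^2 * Om p]. On [[p, 1 / 2]] one has [U >= U p], and [U >= 0] beyond. In total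
    [int U c >= - U p * w (1 / 2) t], which is too small a loss. *)
Lemma kappa_average : k <= kappa t.
Proof.
rewrite leNgt; apply/negP => kk.
have [e0 e00 he] := continuous_ltc (@kc t) kk.
have q1 := sol_ge1 sol t0; have pq' := pq; set q := w 0 t in pq' q1.
have q0 : 0 < q by move: q1; slra.
have psi00 : 0 < psi 0 := psi_gt0 co zero01.
pose kp0 := k * psi 0; have kp00 : 0 < kp0 by rewrite mulr_gt0.
(* Tolerance for the variation of [U] along trajectories during the time step; it costs
   [om * q = 1 / 4] in the rate. *)
pose om := 1 / (4 * q); have om0 : 0 < om by rewrite divr_gt0// mulr_gt0.
have omq : om * q = 1 / 4 by rewrite /om; field; rewrite gt_eqF.
have om4 : om <= 1 / 4 by rewrite -omq ler_peMr// ltW.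
have [de de0 hde] : exists2 de : R, 0 < de & forall c, 0 <= c <= de -> U c - U 0 <= om /\ c <= om.
  have om1 : U 0 < U 0 + om by rewrite ltrDl.
  have [de1 de10 h] := continuous_ltc (@U_cont 0) om1.
  exists (Num.min (de1 / 2) om); first by rewrite lt_min om0 divr_gt0.
  move=> c /andP[c0]; rewrite le_min => /andP[c1 c2]; split => //.
  have := h c; rewrite subr0 ger0_norm// => /(_ ltac:(move: c1 de10; slra)); slra.
pose C0 := 1 + kp0; have C00 : 0 < C0 by rewrite /C0; move: kp00; slra.
pose C1 := kp0 + om; have C10 : 0 < C1 by rewrite /C1; move: kp00 om0; slra.
(* The sum of all lower bounds required of [1 / tau]; [hK] then yields each of them separately. *)
pose K := 2 / e0 + C0 / de + C1 / p + 8 * q * C1 + 16 * (kp0 * q ^+ 2 * C1) + 4 * C1 + 4.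
have a1 : 0 < 2 / e0 by rewrite divr_gt0.
have a2 : 0 < C0 / de by rewrite divr_gt0.
have a3 : 0 < C1 / p by rewrite divr_gt0.
have a4 : 0 < 8 * q * C1 by rewrite mulr_gt0// mulr_gt0.
have a5 : 0 < 16 * (kp0 * q ^+ 2 * C1).
  by rewrite mulr_gt0// mulr_gt0// mulr_gt0// exprn_gt0.
have K0 : 0 < K by rewrite /K; move: a1 a2 a3 a4 a5 C10; slra.
have [tau tau0 hK] : exists2 tau : R, 0 < tau & forall A, A <= K -> A * tau <= 1.
  by exists K^-1; [rewrite invr_gt0|move=> A AK; rewrite ler_pdivrMr// mul1r].
have b1 : tau <= e0 / 2.
  have := hK (2 / e0) ltac:(rewrite /K; move: a2 a3 a4 a5 C10; slra).
  by rewrite mulrAC ler_pdivrMr//; slra.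
have b2 : C0 * tau <= de.
  have := hK (C0 / de) ltac:(rewrite /K; move: a1 a3 a4 a5 C10; slra).
  by rewrite mulrAC ler_pdivrMr// mul1r.
have b3 : C1 * tau <= p.
  have := hK (C1 / p) ltac:(rewrite /K; move: a1 a2 a4 a5 C10; slra).
  by rewrite mulrAC ler_pdivrMr// mul1r.
have b4 := hK (8 * q * C1) ltac:(rewrite /K; move: a1 a2 a3 a5 C10; slra).
have b5 := hK (16 * (kp0 * q ^+ 2 * C1)) ltac:(rewrite /K; move: a1 a2 a3 a4 C10; slra).
have b6 := hK (4 * C1) ltac:(rewrite /K; move: a1 a2 a3 a4 a5; slra).
have b7 := hK 4 ltac:(rewrite /K; move: a1 a2 a3 a4 a5 C10; slra).
clear hK; clearbody K; clear a1 a2 a3 a4 a5 K0.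
pose T := t + tau.
have T0 : 0 <= T by rewrite addr_ge0// ltW.
have tT : t < T by rewrite ltrDl.
have at_ : 0 <= t <= T by rewrite t0 ltW.
have Tt : T - t = tau by rewrite /T; ring.
have kle s : t <= s < T -> kappa s <= k.
  move=> /andP[ts sT]; apply/ltW/he; rewrite ger0_norm ?subr_ge0//.
  by move: sT b1 e00; rewrite /T; slra.
have velU s x : t <= s < T -> 0 <= x < 1 -> U x <= vel s x.
  move=> sT x01; rewrite /velocity /U lerD2l lerN2 ler_pM2r ?kle//.
  exact: (psi_gt0 co).
have psi_le0 x : 0 <= x < 1 -> psi x <= psi 0.
  by move=> /andP[x0 x1]; apply: (psi_ninc co (lexx 0) x0); exact: ltW.
have vel_le s x : t <= s < T -> 0 <= x < 1 -> `|vel s x| <= C0.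
  move=> sT x01; have x01' : 0 <= x <= 1 by case/andP: x01 => -> /ltW ->.
  have h1 := phi_ge0 co x01'; have h2 := phi_le co x01'.
  have h3 := psi_gt0 co x01; have h4 := velU s x sT x01.
  have h5 : k * psi x <= kp0 by rewrite ler_pM2l// psi_le0.
  have h6 : 0 < kappa s * psi x by rewrite mulr_gt0// kp.
  have h7 : be * (1 - x) <= 1.
    have bx : 0 <= be * x by rewrite mulr_ge0 ?(ltW (be_gt0 co))//; case/andP: x01.
    by have b1' := be_lt1 co; move: bx b1'; slra.
  rewrite ler_norml; apply/andP; split; move: h4; rewrite /velocity /U /C0;
    move: h1 h2 h5 h6 h7 kp00; slra.
have step x X : path T X -> X T = x -> X t <= x - tau * (U x - om).
  move=> pX XT; have x01 : 0 <= x < 1 by rewrite -XT; apply: (path_in pX); rewrite T0 lexx.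
  have /andP[x0 x1] := x01.
  have close s : t <= s <= T -> `|X s - x| <= C0 * tau.
    move=> /andP[ts sT]; have s0 := le_trans t0 ts.
    have ST : C0 * (T - s) <= C0 * tau.
      by rewrite ler_pM2l// -Tt lerD2l lerN2.
    have inn r : s < r < T -> 0 < r < T by move=> /andP[sr ->]; rewrite (le_lt_trans s0).
    have inn' r : s < r < T -> t <= r < T by move=> /andP[sr ->]; rewrite (le_trans ts) ?ltW.
    have inX r : s < r < T -> 0 <= X r < 1.
      by move=> h; apply: (path_in pX); case/andP: (inn r h) => /ltW -> /ltW ->.
    have cD (c r : R) : {for r, continuous (fun r => X r - c * r)}.
      apply: continuousB; first exact: path_cont pX.
      by apply: continuousM; [exact: cst_continuous|exact: cvg_id].
    have dD (c r : R) : s < r < T -> is_derive r 1 (fun r => X r - c * r) (vel r (X r) - c).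
      by move=> h; have ? := path_der pX (inn r h); apply: is_derive_eq; rewrite /GRing.scale/=; ring.
    have g1 := ge0_derive_le sT (fun r h => dD (- C0) r h) _ (fun r _ => cD (- C0) r).
    have {}g1 : X s - - C0 * s <= X T - - C0 * T.
      apply: g1 => r h; have := vel_le r _ (inn' r h) (inX r h).
      by rewrite ler_norml => /andP[+ _]; slra.
    have g2 := le0_derive_ge sT (fun r h => dD C0 r h) _ (fun r _ => cD C0 r).
    have {}g2 : X T - C0 * T <= X s - C0 * s.
      apply: g2 => r h; have := vel_le r _ (inn' r h) (inX r h).
      by rewrite ler_norml => /andP[_]; slra.
    rewrite ler_norml; move: g1 g2 ST; rewrite XT => g1 g2 ST.
    by apply/andP; split; move: g1 g2 ST; slra.
  have low s : t <= s < T -> U x - om <= vel s (X s).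
    move=> sT; have Xs : 0 <= X s < 1.
      by apply: (path_in pX); case/andP: sT => /(le_trans t0) -> /ltW ->.
    apply: le_trans (velU s _ sT Xs).
    have := close s; case/andP: (sT) => -> /ltW -> /(_ isT) cl.
    have {}cl := le_trans cl b2; have /andP[Xs0 Xs1] := Xs.
    have [Xx|xX] := leP (X s) x.
      rewrite distrC ger0_norm ?subr_ge0// in cl.
      have [] := hde (x - X s); first by rewrite cl subr_ge0 Xx.
      by have := U_sub Xs0 Xx (ltW x1); slra.
    rewrite ger0_norm ?subr_ge0 ?(ltW xX)// in cl.
    have [] := hde (X s - x); first by rewrite cl subr_ge0 ltW.
    by have := U_lip x0 (ltW xX) (ltW Xs1); slra.
  have cD r : {for r, continuous (fun r => X r - (U x - om) * r)}.
    apply: continuousB; first exact: path_cont pX.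
    by apply: continuousM; [exact: cst_continuous|exact: cvg_id].
  have dD r : t < r < T -> is_derive r 1 (fun r => X r - (U x - om) * r) (vel r (X r) - (U x - om)).
    move=> /andP[tr rT]; have ? : is_derive r 1 X (vel r (X r)).
      by apply: (path_der pX); rewrite (le_lt_trans t0 tr).
    by apply: is_derive_eq; rewrite /GRing.scale/=; ring.
  have := ge0_derive_le (ltW tT) dD _ (fun r _ => cD r).
  rewrite XT => g1; have {}g1 := g1 (fun r h => ltac:(rewrite subr_ge0; apply: low;
    case/andP: h => /ltW -> //)).
  by rewrite -Tt; move: g1; slra.
have wT x c : 0 <= x < 1 -> x - c < 1 -> (forall X, path T X -> X T = x -> X t <= x - c) ->
    expR tau * w (x - c) t <= w x T.
  move=> x01 c1 hX; have [X [pX XT _]] := fl x01 T0.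
  have -> : w x T = w (X T) T by rewrite XT.
  rewrite (sol_path co sol pX at_) Tt ler_pM2l ?expR_gt0//.
  have /andP[Xt0 _] := path_in pX at_.
  by apply: (sol_ninc sol t0 Xt0) => //; exact: hX.
have mT := sol_mass sol T0; have mt := sol_mass sol t0.
have p1 : p < 1 by move: p4; slra.
pose z x := x - tau * (U x - om).
have zlow x : 0 <= x < 1 -> 0 < z x.
  move=> x01; have [X [pX XT _]] := fl x01 T0.
  apply: lt_le_trans (step x X pX XT).
  by apply: (path_gt0 co kc kp pX); rewrite t0.
have zup x : 0 <= x <= p -> z x <= x + C1 * tau.
  move=> /andP[x0 xp]; have x01 : 0 <= x < 1 by rewrite x0 (le_lt_trans xp).
  have h1 : - kp0 <= U x.
    have x01' : 0 <= x <= 1 by rewrite x0 (le_trans xp (ltW p1)).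
    have := phi_ge0 co x01'; have : k * psi x <= kp0 by rewrite ler_pM2l// psi_le0.
    by rewrite /U; slra.
  rewrite /z /C1; have : tau * (- kp0) <= tau * U x by rewrite ler_pM2l.
  slra.
have zup2 x : 0 <= x <= p -> z x <= 2 * p.
  by move=> xp; apply: (le_trans (zup x xp)); case/andP: xp => _; move: b3; slra.
have zup1 x : 0 <= x <= p -> z x < 1.
  by move=> xp; apply: (le_lt_trans (zup2 x xp)); move: p4; slra.
(* The primitive of [U' * (1 - 2 q (x + C1 tau))]: the integration by parts made explicit. *)
pose G x := U x * (1 - 2 * q * (x + C1 * tau)) + 2 * q * Om x.
have pieceA : expR tau * (H t (z 0) - H t (z p) + tau * q * (G p - G 0)) <= H T 0 - H T p.
  pose f x := - H T x + expR tau * (H t (z x) - tau * q * G x).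
  pose dU x := phi1 x - k * psi1 x.
  pose df x := w x T + expR tau * (- w (z x) t * (1 - tau * dU x)
     - tau * q * (dU x * (1 - 2 * q * (x + C1 * tau)))).
  suff : f 0 <= f p by rewrite /f; slra.
  have sub1 x : 0 < x < p -> 0 < x < 1 by move=> /andP[-> xp]; rewrite (lt_trans xp).
  have sub2 x : 0 <= x <= p -> 0 <= x < 1 by move=> /andP[-> xp]; rewrite (le_lt_trans xp).
  have sub3 x : 0 < x < p -> 0 <= x <= p by move=> /andP[/ltW -> /ltW ->].
  have dUx x : 0 < x < p -> is_derive x 1 U (dU x).
    move=> /sub1 x01; have ? := phi_der co x01; have ? := psi_der co x01.
    by apply: is_derive_eq; rewrite /GRing.scale/= /dU; ring.
  apply: (@ge0_derive_le _ f df 0 p (ltW p0)).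
  - move=> x xp; have ? := dUx x xp; have ? := Om_der xp.
    have ? : is_derive x 1 (H T) (- w x T) := mass_der mT (sub1 x xp).
    have ? : is_derive x 1 z (1 - tau * dU x).
      by apply: is_derive_eq; rewrite /GRing.scale/=; ring.
    have ? : is_derive (z x) 1 (H t) (- w (z x) t).
      by apply: (mass_der mt); rewrite zlow ?sub2 ?sub3//= zup1 ?sub3.
    have ? := @is_derive1_comp R (H t) z x _ _ _ _.
    by apply: is_derive_eq; rewrite /GRing.scale/= /df; ring.
  - move=> x xp; have dU0 := U_incr xp; rewrite -/(dU x) in dU0.
    have zx2 := zup2 x (sub3 x xp); have zx := zup x (sub3 x xp).
    have zx0 := zlow x (sub2 x (sub3 x xp)).
    have zx01 : 0 <= z x < 1 by rewrite (ltW zx0) zup1 ?sub3.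
    have h1 : expR tau * w (z x) t <= w x T.
      by apply: wT; [exact/sub2/sub3|case/andP: zx01|move=> X; exact: step].
    have zq : z x * w 0 t <= 1 / 4.
      have : z x * q <= 2 * p * q by rewrite ler_pM2r.
      by rewrite -/q; move: pq'; slra.
    have h2 := profile_ge co prof sol e4 d01 lip t0 late zx01 zq; rewrite -/q in h2.
    have h3 : q * (1 - 2 * q * (x + C1 * tau)) <= w (z x) t.
      apply: le_trans h2; rewrite ler_pM2l//.
      have : z x * q <= (x + C1 * tau) * q by rewrite ler_pM2r.
      slra.
    have h4 : tau * dU x * (q * (1 - 2 * q * (x + C1 * tau))) <= tau * dU x * w (z x) t.
      by rewrite ler_wpM2l// mulr_ge0// ltW.
    have := ler_wpM2l (expR_ge0 tau) h4; rewrite /df; move: h1; slra.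
  - move=> x xp; have x01 := sub2 x xp.
    have zc : {for x, continuous z}.
      apply: continuousB; first exact: cvg_id.
      apply: continuousM; first exact: cst_continuous.
      by apply: continuousB; [exact: U_cont|exact: cst_continuous].
    apply: continuousD; first by apply: continuousN; exact: (mass_cont mT x01).
    apply: continuousM; first exact: cst_continuous.
    apply: continuousB.
      apply: continuous_comp => //; apply: (mass_cont mt).
      by rewrite (ltW (zlow x x01)) zup1.
    apply: continuousM; first exact: cst_continuous.
    apply: continuousD.
      apply: continuousM; first exact: U_cont.
      apply: continuousB; first exact: cst_continuous.
      apply: continuousM; first exact: cst_continuous.
      by apply: continuousD; [exact: cvg_id|exact: cst_continuous].
    by apply: continuousM; [exact: cst_continuous|exact: Om_cont].
(* On [[p, 1 / 2]] the displacement is replaced by its value at [p], the smallest one by concavity;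
   beyond 1 / 2 no displacement is used. *)
pose c := tau * (U p - om).
have half01 : 0 <= (1 / 2 : R) < 1 by apply/andP; split; slra.
have c4 : - (1 / 4) <= c <= 1 / 4.
  have : tau * U p <= tau * (1 / 16) by rewrite ler_pM2l.
  have : 0 <= tau * U p by rewrite mulr_ge0// ltW.
  have : tau * om <= tau * (1 / 4) by rewrite ler_pM2l.
  have : 0 <= tau * om by rewrite mulr_ge0// ltW.
  by move=> l1 l2 l3 l4; rewrite /c; apply/andP; split; move: b7 l1 l2 l3 l4; slra.
have Uge x : p <= x <= 1 / 2 -> U p <= U x.
  move=> /andP[px x2]; have x21 : (1 / 2 : R) <= 1 by slra.
  have := U_chord (ltW p0) px x2 x21; have : 0 <= x - p by rewrite subr_ge0.
  move: Uhalf; have : 0 <= 1 / 2 - x by rewrite subr_ge0.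
  have : 0 < 1 / 2 - p by move: p4; slra.
  by snra.
have zpc : z p = p - c by [].
have pieceB : expR tau * (H t (z p) - H t (1 / 2 - c)) <= H T p - H T (1 / 2).
  rewrite zpc; pose f x := - H T x + expR tau * H t (x - c).
  suff : f p <= f (1 / 2) by rewrite /f; slra.
  have pc0 : 0 < p - c by rewrite -zpc; apply: zlow; rewrite p1 ltW.
  have p2 : p <= 1 / 2 by move: p4; slra.
  have /andP[cl cu] := c4.
  have in1 x : p <= x <= 1 / 2 -> 0 < x - c < 1.
    by move=> /andP[px x2]; apply/andP; split; move: px x2 cl cu pc0; slra.
  have in2 x : p <= x <= 1 / 2 -> 0 < x < 1.
    by move=> /andP[px x2]; apply/andP; split; move: px x2 p0; slra.
  have sub x : p < x < 1 / 2 -> p <= x <= 1 / 2 by move=> /andP[/ltW -> /ltW ->].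
  apply: (@ge0_derive_le _ f (fun x => w x T - expR tau * w (x - c) t) p (1 / 2) p2).
  - move=> x /sub xp; have ? : is_derive x 1 (H T) (- w x T) := mass_der mT (in2 x xp).
    have ? : is_derive (x - c) 1 (H t) (- w (x - c) t) := mass_der mt (in1 x xp).
    have dxc : is_derive x 1 (fun x => x - c) 1.
      by apply: is_derive_eq; ring.
    have ? := @is_derive1_comp R (H t) (fun x => x - c) x _ _ _ dxc.
    by apply: is_derive_eq; rewrite /GRing.scale/=; ring.
  - move=> x /sub xp; rewrite subr_ge0; apply: wT.
    + by case/andP: (in2 x xp) => /ltW -> ->.
    + by case/andP: (in1 x xp).
    + move=> X pX XT; apply: (le_trans (step x X pX XT)).
      by rewrite lerD2l lerN2 /c ler_pM2l// lerD2r Uge.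
  - move=> x xp; have /andP[x0 x1] := in2 x xp; have /andP[xc0 xc1] := in1 x xp.
    apply: continuousD; first by apply: continuousN; apply: (mass_cont mT); rewrite (ltW x0).
    apply: continuousM; first exact: cst_continuous.
    apply: continuous_comp; last by apply: (mass_cont mt); rewrite (ltW xc0).
    by apply: continuousB; [exact: cvg_id|exact: cst_continuous].
have U0le x : p <= x < 1 -> 0 <= U x.
  move=> /andP[px x1]; have := U_chord (ltW p0) px (ltW x1) (lexx 1); rewrite U1.
  have : 0 <= x - p by rewrite subr_ge0.
  have : 0 < 1 - x by rewrite subr_gt0.
  by move: Up0; snra.
have pieceC : expR tau * H t (1 / 2) <= H T (1 / 2).
  have := @mass_compare_ge R _ _ _ _ (1 / 2) (expR tau) 0 1 mT mt half01 (expR_ge0 tau) ltr01.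
  rewrite !add0r mul1r divr1; apply => //.
  move=> x /andP[x2 x1]; rewrite add0r mul1r.
  have x01 : 0 <= x < 1 by rewrite x1; move: x2; slra.
  have := @wT x 0 x01; rewrite subr0; apply => // X pX XT.
  apply: (path_up co kp pX at_); [by case/andP: x01| |by rewrite XT].
  move=> s /andP[ts sT]; apply: le_trans (velU s x _ x01); last by rewrite (ltW ts).
  by apply: U0le; rewrite x1 andbT; move: x2 p4; slra.
have z0E : z 0 = tau * C1 by rewrite /z U0 /C1 /kp0; ring.
have z00 : 0 <= z 0 by apply/ltW/zlow.
have z01 : z 0 < 1 by apply: zup1; rewrite lexx ltW.
have /andP[_ r1] := sol_incr sol t0 (lexx 0) z00 z01.
rewrite (sol_H0 sol t0) subr0 -/q in r1.
have /andP[cl cu] := c4.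
have r2 : H t (1 / 2 - c) - H t (1 / 2) <= 4 * tau * U p.
  have u0 : 0 <= tau * U p by rewrite mulr_ge0// ltW.
  have c0' : c <= tau * U p.
    have : 0 <= tau * om by rewrite mulr_ge0// ltW.
    by rewrite /c; slra.
  have [cn|cp] := leP c 0.
    have l1 : (1 / 2 : R) <= 1 / 2 - c by move: cn; slra.
    have l2 : 1 / 2 - c < 1 by move: cl; slra.
    have /andP[h _] := sol_incr sol t0 (proj1 (andP half01)) l1 l2.
    have wc : 0 < w (1 / 2 - c) t.
      by apply: (sol_gt0 sol t0); rewrite l2; move: cn; slra.
    have : 0 <= (1 / 2 - c - 1 / 2) * w (1 / 2 - c) t.
      by rewrite mulr_ge0 ?(ltW wc)//; move: l1; slra.
    by move: h u0; slra.
  have l1 : 1 / 2 - c <= (1 / 2 : R) by move: cp; slra.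
  have l0 : 0 <= 1 / 2 - c by move: cu; slra.
  have l4 : (1 / 4 : R) <= 1 / 2 - c by move: cu; slra.
  have l2 : (1 / 2 : R) < 1 by case/andP: half01.
  have q4 : (0 : R) <= 1 / 4 by slra.
  have /andP[_ h] := sol_incr sol t0 l0 l1 l2.
  have w4 : w (1 / 4) t <= 4.
    have l5 : (1 / 4 : R) < 1 by slra.
    have /andP[h' _] := sol_incr sol t0 (lexx 0) q4 l5.
    have : 0 <= H t (1 / 4) by apply: (mass_ge0 mt); rewrite q4.
    by move: h'; rewrite (sol_H0 sol t0) subr0; slra.
  have wc : w (1 / 2 - c) t <= 4.
    by apply: le_trans w4; apply: (sol_ninc sol t0 q4 l4); apply: le_lt_trans l1 l2.
  have hc : c * w (1 / 2 - c) t <= c * 4 by rewrite ler_pM2l.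
  by move: h hc c0'; slra.
have sum : expR tau * (H t (z 0) + tau * q * (G p - G 0) - 4 * tau * U p) <= 1.
  have := ler_wpM2l (expR_ge0 tau) r2.
  by move: pieceA pieceB pieceC (sol_H0 sol T0); slra.
have g1 : U p / 2 + kp0 - 2 * (kp0 * q * C1 * tau) <= G p - G 0.
  have u1 : U p * (2 * q * (p + C1 * tau)) <= U p * (1 / 2).
    by rewrite ler_wpM2l//; move: pq' b4; slra.
  have u2 : 0 <= 2 * q * Om p by rewrite mulr_ge0// mulr_ge0// ltW.
  by rewrite /G U0 Om0 -/kp0; move: u1 u2; slra.
(* The rate 5 / 8 is 1 / 4 from [om], 1 / 4 from [U p <= 1 / 16], and 1 / 8 from the terms quadratic
   in [tau]; it stays below the growth rate 1. *)
have key : 1 - 5 / 8 * tau <= H t (z 0) + tau * q * (G p - G 0) - 4 * tau * U p.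
  have tq : 0 < tau * q by rewrite mulr_gt0.
  have v1 := ler_wpM2l (ltW tq) g1.
  have v2 : tau * U p <= tau * (1 / 16) by rewrite ler_pM2l.
  have v3 : 0 <= tau * q * U p by rewrite mulr_ge0// ltW.
  have v4 : tau * (16 * (kp0 * q ^+ 2 * C1) * tau) <= tau * 1 by rewrite ler_pM2l.
  have v5 : z 0 * q = tau * q * kp0 + tau * (1 / 4) by rewrite z0E /C1 -omq; ring.
  rewrite v5 in r1; rewrite expr2 in v4.
  by move: r1 v1 v2 v3 v4; slra.
have e1 : 1 + tau <= expR tau := expR_ge1Dx tau.
have pos : 0 < 1 - 5 / 8 * tau by move: b7; slra.
have : (1 + tau) * (1 - 5 / 8 * tau) <= 1.
  apply: le_trans sum; apply: ler_pM => //; [by move: tau0; slra|exact: ltW].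
have : tau * (4 * tau) <= tau * 1 by rewrite ler_pM2l.
by move: tau0; slra.
Qed.
End Average.

(** * Tangents of the coefficients; first exceedance of [w(0, t)]; the regular case *)

Section LowerBound.
Variable R : realType.
Implicit Types (x y z t s : R).

Lemma is_derive_quot (f : R -> R) x (l : R) : is_derive x 1 f l ->
  forall e : R, 0 < e -> exists2 d : R, 0 < d & forall y, `|y - x| < d -> y != x ->
     `|(f y - f x) / (y - x) - l| < e.
Proof.
move=> [df <-] e e0; move: df; rewrite /derivable => /cvgrPdist_lt/(_ e e0).
move=> /nbhs_ballP[d /= d0 hd]; exists d => // y yx yx0.
have := hd (y - x); rewrite /ball /= sub0r normrN => /(_ yx).
rewrite subr_eq0 => /(_ yx0); rewrite distrC /GRing.scale/= mulr1 subrK mulrC.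
by rewrite /derive /GRing.scale/=; under [X in lim (X @ _)]eq_fun do rewrite mulr1.
Qed.

Section Coefs.
Variables (phi psi phi1 psi1 dW : R -> R) (al be : R).
Hypothesis co : coefs phi psi phi1 psi1 dW al be.
Local Notation W := (wronskian phi psi phi1 psi1).
Local Notation conv_at := (conv_at phi psi phi1 psi1).

Lemma concave_tangent_right (f : R -> R) x y (l : R) :
  (forall x y z, 0 <= x -> x <= y -> y <= z -> z <= 1 ->
    (f z - f y) * (y - x) <= (f y - f x) * (z - y)) ->
  is_derive x 1 f l -> 0 <= x -> x < y -> y <= 1 -> f y - f x <= l * (y - x).
Proof.
move=> ch fd x0 xy y1; have yx0 : 0 < y - x by rewrite subr_gt0.
rewrite leNgt; apply/negP => lt.
pose e := (f y - f x) / (y - x) - l.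
have e0 : 0 < e by rewrite subr_gt0 ltr_pdivlMr.
have [d d0 hd] := is_derive_quot fd e0.
pose z := Num.min y (x + d / 2).
have xz : x < z by rewrite /z lt_min xy/= ltrDl divr_gt0.
have zy : z <= y by rewrite /z ge_min lexx.
have zd : z <= x + d / 2 by rewrite /z ge_min lexx orbT.
have := hd z; rewrite gtr0_norm ?subr_gt0// => /(_ ltac:(lra)).
rewrite gt_eqF// => /(_ isT); rewrite ltr_norml => /andP[_].
rewrite /e ltrD2r ltr_pdivrMr ?subr_gt0// mulrAC ltr_pdivlMr//.
have := ch x z y x0 (ltW xz) zy y1; lra.
Qed.

Lemma concave_tangent (f : R -> R) x y (l : R) :
  (forall x y z, 0 <= x -> x <= y -> y <= z -> z <= 1 ->
    (f z - f y) * (y - x) <= (f y - f x) * (z - y)) ->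
  is_derive x 1 f l -> 0 <= x <= 1 -> 0 <= y <= 1 -> f y - f x <= l * (y - x).
Proof.
move=> ch fd /andP[x0 x1] /andP[y0 y1].
have [xy|yx|->] := ltgtP x y; last by rewrite !subrr mulr0.
  exact: concave_tangent_right.
have := @concave_tangent_right (fun z => f (1 - z)) (1 - x) (1 - y) (- l).
rewrite !subKr; have -> : - l * (1 - y - (1 - x)) = l * (y - x) by ring.
apply; [| |lra|lra|lra].
- move=> a b c a0 ab bc c1.
  have := ch (1 - c) (1 - b) (1 - a); lra.
- have fd' : is_derive (1 - x) 1 (fun z => 1 - z) (- 1).
    by apply: is_derive_eq; ring.
  have fd2 : is_derive (1 - (1 - x)) 1 f l by rewrite subKr.
  have ? := @is_derive1_comp R f (fun z => 1 - z) (1 - x) _ _ fd2 fd'.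
  by apply: is_derive_eq; ring.
Qed.

Lemma phi_tangent x y : 0 < x < 1 -> 0 <= y <= 1 -> phi y - phi x <= phi1 x * (y - x).
Proof.
move=> x01; apply: concave_tangent (phi_chord co) (phi_der co x01) _.
by case/andP: x01 => /ltW -> /ltW ->.
Qed.

Lemma psi_tangent x y : 0 < x < 1 -> 0 <= y <= 1 -> psi1 x * (y - x) <= psi y - psi x.
Proof.
move=> x01 y01.
have ? := psi_der co x01; have dN : is_derive x 1 (fun z => - psi z) (- psi1 x).
  exact: is_deriveN.
have := @concave_tangent (fun z => - psi z) x y (- psi1 x) _ dN _ y01.
move=> h; suff : - psi y - - psi x <= - psi1 x * (y - x) by lra.
apply: h; last by case/andP: x01 => /ltW -> /ltW ->.
by move=> a b c a0 ab bc c1; have := psi_chord co a0 ab bc c1; lra.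
Qed.

Lemma psi1_le0 x : 0 < x < 1 -> psi1 x <= 0.
Proof.
move=> x01; have /andP[x0 x1] := x01.
have := @psi_tangent x 1 x01; rewrite ler01 lexx (psi_at1 co) => /(_ isT).
have := psi_gt0 co (introT andP (conj (ltW x0) x1)).
have x1' : 0 < 1 - x by rewrite subr_gt0.
by move=> p h; rewrite -(pmulr_lle0 _ x1'); lra.
Qed.

(** The derivative of [Gam B] has the sign of [B W + W' psi - W psi'], where [psi' <= 0]. *)
Lemma conv_atP (B xd : R) : 0 < B ->
  (forall x, 0 < x -> xd <= x -> x < 1 -> - dW x * psi x <= B * W x) -> conv_at B xd.
Proof.
move=> B0 h x y x0 xdx xy y1.
have i z : x <= z <= y -> 0 < z < 1.
  by move=> /andP[xz zy]; rewrite (lt_le_trans x0 xz) (le_lt_trans zy).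
have sub z : x < z < y -> x <= z <= y by move=> /andP[/ltW -> /ltW ->].
have pz z : x <= z <= y -> 0 < psi z.
  by move=> /i /andP[z0 z1]; apply: (psi_gt0 co); rewrite (ltW z0).
pose dG z := (B * W z + dW z * psi z - W z * psi1 z) / (B * psi z ^+ 2).
have dGd z : x <= z <= y -> is_derive z 1 (Gam phi psi phi1 psi1 B) (dG z).
  move=> zxy; have z01 := i z zxy; have p := pz z zxy.
  have ? := g_der co z01; have ? : is_derive z 1 W (dW z) := W_der co z01.
  have ? := psi_der co z01.
  have dB : is_derive z 1 (fun u => B * psi u) (B * psi1 z).
    by apply: is_derive_eq; rewrite /GRing.scale/=; ring.
  have ? : is_derive z 1 (fun u => W u / (B * psi u))
     ((dW z * (B * psi z) - W z * (B * psi1 z)) / (B * psi z) ^+ 2).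
    by apply: is_derive_div => //; rewrite mulf_neq0// gt_eqF.
  apply: is_derive_eq; rewrite /dG; field.
  by rewrite !gt_eqF.
apply: (ge0_derive_le xy (fun z hz => dGd z (sub z hz))) => [z /sub zxy|z zxy].
  have z01 := i z zxy; have p := pz z zxy; have Wz := W_gt0 co z01.
  rewrite /dG; apply: divr_ge0; last by rewrite mulr_ge0 ?(ltW B0)// exprn_ge0// ltW.
  have := mulr_ge0_le0 (ltW Wz) (psi1_le0 z01).
  case/andP: z01 => z0 z1; case/andP: zxy => xz zy.
  have := h z z0 (le_trans xdx xz) z1; rewrite /wronskian; lra.
exact: is_derive_continuous (dGd z zxy).
Qed.
End Coefs.

Section Bound.
Variables (phi psi phi1 psi1 dW : R -> R) (al be : R).
Hypothesis co : coefs phi psi phi1 psi1 dW al be.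
Variables (w0 h0 : R -> R).
Hypothesis prof : profile w0 h0.
Variable Psi : R -> R.
Hypothesis PsiP : forall x, 0 <= x < 1 -> is_derive x 1 Psi (psi x)^-1.
Local Notation L := (life w0 h0).
Local Notation Ec := (Ec Psi).
Local Notation g := (coef_ratio phi psi).
Local Notation W := (wronskian phi psi phi1 psi1).
Local Notation conv_at := (conv_at phi psi phi1 psi1).

Let zero01 : 0 <= (0 : R) < 1.
Proof. by rewrite lexx ltr01. Qed.

Section OneSolution.
Variables (kappa : R -> R) (F w H : R -> R -> R).
Hypothesis sol : solution phi psi w0 kappa F w H.
Local Notation vel := (velocity phi psi kappa).

Lemma sol_initial x : 0 <= x < 1 -> w x 0 = w0 x.
Proof.
move=> x01; rewrite (sol_w sol x01 (lexx 0)) expR0 mul1r.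
by have [X [_ X0 ->]] := sol_flow sol x01 (lexx 0); rewrite X0.
Qed.

(** [phi - g xh * psi] is concave and vanishes at [xh] with slope [W xh / psi xh]; its tangent there
    is the affine bound of [kappa_upper] for [k = g xh] and [c = xh]. *)
Lemma vel_ge0_of_large xh s : 0 < xh < 1 -> 0 <= s ->
  1 + W xh / psi xh < W xh / psi xh * xh * w 0 s -> 0 <= vel s xh.
Proof.
move=> xh01 s0 ws; have /andP[xh0 xh1] := xh01.
have pxh : 0 < psi xh by apply: (psi_gt0 co); rewrite (ltW xh0).
have sl0 : 0 < W xh / psi xh by rewrite divr_gt0// (W_gt0 co).
have := @kappa_upper _ _ _ _ _ _ _ _ co w0 _ _ _ _ sol s (g xh) (W xh / psi xh) xh s0 sl0.
rewrite xh0 (ltW xh1) => /(_ isT) ku.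
suff : kappa s <= g xh.
  by rewrite /velocity /coef_ratio ler_pdivlMr// subr_ge0.
apply: ku ws => x /andP[x0 x1].
have x01 : 0 <= x <= 1 by rewrite x0 ltW.
have h1 := phi_tangent co xh01 x01; have h2 := psi_tangent co xh01 x01.
have g0 : 0 <= g xh by rewrite divr_ge0 ?(ltW pxh)// (phi_ge0 co)// !ltW.
have h3 := ler_wpM2l g0 h2.
have E : W xh / psi xh = phi1 xh - g xh * psi1 xh.
  by rewrite /wronskian /coef_ratio; field; rewrite gt_eqF.
have E2 : g xh * psi xh = phi xh by rewrite /coef_ratio mulfVK// gt_eqF.
by rewrite E; lra.
Qed.

Ltac drop_facts ::= clear - co prof PsiP zero01 sol.

(** A time [t'] is taken just after the infimum of the times where [1 / mu] is exceeded. Up to [t']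
    the value is at most [2 / mu], which is what [no_concentration] asks of the past and what yields
    [vel s xd <= 0]. The bound at [T0 + la] puts the whole window after [T0]. *)
Lemma sol_bound (e d la mu xd xh B T0 : R) :
  0 < e -> e <= 1 / 4 -> 0 < d < 1 ->
  (forall x y, 1 - d <= x -> x <= y -> y < 1 -> `|L y - L x| <= e * (y - x)) ->
  0 < la -> 0 < mu -> 0 <= xd -> 0 < B -> conv_at B xd ->
  e * expR la <= 1 / 8 -> 16 * xd * expR la <= mu -> 4 * mu <= xh -> 2 * xh < 1 ->
  960 * (psi 0 / psi (2 * xh)) * (Ec B (2 * xh) / psi (2 * xh) / (Ec B xd / psi xd)) <=
    expR (W xh / psi 0 * la) ->
  0 <= T0 -> 2 < expR T0 * w0 (1 - d / 2) -> expR (T0 + la) * w0 0 <= 1 / mu ->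
  (1 + W xh / psi xh) * mu < W xh / psi xh * xh * expR (- la) ->
  (forall s, 0 <= s -> w 0 s <= 2 / mu -> vel s xd <= 0) ->
  forall t, 0 <= t -> w 0 t <= 1 / mu.
Proof.
move=> e0 e4 d01 lip la0 mu0 xd0 B0 cB ela xdla muh h1 small T00 hT0 hw0 hs hA t t0.
rewrite leNgt; apply/negP => wt.
have w00 : 0 < w0 0 by apply: (mass_gt0 (profile_mass prof)).
have w0T : w 0 0 <= 1 / mu.
  rewrite sol_initial//; apply: le_trans hw0; rewrite ler_peMl ?(ltW w00)//.
  by rewrite -expR0 ler_expR addr_ge0// ltW.
pose A := [set s : R | 0 <= s /\ 1 / mu < w 0 s].
have At : A t by [].
have Ainf : has_inf A by split; [exists t|exists 0 => s []].
have i0 : 0 <= inf A by apply: lb_le_inf; [exists t|move=> s []].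
have below s : 0 <= s -> s < inf A -> w 0 s <= 1 / mu.
  move=> s0 si; rewrite leNgt; apply/negP => ws.
  by have := ge_inf Ainf.2 (conj s0 ws : A s); rewrite leNgt si.
(* Values are known only before the infimum; from 1 / 10 before it to 1 / 10 after it the growth is
   at most [exp (1 / 5) <= 2]. *)
have [t' [t'0 wt'] t'i] := @inf_adherent R A (1 / 10) ltac:(slra) Ainf.
pose s' := Num.max 0 (inf A - 1 / 10).
have s'0 : 0 <= s' by rewrite /s' le_max lexx.
have ws' : w 0 s' <= 1 / mu.
  rewrite /s'; have [h|h] := leP 0 (inf A - 1 / 10) => //.
  by apply: below => //; slra.
have s'i : inf A - 1 / 10 <= s' by rewrite /s' le_max lexx orbT.
have all s : 0 <= s <= t' -> w 0 s <= 2 / mu.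
  move=> /andP[s0 st']; have mu1 : 0 < 1 / mu by rewrite divr_gt0.
  have E : 2 / mu = 2 * (1 / mu) by rewrite mulrA mulr1.
  have [ss'|s's] := leP s s'.
    have [si|is_] := ltP s (inf A); first by have := below s s0 si; rewrite E; move: mu1; slra.
    have es : s' = 0.
      move: ss'; rewrite /s'; have [//|h] := leP 0 (inf A - 1 / 10).
        by move=> _ ss'; exfalso; move: is_ ss'; slra.
      by [].
    have : s = 0 by apply/eqP; rewrite eq_le s0 andbT -es.
    by move=> ->; rewrite E; move: w0T mu1; slra.
  have gr := sol_growth co sol s'0 (ltW s's).
  have e2 : expR (s - s') <= 2.
    have : expR (- (s - s')) * expR (s - s') = 1 by rewrite -expRD addNr expR0.
    have := expR_ge1Dx (- (s - s')); have := expR_gt0 (s - s').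
    set E1 := expR _; set E2 := expR _.
    have d5 : s - s' <= 1 / 5 by move: t'i s'i st'; slra.
    by move: d5; snra.
  rewrite E; apply: (le_trans gr); apply: ler_pM; rewrite ?expR_ge0//.
  by have := sol_ge1 sol s'0; slra.
have T0t' : T0 + la <= t'.
  rewrite leNgt; apply/negP => tl.
  have gr := sol_growth co sol (lexx 0) t'0.
  rewrite subr0 sol_initial// in gr.
  have : expR t' * w0 0 <= expR (T0 + la) * w0 0 by rewrite ler_pM2r// ler_expR ltW.
  move: hw0 wt' gr; slra.
have lat : la <= t' by move: T00 T0t'; slra.
have := @no_concentration _ _ _ _ _ _ _ _ co w0 h0 prof kappa F w H sol Psi PsiP
  e d la mu xd xh B t' e0 e4 d01 lip la0 mu0 xd0 B0 cB ela xdla muh h1 small lat.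
move=> nc; have wt'' := wt'; move: wt''; apply/negP; rewrite -leNgt; apply: nc.
- move=> s /andP[s1 s2]; have s0 : 0 <= s by move: lat s1; slra.
  apply: (flow_late co prof sol d01 s0); apply: (lt_le_trans hT0).
  have wd : 0 < w0 (1 - d / 2).
    by apply: (mass_gt0 (profile_mass prof)); case/andP: d01 => dl dr; apply/andP; split; move: dl dr; slra.
  by rewrite ler_pM2r// ler_expR; move: T0t' s1; slra.
- move=> s /andP[s0 st]; apply: hA; first exact: ltW.
  by apply: all; rewrite !ltW.
- move=> s /andP[s1 s2]; have s0 : 0 <= s by move: lat s1; slra.
  have xh0 : 0 < xh by move: mu0 muh; slra.
  apply: vel_ge0_of_large => //; first by rewrite xh0; move: h1; slra.
  have gr := sol_growth co sol s0 (ltW s2).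
  have ew : expR (- la) <= mu * w 0 s.
    have : expR (- la) * (mu * w 0 t') <= expR (- la) * (mu * (expR (t' - s) * w 0 s)).
      by rewrite ler_pM2l ?expR_gt0// ler_pM2l.
    have : 1 < mu * w 0 t' by move: wt'; rewrite ltr_pdivrMr// mulrC.
    have : expR (- la) * expR (t' - s) <= 1.
      by rewrite -expRD -expR0 ler_expR; move: s1; slra.
    have ws0 := sol_gt0 sol s0 zero01.
    have mw : 0 < mu * w 0 s by rewrite mulr_gt0.
    move=> a1 a2 a3.
    have a4 : expR (- la) * expR (t' - s) * (mu * w 0 s) <= 1 * (mu * w 0 s) by rewrite ler_pM2r.
    have a5 : expR (- la) * 1 <= expR (- la) * (mu * w 0 t') by rewrite ler_pM2l ?expR_gt0// ltW.
    move: a3 a4 a5; slra.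
  have sl0 : 0 < W xh / psi xh.
    rewrite divr_gt0 ?(W_gt0 co) ?(psi_gt0 co)//; apply/andP; split; move: xh0 h1; slra.
  have : W xh / psi xh * xh * expR (- la) <= W xh / psi xh * xh * (mu * w 0 s).
    by rewrite ler_pM2l// mulr_gt0.
  move=> a1; rewrite -(ltr_pM2r mu0).
  set S := W xh / psi xh in hs a1 *; move: hs a1; slra.
- by apply: all; apply/andP; split; move: lat la0; slra.
Qed.
End OneSolution.

Lemma profile_late d : 0 < d < 1 -> exists2 T0 : R, 0 <= T0 & 2 < expR T0 * w0 (1 - d / 2).
Proof.
move=> /andP[d0 d1]; have wd : 0 < w0 (1 - d / 2).
  by apply: (mass_gt0 (profile_mass prof)); apply/andP; split; lra.
exists (2 / w0 (1 - d / 2)); first by rewrite divr_ge0// ltW.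
have := expR_ge1Dx (2 / w0 (1 - d / 2)); rewrite -(ler_pM2r wd) mulrDl mulfVK ?gt_eqF//; lra.
Qed.
End Bound.

Section BoundB.
Variables (phi psi phi1 psi1 dW : R -> R) (al be : R).
Hypothesis co : coefs phi psi phi1 psi1 dW al be.
Variables (w0 h0 : R -> R).
Hypothesis prof : profile w0 h0.

Let zero01 : 0 <= (0 : R) < 1.
Proof. by rewrite lexx ltr01. Qed.

Ltac drop_facts ::= clear - co prof zero01.

(** The barrier is [xd = 0], where the velocity is always negative, and [xh = 1 / 4] is fixed, so
    the distortion is a constant [C]. The window [la = C / k] ensures [exp (k * la) >= C]; then [e],
    [d], [T0] and finally [mu] are chosen in terms of [la]. *)
Lemma sol_bound_regular (B : R) : 0 < B -> conv_at phi psi phi1 psi1 B 0 ->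
  exists2 mu : R, 0 < mu & forall kappa F w H, solution phi psi w0 kappa F w H ->
    forall t, 0 <= t -> w 0 t <= 1 / mu.
Proof.
move=> B0 cB; have [Psi PsiP] := Psi_exists co.
pose xh : R := 1 / 4.
have xh01 : 0 < xh < 1 by rewrite /xh; apply/andP; split; lra.
have xh2 : 2 * xh < 1 by rewrite /xh; lra.
have psi00 : 0 < psi 0 := psi_gt0 co zero01.
have psih : 0 < psi xh by apply: (psi_gt0 co); case/andP: xh01 => /ltW -> ->.
have psi2h : 0 < psi (2 * xh).
  by apply: (psi_gt0 co); rewrite xh2 mulr_ge0//; case/andP: xh01 => /ltW.
have Wh : 0 < wronskian phi psi phi1 psi1 xh := W_gt0 co xh01.
pose k := wronskian phi psi phi1 psi1 xh / psi 0; have k0 : 0 < k by rewrite divr_gt0.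
pose C := 960 * (psi 0 / psi (2 * xh)) *
  (Ec Psi B (2 * xh) / psi (2 * xh) / (Ec Psi B 0 / psi 0)).
have C0 : 0 < C.
  apply: mulr_gt0; last by rewrite divr_gt0// divr_gt0// Ec_gt0.
  by apply: mulr_gt0; rewrite ?ltr0n// divr_gt0.
pose la := C / k; have la0 : 0 < la by rewrite divr_gt0.
have Cla : C <= expR (k * la).
  have := expR_ge1Dx (k * la); have -> : k * la = C by rewrite /la; field; rewrite gt_eqF.
  lra.
pose e := expR (- la) / 8.
have e0 : 0 < e by rewrite divr_gt0 ?expR_gt0.
have e1 : expR (- la) <= 1 by rewrite -expR0 ler_expR; lra.
have [d d01 lip] := profile_lip prof e0.
have [T0 T00 hT0] := profile_late prof d01.
have w00 : 0 < w0 0 by apply: (mass_gt0 (profile_mass prof)).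
pose S := wronskian phi psi phi1 psi1 xh / psi xh; have S0 : 0 < S by rewrite divr_gt0.
pose N := 16 + expR (T0 + la) * w0 0 + 2 * (1 + S) / (S * xh * expR (- la)).
have xh0 : 0 < xh by case/andP: xh01.
have ex0 : 0 < S * xh * expR (- la) by rewrite mulr_gt0 ?expR_gt0// mulr_gt0.
have n1 : 0 < expR (T0 + la) * w0 0 by rewrite mulr_gt0 ?expR_gt0.
have n2 : 0 < 2 * (1 + S) / (S * xh * expR (- la)) by rewrite divr_gt0// mulr_gt0//; move: S0; slra.
have N0 : 0 < N by rewrite /N; move: n1 n2; slra.
exists N^-1; first by rewrite invr_gt0.
move=> kappa F w H sol; apply: (sol_bound (e := e) (d := d) (la := la) (xd := 0) (xh := xh) (B := B) (T0 := T0) co prof PsiP sol) => //.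
- by rewrite /e; move: e1; slra.
- by rewrite invr_gt0.
- by rewrite /e mulrAC -expRD addNr expR0; slra.
- by rewrite mulr0 mul0r invr_ge0 ltW.
- rewrite /xh -[X in X <= _]mulrC ler_pdivrMl//; rewrite /N; move: n1 n2; slra.
- by rewrite div1r invrK /N; move: n2; slra.
- rewrite -/S ltr_pdivrMr// mulrC -ltr_pdivrMr//.
  by rewrite /N; move: n1 n2; rewrite -mulrA; set Q := (1 + S) / _; slra.
- by move=> s s0 _; apply/ltW/(vel0 co (sol_kgt0 sol)).
Qed.
End BoundB.
End LowerBound.

(** * The singular case: record scales of [x W(x)] *)

Section Singular.
Variables (R : realType) (phi psi phi1 psi1 dW : R -> R) (al be : R).
Hypothesis co : coefs phi psi phi1 psi1 dW al be.
Implicit Types (x y s t : R).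
Local Notation g := (coef_ratio phi psi).
Local Notation W := (wronskian phi psi phi1 psi1).

Let zero01 : 0 <= (0 : R) < 1.
Proof. by rewrite lexx ltr01. Qed.

Let psi00 : 0 < psi 0. Proof. exact: (psi_gt0 co zero01). Qed.

Ltac drop_facts ::= clear - co zero01 psi00.

(** [phi1 x >= (phi y - phi x) / (y - x)] is large when [y] is fixed with [phi y / y] large and [x]
    is near 0; the other term [- phi psi1] of [W] is nonnegative. *)
Lemma W_infty K : (forall M, exists2 r, 0 < r & forall x, 0 < x < r -> M * x <= phi x) ->
  exists2 xb, 0 < xb < 1 & forall x, 0 < x <= xb -> K <= W x.
Proof.
move=> phiM; pose M := 2 * `|K| / psi 0.
have M0 : 0 <= M by rewrite divr_ge0 ?mulr_ge0// ltW.
have [r r0 hr] := phiM (2 * M + 1).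
pose y := Num.min (r / 2) (1 / 2).
have y0 : 0 < y by rewrite /y lt_min !divr_gt0.
have yr : y < r.
  by apply: (@le_lt_trans _ _ (r / 2)); [rewrite /y ge_min lexx|rewrite ltr_pdivrMr//; lra].
have y2 : y <= 1 / 2 by rewrite /y ge_min lexx orbT.
have phy : (2 * M + 1) * y <= phi y by apply: hr; rewrite y0.
have py0 : 0 < phi y / 2.
  by rewrite divr_gt0//; apply: lt_le_trans phy; rewrite mulr_gt0//; move: M0; lra.
have [d1 d10 h1] : exists2 d, 0 < d & forall x, `|x - 0| < d -> phi x < phi y / 2.
  have [|d d0 hd] := continuous_ltc (phi_cont co (x := 0)) (c := phi y / 2).
    by rewrite (phi_at0 co).
  by exists d => // x /hd.
have [d2 d20 h2] : exists2 d, 0 < d & forall x, `|x - 0| < d -> psi 0 / 2 < psi x.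
  have [|d d0 hd] := continuous_gtc (psi_cont co (x := 0)) (c := psi 0 / 2).
    by move: psi00; lra.
  by exists d => // x /hd.
pose xb := Num.min (d1 / 2) (Num.min (d2 / 2) (y / 2)).
have xb0 : 0 < xb by rewrite /xb !lt_min !divr_gt0.
have : xb <= xb := lexx _; rewrite {2}/xb !le_min => /and3P[b1 b2 b3].
exists xb => [|x /andP[x0 xxb]]; first by rewrite xb0/=; lra.
have x01 : 0 < x < 1 by rewrite x0; lra.
have y01 : 0 <= y <= 1 by rewrite ltW//; lra.
have /h1 p1 : `|x - 0| < d1 by rewrite subr0 gtr0_norm//; lra.
have /h2 p2 : `|x - 0| < d2 by rewrite subr0 gtr0_norm//; lra.
have t1 := phi_tangent co x01 y01.
have t2 := psi1_le0 co x01.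
have x01' : 0 <= x <= 1 by rewrite ltW//; lra.
have p3 := phi_ge0 co x01'.
have MW : M <= phi1 x.
  have yx : 0 < y - x by move: b3 x0 xxb; slra.
  rewrite -(ler_pM2r yx); apply: le_trans t1; have : 0 <= M * x by rewrite mulr_ge0// ltW.
  by move: phy p1; lra.
have : - (phi x * psi1 x) >= 0 by rewrite oppr_ge0 mulr_ge0_le0.
have : M * (psi 0 / 2) <= phi1 x * psi x.
  by apply: ler_pM => //; [rewrite divr_ge0 ?ltW|exact: ltW].
have -> : M * (psi 0 / 2) = `|K| by rewrite /M; field; rewrite gt_eqF.
have := ler_norm K; rewrite /wronskian; slra.
Qed.

Lemma xW_le x : 0 < x < 1 -> x * W x <= 2 * psi 0.
Proof.
move=> x01; have /andP[x0 x1] := x01.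
have c0 : 0 <= (0 : R) <= 1 by rewrite lexx ler01.
have t1 := phi_tangent co x01 c0; rewrite (phi_at0 co) in t1.
have t2 := psi_tangent co x01 c0.
have x01' : 0 <= x <= 1 by rewrite !ltW.
have p1 := phi_ge0 co x01'; have p2 := psi_gt0 co (introT andP (conj (ltW x0) x1)).
have p3 := psi_ninc co (lexx 0) (ltW x0) (ltW x1).
have p4 := phi_le co x01'; have b1 := be_lt1 co; have b0 := be_gt0 co.
have p5 : phi x <= 1.
  have : 0 <= be * x by rewrite mulr_ge0// ltW.
  by move: p4 b1; lra.
have a1 : (x * phi1 x) * psi x <= phi x * psi x by rewrite ler_pM2r//; move: t1; lra.
have a2 : phi x * (- (x * psi1 x)) <= phi x * psi 0 by rewrite ler_wpM2l//; move: t2 p2; lra.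
have a3 : phi x * psi x <= 1 * psi 0 by apply: ler_pM => //; exact: ltW.
have a4 : phi x * psi 0 <= 1 * psi 0 by rewrite ler_pM2r.
by rewrite /wronskian; move: a1 a2 a3 a4; lra.
Qed.

(** The supremum of [x W(x)] need not be attained, whence the factor 2. The record bounds [W x] by
    [2 (xh / x) W xh] at all smaller [x], so estimates below the scale [xh] remain proportional to
    [W xh]. *)
Lemma record_scale eta : 0 < eta < 1 ->
  exists2 xh, 0 < xh <= eta & forall x, 0 < x <= eta -> x * W x <= 2 * (xh * W xh).
Proof.
move=> /andP[eta0 eta1]; pose A := [set v | exists2 x, 0 < x <= eta & v = x * W x].
have i01 x : 0 < x <= eta -> 0 < x < 1 by move=> /andP[-> /le_lt_trans]; exact.
have pos x : 0 < x <= eta -> 0 < x * W x.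
  by move=> h; rewrite mulr_gt0 ?(W_gt0 co (i01 _ h))//; case/andP: h.
have ee : 0 < eta <= eta by rewrite eta0 lexx.
have hs : has_sup A.
  split; first by exists (eta * W eta), eta.
  by exists (2 * psi 0) => v [x hx ->]; exact: (xW_le (i01 _ hx)).
have s0 : 0 < sup A.
  by apply: (lt_le_trans (pos _ ee)); apply: (ub_le_sup hs.2); exists eta.
have [v [xh hxh ->] hv] := @sup_adherent R A (sup A / 2) ltac:(by rewrite divr_gt0) hs.
exists xh => // x hx; have : x * W x <= sup A by apply: (ub_le_sup hs.2); exists x.
lra.
Qed.

(** For [xd <= x <= xb], [dW_half] gives [- dW x <= 4 / xd * W (xd / 2) <= 16 * S / xd ^+ 2], to be
    compared with [W >= K]. Beyond [xb] the constant [Bb] serves. *)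
Lemma record_conv_at K Bb xb xd S : 0 < K -> 0 < Bb -> 0 < xd < 1 -> 0 <= S ->
  xd / 2 * W (xd / 2) <= 2 * S ->
  (forall x, 0 < x <= xb -> K <= W x) ->
  (forall x, xb <= x < 1 -> - dW x * psi x <= Bb * W x) ->
  conv_at phi psi phi1 psi1 (16 * S * psi 0 / (xd ^+ 2 * K) + Bb) xd.
Proof.
move=> K0 Bb0 /andP[xd0 xd1] S0 hS hK hB; set B1 := _ / _.
have B10 : 0 <= B1.
  by apply: divr_ge0; rewrite !mulr_ge0// ?exprn_ge0 ?ltW.
apply: (conv_atP co) => [|x x0 xdx x1]; first by rewrite ltr_wpDl.
have x01 : 0 < x < 1 by rewrite x0.
have Wx : 0 < W x := W_gt0 co x01.
have [xxb|xbx] := leP x xb; last first.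
  apply: le_trans (hB x _) _; first by rewrite ltW.
  by rewrite ler_pM2r// lerDr.
have hd := dW_half co x01; rewrite -/(W (x / 2)) in hd.
have d0 : 0 <= - dW x by rewrite oppr_ge0 (dW_le0 co).
have pp : psi x <= psi 0 by apply: (psi_ninc co) => //; exact: ltW.
have W2 : W (x / 2) <= W (xd / 2).
  by apply: (W_ninc co); [rewrite divr_gt0|rewrite ler_pM2r//|lra].
have W20 : 0 < W (xd / 2) by apply: (W_gt0 co); rewrite divr_gt0//=; lra.
have i : 4 / x <= 4 / xd by rewrite ler_pM2l// lef_pV2// posrE.
have a1 : - dW x <= 4 / xd * W (xd / 2).
  apply: (le_trans hd); apply: ler_pM => //; first by rewrite divr_ge0// ltW.
  by apply: ltW; apply: (W_gt0 co); rewrite divr_gt0//=; lra.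
have a2 : 4 / xd * W (xd / 2) <= 16 * S / xd ^+ 2.
  have -> : 4 / xd * W (xd / 2) = 8 / xd ^+ 2 * (xd / 2 * W (xd / 2)) by field; rewrite gt_eqF.
  have -> : 16 * S / xd ^+ 2 = 8 / xd ^+ 2 * (2 * S) by field; rewrite gt_eqF.
  by rewrite ler_wpM2l// divr_ge0// exprn_ge0// ltW.
have a3 : - dW x * psi x <= 16 * S / xd ^+ 2 * psi 0.
  apply: ler_pM => //; last exact: le_trans a1 a2.
  by apply: ltW; apply: (psi_gt0 co); rewrite ltW.
apply: (le_trans a3).
have -> : 16 * S / xd ^+ 2 * psi 0 = B1 * K by rewrite /B1; field; rewrite !gt_eqF.
have b1 : B1 * K <= B1 * W x by rewrite ler_wpM2l// hK// x0.
have : 0 <= Bb * W x by rewrite mulr_ge0// ltW.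
by move: b1; lra.
Qed.

(** On [[0, xd]] the loss is of order [xd * xh * W xh], by the record bound on [x g'(x)]; on
    [[xd, p]], [g] grows at rate at least [W xh / psi 0 ^+ 2], and the gain is of order
    [W xh * (p - xd)^2]. The common factor [W xh] drops out, and [128 * xh * xd <= p ^+ 2]
    decides. *)
Lemma record_primitive xd p xh (Om : R -> R) : 0 < xd -> 2 * xd <= p -> p <= xh -> xh < 1 ->
  psi 0 / 2 <= psi xh -> 128 * xh * xd <= p ^+ 2 ->
  (forall x, 0 < x <= xh -> x * W x <= 2 * (xh * W xh)) ->
  (forall x, 0 < x < p -> is_derive x 1 Om (phi x - g xd * psi x)) ->
  (forall x, 0 <= x <= p -> {for x, continuous Om}) ->
  Om 0 = 0 -> 0 <= Om p.
Proof.
move=> xd0 xdp pxh xh1 psih small rec Omd Omc Om0.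
have p0 : 0 < p by lra.
have xh0 : 0 < xh by lra.
have Wh : 0 < W xh by apply: (W_gt0 co); rewrite xh0.
pose S := 8 * (xh * W xh) / psi 0 ^+ 2.
have pge x : 0 <= x <= xh -> psi 0 / 2 <= psi x.
  by move=> /andP[x0 xx]; apply: (le_trans psih); apply: (psi_ninc co) => //; exact: ltW.
have ple x : 0 <= x <= xh -> psi x <= psi 0.
  by move=> /andP[x0 xx]; apply: (psi_ninc co) => //; exact: (le_trans xx (ltW xh1)).
have gm x y : 0 <= x -> x <= y -> y <= xh -> W xh / psi 0 ^+ 2 * (y - x) <= g y - g x.
  move=> x0 xy yx; have [Psi PsiP] := Psi_exists co.
  apply: le_trans (g_slope_ge co PsiP x0 xy yx xh1).
  have y1 : y < 1 by apply: le_lt_trans yx xh1.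
  have /andP[h _] := Psi_bounds co PsiP x0 xy y1.
  have -> : W xh / psi 0 ^+ 2 * (y - x) = W xh / psi 0 * ((y - x) / psi 0) by field; rewrite gt_eqF.
  rewrite ler_pM2l ?divr_gt0//; apply: le_trans h; rewrite ler_wpM2l ?subr_ge0//.
  rewrite lef_pV2 ?posrE//; first by apply: ple; rewrite x0 (le_trans xy).
  by apply: (psi_gt0 co); rewrite x0 (le_lt_trans xy).
have gE x : 0 <= x <= xh -> phi x = g x * psi x.
  move=> /andP[x0 xx]; rewrite /coef_ratio mulfVK// gt_eqF// (psi_gt0 co)// x0.
  exact: le_lt_trans xx xh1.
have loss : - (psi 0 * S * xd) <= Om xd.
  (* [x * (g xd - g x) + S * x] grows at least at the rate [g xd - g x], because [x g' <= S]; so [g]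
     itself need not be integrated. *)
  pose E x := Om x + psi 0 * (x * (g xd - g x) + S * x).
  pose dE x := phi x - g xd * psi x + psi 0 * (g xd - g x - x * (W x / psi x ^+ 2) + S).
  suff : E 0 <= E xd by rewrite /E Om0 subrr; lra.
  have sub x : 0 < x < xd -> 0 < x < 1 /\ 0 < x < p.
    by move=> /andP[x0 xx]; rewrite x0; split; lra.
  apply: (@ge0_derive_le _ E dE 0 xd (ltW xd0)).
  - move=> x /sub[x01 xp]; have ? := Omd x xp; have ? := g_der co x01.
    by apply: is_derive_eq; rewrite /GRing.scale/= /dE; ring.
  - move=> x xx; have /andP[x0 xxd] := xx; have [x01 xp] := sub x xx.
    have xh' : 0 <= x <= xh by rewrite ltW//; lra.
    have gg : 0 <= g xd - g x.
      have := gm x xd (ltW x0) (ltW xxd) ltac:(lra).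
      by apply: le_trans; rewrite mulr_ge0 ?subr_ge0 ?(ltW xxd)// divr_ge0 ?exprn_ge0// ltW.
    have Wx : x * (W x / psi x ^+ 2) <= S.
      rewrite mulrA /S; have -> : 8 * (xh * W xh) / psi 0 ^+ 2 = 2 * (xh * W xh) / (psi 0 / 2) ^+ 2.
        by field; rewrite gt_eqF.
      have q0 : 0 < psi 0 / 2 by rewrite divr_gt0.
      have px : 0 < psi x by apply: (lt_le_trans q0); exact: pge.
      apply: ler_pM.
      + by rewrite mulr_ge0 ?(ltW x0)// ltW// (W_gt0 co).
      + by rewrite invr_ge0 exprn_ge0// ltW.
      + by apply: rec; rewrite x0/=; case/andP: xh'.
      + rewrite lef_pV2 ?posrE ?exprn_gt0// lerXn2r ?nnegrE ?(ltW q0) ?(ltW px)//.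
        exact: pge.
    rewrite /dE (gE x xh').
    have h1 : (g xd - g x) * psi x <= (g xd - g x) * psi 0 by rewrite ler_wpM2l// ple.
    have h2 : psi 0 * (x * (W x / psi x ^+ 2)) <= psi 0 * S by rewrite ler_pM2l.
    by move: h1 h2; lra.
  - move=> x /andP[x0 xx]; have x1 : 0 <= x < 1 by rewrite x0; lra.
    apply: continuousD; first by apply: Omc; rewrite x0; lra.
    apply: continuousM; first exact: cst_continuous.
    apply: continuousD.
      apply: continuousM; first exact: cvg_id.
      by apply: continuousB; [exact: cst_continuous|exact: (g_cont co x1)].
    by apply: continuousM; [exact: cst_continuous|exact: cvg_id].
have gain : W xh / (4 * psi 0) * (p - xd) ^+ 2 <= Om p - Om xd.
  pose c := W xh / (4 * psi 0).
  pose E x := Om x - c * ((x - xd) * (x - xd)).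
  pose dE x := phi x - g xd * psi x - c * (2 * (x - xd)).
  suff : E xd <= E p by rewrite /E -/c expr2; lra.
  have xdp' : xd <= p by lra.
  apply: (@ge0_derive_le _ E dE xd p xdp').
  - move=> x /andP[xx xp]; have xp' : 0 < x < p by rewrite xp andbT; lra.
    have ? := Omd x xp'.
    have ? : is_derive x 1 (fun z => z - xd) 1 by apply: is_derive_eq; ring.
    by apply: is_derive_eq; rewrite /GRing.scale/= /dE; ring.
  - move=> x /andP[xx xp]; have xh' : 0 <= x <= xh by apply/andP; split; lra.
    have h := gm xd x (ltW xd0) (ltW xx) ltac:(lra).
    rewrite /dE (gE x xh').
    have h0 : 0 <= W xh / psi 0 ^+ 2 * (x - xd).
      by rewrite mulr_ge0 ?subr_ge0 ?(ltW xx)// divr_ge0 ?exprn_ge0// ltW.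
    have h1 : W xh / psi 0 ^+ 2 * (x - xd) * (psi 0 / 2) <= (g x - g xd) * psi x.
      by apply: ler_pM => //; [rewrite divr_ge0// ltW|exact: pge].
    have <- : W xh / psi 0 ^+ 2 * (x - xd) * (psi 0 / 2) = c * (2 * (x - xd)).
      by rewrite /c; field; rewrite gt_eqF.
    by move: h1; lra.
  - move=> x /andP[xx xp]; apply: continuousB; first by apply: Omc; rewrite xp andbT; lra.
    apply: continuousM; first exact: cst_continuous.
    by apply: continuousM; (apply: continuousB; [exact: cvg_id|exact: cst_continuous]).
have c0 : 0 < W xh / psi 0 by rewrite divr_gt0.
have sq : p ^+ 2 <= 4 * (p - xd) ^+ 2.
  have : p * p <= (2 * (p - xd)) * (2 * (p - xd)) by apply: ler_pM; move: p0 xdp; slra.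
  by rewrite !expr2; lra.
have f1 : psi 0 * S * xd = W xh / psi 0 * (8 * xh * xd) by rewrite /S; field; rewrite gt_eqF.
have f2 : W xh / (4 * psi 0) * (p - xd) ^+ 2 = W xh / psi 0 * ((p - xd) ^+ 2 / 4).
  by field; rewrite gt_eqF.
rewrite f1 in loss; rewrite f2 in gain.
have : W xh / psi 0 * (8 * xh * xd) <= W xh / psi 0 * ((p - xd) ^+ 2 / 4).
  by rewrite ler_pM2l//; move: small sq; lra.
by move: loss gain; lra.
Qed.

Variables (w0 h0 : R -> R).
Hypothesis prof : profile w0 h0.

Ltac drop_facts ::= clear - co zero01 psi00 prof.

(** This is the barrier property at [xd]. Up to [T0] it comes from [kappa_lower], since [w 0 s <= Q]
    and [phi xd <= 1 / (2 * Q)]; afterwards from [kappa_average] with [k = g xd], the sign of the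
    primitive being [record_primitive]. *)
Lemma kappa_ge_record (d e T0 Q xd p xh : R) kappa F w H :
  solution phi psi w0 kappa F w H -> e <= 1 / 4 -> 0 < d < 1 ->
  (forall x y, 1 - d <= x -> x <= y -> y < 1 ->
     `|life w0 h0 y - life w0 h0 x| <= e * (y - x)) ->
  2 < expR T0 * w0 (1 - d / 2) -> 0 < Q -> (forall s, 0 <= s <= T0 -> w 0 s <= Q) ->
  0 < xd -> 2 * xd <= p -> p <= xh -> xh < 1 -> p <= 1 / 4 ->
  psi 0 / 2 <= psi xh -> 128 * xh * xd <= p ^+ 2 ->
  (forall x, 0 < x <= xh -> x * W x <= 2 * (xh * W xh)) -> 0 < phi xd ->
  (forall x, 0 <= x <= p -> phi x <= 1 / (2 * Q) /\ phi x <= 1 / 16 /\ phi x <= phi (1 / 2)) ->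
  forall s, 0 <= s -> 8 * p * w 0 s <= 1 -> g xd <= kappa s.
Proof.
move=> sol e4 d01 lip late Q0 hQ xd0 xdp pxh xh1 p4 psih small rec phd sm s s0 pw.
have p0 : 0 < p by lra.
have pge x : 0 <= x <= xh -> psi 0 / 2 <= psi x.
  by move=> /andP[x0 xx]; apply: (le_trans psih); apply: (psi_ninc co) => //; exact: ltW.
have q0 : 0 < psi 0 / 2 by rewrite divr_gt0.
have pd : psi 0 / 2 <= psi xd by apply: pge; rewrite ltW//; lra.
have pd0 : 0 < psi xd := lt_le_trans q0 pd.
have k0 : 0 < g xd by rewrite /coef_ratio divr_gt0.
have [sT|Ts] := leP s T0.
  have := kappa_lower co sol s0; have := hQ s (introT andP (conj s0 sT)).
  have := sol_kgt0 sol s; set k := kappa s => kk wQ h.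
  have [h1 _] := sm xd (introT andP (conj (ltW xd0) (ltac:(lra) : xd <= p))).
  have kp : 0 < k * psi 0 by rewrite mulr_gt0.
  have a1 : k * psi 0 * w 0 s <= k * psi 0 * Q by rewrite ler_pM2l.
  rewrite /coef_ratio ler_pdivrMr//.
  have a2 : k * (psi 0 / 2) <= k * psi xd by rewrite ler_pM2l.
  have a3 : 1 / (2 * Q) <= k * (psi 0 / 2).
    by rewrite ler_pdivrMr ?mulr_gt0//; move: h a1 kp; slra.
  by move: h1 a2 a3; slra.
pose U x := phi x - g xd * psi x.
have Uc x : {for x, continuous U}.
  apply: continuousB; first exact: phi_cont co _.
  by apply: continuousM; [exact: cst_continuous|exact: psi_cont co _].
have [Om Omd] := @primitive_exists R U (-1) 1 (fun x _ => Uc x).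
pose Om' x := Om x - Om 0.
have Omd' x : -1 < x < 1 -> is_derive x 1 Om' (U x).
  by move=> /Omd ?; apply: is_derive_eq; ring.
have in1 x : 0 <= x <= p -> -1 < x < 1 by move=> /andP[xl xr]; apply/andP; split; move: xl p4 xr; slra.
have sub x : 0 < x < p -> 0 <= x <= p by move=> /andP[/ltW -> /ltW ->].
have Omc x : 0 <= x <= p -> {for x, continuous Om'}.
  by move=> /in1 /Omd'; exact: is_derive_continuous.
have Om0 : Om' 0 = 0 by rewrite /Om' subrr.
have dU x : 0 < x < 1 -> is_derive x 1 U (phi1 x - g xd * psi1 x).
  move=> x01; have ? := phi_der co x01; have ? := psi_der co x01.
  by apply: is_derive_eq; rewrite /GRing.scale/=; ring.
have Uinc x : 0 < x < p -> 0 <= phi1 x - g xd * psi1 x.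
  move=> xp; have /andP[x0 xp'] := xp; have x01 : 0 < x < 1 by rewrite x0; move: p4 xp; slra.
  have [_ [_ h]] := sm x (sub x xp).
  have half : 0 <= (1 / 2 : R) <= 1 by apply/andP; split; slra.
  have t := phi_tangent co x01 half.
  have x2 : 0 < 1 / 2 - x by move: p4 xp'; slra.
  have p1 : 0 <= phi1 x by rewrite -(pmulr_lge0 _ x2); move: t h; slra.
  have := mulr_ge0_le0 (ltW k0) (psi1_le0 co x01); move: p1; slra.
have [_ [sm1 sm2]] := sm p (introT andP (conj (ltW p0) (lexx p))).
have Ud : U xd = 0 by rewrite /U /coef_ratio mulfVK ?subrr// gt_eqF.
have Up : 0 <= U p.
  rewrite -Ud; apply: (@ge0_derive_le _ U (fun x => phi1 x - g xd * psi1 x)); first by move: xd0 xdp; slra.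
  - by move=> x /andP[x0 xp]; apply: dU; apply/andP; split; move: xd0 x0 p4 xp; slra.
  - by move=> x /andP[x0 xp]; apply: Uinc; apply/andP; split; move: xd0 x0 xp; slra.
  - by move=> x _; exact: Uc.
have pp : 0 <= g xd * psi p.
  by rewrite mulr_ge0 ?(ltW k0)//; apply: le_trans (ltW q0) (pge p _); rewrite ltW.
apply: (kappa_average co prof sol e4 d01 lip s0 _ k0 p0 p4 pw (Om := Om')) => //.
- by apply: (flow_late co prof sol d01 s0); apply: (lt_le_trans late);
    rewrite ler_pM2r ?ler_expR ?(ltW Ts)//; apply: (mass_gt0 (profile_mass prof));
    case/andP: d01 => d0 d1; apply/andP; split; move: d1 d0; slra.
- by move=> x /sub /in1; exact: Omd'.
- apply: (record_primitive xd0 xdp pxh xh1 psih small rec) => //.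
  by move=> x /sub /in1; exact: Omd'.
- by move: pp sm1; rewrite /U; slra.
- have half1 : (1 / 2 : R) <= 1 by slra.
  have : g xd * psi (1 / 2) <= g xd * psi p.
    by rewrite ler_pM2l//; apply: (psi_ninc co); move: p0 p4; slra.
  by rewrite /U; move: sm2; slra.
Qed.
End Singular.

(** * Upper bound for [w(0, t)] in the singular case *)

Section SingularBound.
Variables (R : realType) (phi psi phi1 psi1 dW : R -> R) (al be : R).
Hypothesis co : coefs phi psi phi1 psi1 dW al be.
Implicit Types (x y s t : R).
Local Notation W := (wronskian phi psi phi1 psi1).

Let zero01 : 0 <= (0 : R) < 1.
Proof. by rewrite lexx ltr01. Qed.

Let psi00 : 0 < psi 0. Proof. exact: (psi_gt0 co zero01). Qed.

Lemma phi_gt0 x : 0 < x < 1 -> 0 < phi x.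
Proof.
move=> x01; have /andP[x0 x1] := x01.
rewrite ltNge; apply/negP => ph.
have ph0 := @phi_ge0 _ _ _ _ _ _ _ _ co x (introT andP (conj (ltW x0) (ltW x1))).
have E : phi x = 0 by apply/eqP; rewrite eq_le ph.
have c0 : 0 <= (0 : R) <= 1 by rewrite lexx ler01.
have := phi_tangent co x01 c0; rewrite (phi_at0 co) E.
have := W_gt0 co x01; rewrite E mul0r subr0 pmulr_lgt0; last first.
  by apply: (psi_gt0 co); rewrite ltW.
move=> p h; have : 0 < phi1 x * x by rewrite mulr_gt0.
by move: h; lra.
Qed.

Ltac drop_facts ::= clear - co zero01 psi00.

(** Here the record pays off. The distortion exponent [B * 4 * xh / psi 0] is at most
    [64 * D^2 * W xh / K + 1]; with [K] large against [D^2 / la] this uses at most half of the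
    contraction exponent [W xh * la / psi 0], up to the 1. The other half absorbs the numerical
    factor, because [W xh >= K]. *)
Lemma record_distortion (Psi : R -> R) la D K Bb xh xd B :
  xd = xh / D -> B = 16 * (xh * W xh) * psi 0 / (xd ^+ 2 * K) + Bb ->
  (forall x, 0 <= x < 1 -> is_derive x 1 Psi (psi x)^-1) ->
  0 < la -> 1 <= D -> 0 < xh -> 2 * xh < 1 -> psi 0 / 2 <= psi (2 * xh) ->
  4 * Bb * xh <= psi 0 -> 0 < Bb -> 0 < K -> K <= W xh ->
  128 * D ^+ 2 * psi 0 <= K * la -> 7680 * expR 1 * psi 0 <= K * la ->
  960 * (psi 0 / psi (2 * xh)) * (Ec Psi B (2 * xh) / psi (2 * xh) / (Ec Psi B xd / psi xd)) <=
    expR (W xh / psi 0 * la).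
Proof.
move=> xdE BE PsiP la0 D1 xh0 xh1 ph hBb Bb0 K0 KW K1 K2.
have q0 : 0 < psi 0 / 2 by rewrite divr_gt0.
have ph0 : 0 < psi (2 * xh) := lt_le_trans q0 ph.
have D0 : 0 < D by move: D1; slra.
have xd0 : 0 < xd by rewrite xdE divr_gt0.
have xdh : xd <= xh by rewrite xdE ler_pdivrMr// ler_peMr// ltW.
have xdh2 : xd <= 2 * xh by move: xdh xh0; slra.
have Wh : 0 < W xh := lt_le_trans K0 KW.
have k0 : 0 < W xh / psi 0 by rewrite divr_gt0.
have B1 : 4 * (16 * (xh * W xh) * psi 0 / (xd ^+ 2 * K)) * xh / psi 0 <= W xh / psi 0 * (la / 2).
  have -> : 4 * (16 * (xh * W xh) * psi 0 / (xd ^+ 2 * K)) * xh / psi 0 =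
     W xh / psi 0 * (64 * D ^+ 2 * psi 0 / K).
    by rewrite xdE; field; rewrite !gt_eqF.
  rewrite ler_pM2l// ler_pdivrMr//; move: K1; slra.
have B2 : 4 * Bb * xh / psi 0 <= 1 by rewrite ler_pdivrMr// mul1r.
have B0 : 0 <= B.
  rewrite BE; apply: addr_ge0; last exact: ltW.
  by apply: divr_ge0; rewrite !mulr_ge0// ?exprn_ge0 ?ltW.
have pd : psi xd <= psi 0 by apply: (psi_ninc co) => //; [exact: ltW|move: xdh2 xh1; slra].
have pd0 : 0 < psi xd by apply: (psi_gt0 co); apply/andP; split; move: xd0 xdh2 xh1; slra.
have /andP[_ Pb] := Psi_bounds co PsiP (ltW xd0) xdh2 xh1.
have {}Pb : Psi (2 * xh) - Psi xd <= 4 * xh / psi 0.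
  apply: (le_trans Pb); have -> : 4 * xh / psi 0 = 2 * xh / (psi 0 / 2) by field; rewrite gt_eqF.
  apply: ler_pM; [move: xdh2; slra|by rewrite invr_ge0 ltW|move: xd0; slra|by rewrite lef_pV2// posrE].
have E1 : Ec Psi B (2 * xh) <= Ec Psi B xd * (expR 1 * expR (W xh / psi 0 * (la / 2))).
  rewrite /Ec -!expRD ler_expR.
  have := ler_wpM2l B0 Pb; have -> : B * (4 * xh / psi 0) =
    4 * (16 * (xh * W xh) * psi 0 / (xd ^+ 2 * K)) * xh / psi 0 + 4 * Bb * xh / psi 0.
    by rewrite BE; ring.
  by move: B1 B2; slra.
set E := expR (W xh / psi 0 * (la / 2)) in E1.
have a1 : psi 0 / psi (2 * xh) <= 2 by rewrite ler_pdivrMr//; move: ph; slra.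
have a2 : Ec Psi B (2 * xh) / psi (2 * xh) / (Ec Psi B xd / psi xd) <= expR 1 * E * 2.
  have -> : Ec Psi B (2 * xh) / psi (2 * xh) / (Ec Psi B xd / psi xd) =
     Ec Psi B (2 * xh) / Ec Psi B xd * (psi xd / psi (2 * xh)).
    by field; rewrite !gt_eqF ?Ec_gt0.
  apply: ler_pM.
  - by rewrite divr_ge0// ltW// Ec_gt0.
  - by rewrite divr_ge0// ltW.
  - by rewrite ler_pdivrMr ?Ec_gt0// [_ * Ec Psi B xd]mulrC.
  - by rewrite ler_pdivrMr//; move: ph pd; slra.
have a3 : 3840 * expR 1 <= E.
  have := expR_ge1Dx (W xh / psi 0 * (la / 2)); rewrite -/E.
  have : 3840 * expR 1 <= W xh / psi 0 * (la / 2).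
    have -> : W xh / psi 0 * (la / 2) = W xh * la / 2 / psi 0 by ring.
    rewrite ler_pdivlMr//; have : K * la <= W xh * la by rewrite ler_pM2r.
    by move: K2; slra.
  slra.
have -> : expR (W xh / psi 0 * la) = E * E by rewrite /E -expRD; congr expR; field; rewrite gt_eqF.
have E0 : 0 < E := expR_gt0 _.
have l1 : 0 <= psi 0 / psi (2 * xh) by rewrite divr_ge0// ltW.
have l2 : 0 <= Ec Psi B (2 * xh) / psi (2 * xh) / (Ec Psi B xd / psi xd).
  by rewrite !divr_ge0// ltW// Ec_gt0.
have l3 := ler_pM l1 l2 a1 a2.
have l4 : 3840 * expR 1 * E <= E * E by rewrite ler_pM2r.
by rewrite -[960 * _ * _]mulrA; move: l3 l4; move: (psi 0 / _ * _) (E * E) => X Y; slra.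
Qed.

Variables (w0 h0 : R -> R).
Hypothesis prof : profile w0 h0.

Ltac drop_facts ::= clear - co zero01 psi00 prof.

(** Order of the choices: [la = ln 2], hence [e = 1 / 16]; the ratios [xd = xh / D], [p = xh / 64]
    and [mu = xh / 4] are fixed, [D = 64 * (64 * 128)] being dictated by [128 * xh * xd <= p ^+ 2];
    then [K]; then the smallness [eta]. The record [xh] is not prescribed, only placed below
    [eta]. *)
Lemma sol_bound_singular :
  (forall M, exists2 r, 0 < r & forall x, 0 < x < r -> M * x <= phi x) ->
  exists2 mu : R, 0 < mu & forall kappa F w H, solution phi psi w0 kappa F w H ->
    forall t, 0 <= t -> w 0 t <= 1 / mu.
Proof.
move=> phiM; have [Psi PsiP] := Psi_exists co.
have w00 : 0 < w0 0 by apply: (mass_gt0 (profile_mass prof)).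
have [la la0 la2] : exists2 la : R, 0 < la & expR la = 2.
  by exists (ln 2); [rewrite ln_gt0// ltr1n|rewrite lnK// posrE].
have laN : expR (- la) = 1 / 2 by rewrite expRN la2 div1r.
have e0 : 0 < (1 / 16 : R) by rewrite divr_gt0.
have [d d01 lip] := profile_lip prof e0.
have [T0 T00 hT0] := profile_late prof d01.
have [D DE] : exists D : R, D = 64 * (64 * 128) by eexists.
have D64 : 64 * (64 * 128) <= D by rewrite DE.
have D0 : 0 < D by rewrite DE; lra.
have D1 : 1 <= D by rewrite DE; lra.
have DD : 0 < D ^+ 2 by rewrite exprn_gt0.
have e10 := expR_gt0 (1 : R).
have [K [K0 [K1 [K2 K3]]]] : exists K : R, 0 < K /\ 128 * D ^+ 2 * psi 0 <= K * la /\
    7680 * expR 1 * psi 0 <= K * la /\ psi 0 < K.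
  have l1 : (0 : R) < 128 by lra.
  have l2 : (0 : R) < 7680 by lra.
  have a1 := mulr_gt0 (mulr_gt0 l1 DD) psi00.
  have a2 := mulr_gt0 (mulr_gt0 l2 e10) psi00.
  exists ((128 * D ^+ 2 * psi 0 + 7680 * expR 1 * psi 0) / la + 2 * psi 0).
  move: (128 * D ^+ 2 * psi 0) (7680 * expR 1 * psi 0) a1 a2 => A1 A2 a1 a2.
  have b1 : 0 < (A1 + A2) / la by rewrite divr_gt0// addr_gt0.
  have b2 : 0 < 2 * psi 0 by rewrite mulr_gt0.
  have b3 : 0 < 2 * psi 0 * la by rewrite mulr_gt0.
  have -> : ((A1 + A2) / la + 2 * psi 0) * la = A1 + A2 + 2 * psi 0 * la by field; rewrite gt_eqF.
  have p0 := psi00; move: a1 a2 b1 b2 b3 p0 => a1 a2 b1 b2 b3 p0.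
  by split; [|split; [|split]]; move: a1 a2 b1 b2 b3 p0; slra.
have [xb xb01 hxb] := W_infty co K phiM.
have [Bb Bb0 hBb] := dW_lower co xb01.
have Q0 : 0 < expR T0 * w0 0 by rewrite mulr_gt0 ?expR_gt0.
set Q := expR T0 * w0 0 in Q0.
pose eps := Num.min (1 / (2 * Q)) (Num.min (1 / 16) (phi (1 / 2))).
have half01 : 0 < (1 / 2 : R) < 1 by apply/andP; split; slra.
have eps0 : 0 < eps.
  rewrite /eps !lt_min phi_gt0// andbT; apply/andP; split; apply: divr_gt0 => //.
  by rewrite mulr_gt0.
have [d1 d10 h1] : exists2 d, 0 < d & forall x, `|x - 0| < d -> phi x < eps.
  have [|d' d0 hd] := continuous_ltc (phi_cont co (x := 0)) (c := eps).
    by rewrite (phi_at0 co).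
  by exists d' => // x /hd.
have [d2 d20 h2] : exists2 d, 0 < d & forall x, `|x - 0| < d -> psi 0 / 2 < psi x.
  have [|d' d0 hd] := continuous_gtc (psi_cont co (x := 0)) (c := psi 0 / 2).
    by move: psi00; slra.
  by exists d' => // x /hd.
pose N := 1 + expR (T0 + la) * w0 0.
have N1 : 0 < expR (T0 + la) * w0 0 by rewrite mulr_gt0 ?expR_gt0.
have N0 : 0 < N by move: N1; rewrite /N; slra.
pose eta := Num.min (d1 / 2) (Num.min (d2 / 4) (Num.min xb (Num.min (1 / 5)
  (Num.min (psi 0 / (4 * Bb)) (4 / N))))).
have eta0 : 0 < eta.
  have b0 : 0 < 4 * Bb by rewrite mulr_gt0.
  have /andP[xb0 _] := xb01.
  by rewrite /eta !lt_min xb0 !divr_gt0.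
have : eta <= eta := lexx _.
rewrite {2}/eta !le_min => /and5P[b1 b2 b3 b4 /andP[b5 b6]].
have eta01 : 0 < eta < 1 by rewrite eta0/=; move: b4; slra.
have [xh /andP[xh0 xhe] rec] := record_scale co eta01.
have {}rec x : 0 < x <= xh -> x * W x <= 2 * (xh * W xh).
  by move=> /andP[x0 xx]; apply: rec; rewrite x0 (le_trans xx).
clearbody eta.
have KW : K <= W xh by apply: hxb; rewrite xh0; move: xhe b3; slra.
have ph2 : psi 0 / 2 <= psi (2 * xh) by apply/ltW/h2; rewrite subr0 gtr0_norm; move: xh0 xhe b2 d20; slra.
have xh21 : 2 * xh < 1 by move: xhe b4; slra.
have xh1 : xh < 1 by move: xh21 xh0; slra.
have ph1 : psi 0 / 2 <= psi xh.
  by apply: (le_trans ph2); apply: (psi_ninc co); move: xh0 xh21; slra.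
have psih : 0 < psi xh by apply: lt_le_trans ph1; rewrite divr_gt0.
have hBb' : 4 * Bb * xh <= psi 0.
  have : 4 * Bb * xh <= 4 * Bb * (psi 0 / (4 * Bb)).
    by rewrite ler_pM2l ?mulr_gt0//; exact: le_trans b5.
  by have -> : 4 * Bb * (psi 0 / (4 * Bb)) = psi 0 by field; rewrite gt_eqF.
have [xd xdE] : exists xd, xd = xh / D by eexists.
have [B BE] : exists B, B = 16 * (xh * W xh) * psi 0 / (xd ^+ 2 * K) + Bb by eexists.
have smal := record_distortion xdE BE PsiP la0 D1 xh0 xh21 ph2 hBb' Bb0 K0 KW K1 K2.
have xd0 : 0 < xd by rewrite xdE divr_gt0.
have xdD : 64 * (64 * 128) * xd = xh by rewrite -DE xdE mulrC mulfVK// gt_eqF.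
have xd1 : 0 < xd < 1 by rewrite xd0/=; move: xdD xd0 xh1; slra.
have xd2 : 0 < xd / 2 <= xh by apply/andP; split; move: xdD xd0; slra.
have Wh : 0 < W xh := lt_le_trans K0 KW.
have S0 : 0 < xh * W xh by rewrite mulr_gt0.
have cB := record_conv_at co K0 Bb0 xd1 (ltW S0) (rec _ xd2) hxb hBb.
rewrite -BE in cB.
have B0 : 0 < B.
  rewrite BE ltr_wpDl//; apply: divr_ge0; last by rewrite mulr_ge0 ?exprn_ge0 ?ltW.
  by rewrite mulr_ge0 ?(ltW psi00)// mulr_ge0// ltW.
clear xdE BE DE D64 DD K1 K2 D0 D1.
exists (xh / 4); first by rewrite divr_gt0.
move=> kappa F w H sol.
have i4 : 1 / (xh / 4) = 4 / xh by rewrite invf_div mulrA mul1r.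
apply: (sol_bound (e := 1 / 16) (d := d) (la := la) (xd := xd) (xh := xh) (B := B) (T0 := T0) co prof PsiP sol) => //.
- by slra.
- by rewrite divr_gt0.
- exact: ltW.
- by rewrite la2; slra.
- by rewrite la2; move: xdD xd0; slra.
- by slra.
- rewrite i4 ler_pdivlMr// mulrC -ler_pdivlMr//.
  apply: (le_trans xhe); apply: (le_trans b6).
  by rewrite ler_pM2l// lef_pV2 ?posrE// /N; slra.
- rewrite laN; have : 1 < W xh / psi xh.
    rewrite ltr_pdivlMr// mul1r; apply: le_lt_trans (lt_le_trans K3 KW).
    by apply: (psi_ninc co) => //; exact: ltW.
  move: (W xh / psi xh) => S S1.
  have : 1 * xh < S * xh by rewrite ltr_pM2r.
  by slra.
- move=> s s0 ws; rewrite /velocity subr_le0 -ler_pdivrMr; last first.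
    by apply: (psi_gt0 co); rewrite ltW//; case/andP: xd1.
  apply: (kappa_ge_record co prof (d := d) (e := 1 / 16) (T0 := T0) (Q := Q) (p := xh / 64) (xh := xh) sol) => //.
  + by slra.
  + move=> r /andP[r0 rT]; apply: (le_trans (sol_growth co sol (lexx 0) r0)).
    by rewrite (sol_initial sol)// /Q subr0 ler_pM2r// ler_expR.
  + by move: xdD xd0; slra.
  + by move: xh0; slra.
  + by move: xh1; slra.
  + rewrite expr2; have : xh * xd * (64 * (64 * 128)) = xh * xh by rewrite -mulrA [xd * _]mulrC xdD.
    have -> : xh / 64 * (xh / 64) = xh * xh / 64 / 64 by ring.
    by rewrite -[128 * _ * _]mulrA; move: (xh * xd) (xh * xh) => X Y; slra.
  + exact: phi_gt0.
  + move=> x /andP[x0 xp]; have : phi x < eps by apply: h1; rewrite subr0 ger0_norm//; move: xp xhe b1 xh0 d10; slra.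
    by rewrite /eps !lt_min => /and3P[/ltW ? /ltW ? /ltW ?]; split.
  + have : xh / 8 * w 0 s <= xh / 8 * (2 / (xh / 4)).
      by rewrite ler_pM2l// divr_gt0.
    have -> : xh / 8 * (2 / (xh / 4)) = 1 by field; rewrite gt_eqF.
    by have -> : 8 * (xh / 64) * w 0 s = xh / 8 * w 0 s by field.
Qed.
End SingularBound.

(** Both chords are compared with the one over [[a, q]]. It is applied with [h] the identity and
    with [h = E_al]. *)
Lemma chord_mono (R : realType) (f h : R -> R) (b a p q y : R) :
  (forall x y z, b <= x -> x < y -> y < z -> z < 1 ->
     (f y - f x) * (h z - h y) <= (f z - f y) * (h y - h x)) ->
  (forall x y, b <= x -> x < y -> y < 1 -> h x < h y) ->
  b <= a -> a < y -> y <= q -> a <= p -> p < q -> q < 1 ->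
  (f y - f a) * (h q - h p) <= (f q - f p) * (h y - h a).
Proof.
move=> conv incr ba ay yq ap pq q1.
have aq : a < q by apply: lt_le_trans yq.
have haq : 0 < h q - h a by rewrite subr_gt0 incr.
have hpq : 0 < h q - h p by rewrite subr_gt0 incr// (le_trans ba).
have hay : 0 < h y - h a by rewrite subr_gt0 incr// (le_lt_trans yq).
have s1 : (f y - f a) * (h q - h a) <= (f q - f a) * (h y - h a).
  move: yq; rewrite le_eqVlt => /orP[/eqP->//|yq].
  by have := conv a y q ba ay yq q1; lra.
have s2 : (f q - f a) * (h q - h p) <= (f q - f p) * (h q - h a).
  move: ap; rewrite le_eqVlt => /orP[/eqP->//|ap].
  by have := conv a p q ba ap pq q1; lra.
rewrite -(ler_pM2r haq).
have := ler_wpM2r (ltW hpq) s1; have := ler_wpM2r (ltW hay) s2; lra.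
Qed.

(** * Lower bound for w(0, t) - 1 *)

Section Spread.
Variables (R : realType) (phi psi phi1 psi1 dW : R -> R) (al be : R).
Hypothesis co : coefs phi psi phi1 psi1 dW al be.
Variables (w0 h0 : R -> R).
Variable Psi : R -> R.
Hypothesis PsiP : forall x : R, 0 <= x < 1 -> is_derive x 1 Psi (psi x)^-1.
Variables (kappa : R -> R) (F w H : R -> R -> R).
Hypothesis sol : solution phi psi w0 kappa F w H.
Local Notation path := (trajectory phi psi kappa).
Local Notation vel := (velocity phi psi kappa).
Local Notation g := (coef_ratio phi psi).
Local Notation Gam := (Gam phi psi phi1 psi1).
Local Notation A := (Ec Psi al).
Local Notation conv_at := (conv_at phi psi phi1 psi1).
Implicit Types (X Y : R -> R) (a s t x y z : R).

Let kc := sol_kcont sol.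
Let kp := sol_kgt0 sol.
Let fl := sol_flow sol.

Let zero01 : 0 <= (0 : R) < 1.
Proof. by rewrite lexx ltr01. Qed.

Let psi00 : 0 < psi 0. Proof. exact: (psi_gt0 co zero01). Qed.

Lemma flow_near1 x t : 0 <= x < 1 -> 0 <= t -> 1 - F x t <= expR t * (1 - x).
Proof.
move=> x01 t0; have [X [pX Xt ->]] := fl x01 t0.
have X0 : 0 < 1 - X 0 by rewrite subr_gt0; case/andP: (path_in pX (introT andP (conj (lexx 0) t0))).
have := @Gronwall_lower _ (fun s => 1 - X s) (fun s => 0 - vel s (X s)) 1 0 t t0 X0.
rewrite Xt subr0 mulN1r => gl.
rewrite -ler_pdivrMl ?expR_gt0// -expRN mulrC; apply: gl.
- by move=> s st; have ? := path_der pX st; apply: is_deriveB.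
- move=> s /andP[s0 st] _; have := path_in pX (introT andP (conj (ltW s0) (ltW st))).
  move=> /andP[X0' X1]; have := vel_lip co kp s X0' (ltW X1) (lexx 1).
  by rewrite (vel1 co); lra.
- by move=> s _; apply: continuousB; [exact: cst_continuous|exact: path_cont pX].
Qed.

Lemma sol_mass_split t x : 0 <= t -> 0 <= x < 1 -> 1 <= x * w 0 t + (1 - x) * w x t.
Proof.
move=> t0 x01; have /andP[x0 x1] := x01.
have /andP[_ h] := sol_incr sol t0 (lexx 0) x0 x1.
have := mass_le (sol_mass sol t0) x01.
by move: h; rewrite (sol_H0 sol t0) subr0; lra.
Qed.

Lemma sol_mass_lower t x : 0 <= t -> 0 <= x < 1 -> x * w x t <= 1.
Proof.
move=> t0 x01; have /andP[x0 x1] := x01.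
have /andP[h _] := sol_incr sol t0 (lexx 0) x0 x1.
have := mass_ge0 (sol_mass sol t0) x01.
by move: h; rewrite (sol_H0 sol t0) subr0; lra.
Qed.

(* The gap constant of the distortion estimate from [x1, x2] to [0, x5]. *)
Definition gap_const B x1 x2 x5 := 1 + x1 / (x2 - x1) +
  Ec Psi B x5 / psi x5 * (x5 - x2) / (Ec Psi B x1 / psi x1 * (x2 - x1)).

(** Convexity compares [[0, x1]] with [[x1, x2]], and the distortion estimate compares [[x2, x5]]
    with it. *)
Lemma total_gap B x1 x2 x5 t : 0 < B -> conv_at B x1 -> 0 < x1 -> x1 < x2 -> x2 < x5 -> x5 < 1 ->
  0 <= t -> (forall s, 0 < s < t -> vel s x1 <= 0) ->
  F x5 t - F 0 t <= gap_const B x1 x2 x5 * (F x2 t - F x1 t).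
Proof.
move=> B0 cB x10 x12 x25 x51 t0 v1.
have x21 := lt_trans x25 x51.
have h1 := flow_convex co kc kp fl (lexx 0) (ltW x10) (ltW x12) x21 t0.
have h2 := flow_distortion co sol PsiP B0 cB v1 (ltW x10) (lexx x1) x12 x25 x51 t0.
have d0 : 0 < x2 - x1 by rewrite subr_gt0.
have p1 : 0 < Ec Psi B x1 / psi x1 * (x2 - x1).
  by rewrite mulr_gt0// divr_gt0 ?Ec_gt0// (psi_gt0 co)// (ltW x10) (lt_trans x12).
rewrite /gap_const; rewrite subr0 in h1.
have i1 : F x1 t - F 0 t <= x1 / (x2 - x1) * (F x2 t - F x1 t).
  by rewrite mulrAC ler_pdivlMr//; move: h1; lra.
have i2 : F x5 t - F x2 t <= Ec Psi B x5 / psi x5 * (x5 - x2) / (Ec Psi B x1 / psi x1 * (x2 - x1)) * (F x2 t - F x1 t).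
  by rewrite mulrAC ler_pdivlMr// [leRHS]mulrC.
by move: i1 i2; move: (x1 / _) (_ / (Ec _ _ _ / _ * _)) => c1 c2; lra.
Qed.

Lemma gap_const_ge1 B x1 x2 x5 : 0 < x1 -> x1 < x2 -> x2 < x5 -> x5 < 1 ->
  1 <= gap_const B x1 x2 x5.
Proof.
move=> x10 x12 x25 x51; rewrite /gap_const -addrA lerDl addr_ge0//.
  by rewrite divr_ge0 ?subr_ge0// ltW.
have ps x : 0 <= x -> x < 1 -> 0 <= psi x by move=> ? ?; apply/ltW/(psi_gt0 co)/andP.
apply: divr_ge0; apply: mulr_ge0; rewrite ?subr_ge0 ?(ltW x12) ?(ltW x25)//;
  apply: divr_ge0; rewrite ?(ltW (Ec_gt0 _ _ _))// ps//; lra.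
Qed.

Section Clock.
Variables (T : R) (K : R -> R).
Hypothesis Kd : forall s, -1 < s < T -> is_derive s 1 K (kappa s).

Let inT a t s : 0 <= a -> t < T -> a <= s <= t -> -1 < s < T.
Proof. by move=> a0 tT /andP[as_ st]; apply/andP; split; lra. Qed.

Let Kc a t s : 0 <= a -> t < T -> a <= s <= t -> {for s, continuous K}.
Proof. by move=> a0 tT /(inT a0 tT)/Kd; exact: is_derive_continuous. Qed.

Lemma clock_ge c a t : 0 <= a -> a <= t -> t < T -> (forall s, a < s < t -> c <= kappa s) ->
  c * (t - a) <= K t - K a.
Proof.
move=> a0 at_ tT h; suff : K a - c * a <= K t - c * t by lra.
apply: (@ge0_derive_le _ (fun s => K s - c * s) (fun s => kappa s - c)) => //.
- move=> s /andP[as_ st]; have ? := Kd (inT a0 tT (introT andP (conj (ltW as_) (ltW st)))).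
  by apply: is_derive_eq; rewrite /GRing.scale/=; ring.
- by move=> s st; rewrite subr_ge0 h.
- move=> s st; apply: continuousB; first exact: Kc st.
  by apply: continuousM; [exact: cst_continuous|exact: cvg_id].
Qed.

(** Backward in time a trajectory approaches 1 at relative speed at most [kappa * psi 0]. Measured
    by the clock [K], this holds whatever the size of [kappa]: one unit divides the distance to 1 by
    at most [exp (psi 0)]. *)
Lemma clock_reach t X a : path t X -> 0 <= a -> a <= t -> t < T ->
  (1 - X t) * expR (- (psi 0 * (K t - K a))) <= 1 - X a.
Proof.
move=> pX a0 at_ tT.
rewrite expRN ler_pdivrMr ?expR_gt0//.
have := @Gronwall_upper _ (fun s => 1 - X s) (fun s => 0 - vel s (X s))
    (fun s => psi 0 * K s) (fun s => psi 0 * kappa s) a t at_.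
rewrite -mulrBr; apply.
- move=> s /andP[as_ st]; have ? : is_derive s 1 X (vel s (X s)).
    by apply: (path_der pX); rewrite (le_lt_trans a0).
  by apply: is_deriveB.
- move=> s /andP[as_ st]; have ? := Kd (inT a0 tT (introT andP (conj (ltW as_) (ltW st)))).
  by apply: is_derive_eq; rewrite /GRing.scale/=; ring.
- move=> s /andP[as_ st]; have := path_in pX (introT andP (conj (le_trans a0 (ltW as_)) (ltW st))).
  move=> /andP[X0 X1]; have x01 : 0 <= X s <= 1 by rewrite X0 ltW.
  have p1 := psi_le co x01; have p2 := phi_ge0 co x01.
  have := ler_wpM2l (ltW (kp s)) p1; rewrite /velocity; move: p2; lra.
- by move=> s _; apply: continuousB; [exact: cst_continuous|exact: path_cont pX].
- by move=> s st; apply: continuousM; [exact: cst_continuous|exact: Kc st].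
Qed.

(** To the right of [x1] the slope of [E_al g] in [E_al] is at most [Gam al x1]. Backward, the gap
    in [E_al] therefore expands at least at the rate [al (kappa - Gam al x1)], a true expansion once
    [kappa] is large. *)
Lemma path_Ec_spread x1 t X Y a : 0 < x1 -> path t X -> path t Y -> 0 <= a -> a <= t -> t < T ->
  (forall s, 0 <= s <= t -> X s < Y s) -> (forall s, a <= s <= t -> x1 <= X s) ->
  A (Y t) - A (X t) <= (A (Y a) - A (X a)) * expR (al * (Gam al x1 * (t - a) - (K t - K a))).
Proof.
move=> x10 pX pY a0 at_ tT XY X1; have al0 := al_gt0 co.
have := @Gronwall_upper _ (fun s => A (Y s) - A (X s))
   (fun s => al * (A (Y s) * g (Y s) - kappa s * A (Y s)) - al * (A (X s) * g (X s) - kappa s * A (X s)))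
   (fun s => al * (Gam al x1 * s - K s)) (fun s => al * (Gam al x1 - kappa s)) a t at_.
have -> : al * (Gam al x1 * t - K t) - al * (Gam al x1 * a - K a) =
   al * (Gam al x1 * (t - a) - (K t - K a)) by ring.
have sub s : a < s < t -> 0 < s < t by move=> /andP[as_ ->]; rewrite (le_lt_trans a0).
have sub' s : a < s < t -> a <= s <= t by move=> /andP[/ltW -> /ltW ->].
have sub2 s : a <= s <= t -> 0 <= s <= t by move=> /andP[as_ ->]; rewrite (le_trans a0).
apply.
- move=> s /sub st; have ? := Ec_path_der co PsiP al pX st; have ? := Ec_path_der co PsiP al pY st.
  exact: is_deriveB.
- move=> s st; have ? := Kd (inT a0 tT (sub' s st)).
  by apply: is_derive_eq; rewrite /GRing.scale/=; ring.
- move=> s st; have s0t := sub2 s (sub' s st).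
  have /andP[X0 X1'] := path_in pX s0t; have /andP[Y0 Y1'] := path_in pY s0t.
  have XYs := XY s s0t; have x1X := X1 s (sub' s st).
  have [h _] := Ecg_slope co PsiP (Gam al x1) al0 X0 (ltW XYs) Y1'.
  have {}h := h (fun u hu => ltac:(case/andP: hu => xu uy; exact: (g_concave co x10
    (le_trans x1X (ltW xu)) (lt_trans uy Y1')))).
  by have := ler_wpM2l (ltW al0) h; lra.
- by move=> s /sub2 st; apply: continuousB; [exact: (Ec_path_cont PsiP pY st)|exact: (Ec_path_cont PsiP pX st)].
- move=> s st; apply: continuousM; first exact: cst_continuous.
  apply: continuousB; last exact: Kc st.
  by apply: continuousM; [exact: cst_continuous|exact: cvg_id].
Qed.
End Clock.
End Spread.

(** * Evolution of the spread over one unit of the clock *)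

Section Steps.
Variables (R : realType) (phi psi phi1 psi1 dW : R -> R) (al be : R).
Hypothesis co : coefs phi psi phi1 psi1 dW al be.
Variables (w0 h0 : R -> R).
Hypothesis prof : profile w0 h0.
Variable Psi : R -> R.
Hypothesis PsiP : forall x : R, 0 <= x < 1 -> is_derive x 1 Psi (psi x)^-1.
Variables (kappa : R -> R) (F w H : R -> R -> R).
Hypothesis sol : solution phi psi w0 kappa F w H.
Local Notation vel := (velocity phi psi kappa).
Local Notation L := (life w0 h0).
Local Notation g := (coef_ratio phi psi).
Local Notation A := (Ec Psi al).
Implicit Types (X Y : R -> R) (a s t x y z : R).

Let kc := sol_kcont sol.
Let kp := sol_kgt0 sol.
Let fl := sol_flow sol.
Let m0 := profile_mass prof.

Let zero01 : 0 <= (0 : R) < 1.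
Proof. by rewrite lexx ltr01. Qed.

Let psi00 : 0 < psi 0. Proof. exact: (psi_gt0 co zero01). Qed.

Variables (x1 x2 x5 B C1 e d : R).
Hypotheses (x10 : 0 < x1) (x12 : x1 < x2) (x25 : x2 < x5) (x51 : x5 < 1).
Hypothesis x45 : 1 - (1 - x2) * expR (- psi 0) <= x5.
Hypotheses (B0 : 0 < B) (cB : conv_at phi psi phi1 psi1 B x1).
Hypotheses (C10 : 0 < C1) (kC : forall s, 0 <= s -> C1 <= kappa s).
Hypotheses (g1 : g x1 <= C1) (g2 : g x2 <= C1).
Hypotheses (e0 : 0 < e) (e4 : e <= 1 / 4) (d01 : 0 < d < 1) (d2 : d <= 1 / 2).
Hypothesis lip : forall x y, 1 - d <= x -> x <= y -> y < 1 -> `|L y - L x| <= e * (y - x).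

Let C5 := gap_const psi Psi B x1 x2 x5.
Let G1 := Gam phi psi phi1 psi1 al x1.

Let C51 : 1 <= C5. Proof. exact: (gap_const_ge1 co Psi B x10 x12 x25 x51). Qed.

Let x2in : 0 <= x2 < 1.
Proof. by rewrite (ltW (lt_trans x10 x12)) (lt_trans x25 x51). Qed.

Let x1in : 0 <= x1 < 1.
Proof. by rewrite (ltW x10) (lt_trans x12)//; case/andP: x2in. Qed.

Let x5in : 0 <= x5 < 1.
Proof. by case/andP: x2in => h _; rewrite x51 andbT (le_trans h)// ltW. Qed.

Let G10 : 0 <= G1.
Proof.
have p1 := psi_gt0 co x1in.
apply: addr_ge0.
  by rewrite divr_ge0 ?(ltW p1)// (phi_ge0 co)//; case/andP: x1in => -> /ltW.
rewrite divr_ge0 ?mulr_ge0 ?(ltW p1) ?(ltW (al_gt0 co))//; apply/ltW/(W_gt0 co).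
by rewrite x10; case/andP: x1in.
Qed.

Let vel_le0 s x : 0 <= s -> 0 <= x < 1 -> g x <= C1 -> vel s x <= 0.
Proof.
move=> s0 x01 gx; rewrite /velocity subr_le0 -ler_pdivrMr ?(psi_gt0 co)//.
exact: le_trans gx (kC s0).
Qed.

(** The interval [[x1, x2]] pulled back to time 0, in units of the mean residual life there; by
    [ratio_le] and [ratio_ge] it governs how much [w] drops from [x1] to [x2]. *)
Definition spread t := (F x2 t - F x1 t) / L (F x1 t).

Let gap_gt0 t : 0 <= t -> 0 < F x2 t - F x1 t.
Proof.
by move=> t0; rewrite subr_gt0; apply: (flow_lt co kc kp fl) => //; [exact: ltW|case/andP: x2in].
Qed.

Let L1 t : 0 <= t -> 0 < L (F x1 t).
Proof. by move=> t0; apply: (life_gt0 m0); apply: (flow_in fl). Qed.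

Lemma spread_gt0 t : 0 <= t -> 0 < spread t.
Proof. by move=> t0; rewrite divr_gt0 ?gap_gt0 ?L1. Qed.

Let tgap t : 0 <= t -> F x5 t - F 0 t <= C5 * (F x2 t - F x1 t).
Proof.
move=> t0; apply: (total_gap co PsiP sol B0 cB x10 x12 x25 x51 t0) => s /andP[s0 _].
by apply: vel_le0 => //; exact: ltW.
Qed.

Section Clocked.
Variables (T : R) (K : R -> R).
Hypothesis Kd : forall s, -1 < s < T -> is_derive s 1 K (kappa s).

Ltac drop_facts ::= clear - co prof PsiP sol kc kp fl m0 zero01 psi00 x10 x12 x25 x51 x45
  B0 cB C10 kC g1 g2 e0 e4 d01 d2 lip C5 G1 C51 x2in x1in x5in G10 vel_le0 gap_gt0 L1 tgap
  Kd.

(** Followed backward, the trajectories from [x1] and [x2] do not cross these points to the left,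
    since [g x1] and [g x2] are at most [C1 <= kappa]; within one unit they do not pass [x5], by
    [clock_reach]. *)
Lemma step_points a t : 0 <= a -> a <= t -> t < T -> K t - K a <= 1 ->
  exists p q, [/\ x1 <= p, x2 <= q, p < q & q <= x5] /\
    [/\ F x1 t = F p a, F x2 t = F q a &
    A x2 - A x1 <= (A q - A p) * expR (al * (G1 * (t - a) - (K t - K a)))].
Proof.
move=> a0 at_ tT Ka; have t0 := le_trans a0 at_.
have [X [pX Xt _]] := fl x1in t0; have [Y [pY Yt _]] := fl x2in t0.
have at' : 0 <= a <= t by rewrite a0.
have XY s : 0 <= s <= t -> X s < Y s.
  by move=> st; apply: (path_lt_back co kc kp pX pY st); rewrite Xt Yt.
have X1 s : a <= s <= t -> x1 <= X s.
  move=> /andP[as_ st]; have s0 := le_trans a0 as_.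
  apply: (path_low co kp pX (introT andP (conj s0 st)) (ltW x10)); last by rewrite Xt.
  by move=> r /andP[sr _]; apply: vel_le0 => //; exact: le_trans s0 (ltW sr).
exists (X a), (Y a); split; split.
- by apply: X1; rewrite lexx.
- apply: (path_low co kp pY at'); [by case/andP: x2in| |by rewrite Yt].
  by move=> r /andP[sr _]; apply: vel_le0 => //; exact: le_trans a0 (ltW sr).
- exact: XY.
- have h := clock_reach co sol Kd pY a0 at_ tT; rewrite Yt in h.
  have x21 : 0 <= 1 - x2 by rewrite subr_ge0; case/andP: x2in => _ /ltW.
  have : (1 - x2) * expR (- psi 0) <= (1 - x2) * expR (- (psi 0 * (K t - K a))).
    rewrite ler_wpM2l// ler_expR lerN2; have := ler_wpM2l (ltW psi00) Ka; lra.
  by move: h (x45); slra.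
- by rewrite -(flow_sub co kp fl pX at') Xt.
- by rewrite -(flow_sub co kp fl pY at') Yt.
- by rewrite -Xt -Yt; exact: (path_Ec_spread co PsiP Kd).
Qed.

(** A lower bound for [(q - p) / (x2 - x1)] in [step_points]: [al * A x5 / psi x5] is the largest
    slope of [A] up to [x5], and [exp (al * G1 / C1)] bounds the contraction, as a unit of the clock
    lasts at most [1 / C1]. *)
Definition weak_const := (A x2 - A x1) / (al * A x5 / psi x5 * expR (al * G1 / C1)) / (x2 - x1).

Lemma life_shift a p : 0 <= a -> 1 - d <= F 0 a -> x1 <= p -> p <= x5 ->
  L (F p a) <= L (F x1 a) * (1 + e * (C5 * spread a)).
Proof.
move=> a0 late x1p px5; have p1 : p < 1 by apply: le_lt_trans x51.
have l1 : 1 - d <= F x1 a.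
  by apply: (le_trans late); apply: (flow_le co kc kp fl) => //; [exact: ltW|case/andP: x1in].
have l2 : F x1 a <= F p a by apply: (flow_le co kc kp fl) => //; exact: ltW.
have /andP[_ l3] : 0 <= F p a < 1.
  by apply: (flow_in fl) => //; rewrite p1 andbT (le_trans _ x1p)// ltW.
have := lip l1 l2 l3; rewrite ler_norml => /andP[_ h].
have h2 : F p a - F x1 a <= C5 * (F x2 a - F x1 a).
  apply: le_trans (tgap a0); apply: lerB.
    by apply: (flow_le co kc kp fl) => //; rewrite (le_trans _ x1p)// ltW.
  by apply: (flow_le co kc kp fl) => //; [exact: ltW|case/andP: x1in].
have E : L (F x1 a) * (1 + e * (C5 * spread a)) = L (F x1 a) + e * (C5 * (F x2 a - F x1 a)).
  by rewrite /spread; field; rewrite gt_eqF ?L1.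
have := ler_wpM2l (ltW e0) h2; rewrite E; move: h; slra.
Qed.

Lemma weak_const_gt0 : 0 < weak_const.
Proof.
have a0 := al_gt0 co; have p5 : 0 < psi x5 by exact: (psi_gt0 co).
rewrite /weak_const; apply: divr_gt0; last by rewrite subr_gt0.
apply: divr_gt0.
  by rewrite subr_gt0; apply: (Ec_lt co PsiP a0) => //; [exact: ltW|case/andP: x2in].
by rewrite mulr_gt0 ?expR_gt0// divr_gt0// mulr_gt0// Ec_gt0.
Qed.

(** Convexity of [F] carries the bound on [q - p] over to the pulled-back gap, and [life_shift]
    handles the denominator. A single unit costs a bounded factor, but iterating this alone would
    let the spread decay. *)
Lemma spread_weak_step a t : 0 <= a -> a <= t -> t < T -> K t - K a <= 1 -> 1 - d <= F 0 a ->
  weak_const * spread a <= spread t * (1 + C5 * spread a).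
Proof.
move=> a0 at_ tT Ka late; have t0 := le_trans a0 at_.
have [p [q [[x1p x2q pq q5] [Ep Eq hA]]]] := step_points a0 at_ tT Ka.
have al0 := al_gt0 co.
have Kt : C1 * (t - a) <= K t - K a.
  by apply: (clock_ge Kd) => // s /andP[as_ _]; apply: kC; exact: le_trans a0 (ltW as_).
have q1 : q < 1 by apply: le_lt_trans x51.
have q0 : 0 <= q by apply: le_trans x2q; case/andP: x2in.
have p0 : 0 <= p by apply: le_trans x1p; exact: ltW.
have p5 : 0 < psi x5 by exact: (psi_gt0 co).
have pq0 : 0 < psi q by apply: (psi_gt0 co); rewrite q0.
have ta : t - a <= C1^-1 by rewrite -(ler_pM2l C10) mulfV ?gt_eqF// (le_trans Kt).
have ta0 : 0 <= t - a by rewrite subr_ge0.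
have ex : expR (al * (G1 * (t - a) - (K t - K a))) <= expR (al * G1 / C1).
  rewrite ler_expR -mulrA ler_wpM2l ?(ltW al0)//.
  have := ler_wpM2l G10 ta; have : 0 <= C1 * (t - a) by rewrite mulr_ge0// ltW.
  by move: Kt; slra.
have Aq : A q - A p <= al * A x5 / psi x5 * (q - p).
  have /andP[_ h] := Ec_bounds co PsiP al0 p0 (ltW pq) q1.
  apply: (le_trans h); rewrite ler_wpM2r ?subr_ge0 ?(ltW pq)//.
  apply: ler_pM; rewrite ?invr_ge0 ?mulr_ge0 ?(ltW al0) ?(ltW pq0) ?(ltW (Ec_gt0 _ _ _))//.
    rewrite ler_wpM2l ?(ltW al0)//; move: q5; rewrite le_eqVlt => /orP[/eqP->//|q5].
    by apply/ltW/(Ec_lt co PsiP al0).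
  by rewrite lef_pV2 ?posrE//; apply: (psi_ninc co) => //; exact: ltW.
have qp : weak_const * (x2 - x1) <= q - p.
  have c0 : 0 < al * A x5 / psi x5 * expR (al * G1 / C1).
    by rewrite mulr_gt0 ?expR_gt0// divr_gt0// mulr_gt0// Ec_gt0.
  rewrite /weak_const mulfVK ?subr_eq0 ?gt_eqF// ler_pdivrMr//.
  have Apq : 0 <= A q - A p by rewrite subr_ge0; apply/ltW/(Ec_lt co PsiP al0).
  have := le_trans hA (ler_pM Apq (expR_ge0 _) Aq ex).
  by rewrite mulrAC [_ * (q - p)]mulrC.
have ch : (F x2 a - F x1 a) * (q - p) <= (F q a - F p a) * (x2 - x1).
  apply: (@chord_mono _ (F^~ a) id 0) => //; last exact: ltW.
  by move=> x y z x0 xy yz z1; apply: (flow_convex co kc kp fl) => //; exact: ltW.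
have D0 := gap_gt0 a0; have L0 := L1 a0; have Lt := L1 t0.
have x21 : 0 < x2 - x1 by rewrite subr_gt0.
have D1 : weak_const * (F x2 a - F x1 a) <= F x2 t - F x1 t.
  rewrite Ep Eq -(ler_pM2r x21); apply: le_trans ch.
  by rewrite mulrAC mulrC ler_pM2l.
have D2 : L (F x1 t) <= L (F x1 a) * (1 + C5 * spread a).
  rewrite Ep; apply: (le_trans (life_shift a0 late x1p (le_trans (ltW pq) q5))).
  rewrite ler_pM2l// lerD2l ler_piMl//; last by move: (e4) (e0); slra.
  by rewrite mulr_ge0 ?(ltW (spread_gt0 a0))//; move: (C51); slra.
have -> : weak_const * spread a = weak_const * (F x2 a - F x1 a) / L (F x1 a) by rewrite /spread mulrA.
rewrite ler_pdivrMr//; apply: (le_trans D1).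
have -> : F x2 t - F x1 t = spread t * L (F x1 t) by rewrite /spread mulfVK// gt_eqF.
by rewrite -[leRHS]mulrA ler_pM2l ?spread_gt0// [leRHS]mulrC.
Qed.

Let r := psi 0 / al.

Let r0 : 0 <= r. Proof. by rewrite divr_ge0 ?(ltW psi00)// ltW// (al_gt0 co). Qed.

Ltac drop_facts ::= clear - co prof PsiP sol kc kp fl m0 zero01 psi00 x10 x12 x25 x51 x45
  B0 cB C10 kC g1 g2 e0 e4 d01 d2 lip C5 G1 C51 x2in x1in x5in G10 vel_le0 gap_gt0 L1 tgap
  Kd r r0.

(** With [kappa >= 2 * G1] the gap in [E_al] expands backward by at least [exp (al / 2)] over the
    unit, and convexity of the flow in [E_al] transfers this to the pulled-back gaps. On so short an
    interval the slope [al E_al / psi] is nearly constant: returning to ordinary gaps costs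
    [1 - 2 th] and [1 - 2 r th], the change of [L] costs [1 + th], and the smallness hypothesis
    covers all three. *)
Lemma spread_strong_step a t : 0 <= a -> a <= t -> t < T -> K t - K a = 1 -> 1 - d <= F 0 a ->
  (forall s, a < s < t -> 2 * G1 <= kappa s) ->
  (3 + 2 * r) * (C5 * spread a) <= 1 - expR (- (al / 2)) ->
  spread a <= spread t.
Proof.
move=> a0 at_ tT Ka late k2 small; have t0 := le_trans a0 at_.
have Ka1 : K t - K a <= 1 by rewrite Ka.
have [p [q [[x1p x2q pq q5] [Ep Eq hA]]]] := step_points a0 at_ tT Ka1.
have al0 := al_gt0 co; have N0 := spread_gt0 a0; have la := L1 a0; have lt := L1 t0.
set th := C5 * spread a in small; have th0 : 0 < th.
  by rewrite mulr_gt0//; apply: lt_le_trans C51.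
set E := expR (- (al / 2)) in small; have E0 : 0 < E := expR_gt0 _.
have rth : 0 <= r * th by rewrite mulr_ge0// ltW.
have th3 : th <= 1 / 3 by move: small E0 rth; slra.
have q1 : q < 1 by apply: le_lt_trans x51.
have q0 : 0 <= q by apply: le_trans x2q; case/andP: x2in.
have p0 : 0 <= p by apply: le_trans x1p; exact: ltW.
have Kt : 2 * G1 * (t - a) <= K t - K a by apply: (clock_ge Kd).
have {}hA : A x2 - A x1 <= (A q - A p) * E.
  apply: (le_trans hA); rewrite ler_pM2l; last by rewrite subr_gt0; apply: (Ec_lt co PsiP al0).
  have h : G1 * (t - a) - (K t - K a) <= - (1 / 2) by move: Kt; rewrite Ka; slra.
  by rewrite ler_expR; have := ler_wpM2l (ltW al0) h; slra.
have x10' := ltW x10; have x12' : x1 < 1 by case/andP: x1in.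
set u := F x1 a in N0 la *; pose v := F x2 a; pose p' := F p a; pose q' := F q a.
have uv : u < v by rewrite -subr_gt0; exact: gap_gt0.
have /andP[u0 u1] : 0 <= u < 1 by apply: (flow_in fl).
have /andP[_ v1] : 0 <= v < 1 by apply: (flow_in fl).
have pq' : p' < q' by apply: (flow_lt co kc kp fl).
have up' : u <= p' by apply: (flow_le co kc kp fl) => //; exact: lt_trans pq q1.
have /andP[_ q1'] : 0 <= q' < 1 by apply: (flow_in fl); rewrite ?q0.
have uq' : u <= q' := le_trans up' (ltW pq').
have ul : 1 - d <= u by apply: (le_trans late); apply: (flow_le co kc kp fl).
have u2 : 1 / 2 <= u by move: ul (d2); slra.
have qu : q' - u <= th * (1 - u).
  have h2 : q' - u <= C5 * (v - u).
    apply: le_trans (tgap a0); apply: lerB; apply: (flow_le co kc kp fl) => //.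
  have h3 : C5 * (v - u) = th * L u by rewrite /th /spread -/u -/v; field; rewrite gt_eqF.
  have h4 : L u <= 1 - u by apply: (life_le1 m0); rewrite u0.
  by apply: (le_trans h2); rewrite h3 ler_pM2l.
have ch : (A v - A u) * (A q - A p) <= (A q' - A p') * (A x2 - A x1).
  apply: (@chord_mono _ (fun x => A (F x a)) A 0) => //.
  - by move=> x y z x0 xy yz z1; apply: (flow_Ec_convex co kc kp fl PsiP).
  - by move=> x y x0 xy y1; apply: (Ec_lt co PsiP).
have Apq : 0 < A q - A p by rewrite subr_gt0; apply: (Ec_lt co PsiP al0).
have Apq' : 0 < A q' - A p' by rewrite subr_gt0; apply: (Ec_lt co PsiP al0) => //; exact: le_trans up'.
have Auv : A v - A u <= (A q' - A p') * E.
  rewrite -(ler_pM2r Apq); apply: (le_trans ch).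
  by rewrite -mulrA ler_pM2l// [E * _]mulrC.
have pu : 0 < psi u by apply: (psi_gt0 co); rewrite u0.
have pq0 : 0 < psi q' by apply: (psi_gt0 co); rewrite q1' (le_trans u0).
have /andP[b1 _] := Ec_bounds co PsiP al0 u0 (ltW uv) v1.
have /andP[_ b2] := Ec_bounds co PsiP al0 (le_trans u0 up') (ltW pq') q1'.
have Aq0 : 0 < A q' := Ec_gt0 _ _ _.
have q1u : q' - u <= 2 * th * (1 - q').
  have : 0 <= th * (1 - 2 * th) * (1 - u).
    by rewrite mulr_ge0 ?subr_ge0 ?(ltW u1)// mulr_ge0 ?(ltW th0)//; move: th3; slra.
  have : 2 * th * (q' - u) <= 2 * th * (th * (1 - u)) by rewrite ler_pM2l// mulr_gt0.
  by move: qu; slra.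
have c1 : A q' * (1 - 2 * th) <= A u.
  have /andP[_ h] := Psi_bounds co PsiP u0 uq' q1'.
  have h1 : (q' - u) / psi q' <= 2 * th / al.
    rewrite ler_pdivrMr//; apply: (le_trans q1u).
    have -> : 2 * th / al * psi q' = 2 * th * (psi q' / al) by ring.
    have th2 : 0 < 2 * th by rewrite mulr_gt0.
    rewrite (ler_pM2l th2) ler_pdivlMr// mulrC; apply: (psi_ge co).
    by rewrite (le_trans u0 uq') ltW.
  have h2 : al * (Psi q' - Psi u) <= 2 * th.
    by rewrite -ler_pdivlMl//; apply: (le_trans h); rewrite mulrC in h1 *; rewrite (mulrC al^-1).
  have -> : A u = A q' * expR (- (al * (Psi q' - Psi u))).
    by rewrite /Ec -expRD; congr expR; ring.
  rewrite ler_pM2l//; have := expR_ge1Dx (- (al * (Psi q' - Psi u))).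
  by move: h2; slra.
have c2 : psi u * (1 - 2 * (r * th)) <= psi q'.
  have h1 := psi_chord co (lexx 0) u0 uq' (ltW q1').
  have h2 : (psi u - psi q') * u <= psi 0 * (q' - u).
    have : 0 <= psi u * (q' - u) by rewrite mulr_ge0 ?(ltW pu)// subr_ge0.
    by move: h1; rewrite !subr0; slra.
  have h3 : psi u - psi q' <= 2 * psi 0 * (q' - u).
    have d0 : 0 <= psi u - psi q' by rewrite subr_ge0; apply: (psi_ninc co) => //; exact: ltW.
    have : (psi u - psi q') * (1 / 2) <= (psi u - psi q') * u by rewrite ler_wpM2l.
    by move: h2; slra.
  have h4 : 2 * psi 0 * (q' - u) <= 2 * psi 0 * (th * (psi u / al)).
    rewrite ler_pM2l ?mulr_gt0//; apply: (le_trans qu); rewrite ler_pM2l// ler_pdivlMr// mulrC.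
    by apply: (psi_ge co); rewrite u0 ltW.
  have h5 : 2 * psi 0 * (th * (psi u / al)) = psi u * (2 * (r * th)) by rewrite /r; ring.
  by move: h3 h4; rewrite h5; slra.
have D0 : 0 < v - u by rewrite subr_gt0.
have D0' : 0 < q' - p' by rewrite subr_gt0.
have key : (v - u) * (1 - 2 * th) * (1 - 2 * (r * th)) <= (q' - p') * E.
  have k1 : al * A u / psi u * (v - u) <= al * A q' / psi q' * (q' - p') * E.
    by apply: (le_trans b1); apply: (le_trans Auv); rewrite ler_pM2r.
  have k2' : A u * (v - u) * psi q' <= A q' * (q' - p') * E * psi u.
    have c : 0 < psi u * psi q' / al by rewrite divr_gt0// mulr_gt0.
    have := k1; rewrite -(ler_pM2r c).
    have -> : al * A u / psi u * (v - u) * (psi u * psi q' / al) = A u * (v - u) * psi q'.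
      by field; rewrite !gt_eqF.
    have -> : al * A q' / psi q' * (q' - p') * E * (psi u * psi q' / al) = A q' * (q' - p') * E * psi u.
      by field; rewrite !gt_eqF.
    by [].
  have th1 : 0 <= 1 - 2 * th by move: th3; slra.
  have k3 : A q' * (1 - 2 * th) * (v - u) * psi q' <= A u * (v - u) * psi q'.
    by rewrite ler_pM2r// ler_pM2r.
  have k4 : A q' * (1 - 2 * th) * (v - u) * (psi u * (1 - 2 * (r * th))) <=
     A q' * (1 - 2 * th) * (v - u) * psi q'.
    by rewrite ler_wpM2l// mulr_ge0 ?(ltW D0)// mulr_ge0// ltW.
  have c : 0 < A q' * psi u by rewrite mulr_gt0.
  rewrite -(ler_pM2l c).
  by have := le_trans k4 (le_trans k3 k2'); slra.
have fin : (v - u) * (1 + th) <= q' - p'.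
  rewrite -(ler_pM2r E0); apply: le_trans key; rewrite -[leLHS]mulrA -[leRHS]mulrA ler_pM2l//.
  have f1 : (1 + th) * E <= (1 + th) * (1 - (3 + 2 * r) * th).
    by rewrite ler_pM2l; [move: small; slra|move: th0; slra].
  have f2 : 0 <= th * (r * th) by rewrite mulr_ge0// ltW.
  have f3 : 0 <= th * th by rewrite mulr_ge0// ltW.
  by move: f1 f2 f3; slra.
have Lp : L p' <= L u * (1 + th).
  apply: (le_trans (life_shift a0 late x1p (le_trans (ltW pq) q5))).
  rewrite ler_pM2l// lerD2l ler_piMl//; [exact: ltW|by move: (e4) (e0); slra].
rewrite /spread Ep Eq -/p' -/q' ler_pdivrMr// mulrAC ler_pdivlMr; last first.
  by rewrite /p' -Ep.
apply: (@le_trans _ _ ((v - u) * (L u * (1 + th)))); first by rewrite ler_pM2l.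
by rewrite mulrCA mulrC ler_pM2r.
Qed.

(** [[0, x5]] is pulled back to at most [z' / 2] units of [L], so [w x5 t] is close to [w 0 t]; and
    [x5 * w x5 t <= 1] with [x5] close to 1. *)
Lemma near_uniform z' t : 0 <= t -> 1 - d <= F 0 t -> 0 < z' -> z' <= 1 / 2 -> 1 - z' <= x5 ->
  C5 * spread t <= z' / 4 -> w 0 t * (1 - z') ^+ 2 <= 1.
Proof.
move=> t0 late z0 z2 zx5 sp.
have [F00 F01] := andP (flow_in fl zero01 t0); have /andP[F50 F51] := flow_in fl x5in t0.
have x50 : 0 <= x5 by case/andP: x5in.
have F1 : F 0 t <= F x1 t by apply: (flow_le co kc kp fl) => //; [exact: ltW|case/andP: x1in].
have F15 : F x1 t <= F x5 t.
  by apply: (flow_le co kc kp fl) => //; [exact: ltW|exact/ltW/(lt_trans x12)].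
have L00 : 0 < L (F 0 t) by apply: (life_gt0 m0); rewrite F00.
have LL := L1 t0; have tg := tgap t0.
have h1 : C5 * (F x2 t - F x1 t) <= z' / 4 * L (F x1 t).
  have -> : C5 * (F x2 t - F x1 t) = C5 * spread t * L (F x1 t).
    by rewrite /spread; field; rewrite gt_eqF.
  by rewrite ler_pM2r.
have h2 : L (F x1 t) <= 2 * L (F 0 t).
  have := lip late F1 (le_lt_trans F15 F51); rewrite ler_norml => /andP[_ h].
  have : e * (F x1 t - F 0 t) <= 1 / 4 * (F x1 t - F 0 t) by rewrite ler_wpM2r// subr_ge0.
  have : z' / 4 * L (F x1 t) <= 1 / 2 / 4 * L (F x1 t) by rewrite ler_pM2r//; move: z2; slra.
  by move: h h1 tg F15 F1 LL L00; slra.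
pose M := (F x5 t - F 0 t) / L (F 0 t).
have M2 : M <= z' / 2.
  rewrite ler_pdivrMr//.
  have : z' / 4 * L (F x1 t) <= z' / 4 * (2 * L (F 0 t)) by rewrite ler_pM2l// divr_gt0.
  by move: h1 tg; slra.
have M0 : 0 <= M by rewrite divr_ge0 ?(ltW L00)// subr_ge0 (le_trans F1).
have := ratio_ge m0 d01 lip late (le_trans F1 F15) F51; rewrite -/M => rg.
have w5 : (1 - z') * w x5 t <= 1.
  have wp := sol_gt0 sol t0 x5in.
  have : (1 - z') * w x5 t <= x5 * w x5 t by rewrite ler_pM2r.
  by have := sol_mass_lower sol t0 x5in; slra.
have wp : 0 < w 0 t := sol_gt0 sol t0 zero01.
have rw : w 0 t * (1 - M) <= w x5 t * (1 + M).
  rewrite !(sol_w sol)// -!mulrA ler_pM2l ?expR_gt0//; apply: (le_trans rg).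
  have wp5 : 0 < w0 (F x5 t) by apply: (mass_gt0 m0); rewrite F50.
  rewrite ler_pM2l// lerD2l ler_piMl//; move: (e4); slra.
have z1 : 0 < 1 - z' by move: z2; slra.
have M1 : 0 < 1 + M by move: M0; slra.
rewrite -(ler_pM2r M1) mul1r expr2.
have s1 : w 0 t * (1 - M) * (1 - z') <= w x5 t * (1 + M) * (1 - z') by rewrite ler_pM2r.
have s2 : (1 - z') * w x5 t * (1 + M) <= 1 * (1 + M) by rewrite ler_pM2r.
have s3 : (1 - z') * (1 + M) <= 1 - M.
  have : 0 <= z' * M by rewrite mulr_ge0// ltW.
  by move: M2; slra.
have c0 : 0 <= w 0 t * (1 - z') by rewrite mulr_ge0// ltW.
by have := ler_wpM2l c0 s3; move: s1 s2; slra.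
Qed.

Variables (zeta z' Ns T1 : R).
Hypotheses (zeta0 : 0 < zeta) (zetaG : 2 * G1 * (psi 0 * zeta) <= 1).
Hypotheses (z'0 : 0 < z') (z'2 : z' <= 1 / 2) (z'5 : 1 - z' <= x5).
Hypothesis zz : 1 <= (1 + zeta) * (1 - z') ^+ 2.
Hypotheses (Nsz : C5 * Ns <= z' / 4) (Ns0 : 0 < Ns).
Hypothesis Nsa : (3 + 2 * r) * (C5 * Ns) <= 1 - expR (- (al / 2)).
Hypotheses (T10 : 0 <= T1) (late : forall s, T1 <= s -> 1 - d <= F 0 s).

(** A nearly uniform profile has [w 0 t <= 1 + zeta], and [kappa_lower] then forces [kappa] up. *)
Lemma kappa_large t : T1 <= t -> spread t <= Ns -> 2 * G1 <= kappa t.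
Proof.
move=> Tt sp; have t0 := le_trans T10 Tt.
have C50 : 0 < C5 by apply: lt_le_trans C51.
have h : C5 * spread t <= z' / 4 by apply: le_trans Nsz; rewrite ler_pM2l.
have nu := near_uniform t0 (late Tt) z'0 z'2 z'5 h.
have z1 : 0 < (1 - z') ^+ 2 by rewrite exprn_gt0//; have := z'2; lra.
have w1 : w 0 t <= 1 + zeta by rewrite -(ler_pM2r z1) (le_trans nu).
have := kappa_lower co sol t0 => kl.
have pz : 0 < psi 0 * zeta by rewrite mulr_gt0.
rewrite -(ler_pM2r pz); apply: (le_trans zetaG); apply: (le_trans kl).
by rewrite mulrA ler_pM2l ?mulr_gt0//; move: w1; lra.
Qed.

(** [c -> weak_const * c / (1 + C5 * c)] is increasing, so a lower bound for the earlier spread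
    suffices in the weak step. *)
Lemma spread_weak_mono c m a t : 0 <= a -> a <= t -> t < T -> K t - K a <= 1 -> 1 - d <= F 0 a ->
  0 < c -> c <= spread a -> m * (1 + C5 * c) <= weak_const * c -> m <= spread t.
Proof.
move=> a0 at_ tT Ka la c0 ca mc; have t0 := le_trans a0 at_.
have h := spread_weak_step a0 at_ tT Ka la.
have C50 : 0 < C5 by apply: lt_le_trans C51.
have sa := spread_gt0 a0; have st := spread_gt0 t0; have wc := weak_const_gt0.
have p1 : 0 < 1 + C5 * c by rewrite ltr_wpDr ?ltr01// mulr_ge0// ltW.
have p2 : 0 < 1 + C5 * spread a by rewrite ltr_wpDr ?ltr01// mulr_ge0// ltW.
rewrite -(ler_pM2r p1); apply: (le_trans mc).
rewrite -(ler_pM2r p2).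
have k1 : weak_const * c * (1 + C5 * spread a) <= weak_const * spread a * (1 + C5 * c).
  have : weak_const * c <= weak_const * spread a by rewrite ler_pM2l.
  by move: (weak_const) (spread a) => W S; lra.
apply: (le_trans k1); have := ler_wpM2r (ltW p1) h; lra.
Qed.

(** Either the spread reaches [Ns] somewhere in the block, and the weak step from that moment gives
    [m] whatever came before; or it stays below [Ns], [kappa] is large throughout, and the strong
    step loses nothing. Losses therefore do not accumulate. *)
Lemma spread_block m a t : T1 <= a -> a <= t -> t < T -> K t - K a = 1 ->
  m * (1 + C5 * Ns) <= weak_const * Ns -> m <= spread a -> m <= spread t.
Proof.
move=> Ta at_ tT Ka mN ma; have a0 := le_trans T10 Ta.
have [[s [/andP[as_ st] Nss]]|noN] := pselect (exists s, a <= s <= t /\ Ns <= spread s).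
  apply: (spread_weak_mono (c := Ns) (a := s)) => //.
  - exact: le_trans as_.
  - have : 0 <= K s - K a.
      have := clock_ge Kd (c := 0) a0 as_ (le_lt_trans st tT); rewrite mul0r; apply.
      by move=> u _; exact: ltW.
    by move: Ka; lra.
  - by apply: late; exact: le_trans as_.
have small s : a <= s <= t -> spread s <= Ns.
  by move=> st; rewrite leNgt; apply/negP => h; apply: noN; exists s; split => //; exact: ltW.
apply: (le_trans ma); apply: spread_strong_step => //; first exact: late.
- move=> s /andP[as_ st]; apply: kappa_large; first exact: le_trans (ltW as_).
  by apply: small; rewrite !ltW.
- apply: le_trans Nsa; rewrite ler_pM2l ?ler_pM2l//.
  + by apply: small; rewrite lexx.
  + exact: lt_le_trans C51.
  + by have := r0; lra.
Qed.

Ltac drop_facts ::= clear - co prof PsiP sol kc kp fl m0 zero01 psi00 x10 x12 x25 x51 x45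
  B0 cB C10 kC g1 g2 e0 e4 d01 d2 lip C5 G1 C51 x2in x1in x5in G10 vel_le0 gap_gt0 L1 tgap
  Kd r r0 zeta0 zetaG z'0 z'2 z'5 zz Nsz Ns0 Nsa T10 late.

Lemma spread_lower m s1 : m * (1 + C5 * Ns) <= weak_const * Ns ->
  m * (1 + C5 * s1) <= weak_const * s1 -> 0 < s1 -> s1 <= spread T1 ->
  forall t, T1 <= t -> t < T -> m <= spread t.
Proof.
move=> mN ms s10 sT.
have Kinc a b : T1 <= a -> a <= b -> b < T -> K a <= K b.
  move=> Ta ab bT; have := clock_ge Kd (c := 0) (le_trans T10 Ta) ab bT.
  by rewrite mul0r subr_ge0; apply => u _; exact: ltW.
have ind n : forall t, T1 <= t -> t < T -> K t - K T1 <= n.+1%:R -> m <= spread t.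
  elim: n => [|n IH] t Tt tT Kn.
    exact: (spread_weak_mono (c := s1) T10 Tt tT Kn (late (lexx _))).
  have [K1|K1] := leP (K t - K T1) 1.
    exact: (spread_weak_mono (c := s1) T10 Tt tT K1 (late (lexx _))).
  (* Blocks of exactly one unit are cut off backward from [t]; the incomplete one is left next to
     [T1], where the weak step starts from [s1]. *)
  have [a aI Ea] : exists2 a, a \in `[T1, t] & K a = K t - 1.
    apply: IVT => //.
      apply: continuous_in_subspaceT => u; rewrite inE/= in_itv/= => /andP[Tu ut].
      apply: is_derive_continuous (Kd _).
      have := T10; move: (le_lt_trans ut tT) Tu => l1 l2 l3; apply/andP; split; move: l1 l2 l3; slra.
    rewrite min_l ?max_r; [|exact: Kinc..]; apply/andP; split; move: K1; lra.
  move: aI; rewrite in_itv/= => /andP[Ta at_].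
  apply: (spread_block Ta at_ tT) => //; first by rewrite Ea; ring.
  apply: IH => //; first exact: le_lt_trans tT.
  by rewrite Ea; move: Kn; rewrite -natr1; lra.
move=> t Tt tT; apply: (ind (Num.truncn (K t - K T1))) => //.
by apply: ltW; apply: truncnS_gt.
Qed.
End Clocked.
End Steps.

(** * From the spread to a lower bound for [w(0, t) - 1] *)

Section AwayOne.
Variables (R : realType) (phi psi phi1 psi1 dW : R -> R) (al be : R).
Hypothesis co : coefs phi psi phi1 psi1 dW al be.
Variables (w0 h0 : R -> R).
Hypothesis prof : profile w0 h0.
Implicit Types (s t x y z : R).

Let zero01 : 0 <= (0 : R) < 1.
Proof. by rewrite lexx ltr01. Qed.

Let psi00 : 0 < psi 0. Proof. exact: (psi_gt0 co zero01). Qed.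

Ltac drop_facts ::= clear - co prof zero01 psi00.

(** A spread of at least [m] makes [w x2 t] smaller than [w 0 t] by the factor [1 + 3 / 4 * m], and
    [sol_mass_split] turns this drop into an excess at 0. *)
Lemma sol_spread_away kappa F w H x1 x2 d m t : solution phi psi w0 kappa F w H ->
  0 < d < 1 -> (forall x y, 1 - d <= x -> x <= y -> y < 1 ->
    `|life w0 h0 y - life w0 h0 x| <= 1 / 4 * (y - x)) ->
  0 <= t -> 1 - d <= F 0 t -> 0 <= x1 -> x1 < x2 -> x2 < 1 -> 0 < m ->
  m <= spread w0 h0 F x1 x2 t ->
  1 + (1 - x2) * (1 - (1 + 3 / 4 * m)^-1) <= w 0 t.
Proof.
move=> sol d01 lip t0 late x10 x12 x21 mm0 ms.
have kc := sol_kcont sol; have kp := sol_kgt0 sol; have fl := sol_flow sol.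
have m0 := profile_mass prof.
have x11 : x1 < 1 := lt_trans x12 x21; have x20 : 0 <= x2 := le_trans x10 (ltW x12).
have x1in : 0 <= x1 < 1 by rewrite x10.
have x2in : 0 <= x2 < 1 by rewrite x20.
have F1 : 1 - d <= F x1 t by apply: (le_trans late); apply: (flow_le co kc kp fl).
have F12 : F x1 t <= F x2 t by apply: (flow_le co kc kp fl) => //; exact: ltW.
have /andP[F20 F21] := flow_in fl x2in t0.
have := ratio_le m0 d01 lip F1 F12 F21; rewrite -[(_ - _) / _]/(spread w0 h0 F x1 x2 t) => rl.
have w2 : 0 < w0 (F x2 t) by apply: (mass_gt0 m0); rewrite F20.
have r1 : w x2 t * (1 + 3 / 4 * m) <= w 0 t.
  apply: le_trans (sol_ninc sol t0 (lexx 0) x10 x11).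
  rewrite !(sol_w sol)// -mulrA ler_pM2l ?expR_gt0//; apply: le_trans rl.
  by rewrite ler_pM2l// lerD2l; move: ms; slra.
have p0 : 0 < 1 + 3 / 4 * m by move: mm0; slra.
have r2 : w x2 t <= w 0 t * (1 + 3 / 4 * m)^-1 by rewrite ler_pdivlMr.
have rho1 : (1 + 3 / 4 * m)^-1 <= 1 by rewrite invf_le1//; move: mm0; slra.
move: (1 + 3 / 4 * m)^-1 rho1 r2 => rho rho1 r2.
have sp := sol_mass_split sol t0 x2in.
have w1 := sol_ge1 sol t0.
have c0 : 0 <= (1 - x2) * (1 - rho) by rewrite mulr_ge0 ?subr_ge0// ltW.
have d0 : 0 < 1 - x2 by rewrite subr_gt0.
have := ler_wpM2l (ltW d0) r2; have := ler_wpM2l c0 w1.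
by move: sp; slra.
Qed.

(** Up to [T1] the point [xs] is so close to 1 that its pull-back stays where [w0] is below
    [exp (- T1) / 2]; then [w xs t <= 1 / 2] and the missing mass must sit to the left. After [T1]
    the spread is used, with [C1 = mu / psi 0] as a first lower bound for [kappa]. *)
Lemma sol_away_one mu : 0 < mu ->
  (forall kappa F w H, solution phi psi w0 kappa F w H -> forall t, 0 <= t -> w 0 t <= 1 / mu) ->
  exists2 eta : R, 0 < eta & forall kappa F w H, solution phi psi w0 kappa F w H ->
    forall t, 0 <= t -> 1 + eta <= w 0 t.
Proof.
move=> mu0 hmu; have [Psi PsiP] := Psi_exists co.
have al0 := al_gt0 co; have m0 := profile_mass prof.
pose C1 := mu / psi 0; have C10 : 0 < C1 by rewrite divr_gt0.
have [dg dg0 hg] : exists2 d, 0 < d & forall x, `|x - 0| < d -> coef_ratio phi psi x < C1.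
  have [|d d0 hd] := continuous_ltc (g_cont co zero01) (c := C1).
    by rewrite /coef_ratio (phi_at0 co) mul0r.
  by exists d => // x /hd.
pose x2 := Num.min (dg / 2) (1 / 2).
have x20 : 0 < x2 by rewrite /x2 lt_min !divr_gt0.
have : x2 <= x2 := lexx _; rewrite {2}/x2 le_min => /andP[x2d x2h].
pose x1 := x2 / 2; have x10 : 0 < x1 by rewrite divr_gt0.
have x12 : x1 < x2 by rewrite /x1; move: x20; slra.
have g2 : coef_ratio phi psi x2 <= C1.
  by apply/ltW/hg; rewrite subr0 gtr0_norm//; move: x2d dg0; slra.
have g1 : coef_ratio phi psi x1 <= C1.
  by apply/ltW/hg; rewrite subr0 gtr0_norm//; move: x2d dg0 x12; slra.
have x11 : 0 < x1 < 1 by rewrite x10; move: x12 x2h; slra.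
clearbody x2.
have [B B0 hB] := dW_lower co x11.
have cB : conv_at phi psi phi1 psi1 B x1.
  by apply: (conv_atP co B0) => x _ x1x xx; apply: hB; rewrite x1x.
pose G1 := Gam phi psi phi1 psi1 al x1.
have G10 : 0 <= G1.
  have p1 : 0 < psi x1 by apply: (psi_gt0 co); case/andP: x11 => /ltW -> ->.
  apply: addr_ge0.
    by rewrite divr_ge0 ?(ltW p1)// (phi_ge0 co)//; case/andP: x11 => /ltW -> /ltW.
  by rewrite divr_ge0 ?mulr_ge0 ?(ltW p1) ?(ltW al0)//; apply/ltW/(W_gt0 co).
have [zeta [zeta0 zetaG]] : exists zeta : R, 0 < zeta /\ 2 * G1 * (psi 0 * zeta) <= 1.
  have p : 0 < 2 * (G1 + 1) * psi 0 by rewrite !mulr_gt0//; move: G10; slra.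
  exists (2 * (G1 + 1) * psi 0)^-1; split; first by rewrite invr_gt0.
  by rewrite !mulrA ler_pdivrMr// mul1r ler_pM2r//; move: G10; slra.
have [z' [z'0 z'2 zz]] : exists z' : R, [/\ 0 < z', z' <= 1 / 2 & 1 <= (1 + zeta) * (1 - z') ^+ 2].
  have p : 0 < 2 * (1 + zeta) by move: zeta0; slra.
  (* This makes [(1 + zeta) * (1 - 2 * z') = 1], and the square of [z'] is to spare. *)
  exists (zeta / (2 * (1 + zeta))); split.
  - by rewrite divr_gt0.
  - by rewrite ler_pdivrMr//; move: zeta0; slra.
  - have : (1 + zeta) * (zeta / (2 * (1 + zeta))) = zeta / 2 by field; rewrite gt_eqF//; move: zeta0; slra.
    have : 0 <= (1 + zeta) * (zeta / (2 * (1 + zeta))) ^+ 2.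
      by rewrite mulr_ge0 ?sqr_ge0//; move: zeta0; slra.
    move: (zeta / (2 * (1 + zeta))) => y; rewrite !expr2; slra.
have e0 : 0 < (1 / 4 : R) by rewrite divr_gt0.
have [d' d'01 lip'] := profile_lip prof e0.
pose d := Num.min d' (1 / 2).
have dd' : d <= d' by rewrite /d ge_min lexx.
have d2 : d <= 1 / 2 by rewrite /d ge_min lexx orbT.
have d01 : 0 < d < 1.
  apply/andP; split; last by move: d2; slra.
  by rewrite /d lt_min divr_gt0// andbT; case/andP: d'01.
have lip x y : 1 - d <= x -> x <= y -> y < 1 ->
    `|life w0 h0 y - life w0 h0 x| <= 1 / 4 * (y - x).
  by move=> dx; apply: lip'; move: dx dd'; slra.
clearbody d.
have [T1 T10 hT1] := profile_late prof d01.
have eT0 : 0 < expR (- T1) / 2 by rewrite divr_gt0 ?expR_gt0.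
have [zs zs01 hzs] := profile_lim prof eT0; have /andP[zs0 zs1] := zs01.
have eN : expR (- T1) <= 1 by rewrite -expR0 ler_expR oppr_le0.
have eN0 := expR_gt0 (- T1).
have eE : expR T1 * expR (- T1) = 1 by rewrite -expRD subrr expR0.
pose xs := 1 - expR (- T1) * ((1 - zs) / 2).
have xs1 : xs < 1.
  by rewrite /xs ltrBlDr ltrDl mulr_gt0// divr_gt0// subr_gt0.
have xs0 : 0 <= xs.
  rewrite /xs subr_ge0; have : expR (- T1) * ((1 - zs) / 2) <= 1 * ((1 - zs) / 2).
    by rewrite ler_wpM2r// divr_ge0// subr_ge0 ltW.
  by move: zs0; slra.
have xsT t : t <= T1 -> expR t * (1 - xs) <= (1 - zs) / 2.
  move=> tT; have -> : 1 - xs = expR (- T1) * ((1 - zs) / 2) by rewrite /xs; ring.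
  rewrite mulrA -expRD ler_piMl// ?divr_ge0 ?subr_ge0 ?(ltW zs1)//.
  by rewrite -expR0 ler_expR subr_le0.
clearbody xs.
have ep := expR_gt0 (- psi 0).
have x21 : x2 < 1 by move: x2h; slra.
(* [x5] must dominate the reach of one unit of the clock from [x2], the interval of [near_uniform],
   and [xs], which provides the initial spread. *)
have [x5 [x25 x51 x45 [z'5 xs5]]] : exists x5, [/\ x2 < x5, x5 < 1,
    1 - (1 - x2) * expR (- psi 0) <= x5 & 1 - z' <= x5 /\ xs <= x5].
  pose q := 1 - (1 - x2) * expR (- psi 0).
  exists (Num.max ((1 + x2) / 2) (Num.max q (Num.max (1 - z') xs))); split.
  - by rewrite lt_max; apply/orP; left; move: x21; slra.
  - rewrite !gt_max xs1 andbT; apply/and3P; split; [move: x21; slra| |move: z'0; slra].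
    by rewrite /q ltrBlDr ltrDl mulr_gt0// subr_gt0.
  - by rewrite !le_max -/q lexx orbT.
  - by rewrite !le_max !lexx !orbT.
pose C5 := gap_const psi Psi B x1 x2 x5.
have C51 : 1 <= C5 := gap_const_ge1 co Psi B x10 x12 x25 x51.
have C50 : 0 < C5 by apply: lt_le_trans C51.
pose E := expR (- (al / 2)).
have E1 : 0 < 1 - E by rewrite subr_gt0 -expR0 ltr_expR oppr_lt0 divr_gt0.
pose r := psi 0 / al; have r0 : 0 < r by rewrite divr_gt0.
have r3 : 0 < (3 + 2 * r) * C5 by rewrite mulr_gt0//; move: r0; slra.
have [Ns [Ns0 Nsz Nsa]] : exists Ns : R, [/\ 0 < Ns, C5 * Ns <= z' / 4 & (3 + 2 * r) * (C5 * Ns) <= 1 - E].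
  exists (Num.min (z' / 4 / C5) ((1 - E) / ((3 + 2 * r) * C5))); split.
  - by rewrite lt_min !divr_gt0.
  - by rewrite mulrC -ler_pdivlMr// ge_min lexx.
  - by rewrite mulrA mulrC -ler_pdivlMr// ge_min lexx orbT.
pose s1 := (1 - zs) / 2 / C5; have s10 : 0 < s1 by rewrite !divr_gt0// subr_gt0.
pose wc := weak_const phi psi phi1 psi1 al Psi x1 x2 x5 C1.
have wc0 : 0 < wc by apply: (weak_const_gt0 co PsiP).
have pN : 0 < 1 + C5 * Ns by rewrite addr_gt0// mulr_gt0.
have ps : 0 < 1 + C5 * s1 by rewrite addr_gt0// mulr_gt0.
have [m [mm0 mN ms]] : exists m : R, [/\ 0 < m, m * (1 + C5 * Ns) <= wc * Ns & m * (1 + C5 * s1) <= wc * s1].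
  exists (Num.min (wc * Ns / (1 + C5 * Ns)) (wc * s1 / (1 + C5 * s1))); split.
  - by rewrite lt_min !divr_gt0// mulr_gt0.
  - by rewrite -ler_pdivlMr// ge_min lexx.
  - by rewrite -ler_pdivlMr// ge_min lexx orbT.
pose del := (1 - x2) * (1 - (1 + 3 / 4 * m)^-1).
have del0 : 0 < del.
  rewrite mulr_gt0 ?subr_gt0// invf_lt1; move: mm0; slra.
exists (Num.min del ((1 - xs) / 2)); first by rewrite lt_min del0 divr_gt0// subr_gt0.
move=> kappa F w H sol t t0.
have kc := sol_kcont sol; have kp := sol_kgt0 sol; have fl := sol_flow sol.
have w1 := sol_ge1 sol t0.
have Fxs s : 0 <= s -> s <= T1 -> zs + (1 - zs) / 2 <= F xs s.
  move=> s0 sT; have xsin : 0 <= xs < 1 by rewrite xs0.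
  by have := flow_near1 co sol xsin s0; move: (xsT s sT); slra.
have [tT|Tt] := leP t T1.
  have xsin : 0 <= xs < 1 by rewrite xs0.
  have [F0 F1] := andP (flow_in fl xsin t0).
  have wx : w xs t <= 1 / 2.
    rewrite (sol_w sol xsin t0).
    have h1 : w0 (F xs t) <= expR (- T1) / 2.
      apply: le_trans (ltW hzs); apply: (mass_ninc m0) => //.
      by have := Fxs t t0 tT; move: zs1; slra.
    have h2 : expR t <= expR T1 by rewrite ler_expR.
    have h3 := ler_pM (expR_ge0 t) (ltW (mass_gt0 m0 (introT andP (conj F0 F1)))) h2 h1.
    by apply: (le_trans h3); rewrite mulrA eE.
  have sp := sol_mass_split sol t0 xsin.
  have d0 : 0 <= 1 - xs by rewrite subr_ge0 ltW.
  have := ler_wpM2l d0 wx; have := ler_wpM2l d0 w1.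
  have : Num.min del ((1 - xs) / 2) <= (1 - xs) / 2 by rewrite ge_min lexx orbT.
  by move: (Num.min _ _) sp => y; slra.
have [K Kd] := @primitive_exists R kappa (-1) (t + 1) (fun s _ => kc s).
have kC s : 0 <= s -> C1 <= kappa s.
  move=> s0; have := kappa_lower co sol s0 => h; have hm := hmu _ _ _ _ sol s s0.
  rewrite /C1 ler_pdivrMr//.
  have kps : 0 < kappa s * psi 0 by rewrite mulr_gt0.
  have h2 : 1 <= kappa s * psi 0 * (1 / mu).
    have := ler_wpM2l (ltW kps) hm; move: h kps; slra.
  by move: h2; rewrite mulrA mulr1 ler_pdivlMr// mul1r.
have late s : T1 <= s -> 1 - d <= F 0 s.
  move=> Ts; have s0 := le_trans T10 Ts.
  apply: (flow_late co prof sol d01 s0); apply: (lt_le_trans hT1).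
  rewrite ler_pM2r ?ler_expR//; apply: (mass_gt0 m0).
  by case/andP: d01 => a b; apply/andP; split; move: a b d2; slra.
(* Start of the induction: [w 0 T1 >= 1] forces [F 0 T1 <= zs], while [F x5 T1] is at least the
   midpoint of [[zs, 1]]; [total_gap] and [L <= 1] conclude. *)
have sT : s1 <= spread w0 h0 F x1 x2 T1.
  have v1 s : 0 < s < T1 -> velocity phi psi kappa s x1 <= 0.
    move=> /andP[s0 _]; rewrite /velocity subr_le0 -ler_pdivrMr; last first.
      by apply: (psi_gt0 co); case/andP: x11 => /ltW -> ->.
    by apply: (le_trans g1); apply: kC; exact: ltW.
  have tg := total_gap co PsiP sol B0 cB x10 x12 x25 x51 T10 v1; rewrite -/C5 in tg.
  have F0 : F 0 T1 <= zs.
    rewrite leNgt; apply/negP => zF.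
    have [_ F01] := andP (flow_in fl zero01 T10).
    have h1 := mass_ninc m0 zs0 (ltW zF) F01.
    have h2 := sol_ge1 sol T10; rewrite (sol_w sol zero01 T10) in h2.
    have : expR T1 * w0 (F 0 T1) < expR T1 * (expR (- T1) / 2).
      by rewrite ltr_pM2l ?expR_gt0// (le_lt_trans h1).
    by rewrite mulrA eE; move: h2; slra.
  have F5 : zs + (1 - zs) / 2 <= F x5 T1.
    by apply: (le_trans (Fxs T1 T10 (lexx _))); apply: (flow_le co kc kp fl).
  have dF : s1 <= F x2 T1 - F x1 T1.
    by rewrite /s1 ler_pdivrMr// mulrC; move: tg F0 F5; slra.
  have x1in : 0 <= x1 < 1 by case/andP: x11 => /ltW -> ->.
  have F1in := flow_in fl x1in T10.
  have L0 := life_gt0 m0 F1in.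
  apply: (le_trans dF); rewrite /spread ler_pdivlMr// ler_piMr//; first by apply: le_trans dF; exact: ltW.
  by have /andP[a _] := F1in; move: a (life_le1 m0 F1in); slra.
have e4 : (1 / 4 : R) <= 1 / 4 := lexx _.
have sl := spread_lower co prof PsiP sol x10 x12 x25 x51 x45 B0 cB C10 kC g1 g2 e0 e4 d01 d2 lip Kd
  zeta0 zetaG z'0 z'2 z'5 zz Nsz Ns0 Nsa T10 late mN ms s10 sT (ltW Tt) ltac:(by rewrite ltrDl).
have := sol_spread_away sol d01 lip t0 (late t (ltW Tt)) (ltW x10) x12 x21 mm0 sl.
rewrite -/del; have : Num.min del ((1 - xs) / 2) <= del by rewrite ge_min lexx.
by move: (Num.min _ _) => y; slra.
Qed.
End AwayOne.

(** * Time average of kappa *)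

Section Asymptotics.
Variables (R : realType) (phi psi phi1 psi1 dW : R -> R) (al be : R).
Hypothesis co : coefs phi psi phi1 psi1 dW al be.
Variables (w0 h0 : R -> R).
Hypothesis prof : profile w0 h0.
Local Notation L := (life w0 h0).
Implicit Types (X Y : R -> R) (a s t x y z : R).

Let m0 := profile_mass prof.

Let zero01 : 0 <= (0 : R) < 1.
Proof. by rewrite lexx ltr01. Qed.

Let w0gt0 x : 0 <= x < 1 -> 0 < w0 x. Proof. exact: (mass_gt0 m0). Qed.

Let h0E x : 0 <= x < 1 -> h0 x = L x * w0 x.
Proof. by move=> x01; rewrite /life mulfVK// gt_eqF// w0gt0. Qed.

Let h0gt0 x : 0 <= x < 1 -> 0 < h0 x.
Proof. by move=> x01; rewrite h0E// mulr_gt0 ?w0gt0// (life_gt0 m0). Qed.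

Ltac drop_facts ::= clear - co prof m0 zero01 w0gt0 h0E h0gt0.

(* Since (ln h0)' = - 1 / L and L u <= L z + e (z - u), the function
   ln (h0 u) - ln (L z + e (z - u)) / e is nonincreasing on [1 - d, z]. *)
Lemma life_lower e d z : 0 < e -> 0 < d < 1 ->
  (forall x y, 1 - d <= x -> x <= y -> y < 1 -> `|L y - L x| <= e * (y - x)) ->
  1 - d <= z -> z < 1 ->
  e * ln (h0 z) + ln (L z + e * (z - (1 - d))) <= e * ln (h0 (1 - d)) + ln (L z).
Proof.
move=> e0 /andP[d0 d1] lip dz z1; have u0 : 0 < 1 - d by rewrite subr_gt0.
have z01 : 0 <= z < 1 by rewrite z1 (le_trans (ltW u0)).
have Lz := life_gt0 m0 z01; set eta := L z in Lz *.
pose f u := e * ln (h0 u) - ln (eta + e * (z - u)).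
suff : f z <= f (1 - d) by rewrite /f subrr mulr0 addr0; slra.
have pos u : u <= z -> 0 < eta + e * (z - u).
  by move=> uz; rewrite ltr_wpDr// mulr_ge0 ?(ltW e0)// subr_ge0.
apply: (@le0_derive_ge _ f (fun u => e * (- w0 u / h0 u) - - e / (eta + e * (z - u)))) => //.
- move=> u /andP[du uz]; have u01 : 0 < u < 1 by rewrite (lt_trans u0 du) (lt_trans uz).
  have u01' : 0 <= u < 1 by case/andP: u01 => /ltW -> ->.
  have ? := is_derive_ln_comp (h0gt0 u01') (mass_der m0 u01).
  have dl : is_derive u 1 (fun v => eta + e * (z - v)) (- e).
    by apply: is_derive_eq; rewrite /GRing.scale/=; ring.
  have ? := @is_derive_ln_comp _ (fun v => eta + e * (z - v)) u _ (pos u (ltW uz)) dl.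
  by apply: is_derive_eq; rewrite /GRing.scale/=; ring.
- move=> u /andP[du uz]; have u01 : 0 <= u < 1 by rewrite (ltW (lt_trans u0 du)) (lt_trans uz).
  have := lip u z (ltW du) (ltW uz) z1; rewrite ler_norml -/eta => /andP[h _].
  have Lu := life_gt0 m0 u01; have p := pos u (ltW uz).
  have -> : - w0 u / h0 u = - (L u)^-1.
    by rewrite h0E//; field; rewrite !gt_eqF// w0gt0.
  have h1 : (eta + e * (z - u))^-1 <= (L u)^-1 by rewrite lef_pV2 ?posrE//; move: h; slra.
  by have := ler_wpM2l (ltW e0) h1; slra.
- move=> u /andP[du uz]; have u01 : 0 <= u < 1 by rewrite (ltW (lt_le_trans u0 du)) (le_lt_trans uz).
  apply: continuousB.
    apply: continuousM; first exact: cst_continuous.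
    by apply: (continuous_ln_comp (h0gt0 u01)); exact: (mass_cont m0).
  apply: (@continuous_ln_comp _ (fun v => eta + e * (z - v)) u (pos u uz)).
  apply: continuousD; first exact: cst_continuous.
  apply: continuousM; first exact: cst_continuous.
  by apply: continuousB; [exact: cst_continuous|exact: cvg_id].
Qed.

Section OneSolution.
Variables (kappa : R -> R) (F w H : R -> R -> R).
Hypothesis sol : solution phi psi w0 kappa F w H.
Local Notation path := (trajectory phi psi kappa).
Local Notation vel := (velocity phi psi kappa).

Let kc := sol_kcont sol.
Let kp := sol_kgt0 sol.
Let fl := sol_flow sol.

(** [kappa_upper] with [c = 1]: the affine bound is [phi - k psi <= (al k - be) (x - 1)], and
    [s = al k - be = 2 / eta] satisfies [1 + s < s (1 + eta)]. *)
Lemma kappa_le eta t : 0 < eta -> 0 <= t -> 1 + eta <= w 0 t -> kappa t <= (be + 2 / eta) / al.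
Proof.
move=> eta0 t0 wt; have a0 := al_gt0 co; have b0 := be_gt0 co.
have s0 : 0 < 2 / eta by rewrite divr_gt0.
apply: (kappa_upper co sol t0 s0 (c := 1)).
- by rewrite ltr01 lexx.
- move=> x /andP[x0 x1]; have x01 : 0 <= x <= 1 by rewrite x0 ltW.
  have h1 := phi_le co x01; have h2 := psi_ge co x01.
  have k0 : 0 <= (be + 2 / eta) / al by rewrite divr_ge0 ?(ltW a0)// ltW// addr_gt0.
  have := ler_wpM2l k0 h2; rewrite mulrA mulfVK ?gt_eqF//.
  by move: h1; move: (2 / eta) => y; lra.
- rewrite mulr1; have := ler_wpM2l (ltW s0) wt; rewrite mulrDr mulr1 mulfVK ?gt_eqF//.
  by move: (2 / eta) => y; lra.
Qed.

Section Clock.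
Variables (T : R) (K : R -> R).
Hypothesis T0 : 0 <= T.
Hypothesis Kd : forall s, -1 < s < T + 1 -> is_derive s 1 K (kappa s).

Let Kd' s : 0 <= s <= T -> is_derive s 1 K (kappa s).
Proof. by move=> /andP[s0 sT]; apply: Kd; apply/andP; split; move: s0 sT; lra. Qed.

Let in' s : 0 < s < T -> 0 <= s <= T.
Proof. by move=> /andP[/ltW -> /ltW ->]. Qed.

(** The linear bounds of [phi] and [psi] at 1 give [ln (1 - X)] a derivative of at least
    [al kappa - be]. For the trajectory ending at [(0, T)] this bounds [al K - be T] from above. *)
Lemma clock_le X : path T X ->
  ln (1 - X 0) - al * K 0 <= ln (1 - X T) + be * T - al * K T.
Proof.
move=> pX; pose f s := ln (1 - X s) + be * s - al * K s.
suff : f 0 <= f T by rewrite /f mulr0 addr0.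
have pos s : 0 <= s <= T -> 0 < 1 - X s.
  by move=> /(path_in pX)/andP[_]; rewrite subr_gt0.
apply: (@ge0_derive_le _ f (fun s => (0 - vel s (X s)) / (1 - X s) + be - al * kappa s)) => //.
- move=> s sT; have ? := Kd' (in' sT); have ? := path_der pX sT.
  have d1 : is_derive s 1 (fun s => 1 - X s) (0 - vel s (X s)) by apply: is_deriveB.
  have ? := @is_derive_ln_comp _ (fun s => 1 - X s) s _ (pos s (in' sT)) d1.
  by apply: is_derive_eq; rewrite /GRing.scale/=; ring.
- move=> s sT; have p := pos s (in' sT); have /andP[X0 X1] := path_in pX (in' sT).
  have x01 : 0 <= X s <= 1 by rewrite X0 ltW.
  have h1 := phi_le co x01; have h2 := psi_ge co x01.
  have h3 := ler_wpM2l (ltW (kp s)) h2.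
  have : (al * kappa s - be) <= (0 - vel s (X s)) / (1 - X s).
    by rewrite ler_pdivlMr// /velocity; move: h1 h3; lra.
  lra.
- move=> s sT; apply: continuousB.
    apply: continuousD.
      apply: (@continuous_ln_comp _ (fun s => 1 - X s) s (pos s sT)).
      by apply: continuousB; [exact: cst_continuous|exact: path_cont pX].
    by apply: continuousM; [exact: cst_continuous|exact: cvg_id].
  by apply: continuousM; [exact: cst_continuous|exact: is_derive_continuous (Kd' sT)].
Qed.

(** For the opposite bound, linearising at 1 leaves an error of order [(1 - Y) (1 + kappa)], whose
    time integral must be controlled. For the three solutions [X < Y < 1], strong concavity gives
    [ln ((Y - X) / (1 - X))] a derivative of at least [(p + kappa q) (1 - Y)]. The multiple [M] of
    this logarithm absorbs the error, which is then paid only through its values at times 0 and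
    [T]. *)
Lemma clock_lower X Y C M p q : path T X -> path T Y -> (forall s, 0 <= s <= T -> X s < Y s) ->
  (forall x, 0 <= x -> x <= 1 ->
      be * (1 - x) - C * (1 - x) ^+ 2 <= phi x /\ psi x <= al * (1 - x) + C * (1 - x) ^+ 2) ->
  (forall x y, 0 <= x -> x < y -> y < 1 ->
      p * (1 - y) <= (phi y - phi x) / (y - x) + phi x / (1 - x) /\
      (psi y - psi x) / (y - x) + psi x / (1 - x) <= - (q * (1 - y))) ->
  0 <= M -> (forall s, 0 <= s <= T -> C * (1 + kappa s) <= M * (p + kappa s * q)) ->
  ln (1 - Y T) + be * T - al * K T - M * (ln (Y T - X T) - ln (1 - X T)) <=
  ln (1 - Y 0) - al * K 0 - M * (ln (Y 0 - X 0) - ln (1 - X 0)).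
Proof.
move=> pX pY XY tay str M0 kM.
pose f s := ln (1 - Y s) + be * s - al * K s - M * (ln (Y s - X s) - ln (1 - X s)).
suff : f T <= f 0 by rewrite /f mulr0 addr0.
have posX s : 0 <= s <= T -> 0 < 1 - X s.
  by move=> /(path_in pX)/andP[_]; rewrite subr_gt0.
have posY s : 0 <= s <= T -> 0 < 1 - Y s.
  by move=> /(path_in pY)/andP[_]; rewrite subr_gt0.
have posD s : 0 <= s <= T -> 0 < Y s - X s by move=> /XY; rewrite subr_gt0.
pose df s := (0 - vel s (Y s)) / (1 - Y s) + be - al * kappa s -
  M * ((vel s (Y s) - vel s (X s)) / (Y s - X s) - (0 - vel s (X s)) / (1 - X s)).
apply: (@le0_derive_ge _ f df) => //.
- move=> s sT; have ? := Kd' (in' sT); have ? := path_der pX sT; have ? := path_der pY sT.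
  have d1 : is_derive s 1 (fun s => 1 - X s) (0 - vel s (X s)) by apply: is_deriveB.
  have d2 : is_derive s 1 (fun s => 1 - Y s) (0 - vel s (Y s)) by apply: is_deriveB.
  have d3 : is_derive s 1 (fun s => Y s - X s) (vel s (Y s) - vel s (X s)) by apply: is_deriveB.
  have ? := @is_derive_ln_comp _ (fun s => 1 - X s) s _ (posX s (in' sT)) d1.
  have ? := @is_derive_ln_comp _ (fun s => 1 - Y s) s _ (posY s (in' sT)) d2.
  have ? := @is_derive_ln_comp _ (fun s => Y s - X s) s _ (posD s (in' sT)) d3.
  by apply: is_derive_eq; rewrite /GRing.scale/= /df; ring.
- move=> s sT; have sT' := in' sT; have y1 := posY s sT'; have k0 := kp s.
  have /andP[X0 X1] := path_in pX sT'; have /andP[Y0 Y1] := path_in pY sT'.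
  have [t1 t2] := tay (Y s) Y0 (ltW Y1); have [s1 s2] := str (X s) (Y s) X0 (XY s sT') Y1.
  have h1 : (0 - vel s (Y s)) / (1 - Y s) <= al * kappa s - be + C * (1 - Y s) * (1 + kappa s).
    rewrite ler_pdivrMr// /velocity; have := ler_wpM2l (ltW k0) t2.
    by move: t1; rewrite !expr2; lra.
  have h2 : (p + kappa s * q) * (1 - Y s) <=
     (vel s (Y s) - vel s (X s)) / (Y s - X s) - (0 - vel s (X s)) / (1 - X s).
    have := ler_wpM2l (ltW k0) s2; rewrite /velocity.
    have -> : (phi (Y s) - kappa s * psi (Y s) - (phi (X s) - kappa s * psi (X s))) / (Y s - X s)
       - (0 - (phi (X s) - kappa s * psi (X s))) / (1 - X s) =
      ((phi (Y s) - phi (X s)) / (Y s - X s) + phi (X s) / (1 - X s)) -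
      kappa s * ((psi (Y s) - psi (X s)) / (Y s - X s) + psi (X s) / (1 - X s)) by ring.
    by move: s1; lra.
  have h3 := ler_wpM2l M0 h2; have h4 := ler_wpM2r (ltW y1) (kM s sT').
  by rewrite /df; move: h1 h3 h4; lra.
- move=> s sT; have cX : {for s, continuous X} := path_cont pX; have cY : {for s, continuous Y} := path_cont pY.
  have c1 : {for s, continuous (fun=> 1 : R)} by exact: cst_continuous.
  apply: continuousB.
    apply: continuousB.
      apply: continuousD; first exact: (@continuous_ln_comp _ (fun s => 1 - Y s) s (posY s sT) (continuousB c1 cY)).
      by apply: continuousM; [exact: cst_continuous|exact: cvg_id].
    by apply: continuousM; [exact: cst_continuous|exact: is_derive_continuous (Kd' sT)].
  apply: continuousM; first exact: cst_continuous.
  apply: continuousB; first exact: (@continuous_ln_comp _ (fun s => Y s - X s) s (posD s sT) (continuousB cY cX)).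
  exact: (@continuous_ln_comp _ (fun s => 1 - X s) s (posX s sT) (continuousB c1 cX)).
Qed.
End Clock.

Ltac drop_facts ::= clear - co prof m0 zero01 w0gt0 h0E h0gt0 sol kc kp fl.

(** At [z = 1 / (1 + eta / 2)] the mass forces [w z t <= 1 + eta / 2], whereas [w 0 t >= 1 + eta];
    by [ratio_ge] such a drop takes a definite number of units of [L]. *)
Lemma gap_ge_life e d eta t : 0 < e -> e <= 1 -> 0 < d < 1 ->
  (forall x y, 1 - d <= x -> x <= y -> y < 1 -> `|L y - L x| <= e * (y - x)) ->
  0 < eta -> 0 <= t -> 1 - d <= F 0 t -> 1 + eta <= w 0 t ->
  eta / (4 + 3 * eta) * L (F 0 t) <= F (1 + eta / 2)^-1 t - F 0 t.
Proof.
move=> e0 e1 d01 lip eta0 t0 late wt; set z := (1 + eta / 2)^-1.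
have p0 : 0 < 1 + eta / 2 by move: eta0; lra.
have z0 : 0 < z by rewrite invr_gt0.
have z1 : z < 1 by rewrite invf_lt1//; move: eta0; lra.
have zin : 0 <= z < 1 by rewrite z1 ltW.
have zE : (1 + eta / 2) * z = 1 by rewrite mulfV// gt_eqF.
have /andP[Fz0 Fz1] := flow_in fl zin t0; have F0in := flow_in fl zero01 t0.
have F0z : F 0 t <= F z t by apply: (flow_le co kc kp fl) => //; exact: ltW.
have L0 := life_gt0 m0 F0in.
pose N := (F z t - F 0 t) / L (F 0 t).
have N0 : 0 <= N by rewrite divr_ge0 ?subr_ge0// ltW.
have rg := ratio_ge m0 d01 lip late F0z Fz1; rewrite -/N in rg.
have wz0 : 0 < w z t := sol_gt0 sol t0 zin.
have wz : w z t <= 1 + eta / 2.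
  rewrite -(ler_pM2r z0) zE [leLHS]mulrC; exact: (sol_mass_lower sol t0 zin).
have r1 : w 0 t * (1 - N) <= w z t * (1 + N).
  rewrite !(sol_w sol)// -!mulrA ler_pM2l ?expR_gt0//; apply: (le_trans rg).
  by rewrite ler_pM2l ?w0gt0 ?Fz0// lerD2l ler_piMl.
rewrite -ler_pdivlMr// -/N ler_pdivrMr; last by move: eta0; lra.
have [N1|N1] := leP 1 N.
  have : 0 <= (N - 1) * eta by rewrite mulr_ge0 ?subr_ge0// ltW.
  by move: N1 eta0; lra.
have n1 : 0 <= 1 - N by rewrite subr_ge0 ltW.
have n2 : 0 <= 1 + N by move: N0; lra.
have := ler_wpM2r n1 wt; have := ler_wpM2r n2 wz; move: r1; slra.
Qed.

(** In [life_lower] at [z = F 0 t], write [h0 = L w0] with [w0 (F 0 t) >= exp (- t)]: then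
    [(1 - e) ln L] is at least [- e t] up to a constant, and [1 - e >= 1 / 2] gives the factor 2.
    Lateness for [d / 2] keeps [F 0 t - (1 - d)] away from 0. *)
Lemma life_exp_lower e : 0 < e -> e <= 1 / 2 -> exists C T0 : R,
  [/\ 0 <= C, 0 <= T0 & forall t, T0 <= t -> - (2 * e * t + C) <= ln (L (F 0 t))].
Proof.
move=> e0 e2; have [d d01 lip] := profile_lip prof e0; have /andP[d0 d1] := d01.
have d201 : 0 < d / 2 < 1 by apply/andP; split; move: d0 d1; lra.
have [T0 T00 hT] := profile_late prof d201.
pose c := e * ln (h0 (1 - d)) - ln (e * (d / 2)).
exists (2 * `|c|), T0; split=> [||t Tt]; first by rewrite mulr_ge0.
  by [].
have t0 := le_trans T00 Tt.
have late : 1 - d / 2 <= F 0 t.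
  apply: (flow_late co prof sol d201 t0); apply: (lt_le_trans hT).
  rewrite ler_pM2r ?ler_expR//; apply: w0gt0; apply/andP; split; move: d0 d1; lra.
have Fin := flow_in fl zero01 t0; have /andP[F0 F1] := Fin.
have L0 := life_gt0 m0 Fin; have W0 := w0gt0 Fin.
have l1 : 1 - d <= F 0 t by move: late d0; lra.
have := life_lower e0 d01 lip l1 F1; rewrite h0E// lnM// mulrDr => ll.
have lw : - t <= ln (w0 (F 0 t)).
  rewrite -[X in X <= _]expRK ler_ln ?posrE ?expR_gt0//.
  have := sol_ge1 sol t0; rewrite (sol_w sol zero01 t0) => h.
  by rewrite expRN -div1r ler_pdivrMr ?expR_gt0// mulrC.
have ed : 0 < e * (d / 2) by rewrite mulr_gt0// divr_gt0.
have h1 : e * (d / 2) <= e * (F 0 t - (1 - d)) by rewrite ler_pM2l//; move: late; lra.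
have le : ln (e * (d / 2)) <= ln (L (F 0 t) + e * (F 0 t - (1 - d))).
  rewrite ler_ln ?posrE//; first by move: L0 h1; lra.
  by move: L0 h1 ed; lra.
have h2 := ler_wpM2l (ltW e0) lw; have cn : e * ln (h0 (1 - d)) - ln (e * (d / 2)) <= `|c| := ler_norm c.
have c0 := normr_ge0 c; move: (`|c|) cn c0 => V cn c0.
set l := ln (L (F 0 t)) in ll *.
have key : - (e * t + V) <= (1 - e) * l by move: ll le h2 cn; lra.
have [lp|ln_] := leP 0 l.
  have : 0 <= e * t by rewrite mulr_ge0// ltW.
  by move: c0 lp; slra.
have : (1 - e) * l <= 1 / 2 * l by rewrite ler_wnM2r ?(ltW ln_)//; move: e2; slra.
by move: key; slra.
Qed.

(** [M] depends only on the bounds for [kappa] and on the coefficients; [e] is chosen after it with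
    [2 (1 + M) e <= eps], because the logarithms at time 0 are bounded through [ln (L (F 0 T))]. *)
Lemma clock_asymptotics C1 C2 eta : 0 < C1 -> 0 < eta ->
  (forall s, 0 <= s -> C1 <= kappa s <= C2) -> (forall t, 0 <= t -> 1 + eta <= w 0 t) ->
  forall eps : R, 0 < eps -> exists C T0 : R, 0 <= T0 /\ forall T K, T0 <= T ->
    (forall s, -1 < s < T + 1 -> is_derive s 1 K (kappa s)) ->
    `|al * (K T - K 0) - be * T| <= eps * T + C.
Proof.
move=> C10 eta0 kC wC eps eps0.
have [p [q [p0 q0 pq str]]] := strong co; have [C C0 tay] := taylor1 co.
have C20 : 0 < C2.
  by have /andP[a b] := kC 0 (lexx _); apply: lt_le_trans C10 (le_trans a b).
pose c1 := Num.min 1 C1; have c10 : 0 < c1 by rewrite lt_min ltr01.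
have [M [M0 ME]] : exists M, 0 < M /\ M * (c1 * (p + q)) = C * (1 + C2).
  have cp : 0 < c1 * (p + q) by rewrite mulr_gt0.
  exists (C * (1 + C2) / (c1 * (p + q))); split; last by rewrite mulfVK// gt_eqF.
  by rewrite divr_gt0// mulr_gt0// addr_gt0.
have kM s : 0 <= s -> C * (1 + kappa s) <= M * (p + kappa s * q).
  move=> s0; have /andP[k1 k2] := kC s s0.
  have a1 : c1 * p <= 1 * p by rewrite ler_wpM2r// ge_min lexx.
  have a2 : c1 * q <= kappa s * q by rewrite ler_wpM2r// ge_min k1 orbT.
  have a3 : c1 * (p + q) <= p + kappa s * q by move: a1 a2; lra.
  have := ler_wpM2l (ltW M0) a3; rewrite ME.
  have : C * (1 + kappa s) <= C * (1 + C2) by rewrite ler_pM2l// lerD2l.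
  lra.
pose e := Num.min (1 / 4) (eps / (2 * (1 + M))).
have M1 : 0 < 2 * (1 + M) by move: M0; lra.
have e0 : 0 < e by rewrite lt_min !divr_gt0.
have e4 : e <= 1 / 4 by rewrite ge_min lexx.
have eM : 2 * (1 + M) * e <= eps by rewrite mulrC -ler_pdivlMr// ge_min lexx orbT.
clearbody e.
have [|Ca [T0 [Ca0 T00 hL]]] := @life_exp_lower e e0; first by move: e4; lra.
have [d d01 lip] := profile_lip prof e0; have [T2 T20 hT] := profile_late prof d01.
pose z := (1 + eta / 2)^-1; pose c := eta / (4 + 3 * eta).
have c0 : 0 < c by rewrite divr_gt0//; move: eta0; slra.
have p1 : 0 < 1 + eta / 2 by move: eta0; slra.
have z0 : 0 < z by rewrite invr_gt0.
have z1 : z < 1 by rewrite invf_lt1//; move: eta0; slra.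
have zin : 0 <= z < 1 by rewrite z1 ltW.
exists (Ca * (1 + M) + `|ln (1 - z) + M * ln c|), (Num.max T0 T2).
split; first by rewrite le_max T00.
move=> T K; rewrite ge_max => /andP[TT TT2] Kd; have T0' := le_trans T00 TT.
have late : 1 - d <= F 0 T.
  apply: (flow_late co prof sol d01 T0'); apply: (lt_le_trans hT).
  rewrite ler_pM2r ?ler_expR//; apply: w0gt0; case/andP: d01 => a b.
  by apply/andP; split; move: a b; slra.
have e1 : e <= 1 by move: e4; slra.
have gl := gap_ge_life e0 e1 d01 lip eta0 T0' late (wC T T0').
rewrite -/z -/c in gl.
have Fin := flow_in fl zero01 T0'; have L0 := life_gt0 m0 Fin.
have Fzin := flow_in fl zin T0'.
have [X [pX XT FX]] := fl zero01 T0'; have [Y [pY YT FY]] := fl zin T0'.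
have XY s : 0 <= s <= T -> X s < Y s.
  by move=> st; apply: (path_lt_back co kc kp pX pY st); rewrite XT YT.
have hX := clock_le T0' Kd pX.
have hY := clock_lower T0' Kd pX pY XY tay str (ltW M0) (fun s hs => kM s (proj1 (andP hs))).
rewrite XT YT -FX -FY !subr0 ln1 in hX hY.
have hLT := hL T TT.
have /andP[F0 F1] := Fin; have /andP[Fz0 Fz1] := Fzin.
have q1 : ln (L (F 0 T)) <= ln (1 - F 0 T).
  by rewrite ler_ln ?posrE ?subr_gt0// (life_le1 m0).
have q2 : ln (1 - F 0 T) <= 0 by rewrite ln_le0// lerBlDr lerDl.
have q3 : ln (1 - F z T) <= 0 by rewrite ln_le0// lerBlDr lerDl.
have q4 : ln c + ln (L (F 0 T)) <= ln (F z T - F 0 T).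
  have cL : 0 < c * L (F 0 T) by rewrite mulr_gt0.
  by rewrite -lnM// ler_ln ?posrE//; exact: lt_le_trans gl.
have q5 : ln z <= 0 by rewrite ln_le0// ltW.
have q6 : 2 * e * T <= eps * T.
  rewrite ler_wpM2r//; have : 0 <= M * e by rewrite mulr_ge0 ?ltW.
  by move: eM; slra.
have q7 : 2 * M * e * T <= eps * T by rewrite ler_wpM2r//; move: eM e0; slra.
have Mq4 := ler_wpM2l (ltW M0) q4; have Mq5 := mulr_ge0_le0 (ltW M0) q5.
have Mq2 := mulr_ge0_le0 (ltW M0) q2; have ML := ler_wpM2l (ltW M0) hLT.
have CM : 0 <= Ca * M by rewrite mulr_ge0// ltW.
have := ler_norm (- (ln (1 - z) + M * ln c)); rewrite normrN.
have := normr_ge0 (ln (1 - z) + M * ln c).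
rewrite ler_norml.
move: (`|ln (1 - z) + M * ln c|) hX hY hLT q1 q3 q6 q7 Mq4 Mq5 Mq2 ML CM => V hX hY hLT q1 q3 q6 q7 Mq4 Mq5 Mq2 ML CM V0 V1.
apply/andP; split.
- by move: hY q3 q7 Mq4 Mq5 Mq2 ML V1 Ca0 V0; slra.
- by move: hX q1 hLT q6 CM V0; slra.
Qed.
End OneSolution.
End Asymptotics.

(** * Derivatives within an interval *)

Section OneSided.
Variable R : realType.
Implicit Types (f : R -> R) (x y z l a b : R).

(** Composition with this projection extends a function on [[a, b]] continuously to the line, so
    that two-sided notions apply to it. *)
Definition clamp a b x := Num.max a (Num.min x b).

Lemma clamp_id a b x : a <= x <= b -> clamp a b x = x.
Proof. by move=> /andP[ax xb]; rewrite /clamp min_l// max_r. Qed.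

Lemma clamp_in a b x : a <= b -> a <= clamp a b x <= b.
Proof. by move=> ab; rewrite /clamp le_max lexx/= ge_max ab ge_min lexx orbT. Qed.

Ltac drop_facts ::= clear - R.

Lemma clamp_lip a b x y : a <= b -> `|clamp a b x - clamp a b y| <= `|x - y|.
Proof.
move=> ab; rewrite /clamp.
have gen u v : u <= v -> 0 <= Num.max a (Num.min v b) - Num.max a (Num.min u b) <= v - u.
  move=> uv; case: (leP v b) => l1; case: (leP u b) => l2;
    case: (leP a u) => l3; case: (leP a v) => l4; case: (leP a b) => l5;
    by apply/andP; split; move: uv l1 l2 l3 l4 l5 ab; slra.
have [xy|/ltW yx] := leP x y.
  rewrite distrC [leRHS]distrC; have /andP[h0 h1] := gen _ _ xy.
  by rewrite !ger0_norm// subr_ge0.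
have /andP[h0 h1] := gen _ _ yx.
by rewrite !ger0_norm// subr_ge0.
Qed.

Definition cont_on a b f x := forall e : R, 0 < e ->
  exists2 d : R, 0 < d & forall y, a <= y <= b -> `|y - x| < d -> `|f y - f x| < e.

Definition slope_on a b f x l := forall e : R, 0 < e ->
  exists2 d : R, 0 < d & forall y, a <= y <= b -> `|y - x| < d -> y != x ->
    `|(f y - f x) / (y - x) - l| <= e.

Lemma cont_on_clamp a b f x : a <= b -> cont_on a b f (clamp a b x) ->
  {for x, continuous (fun y => f (clamp a b y))}.
Proof.
move=> ab fc; apply/continuous_for_dist => e e0; have [d d0 hd] := fc e e0.
exists d => // y yx; apply: hd; first exact: clamp_in.
exact: le_lt_trans (clamp_lip _ _ ab) yx.
Qed.

Lemma slope_on_cont a b f x l : slope_on a b f x l -> cont_on a b f x.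
Proof.
move=> fs e e0; have [d d0 hd] := fs 1 ltr01.
have p : 0 < 1 + `|l| by rewrite ltr_pwDl.
exists (Num.min d (e / (1 + `|l|))); first by rewrite lt_min d0 divr_gt0.
move=> y yab; rewrite lt_min => /andP[yd ye].
have [->|yx] := eqVneq y x; first by rewrite subrr normr0.
have yx0 : y - x != 0 by rewrite subr_eq0.
have h := hd y yab yd yx.
have -> : f y - f x = (f y - f x) / (y - x) * (y - x) by rewrite mulfVK.
rewrite normrM; apply: (@le_lt_trans _ _ ((1 + `|l|) * `|y - x|)).
  rewrite ler_wpM2r//; have := ler_normD ((f y - f x) / (y - x) - l) l; rewrite subrK; lra.
by rewrite mulrC -ltr_pdivlMr.
Qed.

Lemma slope_on_is_derive a b f x l : slope_on a b f x l -> a < x < b ->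
  is_derive x 1 (fun y => f (clamp a b y)) l.
Proof.
move=> fs /andP[ax xb]; apply: is_derive_eps => e e0; have [d d0 hd] := fs e e0.
exists (Num.min d (Num.min (x - a) (b - x))); first by rewrite !lt_min d0 !subr_gt0 ax.
move=> y; rewrite !lt_min => /and3P[yd]; rewrite !ltr_norml => /andP[h1 h2] /andP[h3 h4] yx.
have yab : a <= y <= b by apply/andP; split; lra.
by rewrite !clamp_id ?hd//; rewrite !ltW.
Qed.

Lemma deriv01P f x : derivable01 f x -> slope_on 0 1 f x (deriv01 f x).
Proof.
move=> fd e e0; have /cvgrPdist_le/(_ _ e0) : diff_quotient f x y @[y --> within `[0, 1] x^'] --> deriv01 f x := fd.
rewrite /within/= => /nbhs_ballP[d /= d0 hd]; exists d => // y y01 yx ynx.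
by rewrite distrC; apply: hd => //; rewrite /ball/= distrC.
Qed.

Lemma within_cont_on a b f x : {within `[a, b], continuous f} -> a <= x <= b -> cont_on a b f x.
Proof.
move=> /subspace_continuousP fc xab e e0.
have /cvgrPdist_lt/(_ _ e0) := fc x ltac:(by rewrite /= in_itv).
rewrite /within/= => /nbhs_ballP[d /= d0 hd]; exists d => // y yab yx.
rewrite distrC; apply: hd; first by rewrite /ball/= distrC.
by rewrite /= in_itv.
Qed.

(* f restricted to [x, y] is extended continuously by clamping. *)
Lemma cont_on_ge0_derive_le f df a b x y : a <= x -> x <= y -> y <= b ->
  (forall z, x <= z <= y -> cont_on a b f z) ->
  (forall z, x < z < y -> slope_on a b f z (df z)) ->
  (forall z, x < z < y -> 0 <= df z) -> f x <= f y.
Proof.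
move=> ax xy yb fc fs df0.
have ab : a <= b by apply: le_trans yb; exact: le_trans xy.
have xab : a <= x <= b by rewrite ax (le_trans xy).
have yab : a <= y <= b by rewrite yb (le_trans ax).
have in_ z : x <= z <= y -> a <= z <= b.
  by move=> /andP[xz zy]; rewrite (le_trans ax xz) (le_trans zy).
have := @ge0_derive_le _ (fun z => f (clamp a b z)) df x y xy.
rewrite !clamp_id//; apply => //.
- move=> z zxy; apply: (slope_on_is_derive (fs z zxy)).
  by case/andP: zxy => xz zy; rewrite (le_lt_trans ax xz) (lt_le_trans zy).
- by move=> z zxy; apply: cont_on_clamp => //; rewrite (clamp_id (in_ z zxy)); exact: fc.
Qed.
End OneSided.

(** * The coefficients near 1 *)

Section ConcaveEnd.
Variable R : realType.
Implicit Types (x y z l : R).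

Lemma slope_onN a b (f : R -> R) x l : slope_on a b f x l ->
  slope_on a b (fun y => - f y) x (- l).
Proof.
move=> fs e e0; have [d d0 hd] := fs e e0; exists d => // y yab yd yx.
rewrite -normrN; have := hd y yab yd yx; congr (`|_| <= _).
by field; rewrite subr_eq0.
Qed.

Lemma cont_onN a b (f : R -> R) x : cont_on a b f x -> cont_on a b (fun y => - f y) x.
Proof.
move=> fs e e0; have [d d0 hd] := fs e e0; exists d => // y yab yd.
by rewrite -opprD normrN hd.
Qed.

Lemma cont_onD a b (f g : R -> R) x : cont_on a b f x -> cont_on a b g x ->
  cont_on a b (fun y => f y + g y) x.
Proof.
move=> fc gc e e0; have e2 : 0 < e / 2 by rewrite divr_gt0.
have [d1 d10 h1] := fc _ e2; have [d2 d20 h2] := gc _ e2.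
exists (Num.min d1 d2); first by rewrite lt_min d10.
move=> y yab; rewrite lt_min => /andP[y1 y2].
have -> : f y + g y - (f x + g x) = (f y - f x) + (g y - g x) by ring.
apply: le_lt_trans (ler_normD _ _) _.
by have := h1 y yab y1; have := h2 y yab y2; lra.
Qed.

Lemma cont_on_continuous a b (f : R -> R) x : {for x, continuous f} -> cont_on a b f x.
Proof.
move=> /continuous_for_dist fc e e0; have [d d0 hd] := fc e e0.
by exists d => // y _; exact: hd.
Qed.

Lemma slope_on_derive a b (f : R -> R) x l : is_derive x 1 f l -> slope_on a b f x l.
Proof.
move=> fd e e0; have [d d0 hd] := is_derive_quot fd e0.
by exists d => // y _ yx ynx; exact/ltW/hd.
Qed.

Lemma slope_onD a b (f g : R -> R) x l m : slope_on a b f x l -> slope_on a b g x m ->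
  slope_on a b (fun y => f y + g y) x (l + m).
Proof.
move=> fc gc e e0; have e2 : 0 < e / 2 by rewrite divr_gt0.
have [d1 d10 h1] := fc _ e2; have [d2 d20 h2] := gc _ e2.
exists (Num.min d1 d2); first by rewrite lt_min d10.
move=> y yab; rewrite lt_min => /andP[y1 y2] yx.
have -> : (f y + g y - (f x + g x)) / (y - x) - (l + m) =
  ((f y - f x) / (y - x) - l) + ((g y - g x) / (y - x) - m) by ring.
apply: le_trans (ler_normD _ _) _.
by have := h1 y yab y1 yx; have := h2 y yab y2 yx; lra.
Qed.

Variables (f f1 f2 f3 : R -> R).
Hypothesis fc : forall x, 0 <= x <= 1 -> cont_on 0 1 f x.
Hypothesis fs1 : forall x, 0 < x <= 1 -> slope_on 0 1 f x (f1 x).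
Hypothesis fs2 : forall x, 0 < x <= 1 -> slope_on 0 1 f1 x (f2 x).
Hypothesis fs3 : forall x, 0 < x <= 1 -> slope_on 0 1 f2 x (f3 x).
Hypothesis f30 : forall x, 0 < x <= 1 -> 0 <= f3 x.
Hypothesis chord : forall x y z, 0 <= x -> x <= y -> y <= z -> z <= 1 ->
  (f z - f y) * (y - x) <= (f y - f x) * (z - y).

Let lt01 x : 0 < x < 1 -> 0 < x <= 1. Proof. by move=> /andP[-> /ltW ->]. Qed.

Lemma second_incr x y : 0 < x -> x <= y -> y <= 1 -> f2 x <= f2 y.
Proof.
move=> x0 xy y1; apply: (cont_on_ge0_derive_le (df := f3) (ltW x0) xy y1).
- by move=> z /andP[xz zy]; apply/slope_on_cont/fs3; rewrite (lt_le_trans x0 xz) (le_trans zy).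
- by move=> z /andP[xz zy]; apply: fs3; rewrite (lt_trans x0 xz) (le_trans (ltW zy)).
- by move=> z /andP[xz zy]; apply: f30; rewrite (lt_trans x0 xz) (le_trans (ltW zy)).
Qed.

(** By concavity the chord slopes over [[v, 1]] decrease as [v] tends to 1, with limit [f1 1]; any
    other chord is compared with one ending at 1. *)
Lemma end_slope_le x y : 0 <= x -> x <= y -> y <= 1 -> f1 1 * (y - x) <= f y - f x.
Proof.
have one : 0 < (1 : R) <= 1 by rewrite ltr01 lexx.
have key u : 0 <= u -> u < 1 -> f1 1 * (1 - u) <= f 1 - f u.
  move=> u0 u1; rewrite leNgt; apply/negP => lt.
  pose e := (f1 1 - (f 1 - f u) / (1 - u)) / 2.
  have u10 : 0 < 1 - u by rewrite subr_gt0.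
  have e0 : 0 < e by rewrite divr_gt0// subr_gt0 ltr_pdivrMr.
  have [d d0 hd] := fs1 one e0.
  pose v := Num.max ((u + 1) / 2) (1 - d / 2).
  have v1 : v < 1 by rewrite gt_max; apply/andP; split; lra.
  have uv : u < v by rewrite lt_max; apply/orP; left; lra.
  have vd : 1 - d / 2 <= v by rewrite le_max lexx orbT.
  have v01 : 0 <= v <= 1 by rewrite (le_trans u0 (ltW uv)) ltW.
  have := hd v v01; rewrite distrC gtr0_norm ?subr_gt0// => /(_ ltac:(lra)).
  rewrite lt_eqF// => /(_ isT); rewrite ler_norml => /andP[+ _].
  have -> : (f v - f 1) / (v - 1) = (f 1 - f v) / (1 - v).
    by field; rewrite !subr_eq0 [1 == v]eq_sym lt_eqF.
  have v10 : 0 < 1 - v by rewrite subr_gt0.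
  have ch := chord u0 (ltW uv) (ltW v1) (lexx 1).
  have : (f 1 - f v) / (1 - v) <= (f 1 - f u) / (1 - u).
    rewrite ler_pdivrMr// mulrAC ler_pdivlMr//; move: ch; lra.
  by move: e0; rewrite /e; lra.
move=> x0; rewrite le_eqVlt => /orP[/eqP ->|xy]; first by rewrite !subrr mulr0.
rewrite le_eqVlt => /orP[/eqP y1|y1]; first by rewrite y1 in xy *; exact: key.
have k := key y (le_trans x0 (ltW xy)) y1.
have ch := chord x0 (ltW xy) (ltW y1) (lexx 1).
have y10 : 0 < 1 - y by rewrite subr_gt0.
have xy0 : 0 < y - x by rewrite subr_gt0.
rewrite -(ler_pM2r y10); apply: le_trans ch.
by rewrite mulrAC ler_pM2r.
Qed.

Lemma first_decr x y : 0 < x -> x < y -> y < 1 -> f1 y <= f1 x.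
Proof.
move=> x0 xy y1.
have x01 : 0 < x < 1 by rewrite x0 (lt_trans xy).
have y01 : 0 < y < 1 by rewrite y1 (lt_trans x0).
have chc a b c : 0 <= a -> a <= b -> b <= c -> c <= 1 ->
    (f (clamp 0 1 c) - f (clamp 0 1 b)) * (b - a) <= (f (clamp 0 1 b) - f (clamp 0 1 a)) * (c - b).
  move=> a0 ab bc c1; rewrite !clamp_id; first exact: chord.
  - by rewrite a0 (le_trans ab)// (le_trans bc).
  - by rewrite (le_trans a0 ab) (le_trans bc).
  - by rewrite c1 (le_trans a0)// (le_trans ab).
have le01 z : 0 < z < 1 -> 0 <= z <= 1 by move=> /andP[/ltW -> /ltW ->].
have t1 := concave_tangent chc (slope_on_is_derive (fs1 (lt01 x01)) x01) (le01 _ x01) (le01 _ y01).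
have t2 := concave_tangent chc (slope_on_is_derive (fs1 (lt01 y01)) y01) (le01 _ y01) (le01 _ x01).
rewrite !clamp_id ?le01// in t1 t2.
have xy0 : 0 < y - x by rewrite subr_gt0.
by rewrite -(ler_pM2r xy0); move: t1 t2; lra.
Qed.

(** In the interior [f1] is nonincreasing; at 1 the sign passes to the limit by continuity of
    [f2]. *)
Lemma second_le0 x : 0 < x <= 1 -> f2 x <= 0.
Proof.
have inn z : 0 < z < 1 -> f2 z <= 0.
  move=> /andP[z0 z1]; rewrite leNgt; apply/negP => f20.
  have e0 : 0 < f2 z / 2 by rewrite divr_gt0.
  have [d d0 hd] := fs2 (lt01 (introT andP (conj z0 z1))) e0.
  pose v := Num.min ((z + 1) / 2) (z + d / 2).
  have zv : z < v by rewrite lt_min; apply/andP; split; lra.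
  have v1 : v < 1 by rewrite gt_min; apply/orP; left; lra.
  have vd : v <= z + d / 2 by rewrite ge_min lexx orbT.
  have v01 : 0 <= v <= 1 by rewrite (ltW (lt_trans z0 zv)) ltW.
  have := hd v v01; rewrite gtr0_norm ?subr_gt0// => /(_ ltac:(lra)).
  rewrite gt_eqF// => /(_ isT); rewrite ler_norml => /andP[+ _].
  have zv0 : 0 < v - z by rewrite subr_gt0.
  have : (f1 v - f1 z) / (v - z) <= 0 by rewrite pmulr_lle0 ?invr_gt0// subr_le0 first_decr.
  lra.
move=> /andP[x0]; rewrite le_eqVlt => /orP[/eqP x1|x1]; last by apply: inn; rewrite x0.
rewrite x1; rewrite leNgt; apply/negP => f20.
have [d d0 hd] := slope_on_cont (fs3 (introT andP (conj ltr01 (lexx 1)))) f20.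
pose v := Num.max (1 / 2) (1 - d / 2).
have v1 : v < 1 by rewrite gt_max; apply/andP; split; lra.
have v0 : 1 / 2 <= v by rewrite le_max lexx.
have vd : 1 - d / 2 <= v by rewrite le_max lexx orbT.
have := inn v ltac:(apply/andP; split; lra).
have := hd v ltac:(apply/andP; split; lra).
rewrite distrC gtr0_norm ?subr_gt0// => /(_ ltac:(lra)).
by rewrite ltr_norml => /andP[+ _]; lra.
Qed.

Hypothesis f_1 : f 1 = 0.

(* f + (p / 2) x^2 with p = - f'' 1 is still concave, as f'' is nondecreasing. *)
Lemma strong_concave x y : 0 <= x -> x < y -> y < 1 ->
  - f2 1 / 2 * (1 - y) <= (f y - f x) / (y - x) + f x / (1 - x).
Proof.
move=> x0 xy y1; have y0 : 0 < y by apply: le_lt_trans xy.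
pose p := - f2 1.
pose h z := f z + p / 2 * (z * z); pose h1 z := f1 z + p * z.
have le01 z : 0 < z <= 1 -> 0 <= z <= 1 by move=> /andP[/ltW -> ->].
have hc z k : 0 <= z <= 1 -> cont_on 0 1 (fun u => h u + k * u) z.
  move=> z01; apply: cont_onD; last first.
    by apply: cont_on_continuous; apply: continuousM; [exact: cst_continuous|exact: cvg_id].
  apply: cont_onD; first exact: fc.
  apply: cont_on_continuous; apply: continuousM; first exact: cst_continuous.
  by apply: continuousM; exact: cvg_id.
have hs z k : 0 < z <= 1 -> slope_on 0 1 (fun u => h u + k * u) z (h1 z + k).
  move=> z01; apply: slope_onD; last first.
    by apply: slope_on_derive; apply: is_derive_eq; rewrite /GRing.scale/=; ring.
  apply: slope_onD; first exact: fs1.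
  by apply: slope_on_derive; apply: is_derive_eq; rewrite /GRing.scale/=; field.
have h1d u v : 0 < u -> u <= v -> v <= 1 -> h1 v <= h1 u.
  move=> u0 uv v1; rewrite -lerN2.
  apply: (@cont_on_ge0_derive_le _ (fun z => - h1 z) (fun z => - (f2 z + p)) 0 1 _ _ (ltW u0) uv v1).
  - move=> z /andP[uz zv]; apply: cont_onN; apply: cont_onD.
      by apply/slope_on_cont/fs2; rewrite (lt_le_trans u0 uz) (le_trans zv).
    by apply: cont_on_continuous; apply: continuousM; [exact: cst_continuous|exact: cvg_id].
  - move=> z /andP[uz zv]; apply: slope_onN; apply: slope_onD.
      by apply: fs2; rewrite (lt_trans u0 uz) (le_trans (ltW zv)).
    by apply: slope_on_derive; apply: is_derive_eq; rewrite /GRing.scale/=; ring.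
  - move=> z /andP[uz zv]; rewrite oppr_ge0 subr_le0; apply: second_incr => //.
      exact: lt_trans uz.
    exact: le_trans (ltW zv) v1.
have a1 : h1 y * (y - x) <= h y - h x.
  suff : h x + - h1 y * x <= h y + - h1 y * y by lra.
  apply: (@cont_on_ge0_derive_le _ (fun u => h u + - h1 y * u) (fun z => h1 z + - h1 y) 0 1 x y x0 (ltW xy) (ltW y1)).
  - by move=> z /andP[xz zy]; apply: hc; rewrite (le_trans x0 xz) (le_trans zy)// ltW.
  - by move=> z /andP[xz zy]; apply: hs; rewrite (le_lt_trans x0 xz) ltW// (lt_trans zy).
  - by move=> z /andP[xz zy]; rewrite subr_ge0; apply: h1d; [exact: le_lt_trans xz|exact: ltW|exact: ltW].
have a2 : h 1 - h y <= h1 y * (1 - y).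
  suff : - (h y + - h1 y * y) <= - (h 1 + - h1 y * 1) by lra.
  apply: (@cont_on_ge0_derive_le _ (fun u => - (h u + - h1 y * u)) (fun z => - (h1 z + - h1 y)) 0 1 y 1 (ltW y0) (ltW y1) (lexx 1)).
  - by move=> z /andP[yz z1]; apply/cont_onN/hc; rewrite z1 (le_trans (ltW y0)).
  - by move=> z /andP[yz z1]; apply/slope_onN/hs; rewrite (lt_trans y0 yz) ltW.
  - by move=> z /andP[yz z1]; rewrite oppr_ge0 subr_le0; apply: h1d => //; exact: ltW.
have yx : 0 < y - x by rewrite subr_gt0.
have y1' : 0 < 1 - y by rewrite subr_gt0.
have x1' : 0 < 1 - x by lra.
have a3 : (h 1 - h y) * (y - x) <= (h y - h x) * (1 - y).
  have := ler_wpM2r (ltW yx) a2; have := ler_wpM2r (ltW y1') a1; lra.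
have -> : (f y - f x) / (y - x) + f x / (1 - x) =
   ((f y - f x) * (1 - x) + f x * (y - x)) / ((y - x) * (1 - x)).
  by field; rewrite !gt_eqF.
rewrite ler_pdivlMr ?mulr_gt0// -/p.
move: a3; rewrite /h f_1; lra.
Qed.

(** [f2] is nondecreasing, so to the right of 1 / 2 it is at least [f2 (1 / 2)]; integrate twice
    from 1. *)
Lemma end_taylor x : 1 / 2 <= x -> x <= 1 ->
  - f1 1 * (1 - x) + f2 (1 / 2) / 2 * (1 - x) ^+ 2 <= f x.
Proof.
move=> x2 x1; pose m := f2 (1 / 2).
have half : 0 < (1 / 2 : R) by rewrite divr_gt0.
have gt01 z : x <= z <= 1 -> 0 < z <= 1 by move=> /andP[xz ->]; rewrite (lt_le_trans half)// (le_trans x2).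
have lt01' z : x < z < 1 -> 0 < z <= 1.
  by move=> /andP[xz /ltW z1]; apply: gt01; rewrite (ltW xz).
have h1 z : x <= z -> z <= 1 -> f1 z + m * (1 - z) <= f1 1.
  move=> xz z1; have z0 : 0 < z by case/andP: (gt01 z (introT andP (conj xz z1))).
  suff : f1 z + - m * z <= f1 1 + - m * 1 by lra.
  apply: (@cont_on_ge0_derive_le _ (fun u => f1 u + - m * u) (fun u => f2 u + - m) 0 1 z 1 (ltW z0) z1 (lexx 1)).
  - move=> u /andP[zu u1]; apply: cont_onD; first by apply/slope_on_cont/fs2/gt01; rewrite u1 (le_trans xz).
    by apply: cont_on_continuous; apply: continuousM; [exact: cst_continuous|exact: cvg_id].
  - move=> u /andP[zu u1]; apply: slope_onD; first by apply/fs2/lt01'; rewrite u1 (le_lt_trans xz).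
    by apply: slope_on_derive; apply: is_derive_eq; rewrite /GRing.scale/=; ring.
  - move=> u /andP[zu u1]; rewrite subr_ge0; apply: second_incr => //; last exact: ltW.
    by apply: (le_trans x2); rewrite (le_trans xz)// ltW.
have x0 : 0 <= x by lra.
pose q z := m / 2 * ((1 - z) * (1 - z)) + - f1 1 * (1 - z).
have qd z : is_derive z 1 q (- (m * (1 - z)) + f1 1).
  by apply: is_derive_eq; rewrite /GRing.scale/=; field.
have := @cont_on_ge0_derive_le _ (fun z => q z + - f z) (fun z => - (m * (1 - z)) + f1 1 + - f1 z) 0 1 x 1 x0 x1 (lexx 1).
rewrite /q f_1 subrr !mulr0 expr2 => H.
suff : m / 2 * ((1 - x) * (1 - x)) + - f1 1 * (1 - x) + - f x <= 0 + 0 + - 0.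
  by rewrite -/m; lra.
apply: H.
- move=> z xz; apply: cont_onD; first by apply: cont_on_continuous; exact: (is_derive_continuous (qd z)).
  by apply/cont_onN/fc; case/andP: (gt01 z xz) => /ltW -> ->.
- move=> z xz; apply: slope_onD; first by apply: slope_on_derive; exact: qd.
  by apply/slope_onN/fs1/lt01'.
- by move=> z /andP[xz z1]; have := h1 z (ltW xz) (ltW z1); lra.
Qed.
End ConcaveEnd.

(** * Verification of the properties collected in [coefs] *)

Section Build.
Variable R : realType.
Implicit Types (x y z : R).

Lemma slope_on_is_derive_id a b (f : R -> R) x l : slope_on a b f x l -> a < x < b ->
  is_derive x 1 f l.
Proof.
move=> fs /andP[ax xb]; apply: is_derive_eps => e e0; have [d d0 hd] := fs e e0.
exists (Num.min d (Num.min (x - a) (b - x))); first by rewrite !lt_min d0 !subr_gt0 ax.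
move=> y; rewrite !lt_min => /and3P[yd]; rewrite !ltr_norml => /andP[h1 h2] /andP[h3 h4].
by apply: hd => //; apply/andP; split; lra.
Qed.

Lemma cont_onM a b (f g : R -> R) x : a <= x <= b -> cont_on a b f x -> cont_on a b g x ->
  cont_on a b (fun y => f y * g y) x.
Proof.
move=> xab fc gc; have ab : a <= b by case/andP: xab; exact: le_trans.
have cl h : cont_on a b h x -> {for x, continuous (fun y => h (clamp a b y))}.
  by move=> hc; apply: cont_on_clamp => //; rewrite clamp_id.
have /continuous_for_dist fgc := continuousM (cl f fc) (cl g gc).
move=> e e0; have [d d0 hd] := fgc e e0; exists d => // y yab yd.
by have := hd y yd; rewrite /= !clamp_id.
Qed.

Variables (phi phi1 phi2 phi3 psi psi1 psi2 psi3 : R -> R).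
Hypothesis phic : forall x : R, {for x, continuous phi}.
Hypothesis phis1 : forall x, 0 < x <= 1 -> slope_on 0 1 phi x (phi1 x).
Hypothesis phis2 : forall x, 0 < x <= 1 -> slope_on 0 1 phi1 x (phi2 x).
Hypothesis phis3 : forall x, 0 < x <= 1 -> slope_on 0 1 phi2 x (phi3 x).
Hypothesis phi30 : forall x, 0 < x <= 1 -> 0 <= phi3 x.
Hypothesis phi_chord : forall x y z, 0 <= x -> x <= y -> y <= z -> z <= 1 ->
  (phi z - phi y) * (y - x) <= (phi y - phi x) * (z - y).
Hypothesis psic : forall x : R, {for x, continuous psi}.
Hypothesis psis1 : forall x, 0 < x <= 1 -> slope_on 0 1 psi x (psi1 x).
Hypothesis psis2 : forall x, 0 < x <= 1 -> slope_on 0 1 psi1 x (psi2 x).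
Hypothesis psis3 : forall x, 0 < x <= 1 -> slope_on 0 1 psi2 x (psi3 x).
Hypothesis psi30 : forall x, 0 < x <= 1 -> psi3 x <= 0.
Hypothesis psi_chord : forall x y z, 0 <= x -> x <= y -> y <= z -> z <= 1 ->
  (psi y - psi x) * (z - y) <= (psi z - psi y) * (y - x).
Hypotheses (phi_0 : phi 0 = 0) (phi_1 : phi 1 = 0) (psi_1 : psi 1 = 0).
Hypotheses (phi11 : -1 < phi1 1 < 0) (psi11 : psi1 1 < 0) (curv : 0 < psi2 1 - phi2 1).
Hypothesis decr : forall x y, 0 < x -> x <= y -> y < 1 ->
  phi1 y + phi1 1 - phi y * (psi1 y + psi1 1) / psi y <=
  phi1 x + phi1 1 - phi x * (psi1 x + psi1 1) / psi x.

Let Npsis1 x : 0 < x <= 1 -> slope_on 0 1 (fun z => - psi z) x (- psi1 x).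
Proof. by move=> /psis1; exact: slope_onN. Qed.
Let Npsis2 x : 0 < x <= 1 -> slope_on 0 1 (fun z => - psi1 z) x (- psi2 x).
Proof. by move=> /psis2; exact: slope_onN. Qed.
Let Npsis3 x : 0 < x <= 1 -> slope_on 0 1 (fun z => - psi2 z) x (- psi3 x).
Proof. by move=> /psis3; exact: slope_onN. Qed.
Let Npsi30 x : 0 < x <= 1 -> 0 <= - psi3 x.
Proof. by move=> /psi30; rewrite oppr_ge0. Qed.
Let Npsi_chord x y z : 0 <= x -> x <= y -> y <= z -> z <= 1 ->
  (- psi z - - psi y) * (y - x) <= (- psi y - - psi x) * (z - y).
Proof. by move=> x0 xy yz z1; have := psi_chord x0 xy yz z1; lra. Qed.
Let Npsi_1 : - psi 1 = 0. Proof. by rewrite psi_1 oppr0. Qed.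
Let phico x : 0 <= x <= 1 -> cont_on 0 1 phi x.
Proof. by move=> _; exact: cont_on_continuous. Qed.
Let Npsico x : 0 <= x <= 1 -> cont_on 0 1 (fun z => - psi z) x.
Proof. by move=> _; apply: cont_onN; exact: cont_on_continuous. Qed.

Let al := - psi1 1.
Let be := - phi1 1.
Let al0 : 0 < al. Proof. by rewrite oppr_gt0. Qed.
Let be0 : 0 < be. Proof. by rewrite oppr_gt0; case/andP: phi11. Qed.

Let one01 : 0 < (1 : R) <= 1. Proof. by rewrite ltr01 lexx. Qed.

Let half01 : 0 < (1 / 2 : R) <= 1. Proof. by apply/andP; split; lra. Qed.

Let phi_end x y : 0 <= x -> x <= y -> y <= 1 -> - be * (y - x) <= phi y - phi x.
Proof. by move=> x0 xy y1; rewrite opprK; exact: (end_slope_le phis1 phi_chord). Qed.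

Let psi_end x y : 0 <= x -> x <= y -> y <= 1 -> psi y - psi x <= - al * (y - x).
Proof.
by move=> x0 xy y1; rewrite opprK; have := end_slope_le Npsis1 Npsi_chord x0 xy y1; lra.
Qed.

Let phi2_le0 x : 0 < x <= 1 -> phi2 x <= 0.
Proof. exact: (second_le0 phis1 phis2 phis3 phi_chord). Qed.

Let psi2_ge0 x : 0 < x <= 1 -> 0 <= psi2 x.
Proof. by move=> /(second_le0 Npsis1 Npsis2 Npsis3 Npsi_chord); rewrite oppr_le0. Qed.

Let phi2_incr x y : 0 < x -> x <= y -> y <= 1 -> phi2 x <= phi2 y.
Proof. exact: (second_incr phis3 phi30). Qed.

Let psi2_decr x y : 0 < x -> x <= y -> y <= 1 -> psi2 y <= psi2 x.
Proof. by move=> x0 xy y1; rewrite -lerN2; exact: (second_incr Npsis3 Npsi30 x0 xy y1). Qed.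

Let psi_lin x : 0 <= x <= 1 -> al * (1 - x) <= psi x.
Proof. by move=> /andP[x0 x1]; have := psi_end x0 x1 (lexx 1); rewrite psi_1; lra. Qed.

Let phi_lin x : 0 <= x <= 1 -> phi x <= be * (1 - x).
Proof. by move=> /andP[x0 x1]; have := phi_end x0 x1 (lexx 1); rewrite phi_1; lra. Qed.

Let psi_pos x : 0 <= x < 1 -> 0 < psi x.
Proof.
move=> /andP[x0 x1]; apply: lt_le_trans (psi_lin _); last by rewrite x0 ltW.
by rewrite mulr_gt0 ?al0// subr_gt0.
Qed.

Let psi_up x : 0 <= x <= 1 -> psi x <= psi 0 * (1 - x).
Proof.
move=> /andP[x0 x1]; have := psi_chord (lexx 0) x0 x1 (lexx 1); rewrite psi_1; lra.
Qed.

Let phi_pos x : 0 < x < 1 -> 0 < phi x.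
Proof.
move=> /andP[x0 x1]; have e0 : 0 < be / 2 by rewrite divr_gt0 ?be0.
have [d d0 hd] := phis1 one01 e0.
pose u := Num.max x (1 - d / 2).
have u1 : u < 1 by rewrite gt_max x1/=; lra.
have xu : x <= u by rewrite le_max lexx.
have ud : 1 - d / 2 <= u by rewrite le_max lexx orbT.
have u01 : 0 <= u <= 1 by rewrite (le_trans (ltW x0) xu) ltW.
have := hd u u01; rewrite distrC gtr0_norm ?subr_gt0// => /(_ ltac:(lra)).
rewrite lt_eqF// => /(_ isT); rewrite phi_1 subr0 ler_norml => /andP[_ h].
have u10 : 0 < 1 - u by rewrite subr_gt0.
have : phi u / (u - 1) <= - (be / 2) by move: h; rewrite /be; lra.
rewrite -[u - 1]opprB invrN mulrN lerN2 ler_pdivlMr// => hu.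
have pu : 0 < phi u by apply: lt_le_trans hu; rewrite mulr_gt0.
have := phi_chord (lexx 0) (ltW x0) xu (ltW u1); rewrite phi_0 !subr0 => ch.
have : 0 < phi x * u by apply: lt_le_trans (mulr_gt0 pu x0) _; move: ch; lra.
by rewrite pmulr_lgt0//; apply: lt_le_trans xu.
Qed.

Let phi_nneg x : 0 <= x <= 1 -> 0 <= phi x.
Proof.
by move=> /andP[x0 x1]; have := phi_chord (lexx 0) x0 x1 (lexx 1); rewrite phi_0 phi_1; lra.
Qed.

Let W x := phi1 x * psi x - phi x * psi1 x.
Let dW x := phi2 x * psi x - phi x * psi2 x.

Let W_derive x : 0 < x < 1 -> is_derive x 1 W (dW x).
Proof.
move=> x01; have x01' : 0 < x <= 1 by case/andP: x01 => -> /ltW.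
have ? := slope_on_is_derive_id (phis1 x01') x01.
have ? := slope_on_is_derive_id (phis2 x01') x01.
have ? := slope_on_is_derive_id (psis1 x01') x01.
have ? := slope_on_is_derive_id (psis2 x01') x01.
by apply: is_derive_eq; rewrite /GRing.scale/= /dW; ring.
Qed.

Let W_cont x : 0 < x <= 1 -> cont_on 0 1 W x.
Proof.
move=> x01; have x01' : 0 <= x <= 1 by case/andP: x01 => /ltW -> ->.
apply: cont_onD; last apply: cont_onN; apply: cont_onM => //.
- exact: (slope_on_cont (phis2 x01)).
- exact: cont_on_continuous.
- exact: cont_on_continuous.
- exact: (slope_on_cont (psis2 x01)).
Qed.

Let dW_npos x : 0 < x < 1 -> dW x <= 0.
Proof.
move=> /andP[x0 x1]; have x01' : 0 < x <= 1 by rewrite x0 ltW.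
have x01 : 0 <= x <= 1 by rewrite !ltW.
have := mulr_le0_ge0 (phi2_le0 x01') (ltW (psi_pos (introT andP (conj (ltW x0) x1)))).
by have := mulr_ge0 (phi_nneg x01) (psi2_ge0 x01'); rewrite /dW; lra.
Qed.

Ltac drop_facts ::= clear - phic phis1 phis2 phis3 phi30 phi_chord psic psis1 psis2 psis3
  psi30 psi_chord phi_0 phi_1 psi_1 phi11 psi11 curv decr Npsis1 Npsis2 Npsis3 Npsi30
  Npsi_chord Npsi_1 phico Npsico al be al0 be0 one01 half01 phi_end psi_end phi2_le0
  psi2_ge0 phi2_incr psi2_decr psi_lin phi_lin psi_pos psi_up phi_pos phi_nneg W dW
  W_derive W_cont dW_npos.

(** [W] vanishes at 1, and [- W' >= (p * al + q * k) * (1 - x)]: second derivatives are compared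
    with their values at 1, [phi] and [psi] with linear functions vanishing there. The curvature
    condition makes this constant positive. *)
Let W_quad xd : 0 < xd < 1 -> exists2 c : R, 0 < c & forall x, xd <= x < 1 -> c * (1 - x) ^+ 2 <= W x.
Proof.
move=> /andP[xd0 xd1]; pose p := - phi2 1; pose q := psi2 1.
have p0 : 0 <= p by rewrite oppr_ge0 phi2_le0.
have q0 : 0 <= q by exact: psi2_ge0.
have pq : 0 < p + q by move: curv; rewrite /p /q; lra.
have pd : 0 < phi xd by apply: phi_pos; rewrite xd0.
have d1 : 0 < 1 - xd by rewrite subr_gt0.
pose k := phi xd / (1 - xd); have k0 : 0 < k by rewrite divr_gt0.
pose c := p * al + q * k.
have c0 : 0 < c.
  have [p1|p1] := ltP 0 p; first by rewrite /c ltr_pwDl ?mulr_gt0 ?al0// mulr_ge0// ltW.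
  have q1 : 0 < q by move: p1 pq; lra.
  by apply: ltr_wpDl; [apply: mulr_ge0 => //; exact: ltW|exact: mulr_gt0].
exists (c / 2) => [|x /andP[xdx x1]]; first by rewrite divr_gt0.
have x0 : 0 < x by apply: lt_le_trans xdx.
pose s z := (c / 2) * ((1 - z) * (1 - z)).
have sd z : is_derive z 1 s (- (c * (1 - z))).
  by apply: is_derive_eq; rewrite /GRing.scale/=; field.
have := @cont_on_ge0_derive_le _ (fun z => s z + - W z) (fun z => - (c * (1 - z)) + - dW z) 0 1 x 1 (ltW x0) (ltW x1) (lexx 1).
rewrite /s /W phi_1 psi_1 expr2 => H.
suff : c / 2 * ((1 - x) * (1 - x)) - (phi1 x * psi x - phi x * psi1 x) <=
   c / 2 * ((1 - 1) * (1 - 1)) + - (phi1 1 * 0 - 0 * psi1 1) by lra.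
apply: H.
- move=> z /andP[xz z1]; apply: cont_onD.
    by apply: cont_on_continuous; exact: (is_derive_continuous (sd z)).
  by apply: cont_onN; apply: W_cont; rewrite z1 (lt_le_trans x0).
- move=> z /andP[xz z1]; apply: slope_onD; first by apply: slope_on_derive; exact: sd.
  apply: slope_onN; apply: slope_on_derive; apply: W_derive.
  by rewrite z1 (lt_trans x0).
- move=> z /andP[xz z1]; have z0 : 0 < z by apply: lt_trans xz.
  have xdz : xd <= z by apply: (le_trans xdx); exact: ltW.
  have ps := psi_lin (introT andP (conj (ltW z0) (ltW z1))).
  have z10 : 0 < 1 - z by rewrite subr_gt0.
  have h1 : k * (1 - z) <= phi z.
    rewrite /k mulrAC ler_pdivrMr//.
    by have := phi_chord (ltW xd0) xdz (ltW z1) (lexx 1); rewrite phi_1; lra.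
  have h2 := phi2_incr z0 (ltW z1) (lexx 1); have h3 := psi2_decr z0 (ltW z1) (lexx 1).
  have pz : 0 < psi z by apply: psi_pos; rewrite z1 ltW.
  have fz : 0 <= phi z by apply: phi_nneg; rewrite !ltW.
  have i1 : p * (al * (1 - z)) <= p * psi z by rewrite ler_wpM2l.
  have i2 : p * psi z <= - phi2 z * psi z by rewrite ler_pM2r// lerN2.
  have i3 : q * (k * (1 - z)) <= q * phi z by rewrite ler_wpM2l.
  have i4 : phi z * q <= phi z * psi2 z by rewrite ler_wpM2l.
  by rewrite /dW /c; move: i1 i2 i3 i4; slra.
Qed.

Let W_pos x : 0 < x < 1 -> 0 < W x.
Proof.
move=> x01; have [c c0 hc] := W_quad x01; case/andP: x01 => x0 x1.
apply: lt_le_trans (hc x _); last by rewrite lexx.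
by rewrite mulr_gt0// exprn_gt0// subr_gt0.
Qed.

(** Both the upper bound of [- W' psi] and the lower bound of [W] are quadratic in [1 - x]. *)
Let dW_bound xd : 0 < xd < 1 -> exists2 B : R, 0 < B & forall x, xd <= x < 1 ->
  - dW x * psi x <= B * W x.
Proof.
move=> xd01; have [c c0 hc] := W_quad xd01; case/andP: xd01 => xd0 xd1.
have m0 : 0 <= - phi2 xd by rewrite oppr_ge0 phi2_le0// xd0 ltW.
have n0 : 0 <= psi2 xd by apply: psi2_ge0; rewrite xd0 ltW.
have ps0 : 0 < psi 0 by apply: psi_pos; rewrite lexx ltr01.
pose N := (- phi2 xd * psi 0 + psi2 xd * be) * psi 0.
have N0 : 0 <= N by apply: mulr_ge0; [rewrite addr_ge0// mulr_ge0// ltW|exact: ltW].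
exists (N / c + 1) => [|x xx]; first by rewrite ltr_wpDl// divr_ge0// ltW.
have W0 := hc x xx; case/andP: xx => xdx x1.
have x0 : 0 < x by apply: lt_le_trans xdx.
have x01 : 0 <= x <= 1 by rewrite !ltW.
have p1 : 0 < psi x by apply: psi_pos; rewrite x1 ltW.
have p2 := psi_up x01; have f1 := phi_nneg x01; have f2 := phi_lin x01.
have x10 : 0 < 1 - x by rewrite subr_gt0.
have h2 := phi2_incr xd0 xdx (ltW x1); have h3 := psi2_decr xd0 xdx (ltW x1).
have h20 := phi2_le0 (introT andP (conj x0 (ltW x1))).
have h30 := psi2_ge0 (introT andP (conj x0 (ltW x1))).
have i1 : - phi2 x * psi x <= - phi2 xd * (psi 0 * (1 - x)).
  by apply: ler_pM; rewrite ?oppr_ge0 ?lerN2// ltW.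
have i2 : psi2 x * phi x <= psi2 xd * (be * (1 - x)) by apply: ler_pM.
have i3 : - dW x <= (- phi2 xd * psi 0 + psi2 xd * be) * (1 - x).
  by rewrite /dW; move: i1 i2; lra.
have d0 : 0 <= - dW x by rewrite oppr_ge0 dW_npos// x0.
have i4 : - dW x * psi x <= (- phi2 xd * psi 0 + psi2 xd * be) * (1 - x) * (psi 0 * (1 - x)).
  by apply: ler_pM => //; exact: ltW.
have i5 : N / c * (c * (1 - x) ^+ 2) <= N / c * W x by rewrite ler_wpM2l// divr_ge0// ltW.
have Wx : 0 < W x by apply: W_pos; rewrite x0.
rewrite mulrDl mul1r; apply: (le_trans i4).
have <- : N / c * (c * (1 - x) ^+ 2) = (- phi2 xd * psi 0 + psi2 xd * be) * (1 - x) * (psi 0 * (1 - x)).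
  by rewrite /N; field; rewrite gt_eqF.
by apply: (le_trans i5); rewrite lerDl ltW.
Qed.

(** On [[x / 2, x]], [- W'] is at least half its value at [x]: [psi] and the moduli of the second
    derivatives are larger to the left, and [phi] is at least [phi x / 2]. Integrate over this
    interval and drop [W x > 0]. *)
Let dW_scale x : 0 < x < 1 -> - dW x <= 4 / x * W (x / 2).
Proof.
move=> /andP[x0 x1]; pose h := x / 2; have h0 : 0 < h by rewrite divr_gt0.
have hx : h < x by rewrite /h; lra.
have Wx : 0 < W x by apply: W_pos; rewrite x0.
pose m := - dW x / 2.
have := @ge0_derive_le _ (fun z => - W z - m * z) (fun z => - dW z - m) h x (ltW hx).
move=> H; have {H} : - W h - m * h <= - W x - m * x.
  apply: H.
  - move=> z /andP[hz zx]; have ? : is_derive z 1 W (dW z).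
      by apply: W_derive; rewrite (lt_trans h0 hz) (lt_trans zx).
    by apply: is_derive_eq; rewrite /GRing.scale/=; ring.
  - move=> z /andP[hz zx]; have z0 := lt_trans h0 hz.
    have a1 : phi2 z <= phi2 x by apply: phi2_incr => //; exact: ltW.
    have a2 : psi2 x <= psi2 z by apply: psi2_decr => //; exact: ltW.
    have b1 := phi2_le0 (introT andP (conj x0 (ltW x1))).
    have b2 := psi2_ge0 (introT andP (conj x0 (ltW x1))).
    have z1 : z < 1 := lt_trans zx x1.
    have c1 : psi x <= psi z.
      have := psi_end (ltW z0) (ltW zx) (ltW x1).
      have : 0 <= al * (x - z) by rewrite mulr_ge0 ?(ltW al0)// subr_ge0 ltW.
      lra.
    have px : 0 < psi x by apply: psi_pos; rewrite x1 ltW.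
    have fx : 0 <= phi x by apply: phi_nneg; rewrite !ltW.
    have c2 : phi x / 2 <= phi z.
      have := phi_chord (lexx 0) (ltW z0) (ltW zx) (ltW x1); rewrite phi_0 !subr0 => ch.
      have c3 : phi x * z <= phi z * x by move: ch; lra.
      have c4 : phi x * (x / 2) <= phi x * z by rewrite ler_wpM2l// ltW.
      by rewrite -(ler_pM2r x0); move: c3 c4; lra.
    have d1 : - phi2 x * psi x <= - phi2 z * psi z.
      by apply: ler_pM; rewrite ?oppr_ge0 ?lerN2// ltW.
    have d2 : phi x / 2 * psi2 x <= phi z * psi2 z by apply: ler_pM; rewrite ?divr_ge0.
    have d3 : 0 <= - phi2 x * psi x by rewrite mulr_ge0 ?oppr_ge0// ltW.
    by rewrite /m /dW; move: d1 d2 d3; lra.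
  - move=> z /andP[hz zx]; apply: continuousB.
      apply: continuousN; apply: (is_derive_continuous (W_derive _)).
      by rewrite (lt_le_trans h0 hz) (le_lt_trans zx).
    by apply: continuousM; [exact: cst_continuous|exact: cvg_id].
have -> : 4 / x * W (x / 2) = 4 * W h / x by rewrite mulrAC.
have mh : m * h = m * x / 2 by rewrite /h; ring.
have mx : - dW x * x = 2 * (m * x) by rewrite /m; field.
by rewrite ler_pdivlMr// mx mh; move: Wx; move: (m * x) (W x) (W h) => X Y Z; lra.
Qed.

Ltac drop_facts ::= clear - phic phis1 phis2 phis3 phi30 phi_chord psic psis1 psis2 psis3
  psi30 psi_chord phi_0 phi_1 psi_1 phi11 psi11 curv decr Npsis1 Npsis2 Npsis3 Npsi30
  Npsi_chord Npsi_1 phico Npsico al be al0 be0 one01 half01 phi_end psi_end phi2_le0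
  psi2_ge0 phi2_incr psi2_decr psi_lin phi_lin psi_pos psi_up phi_pos phi_nneg W dW
  W_derive W_cont dW_npos W_quad W_pos dW_bound dW_scale.

Lemma build_coefs : coefs phi psi phi1 psi1 dW al be.
Proof.
have int x : 0 < x < 1 -> 0 < x <= 1 by move=> /andP[-> /ltW ->].
split.
- exact: phic.
- exact: psic.
- by move=> x x01; exact: (slope_on_is_derive_id (phis1 (int x x01)) x01).
- by move=> x x01; exact: (slope_on_is_derive_id (psis1 (int x x01)) x01).
- exact: phi_0.
- exact: phi_1.
- exact: psi_1.
- exact: al0.
- exact: be0.
- by rewrite /be; case/andP: phi11 => ? _; lra.
- exact: phi_chord.
- exact: psi_chord.
- exact: phi_end.
- exact: psi_end.
- exists (- phi2 1 / 2), (psi2 1 / 2).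
  have a := phi2_le0 one01; have b := psi2_ge0 one01.
  split; [lra|lra|by move: curv; lra|move=> x y x0 xy y1; split].
    exact: (strong_concave phico phis1 phis2 phis3 phi30 phi_1).
  have := strong_concave Npsico Npsis1 Npsis2 Npsis3 Npsi30 Npsi_1 x0 xy y1.
  have -> : (- psi y - - psi x) / (y - x) + - psi x / (1 - x) =
    - ((psi y - psi x) / (y - x) + psi x / (1 - x)) by ring.
  by rewrite opprK; move: (_ / (y - x) + _) => X; lra.
(* To the right of 1 / 2 this is [end_taylor]; to the left, linear terms are themselves quadratic,
   since [1 - x <= 2 (1 - x)^2]. *)
- have a := phi2_le0 half01; have b := psi2_ge0 half01.
  have ps0 : 0 < psi 0 by apply: psi_pos; rewrite lexx ltr01.
  have b0' := be0; have a0' := al0.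
  pose C := - phi2 (1 / 2) / 2 + 2 * be + (psi2 (1 / 2) / 2 + 4 * psi 0).
  have [c1 c2 c3 c4] : [/\ - phi2 (1 / 2) / 2 <= C, psi2 (1 / 2) / 2 <= C, 2 * be <= C & 4 * psi 0 <= C].
    by split; rewrite /C; lra.
  exists C; first by move: c3; lra.
  move=> x x0 x1; have x01 : 0 <= x <= 1 by rewrite x0.
  have sq : 0 <= (1 - x) ^+ 2 by exact: sqr_ge0.
  have C1 : - phi2 (1 / 2) / 2 * (1 - x) ^+ 2 <= C * (1 - x) ^+ 2.
    by rewrite ler_wpM2r.
  have C2 : psi2 (1 / 2) / 2 * (1 - x) ^+ 2 <= C * (1 - x) ^+ 2.
    by rewrite ler_wpM2r.
  have [x2|x2] := leP (1 / 2) x.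
    have t1 := end_taylor phico phis1 phis2 phis3 phi30 phi_1 x2 x1.
    have t2 := end_taylor Npsico Npsis1 Npsis2 Npsis3 Npsi30 Npsi_1 x2 x1.
    by split; [move: t1 C1; rewrite /be; slra|move: t2 C2; rewrite /al; slra].
  have f0 := phi_nneg x01; have p1 := psi_up x01.
  have y2 : 0 <= 1 - x by lra.
  have h1 : (1 - x) * (1 / 2) <= (1 - x) * (1 - x) by rewrite ler_wpM2l//; move: x2; slra.
  have C3 : 2 * be * (1 - x) ^+ 2 <= C * (1 - x) ^+ 2.
    by rewrite ler_wpM2r.
  have C4 : 4 * psi 0 * (1 - x) ^+ 2 <= C * (1 - x) ^+ 2.
    by rewrite ler_wpM2r.
  rewrite expr2 in C3 C4 *; split.
    by have := ler_wpM2l (ltW b0') h1; move: C3 f0; slra.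
  have := ler_wpM2l (ltW ps0) h1; have : 0 <= al * (1 - x) by rewrite mulr_ge0// ltW.
  have : 0 <= psi 0 * (1 - x) by rewrite mulr_ge0// ltW.
  by move: C4 p1; slra.
- exact: W_derive.
- exact: dW_npos.
- exact: W_pos.
- exact: dW_scale.
- exact: dW_bound.
- move=> x y x0 xy y1.
  have x1 : x < 1 by apply: le_lt_trans y1.
  have y0 : 0 < y by apply: lt_le_trans xy.
  have px : 0 < psi x by apply: psi_pos; rewrite x1 ltW.
  have py : 0 < psi y by apply: psi_pos; rewrite y1 ltW.
  (* As [al = - psi1 1], multiplying by [al] produces the function of the monotonicity hypothesis
     minus the constant [phi1 1]. *)
  have a0' := al0; rewrite -(ler_pM2l a0').
  have E z : 0 < psi z -> al * (phi z / psi z + (phi1 z * psi z - phi z * psi1 z) / (al * psi z)) =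
    phi1 z + phi1 1 - phi z * (psi1 z + psi1 1) / psi z - phi1 1.
    by move=> pz; rewrite /al; field; rewrite (gt_eqF pz) (lt_eqF psi11).
  by rewrite !E// lerD2r; exact: decr.
Qed.

(** With second derivatives bounded up to 0, [- W' psi] is bounded on [(0, 1 / 2]], where
    [W >= W (1 / 2) > 0]; so no barrier away from 0 is needed. *)
Lemma build_conv_at M : (forall x, 0 < x < 1 -> - phi2 x <= M /\ psi2 x <= M) ->
  exists2 B : R, 0 < B & conv_at phi psi phi1 psi1 B 0.
Proof.
move=> hM; have co := build_coefs.
have h2 : 0 < (1 / 2 : R) < 1 by apply/andP; split; lra.
have [B1 B10 hB1] := dW_bound h2.
have ps0 : 0 < psi 0 by apply: psi_pos; rewrite lexx ltr01.
have M0 : 0 <= M by have [_ h] := hM _ h2; apply: le_trans h; exact: psi2_ge0.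
have W2 := W_pos h2; have be0' := be0.
pose N := (M * psi 0 + M * be) * psi 0.
have N0 : 0 <= N by rewrite mulr_ge0 ?(ltW ps0)// addr_ge0// mulr_ge0// ltW.
exists (N / W (1 / 2) + B1); first by rewrite ltr_wpDl// divr_ge0// ltW.
apply: (conv_atP co); first by rewrite ltr_wpDl// divr_ge0// ltW.
move=> x x0 _ x1; have x01 : 0 < x < 1 by rewrite x0.
have Wx := W_pos x01; rewrite -/(W x) mulrDl.
have [x2|x2] := leP (1 / 2) x.
  apply: (le_trans (hB1 x _)); first by rewrite x2.
  by rewrite lerDr mulr_ge0 ?(ltW Wx)// divr_ge0// ltW.
have WW : W (1 / 2) <= W x.
  apply: (@W_ninc _ _ _ _ _ _ _ _ co x (1 / 2) x0 (ltW x2)); lra.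
have [m1 m2] := hM x x01; have x01' : 0 <= x <= 1 by rewrite !ltW.
have p2 := psi_up x01'; have f1 := phi_nneg x01'; have f2 := phi_lin x01'.
have p1 : 0 < psi x by apply: psi_pos; rewrite x1 ltW.
have p3 : psi x <= psi 0.
  by have : 0 <= psi 0 * x by [rewrite mulr_ge0// ltW]; move: p2; slra.
have f3 : phi x <= be.
  by have : 0 <= be * x by [rewrite mulr_ge0// ltW]; move: f2; slra.
have h20 := phi2_le0 (introT andP (conj x0 (ltW x1))).
have h30 := psi2_ge0 (introT andP (conj x0 (ltW x1))).
have i1 : - phi2 x * psi x <= M * psi 0 by apply: ler_pM; rewrite ?oppr_ge0// ltW.
have i2 : psi2 x * phi x <= M * be by apply: ler_pM.
have d0 : 0 <= - dW x by rewrite oppr_ge0 dW_npos.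
have i3 : - dW x <= M * psi 0 + M * be by rewrite /dW; move: i1 i2; slra.
have i4 : - dW x * psi x <= N by apply: ler_pM => //; exact: ltW.
have i5 : N / W (1 / 2) * W (1 / 2) <= N / W (1 / 2) * W x.
  by rewrite ler_wpM2l// divr_ge0// ltW.
rewrite mulfVK ?gt_eqF// in i5.
by apply: (le_trans i4); apply: (le_trans i5); rewrite lerDl mulr_ge0 ?(ltW B10) ?(ltW Wx).
Qed.
End Build.

(** * The initial profile *)

Section Tail.
Variables (R : realType) (f : R -> R).
Notation mu := (@lebesgue_measure R).
Hypothesis fi : mu.-integrable `[0, 1[ (EFin \o f).
Implicit Types (x y z c : R).

(** Extension by zero is integrable on every interval, so tail integrals become differences of one
    primitive [I]. *)
Let f' := f \_ `[0, 1[.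

Let f'i (i : interval R) : mu.-integrable [set` i] (EFin \o f').
Proof.
have : mu.-integrable [set: R] (EFin \o f').
  by rewrite -restrict_EFin -integrable_mkcond.
by apply: integrableS => //; exact: measurable_itv.
Qed.

Let I x := \int[mu]_(y in `[0, x]) f' y.

Let f'E (i : interval R) : [set` i] `<=` `[0, 1[ ->
  \int[mu]_(y in [set` i]) f' y = \int[mu]_(y in [set` i]) f y.
Proof.
move=> sub; apply: eq_Rintegral => y; rewrite inE => iy.
by rewrite /f' patchE mem_set//; exact: sub.
Qed.

Let tailE x : 0 <= x <= 1 -> tail_integral f x = I 1 - I x.
Proof.
move=> /andP[x0 x1]; rewrite /I.
rewrite (@Rintegral_itvB _ f' (BLeft 0) (BRight 1) x) ?bnd_simp//.
rewrite Rintegral_itv_obnd_cbnd// -Rintegral_itv_bndo_bndc// f'E//.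
by apply: subset_itvr; rewrite bnd_simp.
Qed.

Let increment x y : 0 <= x -> x <= y -> y <= 1 -> tail_integral f x - tail_integral f y =
  \int[mu]_(z in `]x, y[) f z.
Proof.
move=> x0 xy y1; have y0 := le_trans x0 xy; have x1 := le_trans xy y1.
rewrite !tailE ?x0 ?y0//.
have -> : I 1 - I x - (I 1 - I y) = I y - I x by ring.
rewrite /I (@Rintegral_itvB _ f' (BLeft 0) (BRight y) x) ?bnd_simp//.
rewrite -Rintegral_itv_bndo_bndc// f'E// => z; rewrite /= !in_itv/= => /andP[xz zy].
by rewrite (le_trans x0 (ltW xz)) (lt_le_trans zy).
Qed.

Let measure_oo x y : x <= y -> fine (mu `]x, y[) = y - x.
Proof.
move=> xy; rewrite lebesgue_measure_itv/= lte_fin; case: ifPn => // xy'.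
by apply/esym/eqP; rewrite subr_eq0 eq_le xy andbT leNgt.
Qed.

Let integrable_oo x y : 0 <= x -> y <= 1 -> mu.-integrable `]x, y[ (EFin \o f).
Proof.
move=> x0 y1; apply: integrableS fi => // z; rewrite /= !in_itv/= => /andP[xz zy].
by rewrite (le_trans x0 (ltW xz)) (lt_le_trans zy).
Qed.

Let integrable_cst_oo x y c : mu.-integrable `]x, y[ (EFin \o cst c).
Proof.
have : mu.-integrable `[x, y] (EFin \o cst c).
  apply: continuous_compact_integrable; first exact: segment_compact.
  by apply: continuous_subspaceT => z; exact: cst_continuous.
by apply: integrableS => //; exact: subset_itv_oo_cc.
Qed.

Lemma tail_ge c x y : 0 <= x -> x <= y -> y <= 1 -> (forall z, x < z < y -> c <= f z) ->
  c * (y - x) <= tail_integral f x - tail_integral f y.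
Proof.
move=> x0 xy y1 fb; rewrite increment// -(measure_oo xy) -Rintegral_cst//.
by apply: le_Rintegral => //; [exact: integrable_cst_oo|exact: integrable_oo].
Qed.

Lemma tail_le c x y : 0 <= x -> x <= y -> y <= 1 -> (forall z, x < z < y -> f z <= c) ->
  tail_integral f x - tail_integral f y <= c * (y - x).
Proof.
move=> x0 xy y1 fb; rewrite increment// -(measure_oo xy) -Rintegral_cst//.
by apply: le_Rintegral => //; [exact: integrable_oo|exact: integrable_cst_oo].
Qed.

Lemma tail1 : tail_integral f 1 = 0.
Proof. by rewrite tailE ?subrr// ler01 lexx. Qed.

Lemma tail_cont_on x : 0 <= x <= 1 -> cont_on 0 1 (tail_integral f) x.
Proof.
move=> x01; have Ic := @parameterized_integral_continuous R 0 1 f' ler01 (f'i `[0, 1]).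
have := within_cont_on Ic x01 => hI e e0; have [d d0 hd] := hI e e0.
exists d => // y y01 yx; rewrite !tailE//.
have -> : I 1 - I y - (I 1 - I x) = - (I y - I x) by ring.
by rewrite normrN; exact: hd.
Qed.

End Tail.

Section MassTail.
Variables (R : realType) (w : R -> R).
Notation mu := (@lebesgue_measure R).
Implicit Types (x y z : R).
Hypothesis wpos : forall x, 0 <= x < 1 -> 0 < w x.
Hypothesis wninc : forall x y, 0 <= x -> x <= y -> y < 1 -> w y <= w x.
Hypothesis wcont : forall x, 0 <= x < 1 -> forall e : R, 0 < e ->
  exists2 d : R, 0 < d & forall y, 0 <= y < 1 -> `|y - x| < d -> `|w y - w x| < e.

Lemma profile_integrable : \int[mu]_(x in `[0, 1[) w x = 1 ->
  mu.-integrable `[0, 1[ (EFin \o w).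
Proof.
move=> w1; apply/integrableP; split.
  apply/measurable_EFinP; apply: subspace_continuous_measurable_fun => //.
  apply/subspace_continuousP => x; rewrite /= in_itv/= => x01.
  apply/cvgrPdist_lt => e e0; have [d d0 hd] := wcont x01 e0.
  rewrite /within/=; apply/nbhs_ballP; exists d => // y /= xy; rewrite in_itv/= => y01.
  by rewrite distrC; apply: hd => //; rewrite distrC.
have -> : (\int[mu]_(x in `[0%R, 1%R[) `|(EFin \o w) x| = \int[mu]_(x in `[0%R, 1%R[) (w x)%:E)%E.
  apply: eq_integral => x; rewrite inE/= in_itv/= => x01.
  by rewrite ger0_norm// ltW// wpos.
(* The real-valued integral sends an infinite value to 0, so mass 1 excludes it. *)
rewrite ltey; apply/eqP => woo; move: w1; rewrite /Rintegral woo/= => /eqP.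
by rewrite eq_sym oner_eq0.
Qed.

Hypothesis wint : mu.-integrable `[0, 1[ (EFin \o w).

Ltac drop_facts ::= clear - wpos wninc wcont wint.

(** [Num.max 0 x] freezes the tail to the left of 0, which makes it continuous there from both
    sides. *)
Lemma mass_tail : mass w (fun x => tail_integral w (Num.max 0 x)).
Proof.
have t1 := tail1 wint.
have mx x : 0 <= x -> Num.max 0 x = x by move=> x0; rewrite max_r.
have incr' x y : 0 <= x -> x <= y -> y <= 1 ->
    0 <= tail_integral w x - tail_integral w y <= (y - x) * w x.
  move=> x0 xy y1; apply/andP; split.
    rewrite -[X in X <= _](mul0r (y - x)); apply: (tail_ge wint x0 xy y1) => z /andP[xz zy].
    by apply/ltW/wpos; rewrite (le_trans x0 (ltW xz)) (lt_le_trans zy).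
  rewrite mulrC; apply: (tail_le wint x0 xy y1) => z /andP[xz zy].
  by apply: wninc => //; [exact: ltW|exact: lt_le_trans y1].
have le x : 0 <= x < 1 -> 0 <= tail_integral w x <= (1 - x) * w x.
  by move=> /andP[x0 x1]; have := incr' x 1 x0 (ltW x1) (lexx 1); rewrite t1 subr0.
have incr x y : 0 <= x -> x <= y -> y < 1 ->
    (y - x) * w y <= tail_integral w x - tail_integral w y <= (y - x) * w x.
  move=> x0 xy y1; have /andP[_ ->] := incr' x y x0 xy (ltW y1); rewrite andbT mulrC.
  apply: (tail_ge wint x0 xy (ltW y1)) => z /andP[xz zy].
  by apply: wninc => //; [exact: le_trans (ltW xz)|exact: ltW].
split => //.
- move=> e e0; have [d d0 hd] := wcont (introT andP (conj (lexx 0) ltr01)) e0.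
  exists d => // x /andP[x0 xd] x1; have := hd x; rewrite x0 x1 subr0 ger0_norm// => /(_ isT xd).
  by rewrite ltr_norml => /andP[+ _]; lra.
- by move=> x /[dup] /andP[x0 _] /le/andP[h _]; rewrite mx.
- by move=> x /[dup] /andP[x0 _] /le/andP[_ h]; rewrite mx.
- by move=> x y x0 xy y1; rewrite !mx ?(le_trans x0)//; exact: incr.
- move=> x /andP[x0 x1]; apply/continuous_for_dist => e e0.
  have [d d0 hd] := tail_cont_on wint (introT andP (conj x0 (ltW x1))) e0.
  exists (Num.min d (1 - x)); first by rewrite lt_min d0 subr_gt0.
  move=> y; rewrite lt_min => /andP[yd y1]; rewrite [Num.max 0 x]mx//.
  have yx : `|Num.max 0 y - x| <= `|y - x|.
    have [y0|y0] := leP 0 y => //; rewrite sub0r normrN ger0_norm//.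
    by rewrite distrC ger0_norm ?subr_ge0; [|apply: ltW; exact: lt_le_trans x0]; rewrite lerBrDr; lra.
  apply: hd; last exact: le_lt_trans yd.
  by rewrite le_max lexx/= ge_max ler01/=; move: y1; rewrite ltr_norml => /andP[_]; lra.
- move=> x /andP[x0 x1]; apply: is_derive_eps => e e0.
  have [d d0 hd] := wcont (introT andP (conj (ltW x0) x1)) e0.
  exists (Num.min d (Num.min x (1 - x))); first by rewrite !lt_min d0 x0 subr_gt0.
  move=> y; rewrite !lt_min => /and3P[yd]; rewrite !ltr_norml => /andP[h1 h2] /andP[h3 h4] yx.
  have y0 : 0 <= y by lra.
  have y1 : y < 1 by lra.
  have wd : `|w y - w x| < e by apply: hd => //; rewrite y0.
  rewrite !mx ?(ltW x0)// opprK.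
  have [xy|yx'|E] := ltgtP x y; last by rewrite E eqxx in yx.
    have /andP[i1 i2] := incr x y (ltW x0) (ltW xy) y1.
    have p : 0 < y - x by rewrite subr_gt0.
    have -> : (tail_integral w y - tail_integral w x) / (y - x) =
       - ((tail_integral w x - tail_integral w y) / (y - x)) by ring.
    have b1 : w y <= (tail_integral w x - tail_integral w y) / (y - x) by rewrite ler_pdivlMr// mulrC.
    have b2 : (tail_integral w x - tail_integral w y) / (y - x) <= w x by rewrite ler_pdivrMr// mulrC.
    rewrite ltr_norml in wd; case/andP: wd => w1 w2; rewrite ler_norml.
    by apply/andP; split; move: b1 b2 w1 w2; move: (_ / _) => X; slra.
  have /andP[i1 i2] := incr y x y0 (ltW yx') x1.
  have p : 0 < x - y by rewrite subr_gt0.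
  have -> : (tail_integral w y - tail_integral w x) / (y - x) =
     - ((tail_integral w y - tail_integral w x) / (x - y)).
    have n1 : y - x != 0 by rewrite subr_eq0.
    have n2 : x - y != 0 by rewrite subr_eq0 eq_sym.
    by field; rewrite ?n1 ?n2.
  have b1 : w x <= (tail_integral w y - tail_integral w x) / (x - y) by rewrite ler_pdivlMr// mulrC.
  have b2 : (tail_integral w y - tail_integral w x) / (x - y) <= w y by rewrite ler_pdivrMr// mulrC.
  rewrite ltr_norml in wd; case/andP: wd => w1 w2; rewrite ler_norml.
  by apply/andP; split; move: b1 b2 w1 w2; move: (_ / _) => X; slra.
Qed.
End MassTail.

(** * The mean residual life of the initial profile *)

Section Profile.
Variables (R : realType) (c0 w : R -> R).
Notation mu := (@lebesgue_measure R).
Implicit Types (x y z : R).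
Hypothesis cge0 : forall x, 0 <= x < 1 -> 0 <= c0 x.
Hypothesis cint : mu.-integrable `[0, 1[ (EFin \o c0).
Hypothesis wE : forall x, 0 <= x < 1 -> w x = tail_integral c0 x.
Hypothesis wpos : forall x, 0 <= x < 1 -> 0 < w x.
Hypothesis w1 : \int[mu]_(x in `[0, 1[) w x = 1.
Hypothesis wbeta : forall e : R, 0 < e -> exists2 d : R, 0 < d < 1 &
  forall x, 1 - d <= x < 1 -> `|profile_beta c0 w x - 1| <= e.
Hypothesis wc : forall x : R, 0 <= x < 1 -> {for x, continuous w}.

Let ninc x y : 0 <= x -> x <= y -> y < 1 -> w y <= w x.
Proof.
move=> x0 xy y1; rewrite !wE ?x0 ?(le_trans x0 xy) ?(le_lt_trans xy)// -subr_ge0.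
rewrite -[X in X <= _](mul0r (y - x)); apply: (tail_ge cint x0 xy (ltW y1)) => z /andP[xz zy].
by apply: cge0; rewrite (le_trans x0 (ltW xz)) (lt_trans zy).
Qed.

Let wcont x : 0 <= x < 1 -> forall e : R, 0 < e ->
  exists2 d : R, 0 < d & forall y, 0 <= y < 1 -> `|y - x| < d -> `|w y - w x| < e.
Proof.
move=> x01 e e0; have /continuous_for_dist/(_ e e0)[d d0 hd] := wc x01.
by exists d => // y _; exact: hd.
Qed.

Let wint := profile_integrable wpos wcont w1.
Let H x := tail_integral w (Num.max 0 x).
Let mw : mass w H := mass_tail wpos ninc wcont wint.

Let HE x : 0 <= x -> H x = tail_integral w x.
Proof. by move=> x0; rewrite /H max_r. Qed.

Ltac drop_facts ::= clear - cge0 cint wE wpos w1 wbeta wc ninc wcont wint H mw HE.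

(* The mean residual life has derivative beta - 1 wherever w is differentiable;
   since w is only absolutely continuous, the bound is obtained from local slopes. *)
Lemma life_local_slope e d x y : 0 < e -> e <= 1 -> 0 < d < 1 ->
  (forall x, 1 - d <= x < 1 -> `|profile_beta c0 w x - 1| <= e / 2) ->
  1 - d <= x -> x < y -> y < 1 -> H x * w x <= (1 + e / 4) * (H y * w y) ->
  (1 - e / 8) * w x <= w y ->
  - e * (y - x) <= life w H y - life w H x <= e * (y - x).
Proof.
move=> e0 e1 /andP[d0 d1] be dx xy y1 r1 r2.
have x0 : 0 <= x by move: dx d1; slra.
have y0 : 0 <= y := le_trans x0 (ltW xy).
have x01 : 0 <= x < 1 by rewrite x0 (lt_trans xy).
have y01 : 0 <= y < 1 by rewrite y0.
have wx := wpos x01; have wy := wpos y01.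
have Hpos z : 0 <= z < 1 -> 0 < H z.
  by move=> z01; have := life_gt0 mw z01; rewrite /life pmulr_lgt0 ?invr_gt0 ?wpos.
have hx := Hpos x x01; have hy := Hpos y y01.
have wyx : w y <= w x := ninc x0 (ltW xy) y1.
have /andP[h1 h2] := mass_incr mw x0 (ltW xy) y1.
have yx : 0 < y - x by rewrite subr_gt0.
have hyx : H y <= H x.
  by have : 0 <= (y - x) * w y by [rewrite mulr_ge0// ltW]; move: h1; slra.
(* The bound on beta and the monotonicity of [w] and [H] confine [c0] between two constants on []x,
   y[]; integrating them estimates [w x - w y] from both sides. *)
have cE z : x < z < y -> (1 - e / 2) * w y ^+ 2 / H x <= c0 z <= (1 + e / 2) * w x ^+ 2 / H y.
  move=> /andP[xz zy]; have z0 : 0 <= z := le_trans x0 (ltW xz).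
  have z1 : z < 1 := lt_trans zy y1.
  have z01 : 0 <= z < 1 by rewrite z0.
  have wz := wpos z01; have hz := Hpos z z01.
  have := be z; rewrite (le_trans dx (ltW xz)) z1 => /(_ isT).
  rewrite /profile_beta -(HE z0) ler_norml => /andP[b1 b2].
  have w1z : w y <= w z := ninc z0 (ltW zy) y1.
  have w2z : w z <= w x := ninc x0 (ltW xz) z1.
  have /andP[hh1 _] := mass_incr mw x0 (ltW xz) z1.
  have /andP[hh2 _] := mass_incr mw z0 (ltW zy) y1.
  have H1 : H z <= H x by have : 0 <= (z - x) * w z by [rewrite mulr_ge0 ?subr_ge0// ltW]; move: hh1; slra.
  have H2 : H y <= H z by have : 0 <= (y - z) * w y by [rewrite mulr_ge0 ?subr_ge0// ltW]; move: hh2; slra.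
  have sq : 0 < w z ^+ 2 by rewrite exprn_gt0.
  have b1' : (1 - e / 2) * w z ^+ 2 <= c0 z * H z.
    rewrite -ler_pdivlMr//; move: b1; move: (_ / _) => X; slra.
  have b2' : c0 z * H z <= (1 + e / 2) * w z ^+ 2.
    rewrite -ler_pdivrMr//; move: b2; move: (_ / _) => X; slra.
  have c00 : 0 <= c0 z := cge0 z01.
  have s1 : w y ^+ 2 <= w z ^+ 2 by rewrite ler_sqr ?nnegrE// ltW.
  have s2 : w z ^+ 2 <= w x ^+ 2 by rewrite ler_sqr ?nnegrE// ltW.
  apply/andP; split.
    rewrite ler_pdivrMr//; have : c0 z * H z <= c0 z * H x by rewrite ler_wpM2l.
    have : (1 - e / 2) * w y ^+ 2 <= (1 - e / 2) * w z ^+ 2 by rewrite ler_wpM2l//; move: e1; slra.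
    by move: b1'; slra.
  rewrite ler_pdivlMr//; have : c0 z * H y <= c0 z * H z by rewrite ler_wpM2l.
  have : (1 + e / 2) * w z ^+ 2 <= (1 + e / 2) * w x ^+ 2 by rewrite ler_wpM2l//; move: e0; slra.
  by move: b2'; slra.
have dw : w x - w y = tail_integral c0 x - tail_integral c0 y by rewrite !wE.
have t1 : (1 - e / 2) * w y ^+ 2 / H x * (y - x) <= w x - w y.
  by rewrite dw; apply: (tail_ge cint x0 (ltW xy) (ltW y1)) => z /cE/andP[].
have t2 : w x - w y <= (1 + e / 2) * w x ^+ 2 / H y * (y - x).
  by rewrite dw; apply: (tail_le cint x0 (ltW xy) (ltW y1)) => z /cE/andP[].
have ww : 0 < w x * w y by rewrite mulr_gt0.
have E : life w H y - life w H x = (H x * (w x - w y) - w x * (H x - H y)) / (w x * w y).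
  by rewrite /life; field; rewrite !gt_eqF.
rewrite E; apply/andP; split.
  rewrite ler_pdivlMr//.
  have a1 : (1 - e / 2) * w y ^+ 2 * (y - x) <= H x * (w x - w y).
    have := ler_wpM2l (ltW hx) t1.
    by have -> : H x * ((1 - e / 2) * w y ^+ 2 / H x * (y - x)) = (1 - e / 2) * w y ^+ 2 * (y - x)
      by field; rewrite gt_eqF.
  have a2 : w x * (H x - H y) <= w x * ((y - x) * w x) by rewrite ler_pM2l.
  have q0 : 0 <= (1 - e / 2) * w y ^+ 2 - w x ^+ 2 + e * (w x * w y).
    have k1 : (1 - e / 8) * w x * ((1 - e / 8) * w x) <= w y * w y.
      by apply: ler_pM => //; rewrite mulr_ge0 ?(ltW wx)//; move: e1; slra.
    have k2 : (1 - e / 2) * ((1 - e / 8) * w x * ((1 - e / 8) * w x)) <= (1 - e / 2) * (w y * w y).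
      by rewrite ler_wpM2l//; move: e1; slra.
    have k3 : e * (w x * ((1 - e / 8) * w x)) <= e * (w x * w y) by rewrite ler_pM2l// ler_pM2l.
    have k4 : 0 <= (e / 4 - e * e * 7 / 64 - e * e * e / 128 + e * e / 8) * (w x * w x).
      rewrite mulr_ge0//; last by rewrite mulr_ge0// ltW.
      have : e * e <= e * 1 by rewrite ler_pM2l.
      have : e * e * e <= e * e * 1 by rewrite ler_pM2l// mulr_gt0.
      have : 0 <= e * e by rewrite mulr_ge0// ltW.
      by move: e0 e1; slra.
    by rewrite !expr2; move: k2 k3 k4; slra.
  have := mulr_ge0 (ltW yx) q0; rewrite !expr2; rewrite !expr2 in a1; move: a1 a2; slra.
rewrite ler_pdivrMr//.
have a1 : H x * (w x - w y) <= (1 + e / 2) * (1 + e / 4) * (w x * w y) * (y - x).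
  have := ler_wpM2l (ltW hx) t2.
  have -> : H x * ((1 + e / 2) * w x ^+ 2 / H y * (y - x)) =
     (1 + e / 2) * (w x * (y - x) / H y) * (H x * w x) by rewrite expr2; ring.
  have p : 0 <= (1 + e / 2) * (w x * (y - x) / H y).
    by rewrite mulr_ge0//; [move: e0; slra|rewrite divr_ge0 ?mulr_ge0// ltW].
  have := ler_wpM2l p r1.
  have -> : (1 + e / 2) * (w x * (y - x) / H y) * ((1 + e / 4) * (H y * w y)) =
    (1 + e / 2) * (1 + e / 4) * (w x * w y) * (y - x) by field; rewrite gt_eqF.
  by slra.
have a2 : w x * ((y - x) * w y) <= w x * (H x - H y) by rewrite ler_pM2l.
have q0 : 0 <= (e / 4 - e * e / 8) * (w x * w y * (y - x)).
  rewrite mulr_ge0//; last by rewrite mulr_ge0// ltW.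
  have : e * e <= e * 1 by rewrite ler_pM2l.
  by move: e0; slra.
by move: a1 a2 q0; slra.
Qed.

(** The slope bound of [life_local_slope] holds only for [y] close to [x], how close depending on
    [x]; [local_slope_le], applied to [life] and to its opposite, makes it uniform. *)
Lemma profile_tail : profile w H.
Proof.
split => //.
- move=> e e0; pose e' := Num.min e 1.
  have e'0 : 0 < e' by rewrite lt_min e0 ltr01.
  have e'1 : e' <= 1 by rewrite ge_min lexx orbT.
  have e'e : e' <= e by rewrite ge_min lexx.
  have [|d d01 hd] := wbeta (e := e' / 2); first by rewrite divr_gt0.
  exists d => // x y dx xy y1; have /andP[d0 d1] := d01.
  have slope z : x <= z < y -> exists2 r : R, 0 < r & forall u, z < u < z + r -> u <= y ->
      - e' * (u - z) <= life w H u - life w H z <= e' * (u - z).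
    move=> /andP[xz zy].
    have z01 : 0 <= z < 1 by apply/andP; split; lra.
    have wz := wpos z01; have hz : 0 < H z.
      by have := life_gt0 mw z01; rewrite /life pmulr_lgt0 ?invr_gt0.
    have hw : 0 < H z * w z by rewrite mulr_gt0.
    have c1 : {for z, continuous (fun u => H u * w u)}.
      by apply: continuousM; [exact: (mass_cont mw)|exact: wc].
    have [|r1 r10 hr1] := continuous_gtc c1 (c := H z * w z / (1 + e' / 4)).
      rewrite ltr_pdivrMr; last by lra.
      by rewrite ltr_pMr//; lra.
    have [|r2 r20 hr2] := continuous_gtc (wc z01) (c := (1 - e' / 8) * w z).
      by rewrite gtr_pMl//; lra.
    exists (Num.min r1 r2); first by rewrite lt_min r10.
    move=> u /andP[zu ur] uy.
    have u1 : u - z < r1 by apply: lt_le_trans (_ : Num.min r1 r2 <= r1); [lra|rewrite ge_min lexx].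
    have u2 : u - z < r2 by apply: lt_le_trans (_ : Num.min r1 r2 <= r2); [lra|rewrite ge_min lexx orbT].
    have k1 := hr1 u; have k2 := hr2 u; rewrite gtr0_norm ?subr_gt0// in k1 k2.
    apply: (life_local_slope e'0 e'1 d01 hd) => //; [move: dx xz; slra|move: y1 uy; slra| |].
      have := ltW (k1 u1); rewrite ler_pdivrMr; last by move: e'0; slra.
      by rewrite [_ * (1 + e' / 4)]mulrC.
    exact/ltW/k2.
  have Lc z : x <= z <= y -> {for z, continuous (life w H)}.
    move=> /andP[xz zy]; have z01 : 0 <= z < 1 by apply/andP; split; lra.
    apply: continuous_div; first by rewrite gt_eqF// wpos.
      exact: (mass_cont mw).
    exact: wc.
  have up := local_slope_le xy Lc (c := e') _.
  have lo := @local_slope_le _ (fun z => - life w H z) e' x y xy _ _.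
  have {}up : life w H y - life w H x <= e' * (y - x).
    apply: up => z /slope[r r0 hr]; exists r => // u zu uy.
    by have /andP[] := hr u zu uy.
  have {}lo : - life w H y - - life w H x <= e' * (y - x).
    apply: lo => [z zxy|z /slope[r r0 hr]]; first by apply: continuousN; exact: Lc.
    by exists r => // u zu uy; have /andP[] := hr u zu uy; lra.
  have : e' * (y - x) <= e * (y - x) by rewrite ler_wpM2r// subr_ge0.
  by rewrite ler_norml; move: up lo => up lo ee; apply/andP; split; lra.
- move=> e e0; have [d d0 hd] := tail_cont_on cint (introT andP (conj ler01 (lexx 1))) e0.
  pose x := Num.max 0 (1 - d / 2).
  have x0 : 0 <= x by rewrite le_max lexx.
  have x1 : x < 1 by rewrite gt_max ltr01/=; lra.
  have xd : 1 - d / 2 <= x by rewrite le_max lexx orbT.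
  exists x; first by rewrite x0.
  rewrite wE ?x0//; have := hd x; rewrite x0 (ltW x1) (tail1 cint) subr0 => /(_ isT).
  rewrite distrC ger0_norm ?subr_ge0 ?(ltW x1)// => /(_ ltac:(lra)).
  exact: le_lt_trans (ler_norm _).
Qed.
End Profile.

(** * Reduction to total functions *)

Section Convert.
Variable R : realType.
Notation mu := (@lebesgue_measure R).
Implicit Types (f : R -> R) (x y z a b : R).

Lemma convex_chord f : convex_function (`[0, 1]%classic : set R) f ->
  forall x y z, 0 <= x -> x <= y -> y <= z -> z <= 1 ->
    (f y - f x) * (z - y) <= (f z - f y) * (y - x).
Proof.
move=> cf x y z x0 xy yz z1.
have [xz|zx] := ltP x z; last first.
  have -> : y = x by apply/eqP; rewrite eq_le xy (le_trans yz zx).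
  by rewrite !subrr mul0r mulr0.
have d0 : 0 < z - x by rewrite subr_gt0.
pose t := (z - y) / (z - x).
have t0 : 0 <= t by rewrite divr_ge0 ?subr_ge0// ltW.
have t1 : t <= 1 by rewrite ler_pdivrMr// mul1r lerD2l lerN2.
have xI : (x : R) \in (`[0, 1]%classic : set R).
  by rewrite inE/= in_itv/= x0 (le_trans (ltW xz)).
have zI : (z : R) \in (`[0, 1]%classic : set R).
  by rewrite inE/= in_itv/= z1 (le_trans x0 (ltW xz)).
have h : f (t * x + (1 - t) * z) <= t * f x + (1 - t) * f z := cf (Itv01 t0 t1) x z xI zI.
have E : t * x + (1 - t) * z = y by rewrite /t; field; rewrite gt_eqF.
rewrite E in h; have := ler_wpM2r (ltW d0) h.
have -> : (t * f x + (1 - t) * f z) * (z - x) = f x * (z - y) + f z * (y - x).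
  by rewrite /t; field; rewrite gt_eqF.
lra.
Qed.

Lemma slope_on_clamp a b f x l : a <= x <= b -> slope_on a b f x l ->
  slope_on a b (fun y => f (clamp a b y)) x l.
Proof.
move=> xab fs e e0; have [d d0 hd] := fs e e0; exists d => // y yab yd yx.
by rewrite !clamp_id//; exact: hd.
Qed.

Lemma diff_quotient_slope_on a b f x l : a <= x <= b ->
  diff_quotient f x y @[y --> within `[a, b] x^'] --> l -> slope_on a b f x l.
Proof.
move=> xab /cvgrPdist_le fd e e0; have := fd e e0.
rewrite /within/= => /nbhs_ballP[d /= d0 hd]; exists d => // y yab yx ynx.
by rewrite distrC; apply: hd => //; rewrite /ball/= distrC.
Qed.

Lemma Rintegral_primitive (f K : R -> R) (T : R) : 0 < T ->
  (forall s : R, {for s, continuous f}) ->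
  (forall s, -1 < s < T + 1 -> is_derive s 1 K (f s)) ->
  \int[mu]_(t in `[0, T]) f t = K T - K 0.
Proof.
move=> T0 fc Kd.
have in' s : 0 <= s <= T -> -1 < s < T + 1 by move=> /andP[? ?]; apply/andP; split; lra.
have Kc s : 0 <= s <= T -> {for s, continuous K}.
  by move=> /in'/Kd; exact: is_derive_continuous.
rewrite /Rintegral (@continuous_FTC2 R f K 0 T T0) //.
- by apply: continuous_subspaceT => s; exact: fc.
- split.
  + move=> s; rewrite in_itv/= => /andP[s0 sT].
    by have [] := Kd s (in' s (introT andP (conj (ltW s0) (ltW sT)))).
  + by apply: cvg_at_right_filter; apply: Kc; rewrite lexx ltW.
  + by apply: cvg_at_left_filter; apply: Kc; rewrite lexx ltW.
- move=> s; rewrite in_itv/= => /andP[s0 sT]; rewrite derive1E.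
  by have [_ ->] := Kd s (in' s (introT andP (conj (ltW s0) (ltW sT)))).
Qed.

Lemma time_average_cvg (al be : R) (I : R -> R) : 0 < al ->
  (forall eps, 0 < eps -> exists C T0 : R, 0 <= T0 /\
     forall T, T0 <= T -> `|al * I T - be * T| <= eps * T + C) ->
  T^-1 * I T @[T --> +oo] --> be / al.
Proof.
move=> al0 hI; apply/cvgrPdist_le => e e0.
have p : 0 < e * al / 2 by rewrite divr_gt0// mulr_gt0.
have [C [T0 [T00 hT]]] := hI _ p.
near=> T.
have T1 : 0 < T by near: T; apply: nbhs_pinfty_gt; exact: num_real.
have T2 : T0 <= T by near: T; apply: nbhs_pinfty_ge; exact: num_real.
have T3 : 2 * C / (e * al) <= T by near: T; apply: nbhs_pinfty_ge; exact: num_real.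
have ea : 0 < e * al by rewrite mulr_gt0.
have aT : 0 < al * T by rewrite mulr_gt0.
have -> : be / al - T^-1 * I T = - (al * I T - be * T) / (al * T).
  by field; rewrite !gt_eqF.
rewrite normrM normfV normrN (gtr0_norm aT) ler_pdivrMr//.
apply: (le_trans (hT T T2)); rewrite ler_pdivrMr// in T3.
by move: T3; lra.
Unshelve. all: by end_near. Qed.
End Convert.

(** * Solutions in total form *)

Section SolutionOf.
Variables (R : realType) (phi psi : R -> R).
Variables (phi1 psi1 dW : R -> R) (al be : R).
Implicit Types (x y s t : R).
Let phic x := phi (clamp 0 1 x).
Let psic x := psi (clamp 0 1 x).
Hypothesis co : coefs phic psic phi1 psi1 dW al be.
Variables (w0 w0c h0 : R -> R).
Hypothesis w0E : forall x, 0 <= x < 1 -> w0c x = w0 x.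
Hypothesis prof : profile w0c h0.

Ltac drop_facts ::= clear - phic psic co w0E prof R.

(** [kappa] is frozen for negative times and each characteristic outside [[0, t]]. Continuity of
    [w(., t)], from the Lipschitz bound of the flow, gives measurability, and mass 1 gives
    integrability. *)
Lemma solution_of (w : R -> R -> R) (kappa : R -> R) : is_solution phi psi w0 w kappa ->
  exists F H, solution phic psic w0c (fun s => kappa (Num.max 0 s)) F w H.
Proof.
move=> [kc kp [F hF] w1]; pose kap s := kappa (Num.max 0 s).
exists F, (fun t x => tail_integral (w ^~ t) (Num.max 0 x)).
have m0 := profile_mass prof.
have kcont s : {for s, continuous kap}.
  move: kc => /subspace_continuousP kc.
  have /kc kcs : [set` `[0, +oo[] (Num.max 0 s) by rewrite /= in_itv/= le_max lexx.
  apply/continuous_for_dist => e e0; have /cvgrPdist_lt/(_ e e0) := kcs.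
  rewrite /within/= => /nbhs_ballP[d /= d0 hd]; exists d => // y yd.
  rewrite distrC; apply: hd; last by rewrite /= in_itv/= le_max lexx.
  rewrite /ball/=; apply: le_lt_trans yd.
  by case: (leP 0 s) => l1; case: (leP 0 y) => l2; rewrite ler_norml;
    have := ler_norm (y - s); have := ler_norm (s - y); rewrite distrC => l3 l4;
    apply/andP; split; move: l1 l2 l3 l4; slra.
have kpos s : 0 < kap s by apply: kp; rewrite le_max lexx.
have flow : is_flow phic psic kap F.
  move=> x t x01 t0; have [[X [Xt X01 Xd] FX] _] := hF x t x01 t0.
  have sl s : 0 <= s <= t -> slope_on 0 t X s (phi (X s) - kappa s * psi (X s)).
    by move=> st; apply: diff_quotient_slope_on (Xd s st).
  exists (fun s => X (clamp 0 t s)); rewrite !clamp_id ?lexx ?t0//; split => //; split.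
  - by move=> s; apply: cont_on_clamp => //; apply: slope_on_cont (sl _ _); exact: clamp_in.
  - by move=> s st; apply: X01; exact: clamp_in.
  - move=> s st; have st' : 0 <= s <= t by case/andP: st => /ltW -> /ltW ->.
    have := slope_on_is_derive (sl s st') st.
    have -> : velocity phic psic kap s (X (clamp 0 t s)) = phi (X s) - kappa s * psi (X s).
      have /andP[a b] := X01 s st'.
      rewrite /velocity /phic /psic /kap !clamp_id ?st' ?a ?(ltW b)// max_r//.
      by case/andP: st'.
    by [].
have wE x t : 0 <= x < 1 -> 0 <= t -> w x t = expR t * w0c (F x t).
  by move=> x01 t0; have [_ ->] := hF x t x01 t0; rewrite w0E//; exact: (flow_in flow).
have fle := flow_le co kcont kpos flow; have flip := flow_lip co kcont kpos flow.
have wmass t : 0 <= t -> mass (w ^~ t) (fun x => tail_integral (w ^~ t) (Num.max 0 x)).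
  move=> t0.
  have wpos x : 0 <= x < 1 -> 0 < w x t.
    by move=> x01; rewrite wE// mulr_gt0 ?expR_gt0// (mass_gt0 m0)// (flow_in flow).
  have wcont x : 0 <= x < 1 -> forall e : R, 0 < e ->
     exists2 d : R, 0 < d & forall y, 0 <= y < 1 -> `|y - x| < d -> `|w y t - w x t| < e.
    move=> x01 e e0; have e' : 0 < e / expR t by rewrite divr_gt0 ?expR_gt0.
    have Fx := flow_in flow x01 t0.
    have /continuous_for_dist/(_ _ e')[d d0 hd] := profile_cont prof Fx.
    exists (d / expR t); first by rewrite divr_gt0 ?expR_gt0.
    move=> y y01 yd; rewrite !wE// -mulrBr normrM gtr0_norm ?expR_gt0// mulrC -ltr_pdivlMr ?expR_gt0//.
    apply: hd; rewrite ltr_pdivlMr ?expR_gt0// in yd; apply: le_lt_trans yd.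
    case/andP: x01 => x0 x1; case/andP: y01 => y0 y1.
    have [xy|/ltW yx] := leP x y.
      by rewrite !ger0_norm ?subr_ge0// ?fle// mulrC; exact: flip.
    by rewrite distrC [`|y - x|]distrC !ger0_norm ?subr_ge0// ?fle// mulrC; exact: flip.
  apply: mass_tail => //.
    move=> x y x0 xy y1; have x1 := le_lt_trans xy y1; have y0 := le_trans x0 xy.
    rewrite !wE ?x0 ?y0// ler_pM2l ?expR_gt0//.
    have Fx := flow_in flow (introT andP (conj x0 x1)) t0.
    have Fy := flow_in flow (introT andP (conj y0 y1)) t0.
    by apply: (mass_ninc m0); [case/andP: Fx|exact: fle|case/andP: Fy].
  by apply: profile_integrable => //; exact: w1.
split => //.
by move=> t t0; rewrite maxxx; exact: w1.
Qed.
End SolutionOf.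

(** * From an upper bound for [w(0, t)] to the asymptotics of [kappa] *)

Lemma asymptotics_of_bound (R : realType) (phi psi phi1 psi1 dW w0 w0c h0 : R -> R) (mu : R) :
  coefs (fun x => phi (clamp 0 1 x)) (fun x => psi (clamp 0 1 x)) phi1 psi1 dW
    (- deriv01 psi 1) (- deriv01 phi 1) ->
  profile w0c h0 -> (forall x, 0 <= x < 1 -> w0c x = w0 x) -> 0 < mu ->
  (forall kappa F w H, solution (fun x => phi (clamp 0 1 x)) (fun x => psi (clamp 0 1 x))
     w0c kappa F w H -> forall t, 0 <= t -> w 0 t <= 1 / mu) ->
  kappa_asymptotics phi psi w0.
Proof.
move=> co prof w0E mu0 hmu; have [eta eta0 heta] := sol_away_one co prof mu0 hmu.
have al0 := al_gt0 co; have be0 := be_gt0 co.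
have zero01 : 0 <= (0 : R) < 1 by rewrite lexx ltr01.
have ps0 := psi_gt0 co zero01; set psic := fun x => psi (clamp 0 1 x) in ps0.
have C20 : 0 < (- deriv01 phi 1 + 2 / eta) / - deriv01 psi 1.
  by rewrite divr_gt0// addr_gt0// divr_gt0.
exists (mu / psic 0), ((- deriv01 phi 1 + 2 / eta) / - deriv01 psi 1); split => //.
  by rewrite divr_gt0.
move=> w kappa /(solution_of co w0E prof)[F [H sol]].
set kap := fun s => kappa (Num.max 0 s) in sol.
have kE t : 0 <= t -> kap t = kappa t by move=> t0; rewrite /kap max_r.
have kb t : 0 <= t -> mu / psic 0 <= kap t <= (- deriv01 phi 1 + 2 / eta) / - deriv01 psi 1.
  move=> t0; apply/andP; split; last exact: (kappa_le co sol eta0 t0 (heta _ _ _ _ sol t t0)).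
  rewrite ler_pdivrMr//; have kp : 0 < kap t * psic 0 by rewrite mulr_gt0// (sol_kgt0 sol).
  have h : 1 <= kap t * psic 0 * (w 0 t - 1) := kappa_lower co sol t0.
  have hm : w 0 t <= 1 / mu := hmu _ _ _ _ sol t t0.
  have h2 : 1 <= kap t * psic 0 * (1 / mu).
    apply: (le_trans h); rewrite ler_wpM2l ?(ltW kp)//.
    by apply: le_trans hm; rewrite lerBlDr lerDl.
  by move: h2; rewrite mulrA mulr1 ler_pdivlMr// mul1r.
split; first by move=> t t0; rewrite -kE//; exact: kb.
have -> : - deriv01 phi 1 / `|deriv01 psi 1| = - deriv01 phi 1 / - deriv01 psi 1.
  by rewrite ltr0_norm//; rewrite -oppr_gt0.
apply: time_average_cvg => // eps eps0.
have C10 : 0 < mu / psic 0 by rewrite divr_gt0.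
have [C [T0 [T00 hT]]] := clock_asymptotics co prof sol C10 eta0 kb
  (fun t t0 => heta _ _ _ _ sol t t0) eps0.
exists C, (Num.max T0 1); split => [|T]; first by rewrite le_max T00.
rewrite ge_max => /andP[TT T1]; have Tp : 0 < T by apply: lt_le_trans T1.
have [K Kd] := @primitive_exists R kap (-1) (T + 1) (fun s _ => sol_kcont sol (s := s)).
have -> : \int[lebesgue_measure]_(t in `[0, T]) kappa t = K T - K 0.
  rewrite -(Rintegral_primitive Tp (sol_kcont sol) Kd); apply: eq_Rintegral => t.
  by rewrite inE/= in_itv/= => /andP[t0 _]; rewrite kE.
exact: hT.
Qed.

Lemma Cn01_slope (R : realType) (n : nat) (A : set R) (f : R -> R) (k : nat) (x : R) :
  Cn01 n A f -> (k < n)%N -> A x -> slope_on 0 1 (deriv01n k f) x (deriv01n k.+1 f x).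
Proof. by move=> [h _] kn Ax; apply: deriv01P; exact: h. Qed.

Lemma beta_near1 (R : realType) (f : R -> R) : f x @[x --> 1^'-] --> (1 : R) ->
  forall e : R, 0 < e -> exists2 d : R, 0 < d < 1 & forall x, 1 - d <= x < 1 -> `|f x - 1| <= e.
Proof.
move=> /cvgrPdist_le fc e e0; have := fc e e0.
rewrite /at_left/within/= => /nbhs_ballP[d /= d0 hd].
exists (Num.min (d / 2) (1 / 2)).
  by rewrite lt_min !divr_gt0//= gt_min; apply/orP; right; lra.
move=> x /andP[dx x1]; rewrite distrC; apply: hd => //.
have : Num.min (d / 2) (1 / 2) <= d / 2 by rewrite ge_min lexx.
by rewrite /ball/= gtr0_norm ?subr_gt0//; move: dx; lra.
Qed.

Theorem theorem1p3 (R : realType) (phi psi c0 w0 : R -> R)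
  (phi_cont : {within `[0, 1], continuous phi})
  (psi_cont : {within `[0, 1], continuous psi})
  (phi_concave : convex_function (`[0, 1]%classic : set R) (fun x => - phi x))
  (phi0 : phi 0 = 0) (phi1 : phi 1 = 0)
  (dphi1 : -1 < deriv01 phi 1 < 0)
  (psi_convex : convex_function (`[0, 1]%classic : set R) psi)
  (psi1 : psi 1 = 0)
  (dpsi1 : deriv01 psi 1 < 0)
  (d2_psi_phi1 : deriv01n 2 psi 1 - deriv01n 2 phi 1 > 0)
  (phi_C3 : Cn01 3 `]0, 1] phi)
  (psi_C3 : Cn01 3 `]0, 1] psi)
  (d3phi : forall x : R, 0 < x <= 1 -> 0 <= deriv01n 3 phi x)
  (d3psi : forall x : R, 0 < x <= 1 -> deriv01n 3 psi x <= 0)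
  (* the point 0 is included only if both derivatives there are finite *)
  (decr : {in [set x : R | 0 <= x < 1 /\
                 (x = 0 -> derivable01 phi 0 /\ derivable01 psi 0)] &,
     nonincreasing_fun (fun x : R => deriv01 phi x + deriv01 phi 1
        - phi x * (deriv01 psi x + deriv01 psi 1) / psi x)})
  (init : initial_data c0 w0)
  (beta1 : profile_beta c0 w0 x @[x --> 1^'-] --> (1 : R)) :
  (phi x / x @[x --> 0^'+] --> +oo ->
     kappa_asymptotics phi psi w0) /\
  (Cn01 2 `[0, 1] phi -> Cn01 2 `[0, 1] psi ->
     (exists2 delta : R, 0 < delta &
        forall x : R, 0 <= x -> 1 - delta <= x < 1 ->
          profile_beta c0 w0 x <= 1) ->
     kappa_asymptotics phi psi w0).
Proof.
have cl (x : R) : 0 <= x <= 1 -> clamp 0 1 x = x by exact: clamp_id.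
have cl0 : clamp 0 1 (0 : R) = 0 by rewrite cl// lexx ler01.
have cl1 : clamp 0 1 (1 : R) = 1 by rewrite cl// lexx ler01.
have cont (f : R -> R) : {within `[0, 1], continuous f} ->
    forall x : R, {for x, continuous (fun y => f (clamp 0 1 y))}.
  by move=> fc x; apply: cont_on_clamp => //; apply: within_cont_on => //; exact: clamp_in.
have slope (f : R -> R) (f3 : Cn01 3 `]0, 1] f) k (k3 : (k < 3)%N) x (x01 : 0 < x <= 1) :
    slope_on 0 1 (deriv01n k f) x (deriv01n k.+1 f x).
  by apply: (Cn01_slope f3 k3); rewrite /= in_itv.
have slope0 (f : R -> R) (f3 : Cn01 3 `]0, 1] f) x (x01 : 0 < x <= 1) :
    slope_on 0 1 (fun y => f (clamp 0 1 y)) x (deriv01 f x).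
  apply: slope_on_clamp; first by case/andP: x01 => /ltW -> ->.
  exact: (slope f f3 0%N).
pose phic x := phi (clamp 0 1 x); pose psic x := psi (clamp 0 1 x).
have phi_chord (x y z : R) : 0 <= x -> x <= y -> y <= z -> z <= 1 ->
    (phic z - phic y) * (y - x) <= (phic y - phic x) * (z - y).
  move=> x0 xy yz z1; rewrite /phic !cl.
  - by have := convex_chord phi_concave x0 xy yz z1; slra.
  - by rewrite x0 (le_trans xy)// (le_trans yz).
  - by rewrite (le_trans x0 xy) (le_trans yz).
  - by rewrite z1 (le_trans x0)// (le_trans xy).
have psi_chord (x y z : R) : 0 <= x -> x <= y -> y <= z -> z <= 1 ->
    (psic y - psic x) * (z - y) <= (psic z - psic y) * (y - x).
  move=> x0 xy yz z1; rewrite /psic !cl.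
  - exact: convex_chord psi_convex x y z x0 xy yz z1.
  - by rewrite z1 (le_trans x0)// (le_trans xy).
  - by rewrite x0 (le_trans xy)// (le_trans yz).
  - by rewrite (le_trans x0 xy) (le_trans yz).
have decr' (x y : R) : 0 < x -> x <= y -> y < 1 ->
    deriv01 phi y + deriv01 phi 1 - phic y * (deriv01 psi y + deriv01 psi 1) / psic y <=
    deriv01 phi x + deriv01 phi 1 - phic x * (deriv01 psi x + deriv01 psi 1) / psic x.
  move=> x0 xy y1; have y0 := lt_le_trans x0 xy; have x1 := le_lt_trans xy y1.
  rewrite /phic /psic !cl ?(ltW x0) ?(ltW y0) ?(ltW x1) ?(ltW y1)//.
  apply: decr => //; rewrite inE/=; split.
  - by rewrite (ltW x0).
  - by move=> x00; rewrite x00 ltxx in x0.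
  - by rewrite (ltW y0).
  - by move=> y00; rewrite y00 ltxx in y0.
have [cge0 cint w0E w0pos w0int] := init.
(* [w0] is prescribed on [[0, 1)] only; this version of it is continuous at 0 from both sides. *)
pose w (x : R) := tail_integral c0 (Num.max 0 x).
have wE x : 0 <= x < 1 -> w x = tail_integral c0 x.
  by move=> /andP[x0 _]; rewrite /w max_r.
have ww0 x : 0 <= x < 1 -> w x = w0 x by move=> x01; rewrite wE// w0E.
have tw x : 0 <= x -> tail_integral w x = tail_integral w0 x.
  move=> x0; apply: eq_Rintegral => y; rewrite inE/= in_itv/= => /andP[xy y1].
  by rewrite ww0// y1 (le_trans x0).
have prof : profile w (fun x => tail_integral w (Num.max 0 x)).
  apply: (profile_tail cge0 cint wE).
  - by move=> x x01; rewrite ww0//; exact: w0pos.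
  - exact: etrans (tw 0 (lexx _)) w0int.
  - move=> e e0; have [d d01 hd] := beta_near1 beta1 e0; exists d => // x xd.
    have x01 : 0 <= x < 1 by case/andP: d01 xd => d0 d1 /andP[dx ->]; rewrite andbT; move: d1 dx; slra.
    by have := hd x xd; rewrite /profile_beta ww0// tw//; case/andP: x01.
  - move=> x /andP[x0 x1]; apply/continuous_for_dist => e e0.
    have [d d0 hd] := tail_cont_on cint (introT andP (conj x0 (ltW x1))) e0.
    exists (Num.min d (1 - x)); first by rewrite lt_min d0 subr_gt0.
    move=> y; rewrite lt_min => /andP[yd y1]; rewrite /w [Num.max 0 x]max_r//.
    have yx : `|Num.max 0 y - x| <= `|y - x|.
      have [y0|y0] := leP 0 y => //; rewrite sub0r normrN ger0_norm//.
      by rewrite distrC ger0_norm; move: y0 x0; slra.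
    apply: hd; last exact: le_lt_trans yd.
    by rewrite le_max lexx/= ge_max ler01/=; move: y1; rewrite ltr_norml => /andP[_]; slra.
have co := build_coefs (cont phi phi_cont) (slope0 phi phi_C3) (slope phi phi_C3 1%N isT)
  (slope phi phi_C3 2%N isT) d3phi phi_chord (cont psi psi_cont) (slope0 psi psi_C3)
  (slope psi psi_C3 1%N isT) (slope psi psi_C3 2%N isT) d3psi psi_chord
  (etrans (congr1 phi cl0) phi0) (etrans (congr1 phi cl1) phi1) (etrans (congr1 psi cl1) psi1)
  dphi1 dpsi1 d2_psi_phi1 decr'.
split=> [/cvgryPge phioo|[_ phi2c] [_ psi2c] _].
  have [|mu mu0 hmu] := sol_bound_singular co prof.
    move=> M; have := phioo M; rewrite /at_right/within/= => /nbhs_ballP[d /= d0 hd].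
    exists (Num.min d 1) => [|x /andP[x0]]; first by rewrite lt_min d0 ltr01.
    rewrite lt_min => /andP[xd x1]; rewrite /phic cl ?(ltW x0) ?(ltW x1)//.
    rewrite -ler_pdivlMr//; apply: hd => //.
    by rewrite /ball/= sub0r normrN gtr0_norm.
  exact: asymptotics_of_bound co prof ww0 mu0 hmu.
(* Continuous on the closed interval, the second derivatives are bounded, as [build_conv_at]
   requires down to 0. *)
have [m _ hm] := EVT_min ler01 phi2c; have [n _ hn] := EVT_max ler01 psi2c.
have [|B B0 cB] := build_conv_at (cont phi phi_cont) (slope0 phi phi_C3) (slope phi phi_C3 1%N isT)
  (slope phi phi_C3 2%N isT) d3phi phi_chord (cont psi psi_cont) (slope0 psi psi_C3)
  (slope psi psi_C3 1%N isT) (slope psi psi_C3 2%N isT) d3psi psi_chord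
  (etrans (congr1 phi cl0) phi0) (etrans (congr1 phi cl1) phi1) (etrans (congr1 psi cl1) psi1)
  dphi1 dpsi1 d2_psi_phi1 decr' (M := Num.max (- deriv01n 2 phi m) (deriv01n 2 psi n)).
  move=> x /andP[x0 x1]; have xI : x \in `[0, 1] by rewrite in_itv/= !ltW.
  by rewrite !le_max lerN2 hm// hn// orbT.
have [mu mu0 hmu] := sol_bound_regular co prof B0 cB.
exact: asymptotics_of_bound co prof ww0 mu0 hmu.
Qed.
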